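(* Let $\Omega\subset\mathbb{R}^2$ be a bounded polygonal domain, and let $(\mathcal{T}_{h_i})_{i\ge 1}$ be an infinite family of triangulations of $\Omega$ which is shape regular, i.e. its shape regularity constant $\mathcal{K}$ (the supremum over $i$ of the shape regularity constants of $\mathcal{T}_{h_i}$) is finite; quasi-uniformity is not assumed. For each $i$ let $H^1_{h_i}$ be the space of piecewise $H^1$ functions subordinated to $\mathcal{T}_{h_i}$, equipped with the norm $\|\cdot\|_{H^1_{h_i}}$. Let $(u_i)_{i\ge 1}$ be a sequence with $u_i\in H^1_{h_i}$ for each $i$, and suppose there is a constant $C$ such that $\|u_i\|_{H^1_{h_i}}\le C$ for all $i$. Then $(u_i)$ has a subsequence that converges in $L^2(\Omega)$.
   Context: A triangulation $\mathcal{T}_h$ of the polygonal domain $\Omega$ (a connected open set) is meant in the usual finite element sense: a finite set of pairwise disjoint open triangles (elements) $\tau$ whose closures cover $\overline\Omega$, the closures of two distinct elements meeting in the empty set, a common vertex, or a common edge. The shape regularity constant of a triangle is $R/r$, where $r$ is the radius of its largest inscribed circle and $R$ the radius of its smallest circumscribed circle; that of a triangulation is the maximum over its triangles; that of a family of triangulations is the supremum over the family. $\Omega_h$ denotes the union of all open elements of $\mathcal{T}_h$, and $\mathcal{E}^0_h$ the set of all interior (open) edges. $H^1_h$ is the space of functions $u$ on $\Omega$ whose restriction to each $\tau\in\mathcal{T}_h$ belongs to $H^1(\tau)$ (no continuity across edges is required; values on edges are irrelevant), so $H^1_h\subset L^2(\Omega)$. On $e\in\mathcal{E}^0_h$, $[\![u]\!]$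 is the difference of the two traces of $u$ on $e$ from the two elements sharing $e$, and $|e|$ is the length of $e$. The norm is $$\|u\|_{H^1_h}=\Big[\|u\|^2_{L^2(\Omega)}+\int_{\Omega_h}|\nabla u|^2+\sum_{e\in\mathcal{E}^0_h}\frac1{|e|}\int_e[\![u]\!]^2\Big]^{1/2}.$$ *)

(* Defs.v *)
From HB Require Import structures.
From mathcomp Require Import all_boot all_order all_algebra.
From mathcomp Require Import all_classical all_reals all_analysis.
Set Implicit Arguments.
Unset Strict Implicit.
Unset Printing Implicit Defensive.
Import Order.TTheory GRing.Theory Num.Theory.
Import numFieldNormedType.Exports.
Local Open Scope classical_set_scope.
Local Open Scope ring_scope.

Notation plane R := (R * R)%type.

(* The library norm on a product is the max norm, hence this definition. *)
Definition edist (R : realType) (x y : plane R) : R :=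
  Num.sqrt ((x.1 - y.1) ^+ 2 + (x.2 - y.2) ^+ 2).

Definition boundary (R : realType) (A : set (plane R)) : set (plane R) :=
  closure A `\` interior A.

Definition noncollinear (R : realType) (a b c : plane R) : Prop :=
  (b.1 - a.1) * (c.2 - a.2) - (b.2 - a.2) * (c.1 - a.1) != 0.

Definition open_triangle (R : realType) (a b c : plane R) : set (plane R) :=
  [set x | exists s t r : R, [/\ 0 < s, 0 < t, 0 < r, s + t + r = 1 &
     x = (s * a.1 + t * b.1 + r * c.1, s * a.2 + t * b.2 + r * c.2)]].

Definition seg_point (R : realType) (a b : plane R) (t : R) : plane R :=
  (a.1 + t * (b.1 - a.1), a.2 + t * (b.2 - a.2)).

Definition open_segment (R : realType) (a b : plane R) : set (plane R) :=
  [set seg_point a b t | t in `]0, 1[].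

Definition closed_segment (R : realType) (a b : plane R) : set (plane R) :=
  [set seg_point a b t | t in `[0, 1]].

Definition is_triangle (R : realType) (tau : set (plane R)) : Prop :=
  exists a b c : plane R, noncollinear a b c /\ tau = open_triangle a b c.

Definition is_vertex (R : realType) (tau : set (plane R)) (a : plane R) : Prop :=
  exists b c : plane R, noncollinear a b c /\ tau = open_triangle a b c.

Definition is_edge (R : realType) (tau e : set (plane R)) : Prop :=
  exists a b c : plane R,
    [/\ noncollinear a b c, tau = open_triangle a b c & e = open_segment a b].

(* The boundary may contain slits; Omega is not assumed simply connected. *)
Definition polygonal_domain (R : realType) (Omega : set (plane R)) : Prop :=
  [/\ Omega !=set0, open Omega, connected Omega &
    exists S : set (plane R * plane R),
      [/\ finite_set S, (forall s, S s -> s.1 != s.2) &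
          boundary Omega = \bigcup_(s in S) closed_segment s.1 s.2]].

Definition is_triangulation (R : realType) (Omega : set (plane R))
    (T : set (set (plane R))) : Prop :=
  [/\ finite_set T,
      (forall tau, T tau -> is_triangle tau /\ tau `<=` Omega),
      (forall tau tau', T tau -> T tau' -> tau <> tau' -> tau `&` tau' = set0),
      closure Omega = \bigcup_(tau in T) closure tau &
      (forall tau tau', T tau -> T tau' -> tau <> tau' ->
        let I := closure tau `&` closure tau' in
        [\/ I = set0,
            (exists v, [/\ is_vertex tau v, is_vertex tau' v & I = [set v]]) |
            (exists e, [/\ is_edge tau e, is_edge tau' e & I = closure e])])].

Definition inscribed_radius (R : realType) (tau : set (plane R)) : R :=
  sup [set r : R | 0 <= r /\
    exists c : plane R, [set x | edist c x < r] `<=` tau].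

Definition circumscribed_radius (R : realType) (tau : set (plane R)) : R :=
  inf [set r : R | 0 <= r /\
    exists c : plane R, tau `<=` [set x | edist c x <= r]].

Definition triangle_regularity (R : realType) (tau : set (plane R)) : R :=
  circumscribed_radius tau / inscribed_radius tau.

Definition triangulation_regularity (R : realType)
    (T : set (set (plane R))) : \bar R :=
  ereal_sup [set (triangle_regularity tau)%:E | tau in T].

Definition family_regularity (R : realType)
    (T : nat -> set (set (plane R))) : \bar R :=
  ereal_sup (range (fun i => triangulation_regularity (T i))).

Definition element_union (R : realType)
    (T : set (set (plane R))) : set (plane R) := \bigcup_(tau in T) tau.

(* An edge is interior when it is not part of the boundary of Omega; by
   conformity it is then an edge of exactly two elements. *)
Definition interior_edges (R : realType) (Omega : set (plane R))
    (T : set (set (plane R))) : set (set (plane R)) :=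
  [set e | (exists2 tau, T tau & is_edge tau e) /\ ~ (e `<=` boundary Omega)].

Notation leb2 R := (@lebesgue_measure R \x @lebesgue_measure R)%E.

Definition L2_sq (R : realType) (U : set (plane R)) (u : plane R -> R) : \bar R :=
  (\int[leb2 R]_(x in U) ((u x) ^+ 2)%:E)%E.

(* Borel measurability loses nothing: a Lebesgue measurable function agrees
   with a Borel one off a null set. *)
Definition in_L2 (R : realType) (U : set (plane R)) (u : plane R -> R) : Prop :=
  measurable_fun (U : set (measurableTypeR R * measurableTypeR R)) u /\ (L2_sq U u < +oo)%E.

(* Endpoints of an open segment given as a set; the choice of their order is
   immaterial below. *)
Definition edge_ends (R : realType) (e : set (plane R)) : plane R * plane R :=
  get [set ab : plane R * plane R | e = open_segment ab.1 ab.2].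

Definition edge_point (R : realType) (e : set (plane R)) (t : R) : plane R :=
  seg_point (edge_ends e).1 (edge_ends e).2 t.

Definition edge_length (R : realType) (e : set (plane R)) : R :=
  edist (edge_ends e).1 (edge_ends e).2.

Definition edge_L2_sq (R : realType) (e : set (plane R)) (g : plane R -> R) : \bar R :=
  ((edge_length e)%:E *
   \int[@lebesgue_measure R]_(t in `]0%R, 1%R[) ((g (edge_point e t)) ^+ 2)%:E)%E.

Definition in_edge_L2 (R : realType) (e : set (plane R)) (g : plane R -> R) : Prop :=
  measurable_fun (`]0, 1[ : set (measurableTypeR R)) (g \o edge_point e) /\ (edge_L2_sq e g < +oo)%E.

Definition dx (R : realType) (f : plane R -> R) (x : plane R) : R :=
  'D_((1, 0) : plane R) f x.

Definition dy (R : realType) (f : plane R -> R) (x : plane R) : R :=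
  'D_((0, 1) : plane R) f x.

Definition C1 (R : realType) (f : plane R -> R) : Prop :=
  [/\ continuous f,
      (forall x, derivable f x ((1, 0) : plane R)),
      (forall x, derivable f x ((0, 1) : plane R)),
      continuous (dx f) & continuous (dy f)].

(* Smooth and C1 test functions define the same weak gradients (mollify). *)
Definition C1c (R : realType) (U : set (plane R)) (f : plane R -> R) : Prop :=
  C1 f /\ exists K, [/\ compact K, K `<=` U & forall x, ~ K x -> f x = 0].

Definition weak_gradient (R : realType) (U : set (plane R)) (u : plane R -> R)
    (g : plane R -> plane R) : Prop :=
  [/\ in_L2 U (fun x => (g x).1), in_L2 U (fun x => (g x).2) &
    forall phi, C1c U phi ->
      (\int[leb2 R]_(x in U) (u x * dx phi x)%:E =
         - \int[leb2 R]_(x in U) ((g x).1 * phi x)%:E)%E /\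
      (\int[leb2 R]_(x in U) (u x * dy phi x)%:E =
         - \int[leb2 R]_(x in U) ((g x).2 * phi x)%:E)%E].

Definition in_H1 (R : realType) (U : set (plane R)) (u : plane R -> R) : Prop :=
  in_L2 U u /\ exists g, weak_gradient U u g.

(* The weak gradient is unique up to null sets, so this is the infimum of a
   singleton when it exists, and +oo otherwise. *)
Definition gradient_L2_sq (R : realType) (U : set (plane R))
    (u : plane R -> R) : \bar R :=
  ereal_inf [set z | exists2 g, weak_gradient U u g &
    z = (\int[leb2 R]_(x in U) ((g x).1 ^+ 2 + (g x).2 ^+ 2)%:E)%E].

Definition H1_sq (R : realType) (U : set (plane R)) (u : plane R -> R) : \bar R :=
  (L2_sq U u + gradient_L2_sq U u)%E.

(* The trace operator H1(tau) -> L2(e) is the continuous extension of the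
   restriction to e of functions that are C1 up to the boundary of tau. *)
Definition is_trace (R : realType) (tau e : set (plane R))
    (u g : plane R -> R) : Prop :=
  in_edge_L2 e g /\
  exists phi : nat -> plane R -> R,
    [/\ forall n, C1 (phi n),
        H1_sq tau (fun x => phi n x - u x) @[n --> \oo] --> 0%E &
        edge_L2_sq e (fun x => phi n x - g x) @[n --> \oo] --> 0%E].

(* Squared L2(e) norm of the jump of u.  For u in H1 of both elements the two
   traces exist and are unique up to null sets, and exchanging the elements
   only changes the sign of the jump: the infimum is that of a singleton. *)
Definition jump_L2_sq (R : realType) (T : set (set (plane R)))
    (e : set (plane R)) (u : plane R -> R) : \bar R :=
  ereal_inf [set z | exists tau1 tau2 (g1 g2 : plane R -> R),
    [/\ [/\ T tau1, T tau2 & tau1 <> tau2],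
        is_edge tau1 e, is_edge tau2 e,
        is_trace tau1 e u g1 /\ is_trace tau2 e u g2 &
        z = edge_L2_sq e (fun x => g1 x - g2 x)]].

Definition in_H1h (R : realType) (Omega : set (plane R))
    (T : set (set (plane R))) (u : plane R -> R) : Prop :=
  in_L2 Omega u /\ forall tau, T tau -> in_H1 tau u.

Definition H1h_norm (R : realType) (Omega : set (plane R))
    (T : set (set (plane R))) (u : plane R -> R) : \bar R :=
  sqrte (L2_sq Omega u + gradient_L2_sq (element_union T) u +
    \sum_(e \in interior_edges Omega T)
      ((edge_length e)^-1)%:E * jump_L2_sq T e u)%E.

Definition cvg_L2 (R : realType) (Omega : set (plane R))
    (u : nat -> plane R -> R) (v : plane R -> R) : Prop :=
  in_L2 Omega v /\ sqrte (L2_sq Omega (fun x => u n x - v x)) @[n --> \oo] --> 0%E.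

(* Main.v *)
(** Summing Green's formula over the elements, a test function phi in C1c(Omega)
satisfies, for each coordinate direction j,
  int u d_j phi = - int g_j phi + sum_e (+-) nu_j(e) int_e [[u]] phi,
where g is the broken gradient.  By Young's inequality the right-hand side is at
most s M + (1/s) (int phi^2 + sum_e |e| int_e phi^2), M depending only on the norm
of u.  If eta >= phi^2 is C1, shape regularity and the trace inequality on the
elements bound sum_e |e| int_e eta by K int (eta + |grad eta|), with no reference
to the triangulation.

Omega is covered, up to a null set, by finitely many parallelograms.  On each of
them let phi = sum_k c_k theta_k, where theta_k is a tent in one direction times
an indicator in the other at scale 2^-m, so that the derivative of phi is a
combination of Haar functions.  With c_k the Haar coefficients of u and s of order
8^-m this gives sum_k c_k^2 <= C 8^-m.  Hence the squared L2 norm of the projections of u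
onto dyadic step functions converges at rate 2^-m, uniformly for all functions of
bounded norm.  A diagonal extraction makes all dyadic integrals of (u_i) converge,
and then (u_i) is Cauchy in L2. *)

Require Import Defs.
From HB Require Import structures.
From mathcomp Require Import all_boot all_order all_algebra.
From mathcomp Require Import all_classical all_reals all_analysis.
From mathcomp Require Import measurable_realfun zify ring lra.
Set Implicit Arguments.
Unset Strict Implicit.
Unset Printing Implicit Defensive.
Import Order.TTheory GRing.Theory Num.Theory.
Import numFieldNormedType.Exports.
Local Open Scope classical_set_scope.
Local Open Scope ring_scope.

(** * Square-integrable functions *)

(** The functions u_i live on unrelated meshes, and u_i - u_j belongs in general to neither space.
    One estimate that mentions no mesh, [derivative_bounded], is therefore extracted from the norm;
    it is stable under subtraction, and nothing after it looks at the edges again. No mesh size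
    enters: shape regularity bounds |e|^2 by a multiple of the area of an adjacent element, so edges
    shorter and longer than the dyadic scale are treated alike.

    The edge terms are controlled through eta and not phi because the test functions must be C1
    while their derivatives approach Haar functions: the indicator factor makes the gradient of phi
    blow up in the limit, whereas phi^2 has a fixed majorant whose gradient costs only 2^m.

    The exponents: phi carries a factor 2^-m, so phi^2 is of size 4^-m c_k^2 on a cell of area 4^-m,
    and the gradient of eta costs 2^m; in total 8^-m sum_k c_k^2. The c_k being the coefficients of
    u itself, the pairing equals sum_k c_k^2, and s is chosen so that half of it is absorbed.
    Energies at level m carry the weight 4^m, and 4^m 8^-m = 2^-m. *)

Lemma normM_le (R : realFieldType) (a b : R) : `|a * b| <= (a ^+ 2 + b ^+ 2) / 2.
Proof.
have := sqr_ge0 (a - b); have := sqr_ge0 (a + b).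
by rewrite ler_norml => h1 h2; apply/andP; split; lra.
Qed.

Lemma sqrrD_le (R : realFieldType) (a b : R) : (a + b) ^+ 2 <= 2 * a ^+ 2 + 2 * b ^+ 2.
Proof. by have := sqr_ge0 (a - b) => h; lra. Qed.

Section SquareIntegrable.
Context d (X : measurableType d) (R : realType).
Variables (mu : {measure set X -> \bar R}) (D : set X).
Hypothesis mD : measurable D.
Implicit Types f g h : X -> R.

(** On the plane with [leb2 R] this is convertible to [in_L2]; the two are exchanged silently
    below. *)
Definition sqint f := measurable_fun D f /\ (\int[mu]_(x in D) (f x ^+ 2)%:E < +oo)%E.

Lemma sqint_integrable f : sqint f -> mu.-integrable D (EFin \o (fun x => f x ^+ 2)).
Proof.
move=> [mf ff]; apply/integrableP; split.
  by apply/measurable_EFinP; exact: measurable_funX.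
under eq_integral do rewrite /= ger0_norm ?sqr_ge0//.
by [].
Qed.

Lemma sqintP f : measurable_fun D f ->
  mu.-integrable D (EFin \o (fun x => f x ^+ 2)) -> sqint f.
Proof.
move=> mf /integrableP[_ ff]; split => //; move: ff.
by under eq_integral do rewrite /= ger0_norm ?sqr_ge0//.
Qed.

Lemma EFin_sqint f : sqint f ->
  ((\int[mu]_(x in D) f x ^+ 2)%R%:E = \int[mu]_(x in D) (f x ^+ 2)%:E)%E.
Proof.
move=> sf; rewrite /Rintegral fineK//; apply: integrable_fin_num => //.
exact: sqint_integrable.
Qed.

Lemma le_integrableR f g : measurable_fun D f -> mu.-integrable D (EFin \o g) ->
  (forall x, D x -> `|f x| <= g x) -> mu.-integrable D (EFin \o f).
Proof.
move=> mf ig fg; apply: (le_integrable mD _ _ ig); first exact/measurable_EFinP.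
move=> x Dx; rewrite /= lee_fin; apply: (le_trans (fg x Dx)); exact: ler_norm.
Qed.

Lemma integrable_measurable f : mu.-integrable D (EFin \o f) -> measurable_fun D f.
Proof. by move=> /integrableP[/measurable_EFinP]. Qed.

Lemma eq_integrableR f g : (forall x, D x -> f x = g x) ->
  mu.-integrable D (EFin \o f) -> mu.-integrable D (EFin \o g).
Proof.
by move=> fg; apply: eq_integrable => // x /set_mem Dx /=; rewrite fg.
Qed.

Lemma integrableRD f g : mu.-integrable D (EFin \o f) -> mu.-integrable D (EFin \o g) ->
  mu.-integrable D (EFin \o (fun x => f x + g x)).
Proof. by move=> fi gi; exact: (integrableD mD fi gi). Qed.

Lemma integrableRZ a f : mu.-integrable D (EFin \o f) ->
  mu.-integrable D (EFin \o (fun x => a * f x)).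
Proof. by move=> fi; exact: (integrableZl mD a fi). Qed.

Lemma integrableRN f : mu.-integrable D (EFin \o f) ->
  mu.-integrable D (EFin \o (fun x => - f x)).
Proof.
move=> /(integrableRZ (-1)) fi; apply: eq_integrableR fi => x _.
by rewrite mulN1r.
Qed.

Lemma integrableRB f g : mu.-integrable D (EFin \o f) -> mu.-integrable D (EFin \o g) ->
  mu.-integrable D (EFin \o (fun x => f x - g x)).
Proof. by move=> fi gi; apply: integrableRD => //; exact: integrableRN. Qed.

Lemma integrableR_norm f : mu.-integrable D (EFin \o f) ->
  mu.-integrable D (EFin \o (fun x => `|f x|)).
Proof. by move=> /integrable_abse. Qed.

Lemma integrableR_sum (I : Type) (s : seq I) (F : I -> X -> R) :
  (forall i, mu.-integrable D (EFin \o F i)) ->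
  mu.-integrable D (EFin \o (fun x => \sum_(i <- s) F i x)).
Proof.
move=> iF; elim: s => [|i s IH].
  apply: (@eq_integrableR (fun=> 0)); last exact: integrable0.
  by move=> x _; rewrite big_nil.
apply: eq_integrableR (integrableRD (iF i) IH) => x _.
by rewrite big_cons.
Qed.

Lemma Rintegral_sum (I : Type) (s : seq I) (F : I -> X -> R) :
  (forall i, mu.-integrable D (EFin \o F i)) ->
  \int[mu]_(x in D) (\sum_(i <- s) F i x) = \sum_(i <- s) \int[mu]_(x in D) F i x.
Proof.
move=> iF; elim: s => [|i s IH].
  rewrite big_nil; under eq_Rintegral do rewrite big_nil.
  by rewrite Rintegral_cst// mul0r.
rewrite big_cons -IH -RintegralD//; last exact: integrableR_sum.
by apply: eq_Rintegral => x _; rewrite big_cons.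
Qed.

Lemma sqintM f g : sqint f -> sqint g -> mu.-integrable D (EFin \o (fun x => f x * g x)).
Proof.
move=> sf sg.
apply: (@le_integrableR _ (fun x => f x ^+ 2 + g x ^+ 2)).
- by apply: measurable_funM; [case: sf|case: sg].
- by apply: integrableRD; apply: sqint_integrable.
- move=> x _; apply: le_trans (normM_le _ _) _.
  by have := sqr_ge0 (f x); have := sqr_ge0 (g x); lra.
Qed.

Lemma sqintD f g : sqint f -> sqint g -> sqint (fun x => f x + g x).
Proof.
move=> sf sg; have mfg : measurable_fun D (fun x => f x + g x).
  by apply: measurable_funD; [case: sf|case: sg].
apply: sqintP => //.
apply: (@le_integrableR _ (fun x => 2 * f x ^+ 2 + 2 * g x ^+ 2)).
- exact: measurable_funX.
- by apply: integrableRD; apply: integrableRZ; exact: sqint_integrable.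
- by move=> x _; rewrite ger0_norm ?sqr_ge0// sqrrD_le.
Qed.

Lemma sqintZ a f : sqint f -> sqint (fun x => a * f x).
Proof.
move=> sf; apply: sqintP.
  by apply: measurable_funM => //; case: sf.
apply: eq_integrableR (integrableRZ (a ^+ 2) (sqint_integrable sf)) => x _.
by rewrite exprMn.
Qed.

Lemma sqintB f g : sqint f -> sqint g -> sqint (fun x => f x - g x).
Proof.
move=> sf /(sqintZ (-1)) sg.
have := sqintD sf sg; rewrite (_ : (fun _ => _) = fun x => f x - g x)//.
by apply/funext => x; rewrite mulN1r.
Qed.

Lemma eq_sqint f g : (forall x, D x -> f x = g x) -> sqint f -> sqint g.
Proof.
move=> fg [mf ff]; split.
  by apply: eq_measurable_fun mf => x /set_mem; exact: fg.
rewrite (_ : integral _ _ _ = \int[mu]_(x in D) (f x ^+ 2)%:E)%E//.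
by apply: eq_integral => x /set_mem /fg ->.
Qed.

Lemma Rintegral_sqr_ge0 f : 0 <= \int[mu]_(x in D) f x ^+ 2.
Proof. by apply: Rintegral_ge0 => x _; exact: sqr_ge0. Qed.

(** The parameter [s] stays free: it is fixed only at the very end, where half of the sum of squared
    Haar coefficients has to be absorbed. *)
Lemma young_sqint s f g : 0 < s -> sqint f -> sqint g ->
  `|\int[mu]_(x in D) (f x * g x)| <=
  s / 2 * \int[mu]_(x in D) f x ^+ 2 + (2 * s)^-1 * \int[mu]_(x in D) g x ^+ 2.
Proof.
move=> s0 sf sg.
apply: le_trans (le_normr_Rintegral mD (sqintM sf sg)) _.
rewrite -!RintegralZl//; try exact: sqint_integrable.
rewrite -RintegralD//; try by apply: integrableRZ; exact: sqint_integrable.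
apply: le_Rintegral => //.
- exact: integrableR_norm (sqintM _ _).
- by apply: integrableRD; apply: integrableRZ; exact: sqint_integrable.
- move=> x _.
  have -> : s / 2 * f x ^+ 2 + (2 * s)^-1 * g x ^+ 2 =
     (2 * s)^-1 * ((s * f x) ^+ 2 + g x ^+ 2) by field; lra.
  have -> : f x * g x = s^-1 * (s * f x * g x) by field; lra.
  rewrite normrM gtr0_norm ?invr_gt0//.
  apply: le_trans (ler_wpM2l _ (normM_le _ _)) _; first by rewrite invr_ge0 ltW.
  by rewrite le_eqVlt; apply/orP; left; apply/eqP; field; lra.
Qed.

Lemma cauchy_schwarz f g : sqint f -> sqint g ->
  (\int[mu]_(x in D) (f x * g x)) ^+ 2 <=
  (\int[mu]_(x in D) f x ^+ 2) * (\int[mu]_(x in D) g x ^+ 2).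
Proof.
move=> sf sg.
set a := \int[mu]_(x in D) f x ^+ 2; set b := \int[mu]_(x in D) g x ^+ 2.
set c := (X in X ^+ 2).
have H t : 0 <= t ^+ 2 * a + 2 * t * c + b.
  have := Rintegral_sqr_ge0 (fun x => t * f x + g x).
  have -> : \int[mu]_(x in D) (t * f x + g x) ^+ 2 =
     \int[mu]_(x in D) (t ^+ 2 * f x ^+ 2 + 2 * t * (f x * g x) + g x ^+ 2).
    by apply: eq_Rintegral => x _; ring.
  have i1 := sqint_integrable sf; have i2 := sqintM sf sg.
  have i3 := sqint_integrable sg.
  rewrite RintegralD//; last by apply: integrableRD; exact: integrableRZ.
  by rewrite RintegralD ?RintegralZl//; exact: integrableRZ.
have a0 : 0 <= a by exact: Rintegral_sqr_ge0.
have b0 : 0 <= b by exact: Rintegral_sqr_ge0.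
(* If a = 0 the quadratic is affine in t, and a nonzero slope would let it reach -1; otherwise it is
   evaluated at its minimum -c / a. *)
have [a_eq0|ane0] := eqVneq a 0.
  have [->|c0] := eqVneq c 0; first by rewrite expr0n/= mulr_ge0.
  have := H (- (b + 1) / (2 * c)); rewrite a_eq0 mulr0 add0r.
  rewrite (_ : 2 * (- (b + 1) / (2 * c)) * c + b = - 1); last by field.
  lra.
have := H (- c / a).
rewrite (_ : _ + b = (a * b - c ^+ 2) / a); last by field.
by rewrite pmulr_lge0 ?subr_ge0// invr_gt0 lt_neqAle eq_sym ane0.
Qed.

Lemma le_sqint_add f g : sqint f -> sqint g ->
  \int[mu]_(x in D) (f x + g x) ^+ 2 <=
  2 * \int[mu]_(x in D) f x ^+ 2 + 2 * \int[mu]_(x in D) g x ^+ 2.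
Proof.
move=> sf sg; rewrite -!RintegralZl//; try exact: sqint_integrable.
rewrite -RintegralD//; try by apply: integrableRZ; exact: sqint_integrable.
apply: le_Rintegral => //.
- by apply: sqint_integrable; exact: sqintD.
- by apply: integrableRD; apply: integrableRZ; exact: sqint_integrable.
- by move=> x _; exact: sqrrD_le.
Qed.

Lemma cvg_sqint (F : nat -> X -> R) f g :
  (forall n, sqint (F n)) -> sqint f -> sqint g ->
  \int[mu]_(x in D) (F n x - f x) ^+ 2 @[n --> \oo] --> (0 : R) ->
  \int[mu]_(x in D) (F n x * g x) @[n --> \oo] --> \int[mu]_(x in D) (f x * g x).
Proof.
move=> sF sf sg F0.
apply/cvgrPdist_le => e e0.
set b := \int[mu]_(x in D) g x ^+ 2.
have b0 : 0 <= b by exact: Rintegral_sqr_ge0.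
(* Adding 1 to [b] keeps the tolerance meaningful when [g] has zero norm. *)
have e1 : 0 < e ^+ 2 / (b + 1) by rewrite divr_gt0 ?exprn_gt0//; lra.
move/cvgrPdist_le : F0 => /(_ _ e1); apply: filterS => n.
rewrite sub0r normrN ger0_norm ?Rintegral_sqr_ge0// => Hn.
rewrite distrC -RintegralB//; try exact: sqintM.
rewrite (_ : (fun x => _) = fun x => (F n x - f x) * g x); last first.
  by apply/funext => x; ring.
rewrite -(@ler_pXn2r _ 2)// ?nnegrE//; last exact: ltW.
rewrite real_normK ?num_real//.
apply: le_trans (cauchy_schwarz (sqintB (sF n) sf) sg) _.
apply: le_trans (ler_wpM2r b0 Hn) _.
rewrite -/b mulrAC ler_pdivrMr; last lra.
by rewrite ler_wpM2l ?sqr_ge0//; lra.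
Qed.

End SquareIntegrable.

(** * Completeness of L2 and diagonal extraction *)

Lemma fatou_le d (X : measurableType d) (R : realType)
    (mu : {measure set X -> \bar R}) (D : set X) (f : nat -> X -> R) (g : X -> R) (e : \bar R) :
  measurable D -> (forall n, measurable_fun D (f n)) ->
  (forall n x, D x -> 0 <= f n x) ->
  (forall x, D x -> f n x @[n --> \oo] --> g x) ->
  (forall n, (\int[mu]_(x in D) (f n x)%:E <= e)%E) ->
  (\int[mu]_(x in D) (g x)%:E <= e)%E.
Proof.
move=> mD mf f0 fg fe.
have -> : (\int[mu]_(x in D) (g x)%:E =
    \int[mu]_(x in D) limn_einf (fun n => (f n x)%:E))%E.
  apply: eq_integral => x /set_mem Dx.
  have cf : (f n x)%:E @[n --> \oo] --> (g x)%:E by apply: cvg_EFin; [exact: nearW|exact: fg].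
  rewrite is_cvg_limn_einfE; last by apply/cvg_ex; exists (g x)%:E.
  by rewrite (cvg_lim _ cf).
apply: le_trans (fatou mu mD _ _) _.
- by move=> n; apply/measurable_EFinP.
- by move=> n x Dx; rewrite lee_fin f0.
rewrite limn_einf_lim; apply: lime_le; first exact: is_cvg_einfs.
apply: nearW => n; apply: le_trans (fe n).
by apply: ereal_inf_lbound; exists n => /=.
Qed.

Section RieszFischer.
Context d (X : measurableType d) (R : realType).
Variables (mu : {measure set X -> \bar R}) (D : set X).
Hypothesis mD : measurable D.

(** With weights 4^j the squared increments have integrals at most 4^-j, so their sum [S] is
    integrable, hence finite almost everywhere. Where it is finite, |F_(j+1) - F_j| <= 4^-j + G_j
    makes the telescoping series absolutely convergent. *)
Lemma ae_cvg_of_summable (F : nat -> X -> R) :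
  (forall j, sqint mu D (F j)) ->
  (forall j, \int[mu]_(x in D) (F j.+1 x - F j x) ^+ 2 <= (4 ^- j) ^+ 2) ->
  {ae mu, forall x, D x -> cvgn (fun j => F j x)}.
Proof.
move=> sF dF.
pose G j x := 4 ^+ j * (F j.+1 x - F j x) ^+ 2.
have sd j : sqint mu D (fun x => F j.+1 x - F j x) by apply: sqintB.
have iG j : mu.-integrable D (EFin \o G j).
  by apply: integrableRZ => //; exact: sqint_integrable.
have G0 j x : 0 <= G j x by rewrite mulr_ge0 ?sqr_ge0// exprn_ge0.
pose S x := (\sum_(0 <= j <oo) (G j x)%:E)%E.
have mG j : measurable_fun D (EFin \o G j) by case/integrableP : (iG j).
have IS : (\int[mu]_(x in D) S x < +oo)%E.
  rewrite integral_nneseries//; last by move=> j x _; rewrite lee_fin.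
  apply: (@le_lt_trans _ _ (\sum_(0 <= j <oo) (4 ^- j)%:E)%E).
    apply: lee_nneseries => [j _ _|j _].
      by apply: integral_ge0 => x _; rewrite lee_fin.
    rewrite -[X in (X <= _)%E]fineK; last exact: (integrable_fin_num mD (iG j)).
    have p4 : 0 < (4 : R) ^+ j by rewrite exprn_gt0.
    rewrite lee_fin -[X in X <= _]/(\int[mu]_(x in D) G j x).
    rewrite RintegralZl//; last exact: sqint_integrable.
    apply: le_trans (ler_wpM2l (ltW p4) (dF j)) _.
    by rewrite expr2 mulrA mulfV ?gt_eqF// mul1r.
  apply: (@le_lt_trans _ _ (1 / (1 - 4^-1))%:E); last exact: ltry.
  apply: lime_le; first by apply: is_cvg_nneseries => j _ _; rewrite lee_fin.
  apply: nearW => n; rewrite sumEFin lee_fin.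
  apply: le_trans (@geometric_le_lim R n 1 4^-1 _ _ _) => //; last first.
    by rewrite ger0_norm//; lra.
  rewrite seriesEnat/=; apply: ler_sum => j _.
  by rewrite mul1r exprVn.
have mS : measurable_fun D S.
  by apply: ge0_emeasurable_sum => [j x Dx _|j _]; [rewrite lee_fin|exact: mG].
have iS : mu.-integrable D S.
  apply/integrableP; split => //.
  under eq_integral.
    move=> x _; rewrite gee0_abs; last first.
      by apply: nneseries_ge0 => j _ _; rewrite lee_fin.
    over.
  exact: IS.
have := integrable_ae mD iS.
apply: filterS => x /[apply] Sx.
have cs : cvgn (series (fun j => F j.+1 x - F j x)).
  apply: (@normed_cvg R R^o).
  apply: nondecreasing_is_cvgn.
    apply/nondecreasing_seqP => n; rewrite /normed_series_of/=.
    by rewrite seriesSr lerDl.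
  exists (1 / (1 - 4^-1) + fine (S x)) => _ [n _ <-]; rewrite /normed_series_of/= seriesEnat/=.
  apply: (@le_trans _ _ (\sum_(0 <= j < n) ((4^-1)^+j + G j x))).
    (* With p = 4^j and a = 4^-j, p a = 1 and |t| = p a |t| <= p (a^2 + t^2) = a + p t^2. *)
    apply: ler_sum => j _; rewrite /G.
    set t := _ - _; set a := _^-1 ^+ j; set p := 4 ^+ j.
    have p0 : 0 < p by rewrite exprn_gt0.
    have pa : p * a = 1 by rewrite /p /a -exprMn mulfV// expr1n.
    have -> : `|t| = p * a * `|t| by rewrite pa mul1r.
    have -> : a = p * a * a by rewrite pa mul1r.
    rewrite -real_normK ?num_real// -!mulrA -mulrDr ler_pM2l//.
    rewrite mulrA pa mul1r.
    by have := sqr_ge0 (`|t| - a / 2); have := sqr_ge0 a => h1 h2; lra.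
  rewrite big_split/= lerD//.
    apply: le_trans (@geometric_le_lim R n 1 4^-1 _ _ _) => //; last first.
      by rewrite ger0_norm//; lra.
    by rewrite seriesEnat/=; apply: ler_sum => j _; rewrite mul1r.
  rewrite -lee_fin fineK// -sumEFin; apply: nneseries_lim_ge => j _ _.
  by rewrite lee_fin.
rewrite (_ : (fun j => F j x) = fun n => F 0%N x + series (fun j => F j.+1 x - F j x) n).
  by apply: is_cvgD => //; exact: is_cvg_cst.
apply/funext => n; have := eq_sum_telescope (fun j => F j x) n.
by [].
Qed.

Lemma riesz_fischer (F : nat -> X -> R) :
  (forall n, sqint mu D (F n)) ->
  (forall e, 0 < e -> exists N, forall p q, (N <= p)%N -> (N <= q)%N ->
     \int[mu]_(x in D) (F p x - F q x) ^+ 2 <= e) ->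
  exists2 v, sqint mu D v & \int[mu]_(x in D) (F n x - v x) ^+ 2 @[n --> \oo] --> (0 : R).
Proof.
move=> sF cF.
have /choice[N HN] : forall j : nat, exists N, forall p q, (N <= p)%N -> (N <= q)%N ->
     \int[mu]_(x in D) (F p x - F q x) ^+ 2 <= (4 ^- j) ^+ 2.
  by move=> j; apply: cF; rewrite exprn_gt0// invr_gt0 exprn_gt0.
(* Accumulating all earlier [N i] and adding j makes [n_ j] at least [N j], at least j, and
   monotone. *)
pose n_ j := (j + \sum_(0 <= i < j.+1) N i)%N.
have n_ge j : (N j <= n_ j)%N by rewrite /n_ big_nat_recr//= addnA leq_addl.
have n_nd j : (n_ j <= n_ j.+1)%N.
  by rewrite /n_ [in leqRHS]big_nat_recr//= addSn; lia.
have jn_ j : (j <= n_ j)%N by rewrite leq_addr.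
have := @ae_cvg_of_summable (fun j => F (n_ j)) (fun j => sF _) _.
case.
  by move=> j; apply: HN => //; apply: leq_trans (n_nd j).
move=> Z [mZ Z0 cZ].
(* Killing the functions on the exceptional set turns almost everywhere convergence into convergence
   at every point of [D], so the limit is measurable although the measure need not be complete. *)
pose F' n x := F n x * \1_(~` Z) x.
have m1 : measurable_fun D (\1_(~` Z) : X -> R).
  by apply: measurable_indic; exact: measurableC.
have aeF n (h : X -> R) : measurable_fun D h ->
  (\int[mu]_(x in D) ((F n x - h x) ^+ 2)%:E = \int[mu]_(x in D) ((F' n x - h x) ^+ 2)%:E)%E.
  move=> mh.
  have mF := (sF n).1.
  apply: ae_eq_integral => //.
  - by apply/measurable_EFinP/measurable_funX/measurable_funB.
  - by apply/measurable_EFinP/measurable_funX/measurable_funB => //; exact: measurable_funM.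
  exists Z; split => // x /= /not_implyP[Dx]; apply: contra_notP => nZx.
  by rewrite /F' indicE mem_set// mulr1.
have cF' x : D x -> cvgn (fun j => F' (n_ j) x).
  move=> Dx; have [Zx|nZx] := pselect (Z x).
    rewrite (_ : (fun _ => _) = (fun=> 0)); first exact: is_cvg_cst.
    by apply/funext => j; rewrite /F' indicE memNset ?mulr0//=; exact.
  rewrite (_ : (fun _ => _) = (fun j => F (n_ j) x)).
    by apply: contrapT => h; apply: nZx; apply: cZ => /= /(_ Dx).
  by apply/funext => j; rewrite /F' indicE mem_set ?mulr1//.
pose v x := lim (F' (n_ j) x @[j --> \oo]).
have mF' n : measurable_fun D (F' n) by apply: measurable_funM => //; case: (sF n).
have mv : measurable_fun D v.
  by apply: (@measurable_fun_cvg _ _ _ _ (fun j => F' (n_ j))) => // x Dx; exact: cF'.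
have close e : 0 < e -> exists N0, forall p, (N0 <= p)%N ->
    (\int[mu]_(x in D) ((F p x - v x) ^+ 2)%:E <= e%:E)%E.
  move=> e0; have [N0 HN0] := cF e e0; exists N0 => p N0p.
  rewrite aeF//.
  apply: (@fatou_le _ _ _ _ _ (fun j x => (F' p x - F' (n_ (j + N0)%N) x) ^+ 2)) => //.
  - by move=> j; apply: measurable_funX; exact: measurable_funB.
  - by move=> j x _; exact: sqr_ge0.
  - move=> x Dx; have := cF' x Dx; rewrite -/(v x) => h.
    have h' : F' (n_ (j + N0)%N) x @[j --> \oo] --> v x.
      by rewrite (cvg_shiftn N0 (fun j => F' (n_ j) x)); exact: h.
    rewrite !expr2; under eq_fun do rewrite expr2.
    by apply: cvgM; apply: cvgB => //; exact: cvg_cst.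
  - move=> j.
    rewrite (_ : integral _ _ _ = \int[mu]_(x in D) ((F p x - F (n_ (j + N0)%N) x) ^+ 2)%:E)%E.
      rewrite -EFin_sqint//; last exact: sqintB.
      by rewrite lee_fin HN0//; apply: leq_trans (jn_ _); rewrite leq_addl.
    have mF n := (sF n).1.
    apply: ae_eq_integral => //.
    + by apply/measurable_EFinP/measurable_funX/measurable_funB.
    + by apply/measurable_EFinP/measurable_funX/measurable_funB.
    exists Z; split => // x /= /not_implyP[Dx]; apply: contra_notP => nZx.
    by rewrite /F' indicE mem_set// !mulr1.
have sFv p : sqint mu D (fun x => F p x - v x) -> sqint mu D v.
  move=> h; have := sqintB mD (sF p) h; apply: eq_sqint => x _.
  by rewrite opprB addrC subrK.
have sv : sqint mu D v.
  have [N0 /(_ _ (leqnn _)) h] := close 1 ltr01.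
  apply: (sFv N0); split; first by apply: measurable_funB => //; case: (sF N0).
  by apply: le_lt_trans h _; exact: ltry.
exists v => //; apply/cvgrPdist_le => e e0; have [N0 h] := close e e0.
exists N0 => // p /= /h; rewrite -EFin_sqint//; last exact: sqintB.
by rewrite lee_fin sub0r normrN ger0_norm// Rintegral_sqr_ge0.
Qed.

End RieszFischer.

Lemma fmap_ultra (T U : Type) (f : T -> U) (F : set_system T) :
  UltraFilter F -> UltraFilter (f @ F).
Proof.
move=> FU; split => [|G PG sub].
  exact: fmap_proper_filter.
apply/seteqP; split => // A GA.
have [//|FA] := in_ultra_setVsetC (f @^-1` A) FU.
by have [y [? nAy]] := filter_ex (filterI GA (sub (~` A) FA)).
Qed.

(* Limits along one ultrafilter exist for all rows at once, so that a single
   pass selects the subsequence. *)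
Lemma diagonal_subsequence (R : realType) (x : nat -> nat -> R) (B : nat -> R) :
  (forall m i, `|x m i| <= B m) ->
  exists2 k : nat -> nat, {homo k : m n / (m < n)%N} &
    forall m, cvgn (fun n => x m (k n)).
Proof.
move=> xB.
have [U [UU subU]] := ultraFilterLemma (@eventually_filter).
have UP : ProperFilter U by exact: ultra_proper.
have /choice[p Hp] : forall m, exists p : R, x m i @[i --> U] --> p.
  move=> m; have := @segment_compact R (- B m) (B m).
  rewrite compact_ultra => /(_ (x m @ U) _ _)[].
    exact: fmap_ultra.
    apply: (@filterS _ U _ setT); last exact: filterT.
    by move=> i _ /=; rewrite in_itv/= -ler_norml.
  by move=> p [_ hp]; exists p.
have step (n a : nat) : exists b : nat, (a < b)%N /\
    forall m, (m <= n)%N -> `|p m - x m b| <= n.+1%:R^-1.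
  have : U [set b | forall m, (m <= n)%N -> `|p m - x m b| <= n.+1%:R^-1].
    elim: {1}n => [|j IH].
      have /cvgrPdist_le/(_ n.+1%:R^-1) := Hp 0%N.
      rewrite invr_gt0 ltr0n => /(_ isT); apply: filterS => b h m.
      by rewrite leqn0 => /eqP ->.
    have /cvgrPdist_le/(_ n.+1%:R^-1) := Hp j.+1.
    rewrite invr_gt0 ltr0n => /(_ isT) h; apply: filterS (filterI h IH) => b [h1 h2] m.
    by rewrite leq_eqVlt => /orP[/eqP ->//|]; exact: h2.
  have : U [set b | (a < b)%N] by apply: subU; exists a.+1.
  move=> h1 h2; have [b [? ?]] := filter_ex (filterI h1 h2).
  by exists b.
have /choice[s Hs] : forall na : nat * nat, exists b : nat, (na.2 < b)%N /\
    forall m, (m <= na.1)%N -> `|p m - x m b| <= na.1.+1%:R^-1.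
  by move=> [n a]; exact: step.
(* [s (n, a)] is an index beyond [a] at which the rows 0, ..., n are all within 1/(n+1) of their
   limits along the ultrafilter. *)
pose k := fix k n := if n is n'.+1 then s (n, k n') else s (0%N, 0%N).
have kh n : (k n < k n.+1)%N by have [] := Hs (n.+1, k n).
have kx n m : (m <= n)%N -> `|p m - x m (k n)| <= n.+1%:R^-1.
  by case: n => [|n]; [have [_] := Hs (0%N, 0%N)|have [_] := Hs (n.+1, k n)]; exact.
exists k; first by apply: homo_ltn => //; exact: ltn_trans.
move=> m; apply/cvg_ex; exists (p m).
apply/cvgrPdist_le => e e0.
have [N _ HN] := near_infty_natSinv_lt (PosNum e0).
exists (maxn m N) => // n /=; rewrite geq_max => /andP[mn Nn].
by apply: le_trans (kx _ _ mn) _; exact/ltW/HN.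
Qed.

(** * Affine changes of variables *)

(** The plane carries the product sigma-algebra, so an open set is exhausted by countably many boxes
    with rational centres and radii 1/(n+1). A radius below e/2 leaves room both for the distance of
    the centre to x and for the box itself. *)
Lemma open_plane_measurable (R : realType) (A : set (plane R)) :
  open A -> measurable (A : set (measurableTypeR R * measurableTypeR R)).
Proof.
move=> oA.
pose B (q : rat * rat) (n : nat) : set (measurableTypeR R * measurableTypeR R) :=
  ball (ratr q.1 : R) n.+1%:R^-1 `*` ball (ratr q.2 : R) n.+1%:R^-1.
pose C q n := if pselect (B q n `<=` A) then B q n else set0.
have -> : A = \bigcup_n \bigcup_k (if unpickle k is Some q then C q n else set0).
  apply/seteqP; split => [x Ax|x [n _ [k _]]]; last first.
    by case: (unpickle k) => [q|//]; rewrite /C; case: pselect => // h /h.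
  move: oA; rewrite openE => /(_ x Ax); rewrite /interior => /nbhs_ballP[e /= e0 eA].
  have [n _ Hn] := near_infty_natSinv_lt (PosNum (divr_gt0 e0 (ltr0Sn R 1))).
  have {}Hn : n.+1%:R^-1 < e / 2 := Hn n (leqnn n).
  have [d dE [d0 de]] : exists2 d : R, n.+1%:R^-1 = d & 0 < d /\ d < e / 2.
    by exists n.+1%:R^-1; rewrite // invr_gt0.
  have /rat_in_itvoo[q1 Hq1] : x.1 - d < x.1 + d by lra.
  have /rat_in_itvoo[q2 Hq2] : x.2 - d < x.2 + d by lra.
  have c1 : `|ratr q1 - x.1| < d by rewrite ltr_distl; move: Hq1; rewrite in_itv.
  have c2 : `|ratr q2 - x.2| < d by rewrite ltr_distl; move: Hq2; rewrite in_itv.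
  exists n; [exact: I|exists (pickle (q1, q2)); [exact: I|rewrite pickleK /C]].
  case: pselect => [h|[]]; first by split; rewrite /ball/= dE.
  move=> y []; rewrite dE /ball/= => y1 y2; apply: eA; split; rewrite /ball/=.
    rewrite -(subrKA (ratr q1)); apply: le_lt_trans (ler_normD _ _) _.
    by rewrite [`|x.1 - _|]distrC; lra.
  rewrite -(subrKA (ratr q2)); apply: le_lt_trans (ler_normD _ _) _.
  by rewrite [`|x.2 - _|]distrC; lra.
apply: bigcupT_measurable => n; apply: bigcupT_measurable => k.
case: (unpickle k) => [q|//]; rewrite /C; case: pselect => [h|h]; last exact: measurable0.
by apply: measurableX; exact: measurable_ball.
Qed.

Lemma closed_plane_measurable (R : realType) (A : set (plane R)) :
  closed A -> measurable (A : set (measurableTypeR R * measurableTypeR R)).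
Proof.
by move=> /closed_openC /open_plane_measurable /measurableC; rewrite setCK.
Qed.

Lemma continuous_plane_measurable (R : realType) (f : plane R -> R) :
  continuous f ->
  measurable_fun (setT : set (measurableTypeR R * measurableTypeR R)) f.
Proof.
move=> cf; apply: (measurability (@RGenOpens.G R)); first exact: RGenOpens.measurableE.
move=> _ [_ [a [b ->]] <-]; rewrite setTI.
by apply: open_plane_measurable; move/continuousP : cf; apply; exact: interval_open.
Qed.

(** By uniqueness of Lebesgue measure it suffices that the scaled pushforward gives half-open
    intervals their length. For negative [a] the preimage is half-open on the other side, hence the
    two cases. *)
Lemma measure_affine (R : realType) (a b : R) (A : set (measurableTypeR R)) : a != 0 ->
  measurable A ->
  (`|a|%:E * lebesgue_measure ((fun x : measurableTypeR R => (a * x + b)%R : measurableTypeR R) @^-1` A)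
   = lebesgue_measure A)%E.
Proof.
move=> a0.
have maff : measurable_fun setT (fun x : measurableTypeR R => a * x + b : measurableTypeR R).
  by apply: measurable_funD => //; exact: measurable_funM.
pose phi (x : measurableTypeR R) : measurableTypeR R := a * x + b.
pose k : {nonneg R} := NngNum (normr_ge0 a).
pose m0 := (fun m : {measure set (measurableTypeR R) -> \bar R} =>
  [the {measure set (measurableTypeR R) -> \bar R} of mscale k m])
  [the {measure set (measurableTypeR R) -> \bar R} of pushforward (@lebesgue_measure R) phi].
pose m : {measure set (measurableTypeR R) -> \bar R} := m0 maff.
move=> mA; rewrite -[LHS]/(m A); apply/esym/lebesgue_measure_unique => //= _ [[p q]] _ <-/=.
rewrite /m /mscale/= /pushforward/= lebesgue_measure_itv/= lte_fin.
have [ap|an|/eqP] := ltgtP a 0; last by rewrite (negbTE a0).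
- rewrite (_ : _ @^-1` _ = `[(q - b) / a, (p - b) / a[%classic); last first.
    apply/seteqP; split => x; rewrite /phi/= !in_itv/= ler_ndivrMr// ltr_ndivlMr//;
      by move=> /andP[? ?]; apply/andP; split; lra.
  rewrite lebesgue_measure_itv/= lte_fin ltr_nM2r ?invr_lt0// ltrD2r.
  case: ifP => _; last by rewrite mule0.
  by rewrite -EFinB -EFinB -EFinM ltr0_norm//; congr EFin; field.
- rewrite (_ : _ @^-1` _ = `](p - b) / a, (q - b) / a]%classic); last first.
    apply/seteqP; split => x; rewrite /phi/= !in_itv/= ler_pdivlMr// ltr_pdivrMr//;
      by move=> /andP[? ?]; apply/andP; split; lra.
  rewrite lebesgue_measure_itv/= lte_fin ltr_pM2r ?invr_gt0// ltrD2r.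
  case: ifP => _; last by rewrite mule0.
  by rewrite -EFinB -EFinB -EFinM gtr0_norm//; congr EFin; field.
Qed.

Lemma ge0_integral_affine (R : realType) (a b : R) (F : R -> \bar R) : a != 0 ->
  measurable_fun (setT : set (measurableTypeR R)) F -> (forall x, 0 <= F x)%E ->
  (`|a|%:E * \int[@lebesgue_measure R]_x F (a * x + b)%R = \int[@lebesgue_measure R]_x F x)%E.
Proof.
move=> a0 mF F0.
have maff : measurable_fun setT (fun x : measurableTypeR R => a * x + b : measurableTypeR R).
  by apply: measurable_funD => //; exact: measurable_funM.
pose phi (x : measurableTypeR R) : measurableTypeR R := a * x + b.
pose k : {nonneg R} := NngNum (normr_ge0 a).
pose m0 := (fun m : {measure set (measurableTypeR R) -> \bar R} =>
  [the {measure set (measurableTypeR R) -> \bar R} of mscale k m])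
  [the {measure set (measurableTypeR R) -> \bar R} of pushforward (@lebesgue_measure R) phi].
pose m : {measure set (measurableTypeR R) -> \bar R} := m0 maff.
transitivity (\int[m]_x F x)%E; last first.
  by apply: eq_measure_integral => A mA _; exact: measure_affine.
rewrite ge0_integral_mscale//; congr (_ * _)%E.
by rewrite ge0_integral_pushforward.
Qed.

(* [plane R] with its Borel structure; the two types are convertible. *)
Notation mplane R := (measurableTypeR R * measurableTypeR R)%type.

Definition para (R : realType) (p v w x : plane R) : plane R :=
  (p.1 + x.1 * v.1 + x.2 * w.1, p.2 + x.1 * v.2 + x.2 * w.2).

Definition det2 (R : realType) (v w : plane R) : R := v.1 * w.2 - v.2 * w.1.

Section ChangeOfVariables.
Context (R : realType).
Local Notation mu := (@lebesgue_measure R).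
Implicit Types (F : mplane R -> \bar R) (p v w x : plane R).

Lemma lty_pmule (a : R) (X : \bar R) : 0 < a -> (0 <= X)%E ->
  (a%:E * X < +oo)%E -> (X < +oo)%E.
Proof.
by move=> a0; case: X => [r _ _|_|//]; [exact: ltry|rewrite gt0_muley ?lte_fin ?ltxx].
Qed.

Lemma measurable_affine2 (a b c : R) :
  measurable_fun (setT : set (mplane R)) (fun x : mplane R => a + x.1 * b + x.2 * c).
Proof.
apply: measurable_funD; last by apply: measurable_funM.
by apply: measurable_funD => //; apply: measurable_funM.
Qed.

Lemma measurable_para p v w :
  measurable_fun (setT : set (mplane R)) (para p v w : mplane R -> mplane R).
Proof. by apply: measurable_fun_pair; exact: measurable_affine2. Qed.

(** Tonelli reduces the change of variables to two successive one-dimensional affine substitutions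
    whose slopes multiply to the determinant. The map has to be factored differently according to
    whether the inner variable moves the first coordinate, that is, whether [v.1] vanishes. *)
Lemma ge0_integral_para p v w F : det2 v w != 0 ->
  measurable_fun setT F -> (forall x, 0 <= F x)%E ->
  (`|det2 v w|%:E * \int[leb2 R]_x F (para p v w x) = \int[leb2 R]_x F x)%E.
Proof.
move=> d0 mF F0.
have mFp : measurable_fun setT (fun x : mplane R => F (para p v w x)).
  exact: (measurableT_comp mF (measurable_para p v w)).
have mFt (y : R) : measurable_fun (setT : set (measurableTypeR R)) (fun x : measurableTypeR R => F (x, y)).
  by apply: (measurableT_comp mF); apply: measurable_fun_pair.
have mFs (x : R) : measurable_fun (setT : set (measurableTypeR R)) (fun y : measurableTypeR R => F (x, y)).
  by apply: (measurableT_comp mF); apply: measurable_fun_pair.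
rewrite fubini_tonelli2//.
have msec : measurable_fun (setT : set (measurableTypeR R)) (fubini_G mu (fun x : mplane R => F (para p v w x))).
  exact: measurable_fun_fubini_tonelli_G.
have sec0 y : (0 <= fubini_G mu (fun x : mplane R => F (para p v w x)) y)%E.
  exact: integral_ge0.
have [v1|v1] := eqVneq v.1 0.
- have v2 : v.2 != 0 by apply: contraNneq d0 => v2; rewrite /det2 v1 v2 !mul0r subrr.
  have w1 : w.1 != 0 by apply: contraNneq d0 => w1; rewrite /det2 v1 w1 mul0r mulr0 subrr.
  rewrite (_ : `|det2 v w| = `|w.1| * `|v.2|); last first.
    by rewrite /det2 v1 mul0r sub0r normrN normrM mulrC.
  rewrite EFinM -muleA -ge0_integralZl//.
  transitivity (`|w.1|%:E * \int[mu]_t \int[mu]_y F ((w.1 * t + p.1)%R, y))%E.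
    congr (_ * _)%E; apply: eq_integral => t _.
    rewrite /fubini_G -(ge0_integral_affine (p.2 + t * w.2) v2 (mFs _))//.
    congr (_ * _)%E; apply: eq_integral => s _; rewrite /para v1/=.
    by congr (F (_, _)); ring.
  have mG : measurable_fun setT (fun x : mplane R => F (w.1 * x.1 + p.1, x.2)).
    apply: (measurableT_comp mF); apply: measurable_fun_pair => //.
    by apply: measurable_funD => //; exact: measurable_funM.
  rewrite -(@fubini_tonelli1 _ _ _ _ R mu mu _ mG)// (@fubini_tonelli2 _ _ _ _ R mu mu _ mG)//.
  rewrite -ge0_integralZl//; last 2 first.
    exact: measurable_fun_fubini_tonelli_G.
    by move=> ? _; exact: integral_ge0.
  rewrite (@fubini_tonelli2 _ _ _ _ R mu mu _ mF)//; apply: eq_integral => y _.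
  by rewrite /fubini_G/= (ge0_integral_affine _ w1 (mFt _)).
- rewrite (_ : `|det2 v w| = `|det2 v w / v.1| * `|v.1|); last first.
    by rewrite -normrM divfK.
  have b0 : det2 v w / v.1 != 0 by rewrite mulf_neq0// invr_eq0.
  set b := det2 v w / v.1 in b0 *.
  rewrite EFinM -muleA -ge0_integralZl//.
  (* Once the first coordinate x has become the inner variable, the second one is affine in t with
     slope det2 v w / v.1. *)
  transitivity (`|b|%:E * \int[mu]_t \int[mu]_x F (x, (b * t + (p.2 + (x - p.1) / v.1 * v.2))%R))%E.
    congr (_ * _)%E; apply: eq_integral => t _.
    have mH : measurable_fun (setT : set (measurableTypeR R)) (fun x : measurableTypeR R => F (x, b * t + (p.2 + (x - p.1) / v.1 * v.2))).
      apply: (measurableT_comp mF); apply: measurable_fun_pair => //.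
      apply: measurable_funD => //; apply: measurable_funD => //; apply: measurable_funM => //.
      by apply: measurable_funM => //; exact: measurable_funB.
    rewrite /fubini_G -(ge0_integral_affine (p.1 + t * w.1) v1 mH)//.
    congr (_ * _)%E; apply: eq_integral => s _; rewrite /para /b /det2/=.
    by congr (F (_, _)); field.
  have mG : measurable_fun setT (fun x : mplane R => F (x.1, b * x.2 + (p.2 + (x.1 - p.1) / v.1 * v.2))).
    apply: (measurableT_comp mF); apply: measurable_fun_pair => //.
    apply: measurable_funD => //; first exact: measurable_funM.
    apply: measurable_funD => //; apply: measurable_funM => //.
    by apply: measurable_funM => //; exact: measurable_funB.
  rewrite -(@fubini_tonelli2 _ _ _ _ R mu mu _ mG)// (@fubini_tonelli1 _ _ _ _ R mu mu _ mG)//.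
  rewrite -ge0_integralZl//; last 2 first.
    exact: measurable_fun_fubini_tonelli_F.
    by move=> ? _; exact: integral_ge0.
  rewrite (@fubini_tonelli1 _ _ _ _ R mu mu _ mF)//; apply: eq_integral => x _.
  by rewrite /fubini_F/= (ge0_integral_affine _ b0 (mFs _)).
Qed.

Lemma ge0_integral_para_in p v w (D : set (mplane R)) F : det2 v w != 0 ->
  measurable D -> measurable_fun D F -> (forall x, D x -> 0 <= F x)%E ->
  (\int[leb2 R]_(x in D) F x =
   `|det2 v w|%:E * \int[leb2 R]_(x in [set x | D (para p v w x)]) F (para p v w x))%E.
Proof.
move=> d0 mD mF F0.
rewrite integral_mkcond -(ge0_integral_para p d0); last 2 first.
- by apply/(measurable_restrictT _ mD).
- by move=> x; apply: erestrict_ge0.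
congr (_ * _)%E; rewrite [RHS]integral_mkcond; apply: eq_integral => x _.
by rewrite /patch; congr (if _ then _ else _); apply/idP/idP => /set_mem h; exact/mem_set.
Qed.

Lemma preimage_para_measurable p v w (D : set (mplane R)) : measurable D ->
  measurable ([set x | D (para p v w x)] : set (mplane R)).
Proof.
by move=> mD; rewrite -[X in measurable X]setTI; apply: (measurable_para p v w).
Qed.

Lemma measurable_fun_para p v w (D : set (mplane R)) (f : mplane R -> R) :
  measurable D -> measurable_fun D f ->
  measurable_fun ([set x | D (para p v w x)] : set (mplane R)) (fun x => f (para p v w x)).
Proof.
move=> mD mf; apply: (measurable_comp mD _ mf).
  by move=> _ [x /= ? <-].
by apply: measurable_funS (measurable_para p v w).
Qed.

Lemma integrable_para p v w (D : set (mplane R)) (f : mplane R -> R) : det2 v w != 0 ->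
  measurable D -> (leb2 R).-integrable D (EFin \o f) ->
  (leb2 R).-integrable ([set x | D (para p v w x)] : set (mplane R))
    (EFin \o (fun x => f (para p v w x))).
Proof.
move=> d0 mD fi; have mf := integrable_measurable fi; apply/integrableP; split.
  by apply/measurable_EFinP; exact: measurable_fun_para.
have /integrableP[_] := fi.
rewrite (ge0_integral_para_in p d0)//; last first.
  by do 2 apply: measurableT_comp => //.
by apply: lty_pmule; [rewrite normr_gt0|exact: integral_ge0].
Qed.

Lemma Rintegral_para p v w (D : set (mplane R)) (f : mplane R -> R) : det2 v w != 0 ->
  measurable D -> (leb2 R).-integrable D (EFin \o f) ->
  \int[leb2 R]_(x in D) f x =
  `|det2 v w| * \int[leb2 R]_(x in [set x | D (para p v w x)]) f (para p v w x).
Proof.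
move=> d0 mD fi; have mf : measurable_fun D (EFin \o f) by case/integrableP : fi.
have gi := integrable_para p d0 mD fi.
have mD' := preimage_para_measurable p v w mD.
rewrite /Rintegral integralE [in RHS]integralE.
rewrite (ge0_integral_para_in p d0 mD (measurable_funepos mf))//.
rewrite (ge0_integral_para_in p d0 mD (measurable_funeneg mf))//.
have p1 := integrable_pos_fin_num mD' gi; have p2 := integrable_neg_fin_num mD' gi.
set P := (\int[leb2 R]_(x in _) _)%E in p1; set N := (\int[leb2 R]_(x in _) _)%E in p2.
have -> : (\int[leb2 R]_(x in [set x | D (para p v w x)]) (EFin \o f)^\+ (para p v w x) = P)%E.
  by apply: eq_integral => x _; rewrite !funeposE.
have -> : (\int[leb2 R]_(x in [set x | D (para p v w x)]) (EFin \o f)^\- (para p v w x) = N)%E.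
  by apply: eq_integral => x _; rewrite !funenegE.
change (fine (`|det2 v w|%:E * P - `|det2 v w|%:E * N)%E = `|det2 v w| * fine (P - N)%E).
by rewrite -(fineK p1) -(fineK p2) -!EFinM -!EFinB/= mulrBr.
Qed.

Lemma leb2_para p v w (D : set (mplane R)) : det2 v w != 0 -> measurable D ->
  (leb2 R D = `|det2 v w|%:E * leb2 R [set x | D (para p v w x)])%E.
Proof.
move=> d0 mD; have mD' := preimage_para_measurable p v w mD.
have := ge0_integral_para_in p d0 mD (measurable_cst 1%E) (fun _ _ => lee01).
by rewrite !integral_cst// !mul1e.
Qed.

(** When the line is not vertical its vertical sections are single points; the other case follows by
    exchanging the coordinates, which is the change of variables with vectors (0, 1) and (1, 0). *)
Lemma negligible_line (a b c : R) : (b != 0) || (c != 0) ->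
  leb2 R [set x | a + x.1 * b + x.2 * c = 0] = 0%E.
Proof.
have ml b' c' : measurable ([set x | a + x.1 * b' + x.2 * c' = 0] : set (mplane R)).
  rewrite -[X in measurable X]setTI.
  exact: (measurable_affine2 a b' c') (measurable_set1 0).
have lc b' c' : c' != 0 -> leb2 R [set x | a + x.1 * b' + x.2 * c' = 0] = 0%E.
  move=> c0; rewrite /product_measure1/=.
  rewrite (eq_integral (fun=> 0%E)) ?integral0// => x _.
  rewrite (_ : xsection _ _ = [set - (a + x * b') / c']) ?lebesgue_measure_set1//.
  apply/seteqP; split => y; rewrite /xsection/= inE/=.
    by move=> h; apply: (mulIf c0); rewrite divfK//; lra.
  by move=> ->; rewrite divfK//; lra.
case/orP => [b0|]; last exact: lc.
have d0 : det2 ((0, 1) : plane R) (1, 0) != 0 by rewrite /det2/= mul0r mulr1 sub0r oppr_eq0 oner_eq0.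
rewrite (leb2_para (0, 0) d0) ?ml// [X in leb2 R X](_ : _ = [set x | a + x.1 * c + x.2 * b = 0]).
  by rewrite lc// mule0.
by apply/seteqP; split => x; rewrite /para/= !mulr1 !mulr0 !add0r !addr0 => h; lra.
Qed.

End ChangeOfVariables.

(** * Functions of class C1 in the plane *)

Section C1Calculus.
Context (R : realType).
Implicit Types (f g fx fy gx gy : plane R -> R) (x y v : plane R).

(** The partials are explicit data, so that the calculus rules compute gradients of products and
    sums of profiles; [has_partialsE] identifies them with [dx] and [dy] afterwards. *)
Definition has_partials f fx fy := [/\ continuous f, continuous fx, continuous fy,
  (forall x, is_derive x ((1, 0) : plane R) f (fx x)) &
  (forall x, is_derive x ((0, 1) : plane R) f (fy x))].

Lemma C1_has_partials f : C1 f -> has_partials f (dx f) (dy f).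
Proof.
by move=> [cf d1 d2 c1 c2]; split => // x; apply/derivableP.
Qed.

Lemma has_partialsE f fx fy : has_partials f fx fy -> dx f = fx /\ dy f = fy.
Proof.
move=> [_ _ _ d1 d2]; split; apply/funext => x.
  by rewrite /dx (@derive_val _ _ _ _ _ _ _ (d1 x)).
by rewrite /dy (@derive_val _ _ _ _ _ _ _ (d2 x)).
Qed.

Lemma has_partials_C1 f fx fy : has_partials f fx fy -> C1 f.
Proof.
move=> h; have [ex ey] := has_partialsE h; case: h => cf c1 c2 d1 d2.
by split; rewrite ?ex ?ey.
Qed.

Lemma has_partials_cst (a : R) : has_partials (fun=> a) (fun=> 0) (fun=> 0).
Proof.
by split=> x; first [exact: cvg_cst|exact: is_derive_cst].
Qed.

Lemma has_partialsD f fx fy g gx gy : has_partials f fx fy -> has_partials g gx gy ->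
  has_partials (fun x => f x + g x) (fun x => fx x + gx x) (fun x => fy x + gy x).
Proof.
move=> [f0 f1 f2 f3 f4] [g0 g1 g2 g3 g4]; split=> x.
- by apply: cvgD; [exact: f0|exact: g0].
- by apply: cvgD; [exact: f1|exact: g1].
- by apply: cvgD; [exact: f2|exact: g2].
- exact: (is_deriveD (f3 x) (g3 x)).
- exact: (is_deriveD (f4 x) (g4 x)).
Qed.

Lemma has_partialsM f fx fy g gx gy : has_partials f fx fy -> has_partials g gx gy ->
  has_partials (fun x => f x * g x) (fun x => fx x * g x + f x * gx x)
    (fun x => fy x * g x + f x * gy x).
Proof.
move=> [f0 f1 f2 f3 f4] [g0 g1 g2 g3 g4]; split.
- by move=> x; apply: cvgM; [exact: f0|exact: g0].
- by move=> x; apply: cvgD; apply: cvgM; [exact: f1|exact: g0|exact: f0|exact: g1].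
- by move=> x; apply: cvgD; apply: cvgM; [exact: f2|exact: g0|exact: f0|exact: g2].
- move=> x; apply: is_derive_eq (is_deriveM (f3 x) (g3 x)) _.
  by rewrite /GRing.scale/=; ring.
- move=> x; apply: is_derive_eq (is_deriveM (f4 x) (g4 x)) _.
  by rewrite /GRing.scale/=; ring.
Qed.

Lemma has_partialsZ a f fx fy : has_partials f fx fy ->
  has_partials (fun x => a * f x) (fun x => a * fx x) (fun x => a * fy x).
Proof.
move=> /(has_partialsM (has_partials_cst a)); congr has_partials;
  by apply/funext => x; rewrite mul0r add0r.
Qed.

Lemma has_partialsB f fx fy g gx gy : has_partials f fx fy -> has_partials g gx gy ->
  has_partials (fun x => f x - g x) (fun x => fx x - gx x) (fun x => fy x - gy x).
Proof.
move=> hf /(has_partialsZ (-1)) hg; have := has_partialsD hf hg.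
by congr has_partials; apply/funext => x; rewrite mulN1r.
Qed.

Lemma has_partials_sum (I : Type) (s : seq I) (f fx fy : I -> plane R -> R) :
  (forall i, has_partials (f i) (fx i) (fy i)) ->
  has_partials (fun x => \sum_(i <- s) f i x) (fun x => \sum_(i <- s) fx i x)
    (fun x => \sum_(i <- s) fy i x).
Proof.
move=> h; elim: s => [|i s IH].
  have := has_partials_cst 0; congr has_partials; by apply/funext => x; rewrite big_nil.
have := has_partialsD (h i) IH.
by congr has_partials; apply/funext => x; rewrite big_cons.
Qed.

Lemma is_derive_line f x v (t : R) (df : R) :
  is_derive t 1 (fun s : R => f (x.1 + s * v.1, x.2 + s * v.2)) df <->
  is_derive ((x.1 + t * v.1, x.2 + t * v.2) : plane R) v f df.
Proof.
set g := fun s : R => _; set y : plane R := (_, _).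
have E : (fun h => h^-1 *: ((g \o shift t) (h *: (1 : R)) - g t)) =
         (fun h => h^-1 *: ((f \o shift y) (h *: v) - f y)).
  apply/funext => h; rewrite /g /shift/=.
  rewrite (_ : h *: v + y = (h * v.1 + y.1, h * v.2 + y.2))//.
  rewrite (_ : h *: 1 = h); last exact: mulr1.
  by rewrite /y/=; congr (_ *: (f (_, _) - _)); ring.
split => -[h1 h2]; split.
- by rewrite /derivable -E.
- by rewrite -h2 /derive -E.
- by rewrite /derivable E.
- by rewrite -h2 /derive E.
Qed.

Lemma continuous_affine (a b c : R) : continuous (fun x : plane R => a + x.1 * b + x.2 * c).
Proof.
move=> x; apply: cvgD; first apply: cvgD.
- exact: cvg_cst.
- by apply: cvgM; [exact: cvg_fst|exact: cvg_cst].
- by apply: cvgM; [exact: cvg_snd|exact: cvg_cst].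
Qed.

(** Every test function, cutoff and majorant below is assembled from one-variable profiles composed
    with affine forms, so this is the only source of partial derivatives. *)
Lemma has_partials_affine (F dF : R -> R) (a b c : R) :
  continuous dF -> (forall t : R, is_derive t (1 : R) F (dF t)) ->
  has_partials (fun x => F (a + x.1 * b + x.2 * c))
    (fun x => dF (a + x.1 * b + x.2 * c) * b) (fun x => dF (a + x.1 * b + x.2 * c) * c).
Proof.
move=> cdF dFF.
have cF : continuous F.
  by move=> t; apply/differentiable_continuous/derivable1_diffP; case: (dFF t).
have dl (p q t : R) : is_derive t (1 : R) (fun s : R => p + s * q) q.
  apply: is_derive_eq (is_deriveD (is_derive_cst p t 1)
    (is_deriveM (is_derive_id t 1) (is_derive_cst q t 1))) _.
  by rewrite /GRing.scale/=; ring.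
split.
- by move=> x; apply: continuous_comp; [exact: continuous_affine|exact: cF].
- move=> x; apply: cvgM; last exact: cvg_cst.
  by apply: continuous_comp; [exact: continuous_affine|exact: cdF].
- move=> x; apply: cvgM; last exact: cvg_cst.
  by apply: continuous_comp; [exact: continuous_affine|exact: cdF].
- move=> x.
  have -> : x = (x.1 + 0 * 1, x.2 + 0 * 0) by rewrite !mul0r !addr0 -surjective_pairing.
  apply/(is_derive_line _ _ (1, 0)) => /=; rewrite !mul0r !addr0.
  rewrite (_ : (fun s => _) = F \o (fun s => (a + x.1 * b + x.2 * c) + s * b)); last first.
    by apply/funext => s /=; congr F; ring.
  have d1 : is_derive ((a + x.1 * b + x.2 * c) + 0 * b) (1 : R) F (dF (a + x.1 * b + x.2 * c)).
    by rewrite mul0r addr0; exact: dFF.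
  exact: (@is_derive1_comp _ F (fun s => (a + x.1 * b + x.2 * c) + s * b) 0 _ _ d1 (dl _ _ _)).
- move=> x.
  have -> : x = (x.1 + 0 * 0, x.2 + 0 * 1) by rewrite !mul0r !addr0 -surjective_pairing.
  apply/(is_derive_line _ _ (0, 1)) => /=; rewrite !mul0r !addr0.
  rewrite (_ : (fun s => _) = F \o (fun s => (a + x.1 * b + x.2 * c) + s * c)); last first.
    by apply/funext => s /=; congr F; ring.
  have d1 : is_derive ((a + x.1 * b + x.2 * c) + 0 * c) (1 : R) F (dF (a + x.1 * b + x.2 * c)).
    by rewrite mul0r addr0; exact: dFF.
  exact: (@is_derive1_comp _ F (fun s => (a + x.1 * b + x.2 * c) + s * c) 0 _ _ d1 (dl _ _ _)).
Qed.

Lemma MVT_two_sided (g dg : R -> R) (a b : R) : (forall t : R, is_derive t (1 : R) g (dg t)) ->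
  exists2 c, `|c - a| <= `|b - a| & g b - g a = dg c * (b - a).
Proof.
move=> dgg.
have cg p q : {within `[p, q], continuous g}.
  by apply: derivable_within_continuous => t _; case: (dgg t).
have [ab|ba] := leP a b.
  have [c] := MVT_segment ab (fun t _ => dgg t) (cg a b).
  rewrite in_itv/= => /andP[ac cb] E; exists c => //.
  by rewrite !ger0_norm ?subr_ge0//; lra.
have [c] := MVT_segment (ltW ba) (fun t _ => dgg t) (cg b a).
rewrite in_itv/= => /andP[bc ca] E; exists c; last by lra.
by rewrite !ler0_norm ?subr_le0//; lra.
Qed.

(** The increment along [v] is split into a horizontal and a vertical step; the mean value theorem
    turns each into a partial derivative at a nearby point, and continuity of the partials
    concludes. Directional derivatives are needed because the sides of triangles are oblique. *)
Lemma has_partials_derive f fx fy x v : has_partials f fx fy ->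
  is_derive x v f (v.1 * fx x + v.2 * fy x).
Proof.
move=> [cf cfx cfy dfx dfy].
suff D : (fun h : R => h^-1 *: ((f \o shift x) (h *: v) - f x)) h @[h --> 0^'] -->
    v.1 * fx x + v.2 * fy x.
  by split; [apply/cvg_ex; exists (v.1 * fx x + v.2 * fy x)|exact/cvg_lim].
apply/cvgrPdist_le => e e0.
pose e' := e / (`|v.1| + `|v.2| + 1).
have n0 : 0 < `|v.1| + `|v.2| + 1 by rewrite ltr_wpDl// addr_ge0.
have e'0 : 0 < e' by rewrite divr_gt0.
have /cvgrPdist_le/(_ _ e'0) := cfx x; have /cvgrPdist_le/(_ _ e'0) := cfy x.
move=> /nbhs_ballP[r2 /= r20 B2] /nbhs_ballP[r1 /= r10 B1].
pose r := Num.min r1 r2; have r0 : 0 < r by rewrite lt_min r10.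
have S : 0 < r / (`|v.1| + `|v.2| + 1) by rewrite divr_gt0.
near=> h.
have h0 : h != 0 by near: h; exact: nbhs_dnbhs_neq.
have hr : `|h| < r / (`|v.1| + `|v.2| + 1).
  near: h; apply: dnbhs0_lt; exact: S.
have hr' : `|h| * (`|v.1| + `|v.2| + 1) < r by rewrite -ltr_pdivlMr.
have hv1 : `|h * v.1| < r.
  rewrite normrM; apply: le_lt_trans hr'; rewrite ler_wpM2l//.
  by have := normr_ge0 v.2; lra.
have hv2 : `|h * v.2| < r.
  rewrite normrM; apply: le_lt_trans hr'; rewrite ler_wpM2l//.
  by have := normr_ge0 v.1; lra.
have D1 (t : R) : is_derive t (1 : R) (fun t => f (t, x.2 + h * v.2)) (fx (t, x.2 + h * v.2)).
  have := (is_derive_line f (0, x.2 + h * v.2) (1, 0) t (fx (t, x.2 + h * v.2))).2.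
  rewrite /= mulr1 mulr0 addr0 add0r => /(_ (dfx _)).
  by under eq_fun do rewrite mulr1 mulr0 addr0 add0r.
have D2 (t : R) : is_derive t (1 : R) (fun t => f (x.1, t)) (fy (x.1, t)).
  have := (is_derive_line f (x.1, 0) (0, 1) t (fy (x.1, t))).2.
  rewrite /= mulr1 mulr0 addr0 add0r => /(_ (dfy _)).
  by under eq_fun do rewrite mulr1 mulr0 addr0 add0r.
have [c1 c1a c1E] := MVT_two_sided x.1 (x.1 + h * v.1) D1.
have [c2 c2a c2E] := MVT_two_sided x.2 (x.2 + h * v.2) D2.
have -> : h^-1 *: ((f \o shift x) (h *: v) - f x) =
    fx (c1, x.2 + h * v.2) * v.1 + fy (x.1, c2) * v.2.
  rewrite /= /shift/= (_ : h *: v + x = (x.1 + h * v.1, x.2 + h * v.2)); last first.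
    by rewrite -[LHS]/(h * v.1 + x.1, h * v.2 + x.2) (addrC (h * v.1)) (addrC (h * v.2)).
  rewrite /GRing.scale/=.
  rewrite -[f (_, _)](subrK (f (x.1, x.2 + h * v.2))) c1E [in X in _ - f X](surjective_pairing x).
  by rewrite -addrA c2E; field.
have h1 : `|fx x - fx (c1, x.2 + h * v.2)| <= e'.
  apply: B1; split; rewrite /ball/=; rewrite distrC.
    apply: le_lt_trans c1a _; rewrite addrC addKr.
    by apply: lt_le_trans hv1 _; rewrite ge_min lexx.
  by rewrite addrC addKr; apply: lt_le_trans hv2 _; rewrite ge_min lexx.
have h2 : `|fy x - fy (x.1, c2)| <= e'.
  apply: B2; split; rewrite /ball/= ?subrr ?normr0// distrC.
  apply: le_lt_trans c2a _; rewrite addrC addKr.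
  by apply: lt_le_trans hv2 _; rewrite ge_min lexx orbT.
rewrite (_ : _ - _ = v.1 * (fx x - fx (c1, x.2 + h * v.2)) + v.2 * (fy x - fy (x.1, c2))); last by ring.
apply: le_trans (ler_normD _ _) _; rewrite !normrM.
apply: (@le_trans _ _ (`|v.1| * e' + `|v.2| * e')); first by rewrite lerD// ler_wpM2l.
rewrite -mulrDl mulrA ler_pdivrMr// mulrC ler_wpM2l ?ltW//; lra.
Unshelve. all: by end_near.
Qed.

End C1Calculus.

(** * Integration over triangles *)

Section TriangleIntegrals.
Context (R : realType).
Local Notation mu := (@lebesgue_measure R).
Implicit Types (f g fx fy : plane R -> R) (x a b c : plane R).

Lemma square_measure_lty (M : R) :
  (leb2 R (`[(- M)%R, M]%classic `*` `[(- M)%R, M]%classic) < +oo)%E.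
Proof.
rewrite product_measure1E//; try exact: measurable_itv.
by rewrite /= lebesgue_measure_itv/=; case: ifP => _; rewrite -?EFinD -?EFinM ?mul0e ltry.
Qed.

Lemma continuous_integrable (D : set (mplane R)) (M : R) f : measurable D ->
  (forall x, D x -> `|x.1| <= M /\ `|x.2| <= M) -> continuous f ->
  (leb2 R).-integrable D (EFin \o f).
Proof.
move=> mD DM cf.
have DS : D `<=` `[- M, M]%classic `*` `[- M, M]%classic.
  by move=> x /DM[h1 h2]; split; rewrite /= in_itv/= -ler_norml.
apply: measurable_bounded_integrable => //.
- apply: le_lt_trans (square_measure_lty M); apply: le_measure => //; rewrite inE//.
  by apply: measurableX; exact: measurable_itv.
- by apply: measurable_funS (continuous_plane_measurable cf).
- have cS : compact (`[- M, M]%classic `*` `[- M, M]%classic : set (plane R)).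
    by apply: compact_setX; exact: segment_compact.
  have cfS : {within (`[- M, M]%classic `*` `[- M, M]%classic : set (plane R)), continuous f}.
    by apply: continuous_subspaceT.
  have [B [Bre HB]] := compact_bounded (continuous_compact cfS cS).
  exists B; split => // y By x Dx; apply: HB => //.
  by exists x => //; exact: DS.
Qed.

Lemma continuous_integrable1 (a b : R) (h : R -> R) : continuous h ->
  mu.-integrable (`]a, b[%classic : set (measurableTypeR R)) (EFin \o h).
Proof.
move=> ch; have : mu.-integrable (`[a, b]%classic : set (measurableTypeR R)) (EFin \o h).
  apply: continuous_compact_integrable; first exact: segment_compact.
  exact: continuous_subspaceT.
apply: integrableS; [exact: measurable_itv|exact: measurable_itv|exact: subset_itv_oo_cc].
Qed.

Definition unit_triangle : set (mplane R) := [set x | [/\ 0 < x.1, 0 < x.2 & x.1 + x.2 < 1]].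

Lemma preimage_itv_measurable (h : mplane R -> R) (i : interval R) :
  measurable_fun setT h -> measurable ([set x | h x \in i] : set (mplane R)).
Proof.
move=> mh; rewrite -[X in measurable X]setTI.
by apply: (mh measurableT [set` i]); exact: measurable_itv.
Qed.

Lemma unit_triangle_measurable : measurable unit_triangle.
Proof.
rewrite (_ : unit_triangle = ([set x | x.1 \in `]0, +oo[] `&` [set x | x.2 \in `]0, +oo[]) `&`
  [set x | (0 + x.1 * 1 + x.2 * 1) \in `]-oo, 1[]).
  by apply: measurableI; [apply: measurableI|]; apply: preimage_itv_measurable => //;
    exact: measurable_affine2.
apply/seteqP; split => x; rewrite /unit_triangle/= !in_itv/= !andbT add0r !mulr1.
  by move=> [].
by move=> [[]].
Qed.

Lemma unit_triangle_bounded x : unit_triangle x -> `|x.1| <= 1 /\ `|x.2| <= 1.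
Proof.
by move=> [h1 h2 h3]; split; rewrite ger0_norm; lra.
Qed.

Lemma continuous_pair (T : topologicalType) (h k : T -> R) : continuous h -> continuous k ->
  continuous (fun t => (h t, k t)).
Proof.
move=> ch ck t; rewrite /continuous_at.
by apply: (cvg_pair (G := nbhs (h t)) (H := nbhs (k t))); [exact: ch|exact: ck].
Qed.

Lemma continuous_section g : continuous g ->
  (forall y : R, continuous (fun x : R => g (x, y))) /\
  (forall x : R, continuous (fun y : R => g (x, y))).
Proof.
move=> cg; split => [y x|x y].
  apply: (@continuous_comp _ _ _ (fun x : R => (x, y)) g); last exact: cg.
  by apply: continuous_pair => [z|z]; [exact: cvg_id|exact: cvg_cst].
apply: (@continuous_comp _ _ _ (fun y : R => (x, y)) g); last exact: cg.
by apply: continuous_pair => [z|z]; [exact: cvg_cst|exact: cvg_id].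
Qed.

(** Each horizontal section is the interval ]0, 1 - t[, on which the fundamental theorem of calculus
    applies; for t outside ]0, 1[ the section is empty. *)
Lemma integral_unit_triangle_fst (G dG : plane R -> R) : continuous G -> continuous dG ->
  (forall s t : R, is_derive s (1 : R) (fun s => G (s, t)) (dG (s, t))) ->
  \int[leb2 R]_(x in unit_triangle) dG x =
  \int[mu]_(t in `]0%R, 1%R[) (G (1 - t, t) - G (0, t)).
Proof.
move=> cG cdG dGG.
have iG : (leb2 R).-integrable unit_triangle (EFin \o dG).
  exact: continuous_integrable unit_triangle_measurable unit_triangle_bounded cdG.
rewrite /Rintegral integral_mkcond -integral21_prod_meas1; last first.
  exact/(integrable_mkcond _ unit_triangle_measurable).
rewrite [in RHS]integral_mkcond; congr fine; apply: eq_integral => t _.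
rewrite /fubini_G patchE; case: ifPn => [/set_mem|/negP nt].
  rewrite /= in_itv/= => /andP[t0 t1].
  transitivity (\int[mu]_(s in `]0%R, (1 - t)%R[) (dG (s, t))%:E)%E.
    rewrite [RHS]integral_mkcond; apply: eq_integral => s _.
    rewrite !patchE; congr (if _ then _ else _); apply/idP/idP => /set_mem h; apply/mem_set.
      by move: h => [/= h1 h2 h3]; rewrite /= in_itv/=; apply/andP; split; lra.
    by move: h; rewrite /= in_itv/= => /andP[h1 h2]; split => /=; lra.
  rewrite -(@integral_itv_bndoo _ 0 (1 - t) _ true false)//; last first.
    apply/measurable_EFinP.
    by apply: measurable_funTS; apply: continuous_measurable_fun; case: (continuous_section cdG).
  have cGt := (continuous_section cG).1 t.
  rewrite (@continuous_FTC2 _ (fun s => dG (s, t)) (fun s => G (s, t)))//.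
  - lra.
  - by apply: continuous_subspaceT; case: (continuous_section cdG).
  - split.
    + by move=> s _; case: (dGG s t).
    + by apply: cvg_at_right_filter; exact: cGt.
    + by apply: cvg_at_left_filter; exact: cGt.
  - by move=> s _; rewrite derive1E; case: (dGG s t).
rewrite [X in integral _ _ X](_ : _ = cst 0%E) ?integral0//; apply/funext => s.
rewrite patchE; case: ifPn => [/set_mem[/= h1 h2 h3]|//]; exfalso; apply: nt.
by apply/mem_set; rewrite /= in_itv/=; apply/andP; split; lra.
Qed.

Lemma continuous_swap (h : plane R -> R) : continuous h -> continuous (fun x : plane R => h (x.2, x.1)).
Proof.
move=> ch x; apply: (@continuous_comp _ _ _ (fun x : plane R => (x.2, x.1)) h); last exact: ch.
by apply: continuous_pair => [z|z]; [exact: cvg_snd|exact: cvg_fst].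
Qed.

Lemma integral_unit_triangle_snd (G dG : plane R -> R) : continuous G -> continuous dG ->
  (forall s t : R, is_derive t (1 : R) (fun t => G (s, t)) (dG (s, t))) ->
  \int[leb2 R]_(x in unit_triangle) dG x =
  \int[mu]_(t in `]0%R, 1%R[) (G (t, 1 - t) - G (t, 0)).
Proof.
move=> cG cdG dGG.
have := @integral_unit_triangle_fst (fun x => G (x.2, x.1)) (fun x => dG (x.2, x.1))
  (continuous_swap cG) (continuous_swap cdG) (fun s t => dGG t s).
move=> <-.
have d0 : det2 ((0, 1) : plane R) (1, 0) != 0 by rewrite /det2/= mul0r mulr1 sub0r oppr_eq0 oner_eq0.
have iG : (leb2 R).-integrable unit_triangle (EFin \o dG).
  exact: continuous_integrable unit_triangle_measurable unit_triangle_bounded cdG.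
rewrite (Rintegral_para (0, 0) d0 unit_triangle_measurable iG).
rewrite /det2/= mul0r mulr1 sub0r normrN normr1 mul1r.
rewrite (_ : [set x | _] = unit_triangle).
  by apply: eq_Rintegral => x _; rewrite /para/= !mulr1 !mulr0 !add0r !addr0.
apply/seteqP; split => x; rewrite /unit_triangle /para/= !mulr1 !mulr0 !add0r !addr0 => -[? ? ?];
  by split => //; rewrite addrC.
Qed.

Lemma ge0_integral_reverse (F : R -> \bar R) :
  measurable_fun (`]0, 1[%classic : set (measurableTypeR R)) F ->
  (forall t : R, t \in `]0, 1[ -> (0 <= F t)%E) ->
  (\int[mu]_(t in `]0%R, 1%R[) F t = \int[mu]_(t in `]0%R, 1%R[) F (1 - t)%R)%E.
Proof.
move=> mF F0; have m1 : (-1 : R) != 0 by rewrite oppr_eq0 oner_eq0.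
have m01 : measurable (`]0, 1[%classic : set (measurableTypeR R)) by exact: measurable_itv.
rewrite integral_mkcond -(ge0_integral_affine 1 m1); last 2 first.
- exact/(measurable_restrictT _ m01).
- by move=> x; apply: erestrict_ge0 => y; exact: F0.
rewrite normrN normr1 mul1e [RHS]integral_mkcond; apply: eq_integral => t _.
rewrite !patchE mulN1r addrC; congr (if _ then _ else _).
apply/idP/idP => /set_mem; rewrite /= in_itv/= => /andP[? ?];
  by apply/mem_set; rewrite /= in_itv/=; apply/andP; split; lra.
Qed.

Lemma Rintegral_reverse (h : R -> R) :
  measurable_fun (`]0, 1[%classic : set (measurableTypeR R)) h ->
  \int[mu]_(t in `]0%R, 1%R[) h t = \int[mu]_(t in `]0%R, 1%R[) h (1 - t).
Proof.
move=> /measurable_EFinP mh; rewrite /Rintegral integralE [in RHS]integralE.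
rewrite (ge0_integral_reverse (measurable_funepos mh))//.
rewrite (ge0_integral_reverse (measurable_funeneg mh))//.
by congr (fine (_ - _)%E); apply: eq_integral => x _; rewrite ?funeposE ?funenegE.
Qed.

(** Twice the signed area. Replacing one vertex by x and dividing by [orient a b c] gives a
    barycentric coordinate of x; the geometry below is done in these coordinates. *)
Definition orient a b c : R := (b.1 - a.1) * (c.2 - a.2) - (b.2 - a.2) * (c.1 - a.1).

Lemma det2_orient a b c : det2 (b - a) (c - a) = orient a b c.
Proof. by []. Qed.

Lemma orient_rot a b c : orient a b c = orient b c a.
Proof. by rewrite /orient; ring. Qed.

Lemma orient_sum a b c x : orient x b c + orient a x c + orient a b x = orient a b c.
Proof. by rewrite /orient; ring. Qed.

Lemma in_open_triangle a b c x : noncollinear a b c -> open_triangle a b c x <->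
  [/\ 0 < orient x b c / orient a b c, 0 < orient a x c / orient a b c &
      0 < orient a b x / orient a b c].
Proof.
move=> d0; have {}d0 : orient a b c != 0 by [].
split=> [[s [t [r [s0 t0 r0 str ->]]]]|[h1 h2 h3]].
  have -> : s = 1 - t - r by lra.
  rewrite (_ : orient (_, _) b c = (1 - t - r) * orient a b c); last by rewrite /orient/=; ring.
  rewrite (_ : orient a (_, _) c = t * orient a b c); last by rewrite /orient/=; ring.
  rewrite (_ : orient a b (_, _) = r * orient a b c); last by rewrite /orient/=; ring.
  by rewrite !mulfK//; split => //; lra.
exists (orient x b c / orient a b c), (orient a x c / orient a b c), (orient a b x / orient a b c).
split => //; first by rewrite -!mulrDl orient_sum mulfV.
have E1 : orient x b c * a.1 + orient a x c * b.1 + orient a b x * c.1 = x.1 * orient a b c.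
  by rewrite /orient; ring.
have E2 : orient x b c * a.2 + orient a x c * b.2 + orient a b x * c.2 = x.2 * orient a b c.
  by rewrite /orient; ring.
rewrite !(mulrAC _ (orient a b c)^-1) -!mulrDl E1 E2 !mulfK//.
exact: surjective_pairing.
Qed.

Lemma open_triangle_para a b c y : noncollinear a b c ->
  open_triangle a b c (para a (b - a) (c - a) y) <-> unit_triangle y.
Proof.
move=> d0; rewrite in_open_triangle//; have {}d0 : orient a b c != 0 by [].
rewrite (_ : orient (para _ _ _ _) b c = (1 - y.1 - y.2) * orient a b c); last by rewrite /orient/para/=; ring.
rewrite (_ : orient a (para _ _ _ _) c = y.1 * orient a b c); last by rewrite /orient/para/=; ring.
rewrite (_ : orient a b (para _ _ _ _) = y.2 * orient a b c); last by rewrite /orient/para/=; ring.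
by rewrite !mulfK//; split => -[? ? ?]; split; lra.
Qed.

Lemma open_triangle_open a b c : noncollinear a b c -> open (open_triangle a b c).
Proof.
move=> d0.
have op (p q r : R) : open [set x : plane R | 0 < p + x.1 * q + x.2 * r].
  rewrite (_ : [set x | _] = (fun x : plane R => p + x.1 * q + x.2 * r) @^-1` [set t | 0 < t])//.
  by move/continuousP : (@continuous_affine R p q r); apply; exact: open_gt.
pose D := orient a b c.
rewrite (_ : open_triangle a b c =
  [set x | 0 < (b.1 * c.2 - b.2 * c.1) / D + x.1 * ((b.2 - c.2) / D) + x.2 * ((c.1 - b.1) / D)] `&`
  [set x | 0 < (c.1 * a.2 - c.2 * a.1) / D + x.1 * ((c.2 - a.2) / D) + x.2 * ((a.1 - c.1) / D)] `&`
  [set x | 0 < (a.1 * b.2 - a.2 * b.1) / D + x.1 * ((a.2 - b.2) / D) + x.2 * ((b.1 - a.1) / D)]).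
  by apply: openI; [apply: openI|]; exact: op.
have E x : [/\ (b.1 * c.2 - b.2 * c.1) / D + x.1 * ((b.2 - c.2) / D) + x.2 * ((c.1 - b.1) / D) = orient x b c / D,
   (c.1 * a.2 - c.2 * a.1) / D + x.1 * ((c.2 - a.2) / D) + x.2 * ((a.1 - c.1) / D) = orient a x c / D &
   (a.1 * b.2 - a.2 * b.1) / D + x.1 * ((a.2 - b.2) / D) + x.2 * ((b.1 - a.1) / D) = orient a b x / D].
  by rewrite /orient; split; ring.
apply/seteqP; split => x; rewrite in_open_triangle//= -/D; have [-> -> ->] := E x.
  by move=> [].
by move=> [[]].
Qed.

End TriangleIntegrals.

(** * Green's formula and the trace inequality for C1 functions on a triangle *)

Section Divergence.
Context (R : realType).
Local Notation mu := (@lebesgue_measure R).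
Implicit Types (f g fx fy : plane R -> R) (x a b c p q v w : plane R).

(** The integral against the parameter in ]0, 1[, that is the mean value on the segment: length
    factors always appear separately. *)
Definition edge_integral p q f : R := \int[mu]_(t in `]0%R, 1%R[) f (seg_point p q t).

Lemma continuous_seg_point p q : continuous (seg_point p q : R -> plane R).
Proof.
apply: continuous_pair => t; apply: cvgD; try exact: cvg_cst.
  by apply: cvgM; [exact: cvg_id|exact: cvg_cst].
by apply: cvgM; [exact: cvg_id|exact: cvg_cst].
Qed.

Lemma continuous_para p v w : continuous (para p v w).
Proof. by apply: continuous_pair; exact: continuous_affine. Qed.

Lemma continuous_edge p q f : continuous f -> continuous (fun t : R => f (seg_point p q t)).
Proof.
by move=> cf t; apply: continuous_comp; [exact: continuous_seg_point|exact: cf].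
Qed.

Lemma edge_integrable p q f : continuous f ->
  mu.-integrable (`]0, 1[%classic : set (measurableTypeR R)) (EFin \o (fun t => f (seg_point p q t))).
Proof. by move=> cf; apply: continuous_integrable1; exact: continuous_edge. Qed.

Lemma seg_point_rev p q (t : R) : seg_point p q (1 - t) = seg_point q p t.
Proof. by rewrite /seg_point; congr pair; ring. Qed.

Lemma edge_integral_rev p q f : continuous f -> edge_integral p q f = edge_integral q p f.
Proof.
move=> cf; rewrite /edge_integral Rintegral_reverse.
  by apply: eq_Rintegral => t _; rewrite seg_point_rev.
by apply: measurable_funTS; apply: continuous_measurable_fun; exact: continuous_edge.
Qed.

Lemma open_triangle_bounded a b c x : open_triangle a b c x ->
  `|x.1| <= `|a.1| + `|b.1| + `|c.1| + `|a.2| + `|b.2| + `|c.2| /\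
  `|x.2| <= `|a.1| + `|b.1| + `|c.1| + `|a.2| + `|b.2| + `|c.2|.
Proof.
move=> [s [t [r [s0 t0 r0 str ->]]]] /=.
have H (u v w : R) : `|s * u + t * v + r * w| <= `|u| + `|v| + `|w|.
  have B (k z : R) : 0 < k -> k <= 1 -> `|k * z| <= `|z|.
    by move=> k0 k1; rewrite normrM gtr0_norm// ler_piMl.
  apply: le_trans (ler_normD _ _) _; apply: lerD; last by apply: B => //; lra.
  by apply: le_trans (ler_normD _ _) _; apply: lerD; apply: B => //; lra.
have := H a.1 b.1 c.1; have := H a.2 b.2 c.2.
have := normr_ge0 a.1; have := normr_ge0 b.1; have := normr_ge0 c.1.
have := normr_ge0 a.2; have := normr_ge0 b.2; have := normr_ge0 c.2.
move=> *; split; lra.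
Qed.

Lemma open_triangle_measurable a b c : noncollinear a b c ->
  measurable (open_triangle a b c : set (mplane R)).
Proof. by move=> d0; apply: open_plane_measurable; exact: open_triangle_open. Qed.

Lemma triangle_integrable a b c f : noncollinear a b c -> continuous f ->
  (leb2 R).-integrable (open_triangle a b c) (EFin \o f).
Proof.
move=> d0; apply: continuous_integrable; first exact: open_triangle_measurable.
exact: open_triangle_bounded.
Qed.

Lemma integral_triangle_para a b c f : noncollinear a b c -> continuous f ->
  \int[leb2 R]_(x in open_triangle a b c) f x =
  `|orient a b c| * \int[leb2 R]_(y in @unit_triangle R) f (para a (b - a) (c - a) y).
Proof.
move=> d0 cf; rewrite (Rintegral_para a (v := b - a) (w := c - a) d0); last 2 first.
- exact: open_triangle_measurable.
- exact: triangle_integrable.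
rewrite det2_orient; congr (_ * _); congr Rintegral.
by apply/seteqP; split => y /=; move/(open_triangle_para y d0).
Qed.

Lemma is_derive_para_fst f fx fy p v w (s t : R) : has_partials f fx fy ->
  is_derive s (1 : R) (fun s => f (para p v w (s, t)))
    (v.1 * fx (para p v w (s, t)) + v.2 * fy (para p v w (s, t))).
Proof.
move=> hf; pose z : plane R := (p.1 + t * w.1, p.2 + t * w.2).
have E s' : para p v w (s', t) = (z.1 + s' * v.1, z.2 + s' * v.2).
  by rewrite /para /z/=; congr pair; ring.
rewrite (_ : (fun s => _) = (fun s => f (z.1 + s * v.1, z.2 + s * v.2))); last first.
  by apply/funext => s'; rewrite E.
by apply/is_derive_line; rewrite -E; exact: has_partials_derive.
Qed.

Lemma is_derive_para_snd f fx fy p v w (s t : R) : has_partials f fx fy ->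
  is_derive t (1 : R) (fun t => f (para p v w (s, t)))
    (w.1 * fx (para p v w (s, t)) + w.2 * fy (para p v w (s, t))).
Proof.
move=> hf; pose z : plane R := (p.1 + s * v.1, p.2 + s * v.2).
have E t' : para p v w (s, t') = (z.1 + t' * w.1, z.2 + t' * w.2).
  by rewrite /para /z/=.
rewrite (_ : (fun s => _) = (fun s => f (z.1 + s * w.1, z.2 + s * w.2))); last first.
  by apply/funext => s'; rewrite E.
by apply/is_derive_line; rewrite -E; exact: has_partials_derive.
Qed.

Lemma continuous_comp_para f p v w : continuous f -> continuous (fun y => f (para p v w y)).
Proof. by move=> cf y; apply: continuous_comp; [exact: continuous_para|exact: cf]. Qed.

Lemma continuous_lincomb (k l : R) f g : continuous f -> continuous g ->
  continuous (fun x => k * f x + l * g x).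
Proof.
by move=> cf cg x; apply: cvgD; apply: cvgM; try exact: cvg_cst; [exact: cf|exact: cg].
Qed.

Lemma integral_derive_fst a b c f fx fy : noncollinear a b c -> has_partials f fx fy ->
  \int[leb2 R]_(x in open_triangle a b c) ((b - a).1 * fx x + (b - a).2 * fy x) =
  `|orient a b c| * (edge_integral b c f - edge_integral a c f).
Proof.
move=> d0 hf; have [cf cfx cfy _ _] := hf.
rewrite (integral_triangle_para d0); last exact: continuous_lincomb.
congr (_ * _).
have cG := continuous_comp_para (p := a) (v := b - a) (w := c - a) cf.
have cdG := continuous_comp_para (p := a) (v := b - a) (w := c - a)
  (continuous_lincomb (k := (b - a).1) (l := (b - a).2) cfx cfy).
rewrite (integral_unit_triangle_fst cG cdG (fun s t => is_derive_para_fst a (b - a) (c - a) s t hf)).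
rewrite -RintegralB//; try exact: edge_integrable.
by apply: eq_Rintegral => t _; congr (f _ - f _); rewrite /para /seg_point/=; congr pair; ring.
Qed.

Lemma integral_derive_snd a b c f fx fy : noncollinear a b c -> has_partials f fx fy ->
  \int[leb2 R]_(x in open_triangle a b c) ((c - a).1 * fx x + (c - a).2 * fy x) =
  `|orient a b c| * (edge_integral b c f - edge_integral a b f).
Proof.
move=> d0 hf; have [cf cfx cfy _ _] := hf.
rewrite (integral_triangle_para d0); last exact: continuous_lincomb.
congr (_ * _).
have cG := continuous_comp_para (p := a) (v := b - a) (w := c - a) cf.
have cdG := continuous_comp_para (p := a) (v := b - a) (w := c - a)
  (continuous_lincomb (k := (c - a).1) (l := (c - a).2) cfx cfy).
rewrite (integral_unit_triangle_snd cG cdG (fun s t => is_derive_para_snd a (b - a) (c - a) s t hf)).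
rewrite (edge_integral_rev b)// -RintegralB//; try exact: edge_integrable.
by apply: eq_Rintegral => t _; congr (f _ - f _); rewrite /para /seg_point/=; congr pair; ring.
Qed.

(* [orient / `|orient|] is the orientation sign of the triangle: both sides
   change sign consistently when two vertices are exchanged. *)
Lemma divergence_theorem a b c f fx fy : noncollinear a b c -> has_partials f fx fy ->
  \int[leb2 R]_(x in open_triangle a b c) fx x =
    Num.sg (orient a b c) * ((c.2 - b.2) * edge_integral b c f +
      (a.2 - c.2) * edge_integral c a f + (b.2 - a.2) * edge_integral a b f) /\
  \int[leb2 R]_(x in open_triangle a b c) fy x =
    - (Num.sg (orient a b c) * ((c.1 - b.1) * edge_integral b c f +
      (a.1 - c.1) * edge_integral c a f + (b.1 - a.1) * edge_integral a b f)).
Proof.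
move=> d0 hf; have [cf cfx cfy _ _] := hf.
have mT := open_triangle_measurable d0.
have ix := triangle_integrable d0 cfx; have iy := triangle_integrable d0 cfy.
have := integral_derive_fst d0 hf; have := integral_derive_snd d0 hf.
rewrite !RintegralD//; try exact: integrableRZ.
rewrite !RintegralZl// (edge_integral_rev c a)//.
have -> : `|orient a b c| = Num.sg (orient a b c) * orient a b c by rewrite -normrEsg.
set X := Rintegral _ _ _; set Y := Rintegral _ _ _.
set I1 := edge_integral b c f; set I2 := edge_integral a c f; set I3 := edge_integral a b f.
set s := Num.sg _ => E2 E1.
have {}d0 : orient a b c != 0 by [].
have dE : orient a b c = (b - a).1 * (c - a).2 - (b - a).2 * (c - a).1 by [].
(* The two directional identities form a linear system for the integrals of the partials, with
   determinant [orient a b c]; Cramer's rule solves it. *)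
split; apply: (mulIf d0).
  transitivity ((c - a).2 * ((b - a).1 * X + (b - a).2 * Y) - (b - a).2 * ((c - a).1 * X + (c - a).2 * Y)).
    by rewrite dE; ring.
  by rewrite E1 E2 /=; ring.
transitivity ((b - a).1 * ((c - a).1 * X + (c - a).2 * Y) - (c - a).1 * ((b - a).1 * X + (b - a).2 * Y)).
  by rewrite dE; ring.
by rewrite E1 E2 /=; ring.
Qed.

(** This is the divergence theorem for the field (x - a) f, which is tangent to the two sides
    through [a]. In reference coordinates, integrating the derivatives of s G along s and of t G
    along t leaves the weights 1 - t and t on the side opposite to [a], which add up to 1, while the
    other boundary terms carry the factor 0. The divergence is 2 f + (x - a) . grad f. *)
Lemma trace_inequality a b c f fx fy (H : R) : noncollinear a b c -> has_partials f fx fy ->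
  (forall x, 0 <= f x) ->
  (forall x, open_triangle a b c x -> `|x.1 - a.1| <= H /\ `|x.2 - a.2| <= H) ->
  `|orient a b c| * edge_integral b c f <=
  \int[leb2 R]_(x in open_triangle a b c) (2 * f x + H * (`|fx x| + `|fy x|)).
Proof.
move=> d0 hf f0 HH; have [cf cfx cfy _ _] := hf.
set A := para a (b - a) (c - a).
pose G y := f (A y); pose Gs y := (b - a).1 * fx (A y) + (b - a).2 * fy (A y).
pose Gt y := (c - a).1 * fx (A y) + (c - a).2 * fy (A y).
have cG : continuous G by exact: continuous_comp_para.
have cGs : continuous Gs by apply: continuous_lincomb; exact: continuous_comp_para.
have cGt : continuous Gt by apply: continuous_lincomb; exact: continuous_comp_para.
have c1 : continuous (fst : plane R -> R) by move=> x; exact: cvg_fst.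
have c2 : continuous (snd : plane R -> R) by move=> x; exact: cvg_snd.
have cM (h k : plane R -> R) : continuous h -> continuous k -> continuous (fun y => h y * k y).
  by move=> ch ck y; apply: cvgM; [exact: ch|exact: ck].
have cD (h k : plane R -> R) : continuous h -> continuous k -> continuous (fun y => h y + k y).
  by move=> ch ck y; apply: cvgD; [exact: ch|exact: ck].
have D1 (s t : R) : is_derive s (1 : R) (fun s => s * G (s, t)) (G (s, t) + s * Gs (s, t)).
  apply: is_derive_eq (is_deriveM (is_derive_id s 1) (is_derive_para_fst a (b - a) (c - a) s t hf)) _.
  by rewrite /GRing.scale/= mulr1 addrC.
have D2 (s t : R) : is_derive t (1 : R) (fun t => t * G (s, t)) (G (s, t) + t * Gt (s, t)).
  apply: is_derive_eq (is_deriveM (is_derive_id t 1) (is_derive_para_snd a (b - a) (c - a) s t hf)) _.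
  by rewrite /GRing.scale/= mulr1 addrC.
have c1G := cM _ _ c1 cG; have c1d := cD _ _ cG (cM _ _ c1 cGs).
have c2G := cM _ _ c2 cG; have c2d := cD _ _ cG (cM _ _ c2 cGt).
have e1 := integral_unit_triangle_fst c1G c1d D1.
have e2 := integral_unit_triangle_snd c2G c2d D2.
have iU h : continuous h -> (leb2 R).-integrable (@unit_triangle R) (EFin \o h).
  exact: continuous_integrable (@unit_triangle_measurable R) (@unit_triangle_bounded R).
have ciE h : continuous h -> mu.-integrable (`]0, 1[%classic : set (measurableTypeR R)) (EFin \o h).
  exact: continuous_integrable1.
have mU := @unit_triangle_measurable R.
have key : edge_integral b c f =
    \int[leb2 R]_(y in @unit_triangle R) ((G y + y.1 * Gs y) + (G y + y.2 * Gt y)).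
  rewrite RintegralD//; try exact: iU.
  rewrite e1 e2 /=.
  have cr : continuous (fun t : R => (1 - t) * G (t, 1 - t)).
    move=> t; apply: cvgM; first by apply: cvgB; [exact: cvg_cst|exact: cvg_id].
    apply: (@continuous_comp _ _ _ (fun t : R => (t, 1 - t)) G); last exact: cG.
    by apply: continuous_pair => z; [exact: cvg_id|apply: cvgB; [exact: cvg_cst|exact: cvg_id]].
  have cr' : continuous (fun t : R => t * G (1 - t, t)).
    move=> t; apply: cvgM; first exact: cvg_id.
    apply: (@continuous_comp _ _ _ (fun t : R => (1 - t, t)) G); last exact: cG.
    by apply: continuous_pair => z; [apply: cvgB; [exact: cvg_cst|exact: cvg_id]|exact: cvg_id].
  have cr'' : continuous (fun t : R => (1 - t) * G (1 - t, t)).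
    move=> t; apply: cvgM; first by apply: cvgB; [exact: cvg_cst|exact: cvg_id].
    apply: (@continuous_comp _ _ _ (fun t : R => (1 - t, t)) G); last exact: cG.
    by apply: continuous_pair => z; [apply: cvgB; [exact: cvg_cst|exact: cvg_id]|exact: cvg_id].
  under eq_Rintegral do rewrite mul0r subr0.
  under [in X in _ = _ + X]eq_Rintegral do rewrite mul0r subr0.
  rewrite [X in _ = _ + X]Rintegral_reverse; last first.
    by apply: measurable_funTS; exact: continuous_measurable_fun.
  rewrite (_ : \int[mu]_(t in `]0, 1[) ((1 - (1 - t)) * G (1 - t, 1 - (1 - t))) =
               \int[mu]_(t in `]0, 1[) (t * G (1 - t, t))); last first.
    by apply: eq_Rintegral => t _; rewrite subKr.
  rewrite -RintegralD//; try exact: ciE.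
  apply: eq_Rintegral => t _; rewrite -mulrDl subrK mul1r /G /A.
  by congr f; rewrite /para /seg_point/=; congr pair; ring.
have cn (h : plane R -> R) : continuous h -> continuous (fun x : plane R => `|h x| : R).
  by move=> ch x; apply: cvg_norm; exact: ch.
have cR : continuous (fun x => 2 * f x + H * (`|fx x| + `|fy x|)).
  by apply: continuous_lincomb => //; apply: cD; exact: cn.
rewrite key (integral_triangle_para d0)//; apply: ler_wpM2l => //.
apply: le_Rintegral => //.
- by apply: iU; apply: cD.
- apply: iU; exact: (continuous_comp_para (p := a) (v := b - a) (w := c - a) cR).
move=> y /(open_triangle_para y d0) /HH; rewrite -/A => -[h1 h2].
have -> : G y + y.1 * Gs y + (G y + y.2 * Gt y) =
   2 * f (A y) + (((A y).1 - a.1) * fx (A y) + ((A y).2 - a.2) * fy (A y)).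
  by rewrite /G /Gs /Gt {3 6}/A /para/=; ring.
rewrite lerD2l mulrDr; apply: lerD.
  by apply: le_trans (ler_norm _) _; rewrite normrM ler_wpM2r.
by apply: le_trans (ler_norm _) _; rewrite normrM ler_wpM2r.
Qed.

End Divergence.

(** * Smooth steps, tents and bumps *)

Section SmoothFunctions.
Context (R : realType).
Implicit Types z t k : R.

Definition pos z : R := (z + `|z|) / 2.

Lemma pos_ge0 z : 0 <= pos z.
Proof. by rewrite /pos; have := ler_norm (- z); rewrite normrN => h; lra. Qed.

Lemma pos_id z : 0 <= z -> pos z = z.
Proof. by move=> h; rewrite /pos ger0_norm//; lra. Qed.

Lemma pos_eq0 z : z <= 0 -> pos z = 0.
Proof. by move=> h; rewrite /pos ler0_norm//; lra. Qed.

Lemma continuous_pos : continuous pos.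
Proof.
move=> z; apply: cvgM; last exact: cvg_cst.
by apply: cvgD; [exact: cvg_id|apply: cvg_norm; exact: cvg_id].
Qed.

Lemma sqr_pos_taylor z h : `|pos (z + h) ^+ 2 - pos z ^+ 2 - h * (2 * pos z)| <= h ^+ 2.
Proof.
have [z0|z0] := leP 0 z; have [zh0|zh0] := leP 0 (z + h).
- rewrite !pos_id// (_ : _ - _ = h ^+ 2); last by ring.
  by rewrite ger0_norm// sqr_ge0.
- rewrite (pos_eq0 (ltW zh0)) pos_id// ler_norml; apply/andP; split; last by have := sqr_ge0 (z + h); lra.
  have h1 : 0 <= z * (- h - z) by apply: mulr_ge0 => //; lra.
  by have := sqr_ge0 h; have := sqr_ge0 z; lra.
- rewrite (pos_eq0 (ltW z0)) pos_id// ger0_norm; last by have := sqr_ge0 (z + h); lra.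
  have h1 : 0 <= (- z) * (h + (z + h)) by apply: mulr_ge0; lra.
  by lra.
- rewrite (pos_eq0 (ltW z0)) (pos_eq0 (ltW zh0)) (_ : _ - _ = 0); last by ring.
  by rewrite normr0 sqr_ge0.
Qed.

Lemma is_derive_sqr_pos z : is_derive z (1 : R) (fun z => pos z ^+ 2) (2 * pos z).
Proof.
suff D : (fun h : R => h^-1 *: (((fun z => pos z ^+ 2) \o shift z) (h *: (1 : R)) - pos z ^+ 2)) h @[h --> 0^'] -->
    2 * pos z.
  by split; [apply/cvg_ex; exists (2 * pos z)|exact/cvg_lim].
apply/cvgrPdist_le => e e0; near=> h.
have h0 : h != 0 by near: h; exact: nbhs_dnbhs_neq.
have he : `|h| < e by near: h; exact: dnbhs0_lt.
rewrite /= /shift/= (_ : h *: 1 = h); last exact: mulr1.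
rewrite distrC /GRing.scale/= (_ : _ - _ = h^-1 * (pos (z + h) ^+ 2 - pos z ^+ 2 - h * (2 * pos z))); last first.
  by rewrite (addrC h); field.
rewrite normrM normfV mulrC ler_pdivrMr ?normr_gt0//.
apply: le_trans (sqr_pos_taylor z h) _.
by rewrite -real_normK ?num_real// expr2 ler_wpM2r// ltW.
Unshelve. all: by end_near.
Qed.

(** A C1 step from 0 to 1, zero for [z <= 0]. It is rational in [pos z], so that the bounds needed
    below are polynomial inequalities. *)
Definition ramp z : R := 1 - (1 + pos z ^+ 2)^-1.
Definition dramp z : R := 2 * pos z / (1 + pos z ^+ 2) ^+ 2.

Lemma ramp_den_gt0 z : 0 < 1 + pos z ^+ 2.
Proof. by rewrite ltr_pwDl// sqr_ge0. Qed.

Lemma is_derive_lin (a b z : R) : is_derive z (1 : R) (fun s : R => a + s * b) b.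
Proof.
apply: is_derive_eq (is_deriveD (is_derive_cst a z 1)
  (is_deriveM (is_derive_id z 1) (is_derive_cst b z 1))) _.
by rewrite /GRing.scale/=; ring.
Qed.

Lemma is_derive_ramp z : is_derive z (1 : R) ramp (dramp z).
Proof.
have d1 := is_deriveD (is_derive_cst (1 : R) z 1) (is_derive_sqr_pos z).
have n0 : (cst 1 + (fun z => pos z ^+ 2)) z != 0 by exact: lt0r_neq0 (ramp_den_gt0 z).
have d2 := is_deriveB (is_derive_cst (1 : R) z 1) (is_deriveV n0 d1).
apply: is_derive_eq d2 _; 
change (0 - (- (1 + pos z ^+ 2) ^- 2 * (0 + 2 * pos z)) = 2 * pos z / (1 + pos z ^+ 2) ^+ 2).
by rewrite !add0r mulNr opprK mulrC.
Qed.

Lemma continuous_sqr_pos : continuous (fun z => pos z ^+ 2).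
Proof.
by move=> z; exact: (cvgM (continuous_pos (x:=z)) (continuous_pos (x:=z))).
Qed.

Lemma continuous_ramp_den : continuous (fun z => 1 + pos z ^+ 2).
Proof. by move=> z; apply: cvgD; [exact: cvg_cst|exact: continuous_sqr_pos]. Qed.

Lemma continuous_ramp : continuous ramp.
Proof.
move=> z; apply: cvgB; first exact: cvg_cst.
by apply: cvgV; [exact: lt0r_neq0 (ramp_den_gt0 z)|exact: continuous_ramp_den].
Qed.

Lemma continuous_dramp : continuous dramp.
Proof.
move=> z; apply: cvgM; first by apply: cvgM; [exact: cvg_cst|exact: continuous_pos].
apply: cvgV; first by rewrite expf_neq0// lt0r_neq0// ramp_den_gt0.
exact: (cvgM (continuous_ramp_den (x:=z)) (continuous_ramp_den (x:=z))).
Qed.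

Lemma ramp_ge0 z : 0 <= ramp z.
Proof.
rewrite /ramp subr_ge0 invf_le1 ?ramp_den_gt0// lerDl; exact: sqr_ge0.
Qed.

Lemma ramp_le1 z : ramp z <= 1.
Proof. by rewrite /ramp gerBl invr_ge0 ltW// ramp_den_gt0. Qed.

Lemma ramp_eq0 z : z <= 0 -> ramp z = 0.
Proof. by move=> h; rewrite /ramp pos_eq0// expr0n/= addr0 invr1 subrr. Qed.

Lemma onem_ramp_le z : 0 < z -> 1 - ramp z <= z^-1.
Proof.
move=> z0; rewrite /ramp subKr (pos_id (ltW z0)) lef_pV2 ?posrE//; last by rewrite ltr_pwDl// sqr_ge0.
by have := sqr_ge0 (z - 1); have := sqr_ge0 z; lra.
Qed.

Lemma dramp_ge0 z : 0 <= dramp z.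
Proof. by rewrite /dramp mulr_ge0 ?invr_ge0 ?sqr_ge0// mulr_ge0 ?pos_ge0. Qed.

Lemma dramp_eq0 z : z <= 0 -> dramp z = 0.
Proof. by move=> h; rewrite /dramp pos_eq0// mulr0 mul0r. Qed.

(** [z * dramp z] is, up to scaling, the second term of the derivative of [relu]: the bound 1 keeps
    that derivative bounded uniformly in n, the bound 2 / z makes it converge to 1. *)
Lemma dramp_bound z : z * dramp z <= 1 /\ (0 < z -> z * dramp z <= 2 / z).
Proof.
have [z0|z0] := leP z 0.
  by rewrite dramp_eq0// mulr0; split => // h; lra.
have e : z * dramp z = 2 * z ^+ 2 / (1 + z ^+ 2) ^+ 2.
  by rewrite /dramp (pos_id (ltW z0)); ring.
have s0 : 0 < 1 + z ^+ 2 by rewrite ltr_pwDl// sqr_ge0.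
have s1 := sqr_ge0 z.
rewrite e; split => [|_].
  rewrite ler_pdivrMr ?exprn_gt0// mul1r.
  by have := sqr_ge0 (z ^+ 2); lra.
have s2 : 0 <= (z ^+ 2) ^+ 2 by exact: sqr_ge0.
have s3 : 0 <= z ^+ 2 * (z - 1) ^+ 2 by rewrite mulr_ge0// sqr_ge0.
rewrite ler_pdivrMr ?exprn_gt0// mulrAC ler_pdivlMr//.
by lra.
Qed.

End SmoothFunctions.

(** * Profiles of the test functions: bumps, tents and hats *)

Section Bumps.
Context (R : realType).
Implicit Types (z t x w : R) (n : nat).

Lemma is_derive_comp_lin (F dF : R -> R) (a b t : R) :
  (forall z, is_derive z (1 : R) F (dF z)) ->
  is_derive t (1 : R) (fun s : R => F (a + s * b)) (dF (a + t * b) * b).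
Proof.
move=> dFF.
exact: (@is_derive1_comp _ F (fun s => a + s * b) t _ _ (dFF _) (is_derive_lin a b t)).
Qed.

Lemma continuous_comp_lin (F : R -> R) (a b : R) : continuous F ->
  continuous (fun s : R => F (a + s * b)).
Proof.
move=> cF t; apply: (@continuous_comp _ _ _ (fun s : R => a + s * b) F); last exact: cF.
by apply: cvgD; [exact: cvg_cst|apply: cvgM; [exact: cvg_id|exact: cvg_cst]].
Qed.

Lemma is_derive_mul (F dF G dG : R -> R) (t : R) :
  is_derive t (1 : R) F (dF t) -> is_derive t (1 : R) G (dG t) ->
  is_derive t (1 : R) (fun s => F s * G s) (dF t * G t + F t * dG t).
Proof.
move=> hF hG; apply: is_derive_eq (is_deriveM hF hG) _.
by rewrite /GRing.scale/=; ring.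
Qed.

Lemma near_natmul_gt (a c : R) : 0 < a -> \forall n \near \oo, c < n.+1%:R * a.
Proof.
move=> a0; near=> n; rewrite -ltr_pdivrMr//.
apply: (@lt_trans _ _ n%:R); last by rewrite ltr_nat.
by near: n; exact: nbhs_infty_gtr.
Unshelve. all: by end_near.
Qed.

Lemma ramp_cvg (a : R) : 0 < a -> ramp (-1 + a * n.+1%:R) @[n --> \oo] --> (1 : R).
Proof.
move=> a0; apply/cvgrPdist_le => e e0; near=> n.
have h : e^-1 + 1 < n.+1%:R * a by near: n; exact: near_natmul_gt.
have h0 : 0 < e^-1 by rewrite invr_gt0.
rewrite ger0_norm ?subr_ge0 ?ramp_le1//.
apply: le_trans (onem_ramp_le _) _; first by rewrite (mulrC a); lra.
by rewrite -[leRHS]invrK lef_pV2 ?posrE//; rewrite (mulrC a); lra.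
Unshelve. all: by end_near.
Qed.

(** The two ramps start at t = 1/(n+1) and end at t = 1 - 1/(n+1), so the support stays away from 0
    and 1, as compactly supported test functions require. The limit is the indicator of ]0, 1[. *)
Definition bump n t : R := ramp (-1 + t * n.+1%:R) * ramp ((n.+1%:R - 1) + t * - n.+1%:R).
Definition dbump n t : R :=
  dramp (-1 + t * n.+1%:R) * n.+1%:R * ramp ((n.+1%:R - 1) + t * - n.+1%:R) +
  ramp (-1 + t * n.+1%:R) * (dramp ((n.+1%:R - 1) + t * - n.+1%:R) * - n.+1%:R).

Lemma is_derive_bump n t : is_derive t (1 : R) (bump n) (dbump n t).
Proof.
exact: (is_derive_mul (dF := fun t => dramp (-1 + t * n.+1%:R) * n.+1%:R)
  (dG := fun t => dramp ((n.+1%:R - 1) + t * - n.+1%:R) * - n.+1%:R)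
  (is_derive_comp_lin _ _ t (@is_derive_ramp R)) (is_derive_comp_lin _ _ t (@is_derive_ramp R))).
Qed.

Lemma continuous_dbump n : continuous (dbump n).
Proof.
have c1 (a b : R) := continuous_comp_lin (a := a) (b := b) (@continuous_ramp R).
have c2 (a b : R) := continuous_comp_lin (a := a) (b := b) (@continuous_dramp R).
move=> t; apply: cvgD; apply: cvgM; try exact: c1.
  by apply: cvgM; [exact: c2|exact: cvg_cst].
by apply: cvgM; [exact: c2|exact: cvg_cst].
Qed.

Lemma bump_ge0 n t : 0 <= bump n t.
Proof. by rewrite mulr_ge0 ?ramp_ge0. Qed.

Lemma bump_le1 n t : bump n t <= 1.
Proof. by rewrite mulr_ile1 ?ramp_ge0 ?ramp_le1. Qed.

Lemma bump_eq0 n t : t <= n.+1%:R^-1 \/ 1 - n.+1%:R^-1 <= t -> bump n t = 0.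
Proof.
have n0 : (0 : R) < n.+1%:R by rewrite ltr0n.
rewrite /bump => -[h|h].
  rewrite ramp_eq0 ?mul0r//; have : t * n.+1%:R <= n.+1%:R^-1 * n.+1%:R by rewrite ler_pM2r.
  by rewrite mulVf ?gt_eqF//; lra.
rewrite [X in _ * X]ramp_eq0 ?mulr0//.
have : (1 - n.+1%:R^-1) * n.+1%:R <= t * n.+1%:R by rewrite ler_pM2r.
by rewrite mulrBl mulVf ?gt_eqF//; lra.
Qed.

Lemma bump_outside n t : t \notin `]0, 1[ -> bump n t = 0.
Proof.
rewrite in_itv/= negb_and -!leNgt => /orP h; apply: bump_eq0.
have n0 : (0 : R) < n.+1%:R^-1 by rewrite invr_gt0 ltr0n.
set d := n.+1%:R^-1 in n0 *.
by case: h => h; [left|right]; lra.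
Qed.

Lemma bump_cvg t : bump n t @[n --> \oo] --> ((t \in `]0, 1[)%:R : R).
Proof.
have [h|h] := boolP (t \in `]0, 1[); last first.
  under eq_fun do rewrite bump_outside//; exact: cvg_cst.
move: h; rewrite in_itv/= => /andP[t0 t1].
rewrite -[X in _ --> X](mulr1 (1 : R)); apply: cvgM; first exact: ramp_cvg.
have : 0 < 1 - t by lra.
move=> /ramp_cvg; apply: cvg_trans; apply: near_eq_cvg; apply: nearW => n.
by congr ramp; ring.
Qed.

(* C1 approximation of the positive part; [tent n] is a C1 approximation of
   [x |-> max(0, 1 - |x - 1|)] vanishing near and beyond the ends of [0, 2], whose
   derivative converges boundedly to the Haar function [haar]. *)
Definition relu n z : R := z * ramp (0 + z * n.+1%:R).
Definition drelu n z : R := ramp (0 + z * n.+1%:R) + z * (dramp (0 + z * n.+1%:R) * n.+1%:R).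

Lemma is_derive_relu n z : is_derive z (1 : R) (relu n) (drelu n z).
Proof.
apply: is_derive_eq (is_deriveM (is_derive_id z 1)
  (is_derive_comp_lin 0 n.+1%:R z (@is_derive_ramp R))) _.
by rewrite /drelu /GRing.scale/=; ring.
Qed.

Lemma continuous_drelu n : continuous (drelu n).
Proof.
have c1 (a b : R) := continuous_comp_lin (a := a) (b := b) (@continuous_ramp R).
have c2 (a b : R) := continuous_comp_lin (a := a) (b := b) (@continuous_dramp R).
move=> t; apply: cvgD; first exact: c1.
apply: cvgM; first exact: cvg_id.
by apply: cvgM; [exact: c2|exact: cvg_cst].
Qed.

Lemma relu_eq0 n z : z <= 0 -> relu n z = 0.
Proof. by move=> h; rewrite /relu add0r ramp_eq0 ?mulr0// mulr_le0_ge0. Qed.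

Lemma drelu_eq0 n z : z <= 0 -> drelu n z = 0.
Proof.
by move=> h; rewrite /drelu add0r ramp_eq0 ?dramp_eq0 ?mul0r ?mulr0 ?addr0// mulr_le0_ge0.
Qed.

Lemma relu_ge0 n z : 0 <= relu n z.
Proof.
have [h|h] := leP z 0; first by rewrite relu_eq0.
by rewrite mulr_ge0 ?ramp_ge0// ltW.
Qed.

Lemma relu_le n z : 0 <= z -> relu n z <= z.
Proof. by move=> h; rewrite /relu ler_piMr ?ramp_le1. Qed.

Lemma relu_ge n z : z - n.+1%:R^-1 <= relu n z.
Proof.
have n0 : (0 : R) < n.+1%:R by rewrite ltr0n.
have ni0 : (0 : R) < n.+1%:R^-1 by rewrite invr_gt0.
have [h|h] := leP z 0; first by rewrite relu_eq0// subr_le0 (le_trans h (ltW ni0)).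
have zn : 0 < z * n.+1%:R by rewrite mulr_gt0.
rewrite lerBlDr -lerBlDl /relu add0r -[X in X - _]mulr1 -mulrBr.
apply: le_trans (ler_wpM2l (ltW h) (onem_ramp_le zn)) _.
by rewrite invfM mulrA mulfV ?gt_eqF// mul1r.
Qed.

Lemma drelu_ge0 n z : 0 <= drelu n z.
Proof.
have [h|h] := leP z 0; first by rewrite drelu_eq0.
apply: addr_ge0; first exact: ramp_ge0.
by apply: mulr_ge0; [exact: ltW|rewrite mulr_ge0 ?dramp_ge0].
Qed.

Lemma drelu_le n z : drelu n z <= 2.
Proof.
rewrite /drelu add0r (mulrC (dramp _)) mulrA; set y := _ * n.+1%:R.
by have := ramp_le1 y; have [+ _] := dramp_bound y; lra.
Qed.

Lemma drelu_near1 n z : 0 < z -> `|1 - drelu n z| <= 3 / (n.+1%:R * z).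
Proof.
move=> z0; rewrite /drelu add0r (mulrC (dramp _)) mulrA (mulrC z).
set y := n.+1%:R * z; have y0 : 0 < y by rewrite mulr_gt0// ltr0n.
have h1 := onem_ramp_le y0; have [_ /(_ y0) h2] := dramp_bound y.
have h3 : 0 <= y * dramp y by rewrite mulr_ge0 ?dramp_ge0// ltW.
have h4 := ramp_le1 y.
have h5 : 0 < y^-1 by rewrite invr_gt0.
rewrite ler_norml; apply/andP; split; lra.
Qed.

Definition smooth_abs n z : R := relu n z + relu n (0 + z * -1).
Definition dsmooth_abs n z : R := drelu n z + drelu n (0 + z * -1) * -1.
(** [smooth_abs] may fall short of the absolute value by 1/(n+1), and the tent has to vanish already
    at distance 1/(n+1) from its ends; lowering the peak by 3/(n+1) absorbs both. *)
Definition tent_height n : R := 1 - 3 / n.+1%:R.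
Definition tent n x : R := relu n (tent_height n - smooth_abs n (-1 + x * 1)).
Definition dtent n x : R :=
  drelu n (tent_height n - smooth_abs n (-1 + x * 1)) * - (dsmooth_abs n (-1 + x * 1) * 1).
(** Open intervals give the value 0 at the break points 0, 1 and 2, which is the pointwise limit of
    [dtent] there. Dyadic cells are half-open, and the discrepancy lies on null lines. *)
Definition haar x : R := (x \in `]0, 1[)%:R - (x \in `]1, 2[)%:R.

Lemma is_derive_smooth_abs n z : is_derive z (1 : R) (smooth_abs n) (dsmooth_abs n z).
Proof.
exact: is_deriveD (is_derive_relu n z) (is_derive_comp_lin 0 (-1) z (is_derive_relu n)).
Qed.

Lemma is_derive_tent n x : is_derive x (1 : R) (tent n) (dtent n x).
Proof.
have d1 : is_derive x (1 : R) (fun x => tent_height n - smooth_abs n (-1 + x * 1))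
    (- (dsmooth_abs n (-1 + x * 1) * 1)).
  apply: is_derive_eq (is_deriveB (is_derive_cst (tent_height n) x 1)
    (is_derive_comp_lin (-1) 1 x (is_derive_smooth_abs n))) _.
  by rewrite sub0r.
exact: (@is_derive1_comp _ (relu n) (fun x => tent_height n - smooth_abs n (-1 + x * 1)) x _ _
  (is_derive_relu n _) d1).
Qed.

Lemma continuous_of_derive (F dF : R -> R) : (forall z, is_derive z (1 : R) F (dF z)) ->
  continuous F.
Proof.
by move=> h z; apply/differentiable_continuous/derivable1_diffP; case: (h z).
Qed.

Lemma continuous_dtent n : continuous (dtent n).
Proof.
move=> x; apply: cvgM.
  apply: (@continuous_comp _ _ _ (fun x => tent_height n - smooth_abs n (-1 + x * 1)) (drelu n)).
    apply: cvgB; first exact: cvg_cst.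
    exact: (continuous_comp_lin (a := -1) (b := 1) (continuous_of_derive (is_derive_smooth_abs n))).
  exact: continuous_drelu.
apply: cvgN; apply: cvgM; last exact: cvg_cst.
apply: (continuous_comp_lin (a := -1) (b := 1)) => z; apply: cvgD; first exact: continuous_drelu.
apply: cvgM; last exact: cvg_cst.
exact: (continuous_comp_lin (a := 0) (b := -1) (@continuous_drelu n)).
Qed.

Lemma smooth_abs_ge n z : `|z| - n.+1%:R^-1 <= smooth_abs n z.
Proof.
rewrite /smooth_abs add0r mulrN1; have := relu_ge n z; have := relu_ge n (- z).
have := relu_ge0 n z; have := relu_ge0 n (- z); set d := n.+1%:R^-1.
by have [h|h] := leP 0 z; [rewrite ger0_norm//|rewrite ltr0_norm//]; lra.
Qed.

Lemma smooth_abs_ge0 n z : 0 <= smooth_abs n z.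
Proof. by rewrite addr_ge0 ?relu_ge0. Qed.

Lemma smooth_abs_le n z : smooth_abs n z <= `|z|.
Proof.
rewrite /smooth_abs add0r mulrN1.
have [h|h] := leP 0 z.
  by rewrite (@relu_eq0 n (- z)) ?addr0 ?ger0_norm ?relu_le//; lra.
by rewrite (@relu_eq0 n z) ?add0r ?ltr0_norm ?relu_le//; lra.
Qed.

Lemma tent_ge0 n x : 0 <= tent n x.
Proof. exact: relu_ge0. Qed.

Lemma tent_le1 n x : tent n x <= 1.
Proof.
rewrite /tent; set w := _ - _.
have w1 : w <= 1.
  rewrite /w /tent_height; have := smooth_abs_ge0 n (-1 + x * 1).
  have : (0 : R) <= 3 / n.+1%:R by rewrite divr_ge0.
  set d := 3 / _; lra.
have [h|h] := leP 0 w; first exact: le_trans (relu_le n h) w1.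
by rewrite relu_eq0 ?ltW.
Qed.

Lemma tent_eq0 n x : x <= n.+1%:R^-1 \/ 2 - n.+1%:R^-1 <= x -> tent n x = 0.
Proof.
have n0 : (0 : R) < n.+1%:R^-1 by rewrite invr_gt0 ltr0n.
have := smooth_abs_ge n (-1 + x * 1); rewrite /tent /tent_height.
set d := n.+1%:R^-1 in n0 * => ge h; rewrite relu_eq0//; move: ge.
have : 1 - d <= `|-1 + x * 1|.
  by case: h => h; rewrite ler_normr; apply/orP; [right|left]; lra.
lra.
Qed.

Lemma dsmooth_abs_le n z : `|dsmooth_abs n z| <= 2.
Proof.
rewrite /dsmooth_abs add0r !mulrN1.
have := drelu_ge0 n z; have := drelu_le n z.
have := drelu_ge0 n (- z); have := drelu_le n (- z).
by rewrite ler_norml => *; apply/andP; split; lra.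
Qed.

Lemma dtent_le n x : `|dtent n x| <= 4.
Proof.
rewrite /dtent; set w := _ - _; set z := _ + x * 1.
rewrite mulr1 normrM normrN (ger0_norm (drelu_ge0 n w)).
apply: le_trans (ler_pM (drelu_ge0 n w) (normr_ge0 _) (drelu_le n w) (dsmooth_abs_le n z)) _.
lra.
Qed.

Lemma drelu_cvg1 (w : nat -> R) (c : R) : 0 < c -> (\forall n \near \oo, c <= w n) ->
  drelu n (w n) @[n --> \oo] --> (1 : R).
Proof.
move=> c0 hw; apply/cvgrPdist_le => e e0; near=> n.
have cw : c <= w n by near: n.
have h : 3 / e < n.+1%:R * c by near: n; exact: near_natmul_gt.
apply: le_trans (drelu_near1 n (lt_le_trans c0 cw)) _.
have n0 : (0 : R) < n.+1%:R by rewrite ltr0n.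
rewrite ler_pdivrMr ?mulr_gt0//; last exact: lt_le_trans cw.
move: h; rewrite ltr_pdivrMr// => h; apply: le_trans (ltW h) _.
by rewrite mulrC ler_wpM2l ?(ltW e0)// ler_wpM2l// ltW.
Unshelve. all: by end_near.
Qed.

Lemma haar_left x : 0 < x -> x < 1 -> haar x = 1.
Proof.
by move=> h1 h2; rewrite /haar !in_itv/= h1 h2 (ltNge 1 x) (ltW h2) subr0.
Qed.

Lemma haar_right x : 1 < x -> x < 2 -> haar x = -1.
Proof.
by move=> h1 h2; rewrite /haar !in_itv/= h1 h2 (ltNge x 1) (ltW h1) andbF sub0r.
Qed.

Lemma haar_outside x : [\/ x <= 0, x = 1 | 2 <= x] -> haar x = 0.
Proof.
move=> h; rewrite /haar !in_itv/=.
have -> : (0 < x < 1) = false by apply/negbTE/negP => /andP[]; case: h => h; lra.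
have -> : (1 < x < 2) = false by apply/negbTE/negP => /andP[]; case: h => h; lra.
by rewrite subrr.
Qed.

(** For |x - 1| < 1 the argument of the outer [relu] stays above a positive constant, so its
    derivative tends to 1 and only the slope of the smoothed absolute value remains. At the peak the
    two halves of that slope cancel; for |x - 1| >= 1 the derivative is exactly 0. *)
Lemma dtent_cvg x : dtent n x @[n --> \oo] --> haar x.
Proof.
pose z := -1 + x * 1.
have inner : `|z| < 1 -> drelu n (tent_height n - smooth_abs n z) @[n --> \oo] --> (1 : R).
  move=> z1; have c0 : 0 < (1 - `|z|) / 2 by lra.
  apply: (drelu_cvg1 c0); near=> n.
  have h : 3 < n.+1%:R * ((1 - `|z|) / 2) by near: n; exact: near_natmul_gt.
  have n0 : (0 : R) < n.+1%:R by rewrite ltr0n.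
  have h' : 3 / n.+1%:R < (1 - `|z|) / 2 by rewrite ltr_pdivrMr// mulrC.
  rewrite /tent_height; have := smooth_abs_le n z; move: h'; set d := 3 / _; lra.
have outer : 1 <= `|z| -> forall n, dtent n x = 0.
  move=> z1 n; rewrite /dtent drelu_eq0 ?mul0r// /tent_height -/z.
  have n0 : (0 : R) < n.+1%:R^-1 by rewrite invr_gt0 ltr0n.
set d := n.+1%:R^-1 in n0 *.
  by have := smooth_abs_ge n z; rewrite -/d; lra.
have hz : z = x - 1 by rewrite /z; ring.
have [z1|z1] := leP 1 `|z|.
  under eq_fun do rewrite outer//.
  rewrite haar_outside; first exact: cvg_cst.
  by move: z1; rewrite ler_normr => /orP[z1|z1]; [apply: Or33|apply: Or31]; lra.
have {}inner := inner z1; move: z1; rewrite ltr_norml => /andP[z1 z2].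
rewrite /dtent -/z.
have [z0|z0|z0] := ltgtP z 0.
- rewrite haar_left; [|lra|lra].
  rewrite -[X in _ --> X](mulr1 (1 : R)); apply: cvgM => //.
  rewrite /dsmooth_abs add0r.
  under eq_fun do rewrite (drelu_eq0 _ (ltW z0)) add0r !mulr1 !mulrN1 opprK.
  by apply: (@drelu_cvg1 _ (- z)); [lra|exact: nearW].
- rewrite haar_right; [|lra|lra].
  rewrite -[X in _ --> X](mul1r (-1 : R)); apply: cvgM => //.
  rewrite /dsmooth_abs add0r.
  have nz : z * -1 <= 0 by lra.
  under eq_fun do rewrite (drelu_eq0 _ nz) mul0r addr0 mulr1.
  by apply: cvgN; apply: (@drelu_cvg1 _ z) => //; exact: nearW.
- rewrite haar_outside; last by apply: Or32; lra.
  rewrite (_ : (fun n => _) = fun=> 0); first exact: cvg_cst.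
  by apply/funext => n; rewrite /dsmooth_abs z0 mul0r addr0 mulrN1 subrr mul0r oppr0 mulr0.
Unshelve. all: by end_near.
Qed.

(* On [0, 2] the parabola is at least 3, hence the factor 1/9 makes [hat] at
   least 1 there. *)
Definition hat t : R := 9^-1 * pos (4 - (t - 1) ^+ 2) ^+ 2.
Definition dhat t : R := 9^-1 * (2 * pos (4 - (t - 1) ^+ 2) * (- 2 * (t - 1))).

Lemma is_derive_hat t : is_derive t (1 : R) hat (dhat t).
Proof.
have d0 : is_derive t (1 : R) (fun t : R => t - 1) 1.
  by apply: is_derive_eq (is_deriveB (is_derive_id t 1) (is_derive_cst (1 : R) t 1)) _; rewrite subr0.
have d1 : is_derive t (1 : R) (fun t : R => 4 - (t - 1) ^+ 2) (- 2 * (t - 1)).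
  apply: is_derive_eq (is_deriveB (is_derive_cst (4 : R) t 1)
    (is_derive_mul (dF := fun=> 1) (dG := fun=> 1) d0 d0)) _.
  ring.
have d2 := @is_derive1_comp _ (fun z => pos z ^+ 2) (fun t : R => 4 - (t - 1) ^+ 2) t _ _
  (is_derive_sqr_pos _) d1.
apply: is_derive_eq (is_derive_mul (dF := fun=> 0) (dG := fun t => 2 * pos (4 - (t - 1) ^+ 2) * (- 2 * (t - 1)))
  (is_derive_cst (9^-1 : R) t 1) d2) _.
by rewrite mul0r add0r.
Qed.

Lemma continuous_dhat : continuous dhat.
Proof.
have c1 : continuous (fun t : R => t - 1).
  by move=> t; apply: cvgB; [exact: cvg_id|exact: cvg_cst].
move=> t; apply: cvgM; first exact: cvg_cst.
apply: cvgM; last by apply: cvgM; [exact: cvg_cst|exact: c1].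
apply: cvgM; first exact: cvg_cst.
apply: (@continuous_comp _ _ _ (fun t : R => 4 - (t - 1) ^+ 2) (@pos R)); last exact: continuous_pos.
by apply: cvgB; [exact: cvg_cst|exact: (cvgM (c1 t) (c1 t))].
Qed.

Lemma hat_ge0 t : 0 <= hat t.
Proof. by rewrite mulr_ge0 ?sqr_ge0. Qed.

Lemma hat_ge1 t : 0 <= t <= 2 -> 1 <= hat t.
Proof.
move=> /andP[t0 t2]; have h : 0 <= t * (2 - t) by apply: mulr_ge0; lra.
rewrite /hat pos_id; last by lra.
have h3 : 3 <= 4 - (t - 1) ^+ 2 by lra.
have : 3 ^+ 2 <= (4 - (t - 1) ^+ 2) ^+ 2 by rewrite ler_pXn2r ?nnegrE//; lra.
lra.
Qed.

Lemma hat_support t : t \notin `[-1, 3] -> hat t = 0 /\ dhat t = 0.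
Proof.
rewrite in_itv/= negb_and -!ltNge => /orP h.
suff p : pos (4 - (t - 1) ^+ 2) = 0 by rewrite /hat /dhat p; split; ring.
apply: pos_eq0; case: h => h.
  have : 0 <= (-1 - t) * (3 - t) by apply: mulr_ge0; lra.
  lra.
have : 0 <= (t - 3) * (t + 1) by apply: mulr_ge0; lra.
lra.
Qed.

Lemma pos_parabola_le t : 0 <= pos (4 - (t - 1) ^+ 2) <= 4.
Proof.
rewrite pos_ge0/=; have [h|h] := leP 0 (4 - (t - 1) ^+ 2).
  by rewrite pos_id//; have := sqr_ge0 (t - 1); lra.
by rewrite (pos_eq0 (ltW h)).
Qed.

Lemma hat_le t : hat t <= 4 * (t \in `[-1, 3])%:R.
Proof.
have [h|/hat_support[-> _]] := boolP (t \in _); last by rewrite mulr0.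
have /andP[p0 p4] := pos_parabola_le t.
have : pos (4 - (t - 1) ^+ 2) ^+ 2 <= 4 ^+ 2 by rewrite ler_pXn2r ?nnegrE.
rewrite /hat mulr1; lra.
Qed.

Lemma dhat_le t : `|dhat t| <= 4 * (t \in `[-1, 3])%:R.
Proof.
have [h|/hat_support[_ ->]] := boolP (t \in _); last by rewrite mulr0 normr0.
have := pos_parabola_le t; rewrite mulr1 /dhat; move: (pos _) => p /andP[p0 p4].
move: h; rewrite in_itv/= => /andP[t1 t3].
have h1 : 0 <= p * (2 - (t - 1)) by apply: mulr_ge0; lra.
have h2 : 0 <= p * (2 + (t - 1)) by apply: mulr_ge0; lra.
by rewrite ler_norml; apply/andP; split; lra.
Qed.

End Bumps.

(** * The fundamental lemma on a triangle *)

Section Uniqueness.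
Context (R : realType).

Definition open_boxes : set (set (mplane R)) :=
  [set E | exists a b c d : R, E = `]a, b[%classic `*` `]c, d[%classic].

Lemma open_boxes_setI : setI_closed open_boxes.
Proof.
move=> _ _ [a [b [c [d ->]]]] [a' [b' [c' [d' ->]]]].
exists (Num.max a a'), (Num.min b b'), (Num.max c c'), (Num.min d d').
apply/seteqP; split => x; rewrite /= !in_itv/= !gt_max !lt_min.
  by move=> [[/andP[-> ->] /andP[-> ->]] [/andP[-> ->] /andP[-> ->]]].
by move=> [/andP[/andP[-> ->] /andP[-> ->]] /andP[/andP[-> ->] /andP[-> ->]]].
Qed.

Lemma natr_bound (y : R) : exists n : nat, `|y| < n%:R.
Proof.
exists (Num.Def.truncn `|y|).+1; have /andP[_] := truncn_itv (normr_ge0 y).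
by [].
Qed.

(** The nontrivial inclusion says that both projections are measurable for the sigma-algebra
    generated by the boxes: a strip is the countable union of boxes of growing width. *)
Lemma open_boxes_generate : @measurable _ (mplane R) = <<s open_boxes >>.
Proof.
apply/seteqP; split; last first.
  apply: smallest_sub; first exact: sigma_algebra_measurable.
  by move=> _ [a [b [c [d ->]]]]; apply: measurableX; exact: measurable_itv.
have mbox a b c d : <<s open_boxes >> (`]a, b[%classic `*` `]c, d[%classic : set (mplane R)).
  by apply: sub_sigma_algebra; exists a, b, c, d.
apply: smallest_sub; first exact: smallest_sigma_algebra.
pose T' := g_sigma_algebraType open_boxes.
have m1 : measurable_fun (setT : set T') (fst : T' -> measurableTypeR R).
  apply: (measurability (@RGenOpens.G R)); first exact: RGenOpens.measurableE.
  move=> _ [_ [a [b ->]] <-]; rewrite setTI.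
  rewrite (_ : _ @^-1` _ = \bigcup_n (`]a, b[%classic `*` `]- n%:R, n%:R[%classic : set T')).
    by apply: (@bigcupT_measurable _ T') => n; exact: mbox.
  apply/seteqP; split => [x /= xab|x [n _ [/=]]//].
  by have [n hn] := natr_bound x.2; exists n => //; split => //=; rewrite in_itv/= -ltr_norml.
have m2 : measurable_fun (setT : set T') (snd : T' -> measurableTypeR R).
  apply: (measurability (@RGenOpens.G R)); first exact: RGenOpens.measurableE.
  move=> _ [_ [a [b ->]] <-]; rewrite setTI.
  rewrite (_ : _ @^-1` _ = \bigcup_n (`]- n%:R, n%:R[%classic `*` `]a, b[%classic : set T')).
    by apply: (@bigcupT_measurable _ T') => n; exact: mbox.
  apply/seteqP; split => [x /= xab|x [n _ [/=]]//].
  by have [n hn] := natr_bound x.1; exists n => //; split => //=; rewrite in_itv/= -ltr_norml.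
move=> A [[B mB <-]|[B mB <-]].
  exact: (m1 measurableT B mB).
exact: (m2 measurableT B mB).
Qed.

(** Sets over which the integral vanishes form a Dynkin class, and open boxes are stable under
    intersection and generate the sigma-algebra. The whole plane is not a box: it comes from
    dominated convergence along growing squares. *)
Lemma ae0_of_boxes (D : set (mplane R)) (h : mplane R -> R) : measurable D ->
  (leb2 R).-integrable D (EFin \o h) ->
  (forall a b c d : R,
    (\int[leb2 R]_(x in D `&` (`]a, b[%classic `*` `]c, d[%classic)) (h x)%:E = 0)%E) ->
  ae_eq (leb2 R) D (EFin \o h) (cst 0%E).
Proof.
move=> mD ih hbox.
pose P (E : set (mplane R)) := (\int[leb2 R]_(x in D `&` E) (h x)%:E = 0)%E.
have mbox n : measurable (`]- n%:R, n%:R[%classic `*` `]- n%:R, n%:R[%classic : set (mplane R)).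
  by apply: measurableX; exact: measurable_itv.
have PT : P setT.
  rewrite /P setIT.
  pose hn n x := (h x * \1_(`]- n%:R, n%:R[%classic `*` `]- n%:R, n%:R[%classic : set (mplane R)) x)%:E.
  have hn0 n : (\int[leb2 R]_(x in D) hn n x = 0)%E.
    rewrite -(hbox (- n%:R) n%:R (- n%:R) n%:R) integral_mkcondr.
    apply: eq_integral => x _; rewrite /hn patchE indicE.
    by case: ifP => _; rewrite ?mulr1 ?mulr0.
  have mh := measurable_int _ ih.
  have mhn n : measurable_fun D (hn n).
    apply/measurable_EFinP; apply: measurable_funM; first exact/measurable_EFinP.
    exact: measurable_indic.
  have cv : {ae leb2 R, forall x, D x -> hn n x @[n --> \oo] --> (EFin \o h) x}.
    apply: aeW => x Dx; apply: cvg_near_cst; near=> n.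
    rewrite /hn indicE mem_set ?mulr1//; split; rewrite /= in_itv/= -ltr_norml.
      by near: n; exact: nbhs_infty_gtr.
    by near: n; exact: nbhs_infty_gtr.
  have dom : {ae leb2 R, forall x n, D x -> (`|hn n x| <= `|(EFin \o h) x|)%E}.
    apply: aeW => x n Dx; rewrite /hn /= lee_fin normrM indicE.
    by case: (_ \in _); rewrite ?normr1 ?mulr1// normr0 mulr0.
  have [_ _] := dominated_convergence mD mhn mh cv (integrable_abse ih) dom.
  under eq_fun do rewrite hn0.
  by move=> /cvg_lim <-//; rewrite lim_cst.
have PG : open_boxes `<=` P by move=> _ [a [b [c [d ->]]]]; exact: hbox.
have PC S : measurable S -> P S -> P (~` S).
  move=> mS PS; have DE : D = (D `&` S) `|` (D `&` ~` S).
    by rewrite -setIUr setUv setIT.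
  have := PT; rewrite /P setIT {1}DE integral_setU; first by rewrite PS add0e.
  - exact: measurableI.
  - by apply: measurableI => //; exact: measurableC.
  - by rewrite -DE; exact: measurable_int ih.
  - by apply/disj_setPS => x [[_ Sx] [_ nSx]].
have PU (F : (set (mplane R))^nat) : (forall n, measurable (F n)) -> trivIset setT F ->
    (forall n, P (F n)) -> P (\bigcup_k F k).
  move=> mF tF PF; rewrite /P setI_bigcupr integral_bigcup.
  - by rewrite eseries0// => n _ _; exact: PF.
  - by apply: trivIset_setIl.
  - by move=> k; exact: measurableI.
  - rewrite -setI_bigcupr; apply: integrableS ih => //.
    by apply: measurableI => //; exact: bigcupT_measurable.
have main S : measurable S -> P S.
  move=> mS; apply: (dynkin_induction open_boxes_generate open_boxes_setI PT PG PC PU).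
  by rewrite -open_boxes_generate.
apply: integral_ae_eq => // E ED mE.
have := main E mE; rewrite /P setIidr// integral0; exact.
Unshelve. all: by end_near.
Qed.

End Uniqueness.

Lemma cvg_integral_bounded_mul d (X : measurableType d) (R : realType)
    (mu : {measure set X -> \bar R}) (D : set X) (h chi : X -> R) (phi : nat -> X -> R) (B : R) :
  measurable D -> mu.-integrable D (EFin \o h) ->
  (forall n, measurable_fun D (phi n)) ->
  (forall n x, D x -> `|phi n x| <= B) ->
  (forall x, D x -> phi n x @[n --> \oo] --> chi x) ->
  mu.-integrable D (EFin \o (fun x => h x * chi x)) /\
  \int[mu]_(x in D) (h x * phi n x) @[n --> \oo] --> \int[mu]_(x in D) (h x * chi x).
Proof.
move=> mD ih mphi phiB phichi.
have mh := integrable_measurable ih.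
have mchi : measurable_fun D chi by exact: measurable_fun_cvg mphi phichi.
have chiB x : D x -> `|chi x| <= B.
  move=> Dx; have hc : `|phi n x| @[n --> \oo] --> `|chi x| by apply: cvg_norm; exact: phichi.
  rewrite -(cvg_lim _ hc)//; apply: limr_le; first by apply/cvg_ex; exists `|chi x|.
  by apply: nearW => n; exact: phiB.
have iB : mu.-integrable D (EFin \o (fun x => B * `|h x|)).
  by apply: integrableRZ => //; exact: integrableR_norm.
have [] := @dominated_convergence _ _ _ mu D mD (fun n x => (h x * phi n x)%:E)
  (EFin \o (fun x => h x * chi x)) (EFin \o (fun x => B * `|h x|)).
- by move=> n; apply/measurable_EFinP; exact: measurable_funM.
- by apply/measurable_EFinP; exact: measurable_funM.
- apply: aeW => x Dx; apply: cvg_EFin; first exact: nearW.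
  by apply: cvgM; [exact: cvg_cst|exact: phichi].
- exact: iB.
- by apply: aeW => x n Dx; rewrite /= lee_fin normrM mulrC ler_wpM2r// phiB.
move=> ihc _ hcv; split => //; apply: fine_cvg.
by rewrite fineK; [exact: hcv|exact: (integrable_fin_num mD ihc)].
Qed.

Section FundamentalLemma.
Context (R : realType).
Implicit Types (a b c x : plane R).

Lemma bounded_closed_compact_plane (K : set (plane R)) (M : R) : closed K ->
  (forall x, K x -> `|x.1| <= M /\ `|x.2| <= M) -> compact K.
Proof.
move=> cK KM; apply: (@subclosed_compact _ K (`[- M, M]%classic `*` `[- M, M]%classic)) => //.
  by apply: compact_setX; exact: segment_compact.
by move=> x /KM[h1 h2]; split; rewrite /= in_itv/= -ler_norml.
Qed.

Lemma orient_affine a b : exists p q r, forall x, orient a b x = p + x.1 * q + x.2 * r.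
Proof.
exists (a.1 * b.2 - a.2 * b.1), (a.2 - b.2), (b.1 - a.1) => x.
by rewrite /orient; ring.
Qed.

(** Product of ramps of the three barycentric coordinates. Each ramp starts at the value 1/(n+1), so
    the support lies in a smaller closed triangle. *)
Lemma triangle_cutoff a b c : noncollinear a b c ->
  exists chi : nat -> plane R -> R,
  [/\ forall n, exists chix chiy, has_partials (chi n) chix chiy,
      forall n, exists K, [/\ compact K, K `<=` open_triangle a b c & forall x, ~ K x -> chi n x = 0],
      forall n x, 0 <= chi n x <= 1 &
      forall x, open_triangle a b c x -> chi n x @[n --> \oo] --> (1 : R)].
Proof.
move=> d0; have D0 : orient a b c != 0 by [].
set D := orient a b c in D0.
have H u v : exists p q r, forall x, orient u v x / D = p + x.1 * q + x.2 * r.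
  have [p [q [r E]]] := orient_affine u v.
  by exists (p / D), (q / D), (r / D) => x; rewrite E; ring.
have [p1 [q1 [r1 E1]]] := H b c.
have [p2 [q2 [r2 E2]]] := H c a.
have [p3 [q3 [r3 E3]]] := H a b.
pose l (p q r : R) x := p + x.1 * q + x.2 * r.
have inT x : open_triangle a b c x <-> [/\ 0 < l p1 q1 r1 x, 0 < l p2 q2 r2 x & 0 < l p3 q3 r3 x].
  by rewrite in_open_triangle// -/D (orient_rot x) -(orient_rot c a x) E1 E2 E3.
pose f n p q r x := ramp ((-1 + p * n.+1%:R) + x.1 * (q * n.+1%:R) + x.2 * (r * n.+1%:R)).
have fE n p q r x : f n p q r x = ramp (-1 + l p q r x * n.+1%:R).
  by rewrite /f /l; congr ramp; ring.
have hp n p q r : has_partials (f n p q r) _ _ :=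
  has_partials_affine _ _ _ (@continuous_dramp R) (@is_derive_ramp R).
exists (fun n x => f n p1 q1 r1 x * f n p2 q2 r2 x * f n p3 q3 r3 x); split.
- move=> n; have h := has_partialsM (has_partialsM (hp n p1 q1 r1) (hp n p2 q2 r2)) (hp n p3 q3 r3).
  by do 2 eexists; exact: h.
- move=> n; pose k : R := n.+1%:R^-1.
  have k0 : 0 < k by rewrite invr_gt0 ltr0n.
  have n0 : 0 < n.+1%:R :> R by rewrite ltr0n.
  have cl p q r : closed [set x | k <= l p q r x].
    rewrite (_ : [set x | _] = l p q r @^-1` [set t | k <= t])//.
    by apply: closed_comp; [move=> x _; exact: continuous_affine|exact: closed_ge].
  have f0 p q r x : ~ k <= l p q r x -> f n p q r x = 0.
    move=> /negP; rewrite -ltNge => h; rewrite fE ramp_eq0//.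
    have : l p q r x * n.+1%:R < k * n.+1%:R by rewrite ltr_pM2r.
    by rewrite mulVf ?gt_eqF//; lra.
  exists ([set x | k <= l p1 q1 r1 x] `&` [set x | k <= l p2 q2 r2 x] `&` [set x | k <= l p3 q3 r3 x]).
  have KT : [set x | k <= l p1 q1 r1 x] `&` [set x | k <= l p2 q2 r2 x] `&` [set x | k <= l p3 q3 r3 x]
      `<=` open_triangle a b c.
    by move=> x [[h1 h2] h3]; apply/inT; split; apply: lt_le_trans k0 _.
  split => //.
    apply: (bounded_closed_compact_plane (M := `|a.1| + `|b.1| + `|c.1| + `|a.2| + `|b.2| + `|c.2|)).
      by apply: closedI; [apply: closedI|]; exact: cl.
    by move=> x /KT; exact: open_triangle_bounded.
  move=> x nK.
  have [h1|/f0 ->] := pselect (k <= l p1 q1 r1 x); last by rewrite !mul0r.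
  have [h2|/f0 ->] := pselect (k <= l p2 q2 r2 x); last by rewrite mulr0 mul0r.
  have [h3|/f0 ->] := pselect (k <= l p3 q3 r3 x); last by rewrite mulr0.
  by exfalso; apply: nK.
- move=> n x; rewrite !mulr_ge0 ?ramp_ge0//=.
  by rewrite !mulr_ile1 ?mulr_ge0 ?ramp_ge0 ?ramp_le1.
- move=> x /inT[h1 h2 h3].
  have cf p q r : 0 < l p q r x -> f n p q r x @[n --> \oo] --> (1 : R).
    by move=> h; under eq_fun do rewrite fE; exact: ramp_cvg.
  rewrite -[X in _ --> X](mulr1 (1 : R)); apply: cvgM; last exact: cf.
  by rewrite -[X in _ --> X](mulr1 (1 : R)); apply: cvgM; exact: cf.
Qed.

Lemma triangle_finite a b c : noncollinear a b c -> (leb2 R (open_triangle a b c) < +oo)%E.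
Proof.
move=> d0; have c1 : continuous (fun _ : plane R => 1 : R) by move=> x; exact: cvg_cst.
have := triangle_integrable d0 c1.
move=> /integrableP[_]; under eq_integral do rewrite /= normr1.
by rewrite integral_cst ?mul1e//; exact: open_triangle_measurable.
Qed.

(** Cutoffs of the triangle times bumps in the two coordinates are admissible test functions
    converging boundedly to the indicator of a box, which reduces the claim to [ae0_of_boxes]. It
    yields uniqueness of weak gradients on an element. *)
Lemma fundamental_lemma a b c (h : mplane R -> R) : noncollinear a b c ->
  sqint (leb2 R) (open_triangle a b c) h ->
  (forall phi, C1c (open_triangle a b c) phi ->
    \int[leb2 R]_(x in open_triangle a b c) (h x * phi x) = 0) ->
  ae_eq (leb2 R) (open_triangle a b c) (EFin \o h) (cst 0%E).
Proof.
move=> d0 sh hphi; set T := open_triangle a b c in sh hphi *.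
have mT : measurable (T : set (mplane R)) by exact: open_triangle_measurable.
have s1 : sqint (leb2 R) T (fun=> 1).
  split=> //; under eq_integral do rewrite expr1n.
  by rewrite integral_cst// mul1e; exact: triangle_finite.
have ih : (leb2 R).-integrable T (EFin \o h).
  by apply: (eq_integrableR mT _ (sqintM mT sh s1)) => x _; rewrite mulr1.
apply: ae0_of_boxes => // a' b' c' d'.
have [ab|ba] := ltP a' b'; last first.
  rewrite (_ : _ `*` _ = set0) ?setI0 ?integral_set0//.
  by apply/seteqP; split => x //= [+ _]; rewrite in_itv/= => /andP[]; lra.
have [cd|dc] := ltP c' d'; last first.
  rewrite (_ : _ `*` _ = set0) ?setI0 ?integral_set0//.
  by apply/seteqP; split => x //= [_]; rewrite in_itv/= => /andP[]; lra.
have [chi [chiC chiK chi01 chi1]] := triangle_cutoff d0.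
pose ux (x : plane R) := (- a' / (b' - a')) + x.1 * (b' - a')^-1 + x.2 * 0.
pose uy (x : plane R) := (- c' / (d' - c')) + x.1 * 0 + x.2 * (d' - c')^-1.
pose phi n x := chi n x * (bump n (ux x) * bump n (uy x)).
pose box x : R := 1 * ((ux x \in `]0, 1[)%:R * (uy x \in `]0, 1[)%:R).
have phiC n : C1 (phi n).
  have [chix [chiy hchi]] := chiC n.
  apply: has_partials_C1; apply: (has_partialsM hchi).
  exact: (has_partialsM (has_partials_affine _ _ _ (@continuous_dbump R n) (@is_derive_bump R n))
    (has_partials_affine _ _ _ (@continuous_dbump R n) (@is_derive_bump R n))).
have phiCc n : C1c T (phi n).
  split; first exact: phiC.
  have [K [cK KT K0]] := chiK n; exists K; split => // x nK.
  by rewrite /phi K0// mul0r.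
have mphi n : measurable_fun (T : set (mplane R)) (phi n).
  by apply: measurable_funTS; apply: continuous_plane_measurable; case: (phiC n).
have phiB n x : T x -> `|phi n x| <= 1.
  move=> _; have /andP[c0 c1] := chi01 n x.
  have b0 : 0 <= bump n (ux x) * bump n (uy x) by rewrite mulr_ge0 ?bump_ge0.
  have b1 : bump n (ux x) * bump n (uy x) <= 1 by rewrite mulr_ile1 ?bump_ge0 ?bump_le1.
  by rewrite /phi ger0_norm; [exact: mulr_ile1|exact: mulr_ge0].
have cphi x : T x -> phi n x @[n --> \oo] --> box x.
  move=> Tx; apply: cvgM; first exact: chi1.
  by apply: cvgM; exact: bump_cvg.
have [ib cb] := cvg_integral_bounded_mul mT ih mphi phiB cphi.
rewrite integral_mkcondr; transitivity (\int[leb2 R]_(x in T) (h x * box x)%:E)%E.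
  apply: eq_integral => x _; rewrite patchE /box mul1r.
  have -> : (ux x \in `]0, 1[) = (x.1 \in `]a', b'[).
    rewrite !in_itv/= /ux mulr0 addr0 -mulrDl (addrC (- a')).
    by rewrite pmulr_lgt0 ?invr_gt0 ?subr_gt0// ltr_pdivrMr ?subr_gt0// mul1r ltrD2r ?subr_gt0.
  have -> : (uy x \in `]0, 1[) = (x.2 \in `]c', d'[).
    rewrite !in_itv/= /uy mulr0 addr0 -mulrDl (addrC (- c')).
    by rewrite pmulr_lgt0 ?invr_gt0 ?subr_gt0// ltr_pdivrMr ?subr_gt0// mul1r ltrD2r ?subr_gt0.
  rewrite -natrM mulnb.
  have -> : (x \in `]a', b'[%classic `*` `]c', d'[%classic) = (x.1 \in `]a', b'[) && (x.2 \in `]c', d'[).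
    by apply/idP/andP => [/set_mem[]//|[h1 h2]]; exact/mem_set.
  by case: ifP => _; rewrite ?mulr1 ?mulr0.
have -> : (\int[leb2 R]_(x in T) (h x * box x)%:E = (\int[leb2 R]_(x in T) (h x * box x))%:E)%E.
  by rewrite /Rintegral fineK//; exact: (integrable_fin_num mT ib).
rewrite -(cvg_lim _ cb)//; under eq_fun do rewrite hphi//.
by rewrite lim_cst.
Qed.

End FundamentalLemma.

(** * Dyadic energies *)

Lemma sum_even_odd (V : zmodType) (n : nat) (F : nat -> V) :
  \sum_(i < n * 2) F i = \sum_(i < n) (F (i * 2)%N + F (i * 2).+1).
Proof.
elim: n => [|n IH]; first by rewrite mul0n !big_ord0.
by rewrite mulSn addnC addn2 !big_ord_recr/= IH -addrA.
Qed.

Section Dyadic.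
Context (R : realType).
Local Notation mu := (@lebesgue_measure R).
Implicit Types (f g h : mplane R -> R) (m i j : nat) (t : R).

Definition dyadic_itv m i : interval R := `[i%:R / 2 ^+ m, i.+1%:R / 2 ^+ m[.
Definition dyadic_ind m i t : R := (t \in dyadic_itv m i)%:R.
Definition square_ind m i j (x : mplane R) : R := dyadic_ind m i x.1 * dyadic_ind m j x.2.
Definition unit_square : set (mplane R) := `[0, 1[%classic `*` `[0, 1[%classic.

Lemma pow2_gt0 m : 0 < (2 : R) ^+ m. Proof. by rewrite exprn_gt0. Qed.

Lemma in_dyadic_itv m i t : (t \in dyadic_itv m i) = (i%:R <= t * 2 ^+ m < i.+1%:R).
Proof. by rewrite in_itv/= ler_pdivrMr ?pow2_gt0// ltr_pdivlMr ?pow2_gt0. Qed.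

Lemma dyadic_ind_split m i t :
  dyadic_ind m i t = dyadic_ind m.+1 (i * 2) t + dyadic_ind m.+1 (i * 2).+1 t.
Proof.
rewrite /dyadic_ind !in_dyadic_itv exprS mulrCA; set s := t * _.
have e1 : (i * 2)%:R = 2 * i%:R :> R by rewrite natrM mulrC.
have e2 : (i * 2).+1%:R = 2 * i%:R + 1 :> R by rewrite -addn1 natrD e1.
have e3 : (i * 2).+2%:R = 2 * i%:R + 2 :> R by rewrite -addn2 natrD e1.
have e4 : i.+1%:R = i%:R + 1 :> R by rewrite -addn1 natrD.
rewrite e1 e2 e3 e4; move: (i%:R) => r.
have -> : (r <= s) = (2 * r <= 2 * s) by rewrite ler_pM2l.
have -> : (s < r + 1) = (2 * s < 2 * r + 2).
  by rewrite -(@ltr_pM2l _ 2)// mulrDr mulr1.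
have [h|h] := ltP (2 * s) (2 * r + 1).
  by rewrite (lt_trans h) ?andbT ?addr0// ltrD2l; lra.
by rewrite (le_trans _ h) ?lerDl//= add0r.
Qed.

Lemma dyadic_ind_disjoint m i i' t :
  dyadic_ind m i t * dyadic_ind m i' t = (i == i')%:R * dyadic_ind m i t.
Proof.
rewrite /dyadic_ind; case: eqVneq => [->|ne]; first by rewrite mul1r; case: (_ \in _); rewrite ?mulr0 ?mulr1.
rewrite mul0r; have [h1|_] := boolP (t \in dyadic_itv m i); last by rewrite mul0r.
have [h2|_] := boolP (t \in dyadic_itv m i'); last by rewrite mulr0.
move: h1 h2; rewrite !in_dyadic_itv => /andP[h1 h2] /andP[h3 h4].
have := le_lt_trans h1 h4; have := le_lt_trans h3 h2; rewrite !ltr_nat => k1 k2.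
by move: ne; rewrite (_ : i = i') ?eqxx//; lia.
Qed.

Lemma dyadic_ind_ex m t : 0 <= t < 1 -> exists2 i, (i < 2 ^ m)%N & t \in dyadic_itv m i.
Proof.
move=> /andP[t0 t1]; exists (Num.Def.truncn (t * 2 ^+ m)).
  have /andP[h _] := truncn_itv (mulr_ge0 t0 (ltW (pow2_gt0 m))).
  rewrite -(ltr_nat R) natrX; apply: le_lt_trans h _.
  by rewrite gtr_pMl ?pow2_gt0.
by rewrite in_dyadic_itv; exact: truncn_itv (mulr_ge0 t0 (ltW (pow2_gt0 m))).
Qed.

Lemma dyadic_ind_sub m i t : (i < 2 ^ m)%N -> t \in dyadic_itv m i -> 0 <= t < 1.
Proof.
move=> im; rewrite in_dyadic_itv => /andP[h1 h2]; apply/andP; split.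
  by have := le_trans (ler0n _ i) h1; rewrite pmulr_lge0 ?pow2_gt0.
have : t * 2 ^+ m < 1 * 2 ^+ m.
  by apply: lt_le_trans h2 _; rewrite mul1r -natrX ler_nat.
by rewrite ltr_pM2r ?pow2_gt0.
Qed.

Lemma square_ind01 m i j x : 0 <= square_ind m i j x <= 1.
Proof.
by rewrite /square_ind /dyadic_ind; do 2 case: (_ \in _); rewrite /= ?mulr0 ?mulr1 ?lexx ?ler01 ?mul0r.
Qed.

Lemma measurable_dyadic_ind m i : measurable_fun (setT : set (measurableTypeR R)) (dyadic_ind m i).
Proof.
rewrite (_ : dyadic_ind m i = \1_([set` dyadic_itv m i])).
  by apply: measurable_indic; exact: measurable_itv.
by apply/funext => t; rewrite indicE; congr ((nat_of_bool _)%:R); apply/idP/idP => [/mem_set|/set_mem].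
Qed.

Lemma measurable_square_ind m i j : measurable_fun setT (square_ind m i j).
Proof.
by apply: measurable_funM; apply: (measurableT_comp (measurable_dyadic_ind _ _)).
Qed.

Lemma unit_square_measurable : measurable unit_square.
Proof. by apply: measurableX; exact: measurable_itv. Qed.

Lemma lebesgue_unit_itv : (mu (`[0%R, 1%R[%classic : set R) = 1)%E.
Proof. by rewrite lebesgue_measure_itv/= lte_fin ltr01 -EFinD subr0. Qed.

Lemma leb2_unit_square : leb2 R unit_square = 1%E.
Proof.
rewrite product_measure1E; try exact: measurable_itv.
by have := lebesgue_unit_itv => /= ->; rewrite mul1e.
Qed.

Local Notation sqS := (sqint (leb2 R) unit_square).

Lemma bounded_sqint f (B : R) : measurable_fun unit_square f ->
  (forall x, unit_square x -> `|f x| <= B) -> sqS f.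
Proof.
move=> mf fB; have mS := unit_square_measurable; split => //.
have [x0 Sx0] : exists x0, unit_square x0.
  by exists (0, 0); split; rewrite /= in_itv/= lexx ltr01.
have B0 : 0 <= B by exact: le_trans (fB _ Sx0).
apply: (@le_lt_trans _ _ (\int[leb2 R]_(x in unit_square) (B ^+ 2)%:E)%E).
  apply: ge0_le_integral => //.
  - by move=> x _; rewrite lee_fin sqr_ge0.
  - by apply/measurable_EFinP; exact: measurable_funX.
  - move=> x Sx; rewrite lee_fin -[leLHS]real_normK ?num_real//.
    by rewrite ler_pXn2r ?nnegrE//; exact: fB.
by rewrite integral_cst// [X in (_ * X)%E]leb2_unit_square mule1 ltry.
Qed.

Lemma sqint_square_ind m i j : sqS (square_ind m i j).
Proof.
apply: (@bounded_sqint _ 1); first by apply: measurable_funTS; exact: measurable_square_ind.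
by move=> x _; have /andP[h1 h2] := square_ind01 m i j x; rewrite ger0_norm.
Qed.

Lemma sqint_integrable1 f : sqS f -> (leb2 R).-integrable unit_square (EFin \o f).
Proof.
move=> sf; have s1 : sqS (fun=> 1) by apply: (@bounded_sqint _ 1) => // x _; rewrite normr1.
have mS := unit_square_measurable.
by apply: (eq_integrableR mS _ (sqintM mS sf s1)) => x _; rewrite mulr1.
Qed.

Definition sq_int m i j f : R := \int[leb2 R]_(x in unit_square) (f x * square_ind m i j x).

Lemma sq_int_split m i j f : sqS f ->
  sq_int m i j f = sq_int m.+1 (i * 2) (j * 2) f + sq_int m.+1 (i * 2) (j * 2).+1 f
    + sq_int m.+1 (i * 2).+1 (j * 2) f + sq_int m.+1 (i * 2).+1 (j * 2).+1 f.
Proof.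
move=> sf; have mS := unit_square_measurable.
have iq k l : (leb2 R).-integrable unit_square (EFin \o (fun x => f x * square_ind m.+1 k l x)).
  by apply: sqintM => //; exact: sqint_square_ind.
rewrite /sq_int -!RintegralD//; try by repeat apply: integrableRD => //.
apply: eq_Rintegral => x _.
by rewrite /square_ind !(dyadic_ind_split m); ring.
Qed.

Lemma sq_int_square_ind m i j i' j' : (i < 2 ^ m)%N -> (j < 2 ^ m)%N ->
  sq_int m i j (square_ind m i' j') = (i == i')%:R * (j == j')%:R * (4 ^+ m)^-1.
Proof.
move=> im jm; have mS := unit_square_measurable.
transitivity (\int[leb2 R]_(x in unit_square) ((i == i')%:R * (j == j')%:R * square_ind m i j x)).
  apply: eq_Rintegral => x _; rewrite /square_ind.
  rewrite (_ : _ * _ = (dyadic_ind m i x.1 * dyadic_ind m i' x.1) * (dyadic_ind m j x.2 * dyadic_ind m j' x.2)); last by ring.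
  by rewrite !dyadic_ind_disjoint; ring.
rewrite RintegralZl//; last by apply: sqint_integrable1; exact: sqint_square_ind.
congr (_ * _).
have wd k : (k%:R / 2 ^+ m < k.+1%:R / 2 ^+ m :> R) by rewrite ltr_pM2r ?invr_gt0 ?pow2_gt0// ltr_nat.
have lk k : (mu ([set` dyadic_itv m k] : set R) = (2 ^- m)%:E)%E.
  rewrite lebesgue_measure_itv/= lte_fin wd -EFinB -mulrBl -addn1 natrD addrAC subrr add0r.
  by rewrite mul1r.
transitivity (\int[leb2 R]_(x in unit_square) \1_([set` dyadic_itv m i] `*` [set` dyadic_itv m j]) x).
  apply: eq_Rintegral => x _; rewrite /square_ind /dyadic_ind indicE -natrM mulnb; congr ((nat_of_bool _)%:R).
  by apply/andP/idP => [[h1 h2]|/set_mem[]//]; exact/mem_set.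
rewrite /Rintegral integral_indic//; last by apply: measurableX; exact: measurable_itv.
rewrite setIidl; last first.
  by move=> x [/= /(dyadic_ind_sub im) h1 /(dyadic_ind_sub jm) h2]; split; rewrite /= in_itv/=.
rewrite [X in fine X]product_measure1E; try exact: measurable_itv.
have := lk i; have := lk j => /= -> ->.
by rewrite -EFinM/= -invfM -exprMn -natrM.
Qed.

(** The squared L2 norm of the projection [dyadic_mean m f]: cells have area 4^-m, the mean on a
    cell is 4^m times [sq_int], and (4^m)^2 4^-m = 4^m. *)
Definition dyadic_energy m f : R :=
  4 ^+ m * \sum_(i < 2 ^ m) \sum_(j < 2 ^ m) sq_int m i j f ^+ 2.

Definition dyadic_mean m f (x : mplane R) : R :=
  \sum_(i < 2 ^ m) \sum_(j < 2 ^ m) 4 ^+ m * sq_int m i j f * square_ind m i j x.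

Lemma measurable_dyadic_mean m f : measurable_fun setT (dyadic_mean m f).
Proof.
apply: measurable_sum => i; apply: measurable_sum => j.
by apply: measurable_funM => //; exact: measurable_square_ind.
Qed.

Lemma sqint_dyadic_mean m f : sqS (dyadic_mean m f).
Proof.
apply: (@bounded_sqint _ (\sum_(i < 2 ^ m) \sum_(j < 2 ^ m) `|4 ^+ m * sq_int m i j f|)).
  by apply: measurable_funTS; exact: measurable_dyadic_mean.
move=> x _; apply: le_trans (ler_norm_sum _ _ _) _; apply: ler_sum => i _.
apply: le_trans (ler_norm_sum _ _ _) _; apply: ler_sum => j _.
rewrite normrM ler_piMr//; have /andP[h1 h2] := square_ind01 m i j x; by rewrite ger0_norm.
Qed.

Lemma integral_dyadic_mean m f g : sqS g ->
  \int[leb2 R]_(x in unit_square) (dyadic_mean m f x * g x) =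
  4 ^+ m * \sum_(i < 2 ^ m) \sum_(j < 2 ^ m) sq_int m i j f * sq_int m i j g.
Proof.
move=> sg; have mS := unit_square_measurable.
have iq k l : (leb2 R).-integrable unit_square (EFin \o (fun x => g x * square_ind m k l x)).
  by apply: sqintM => //; exact: sqint_square_ind.
transitivity (\int[leb2 R]_(x in unit_square) (\sum_(i < 2 ^ m) \sum_(j < 2 ^ m)
    4 ^+ m * sq_int m i j f * (g x * square_ind m i j x))).
  apply: eq_Rintegral => x _; rewrite /dyadic_mean mulr_suml; apply: eq_bigr => i _.
  by rewrite mulr_suml; apply: eq_bigr => j _; ring.
rewrite Rintegral_sum//; last first.
  by move=> i; apply: integrableR_sum => // j; exact: integrableRZ.
rewrite mulr_sumr; apply: eq_bigr => i _.
rewrite Rintegral_sum//; last by move=> j; exact: integrableRZ.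
rewrite mulr_sumr; apply: eq_bigr => j _.
by rewrite RintegralZl// mulrA.
Qed.

(** At its own level the projection keeps cell integrals because the cell indicators are orthogonal;
    coarser cells follow by splitting them down to level [k]. *)
Lemma sq_int_dyadic_mean m k i j f : (m <= k)%N -> (i < 2 ^ m)%N -> (j < 2 ^ m)%N ->
  sqS f -> sq_int m i j (dyadic_mean k f) = sq_int m i j f.
Proof.
move=> mk im jm sf.
have base k' i' j' : (i' < 2 ^ k')%N -> (j' < 2 ^ k')%N ->
    sq_int k' i' j' (dyadic_mean k' f) = sq_int k' i' j' f.
  move=> ik jk; rewrite {1}/sq_int integral_dyadic_mean; last exact: sqint_square_ind.
  rewrite (bigD1 (Ordinal ik))//= [X in _ * (_ + X)]big1 ?addr0; last first.
    move=> a; rewrite -val_eqE/= => ne; rewrite big1// => b _.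
    by rewrite sq_int_square_ind// (negbTE ne) mul0r mul0r mulr0.
  rewrite (bigD1 (Ordinal jk))//= [X in _ * (_ + X)]big1 ?addr0; last first.
    move=> b; rewrite -val_eqE/= => ne.
    by rewrite sq_int_square_ind// (negbTE ne) mulr0 mul0r mulr0.
  by rewrite sq_int_square_ind// !eqxx !mul1r mulrC divfK// expf_neq0.
have {mk}[n ->] : exists n, k = (m + n)%N by exists (k - m)%N; lia.
elim: n m i j im jm => [|n IH] m i j im jm; first by rewrite addn0 base.
have i2 : ((i * 2).+1 < 2 ^ m.+1)%N by rewrite expnS; lia.
have j2 : ((j * 2).+1 < 2 ^ m.+1)%N by rewrite expnS; lia.
rewrite !(@sq_int_split m)//; last exact: sqint_dyadic_mean.
by rewrite -addSnnS !IH// ltnW.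
Qed.

Lemma dyadic_energy_inner m k f : (m <= k)%N -> sqS f ->
  \int[leb2 R]_(x in unit_square) (dyadic_mean m f x * dyadic_mean k f x) = dyadic_energy m f.
Proof.
move=> mk sf; rewrite integral_dyadic_mean; last exact: sqint_dyadic_mean.
congr (_ * _); apply: eq_bigr => i _; apply: eq_bigr => j _.
by rewrite sq_int_dyadic_mean// expr2.
Qed.

Lemma integral_sqrB f g : sqS f -> sqS g ->
  \int[leb2 R]_(x in unit_square) (f x - g x) ^+ 2 =
  \int[leb2 R]_(x in unit_square) (f x * f x) - 2 * \int[leb2 R]_(x in unit_square) (f x * g x) +
  \int[leb2 R]_(x in unit_square) (g x * g x).
Proof.
move=> sf sg; have mS := unit_square_measurable.
have i1 := sqintM mS sf sf; have i2 := sqintM mS sf sg; have i3 := sqintM mS sg sg.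
rewrite -RintegralZl// -RintegralB//; last exact: integrableRZ.
rewrite -RintegralD//; last by apply: integrableRB => //; exact: integrableRZ.
by apply: eq_Rintegral => x _; ring.
Qed.

(** Pythagoras: the projections are nested, so the inner product of two of them is the energy of the
    coarser one, and distances become differences of energies. *)
Lemma dyadic_mean_dist m k f : (m <= k)%N -> sqS f ->
  \int[leb2 R]_(x in unit_square) (dyadic_mean m f x - dyadic_mean k f x) ^+ 2 =
  dyadic_energy k f - dyadic_energy m f.
Proof.
move=> mk sf; rewrite integral_sqrB; try exact: sqint_dyadic_mean.
by rewrite !dyadic_energy_inner//; ring.
Qed.

Lemma dyadic_mean_dist_self m f : sqS f ->
  \int[leb2 R]_(x in unit_square) (dyadic_mean m f x - f x) ^+ 2 =
  \int[leb2 R]_(x in unit_square) f x ^+ 2 - dyadic_energy m f.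
Proof.
move=> sf; rewrite integral_sqrB//; last exact: sqint_dyadic_mean.
rewrite dyadic_energy_inner// integral_dyadic_mean//.
have -> : 4 ^+ m * (\sum_(i < 2 ^ m) \sum_(j < 2 ^ m) sq_int m i j f * sq_int m i j f) = dyadic_energy m f.
  by [].
have -> : \int[leb2 R]_(x in unit_square) f x ^+ 2 = \int[leb2 R]_(x in unit_square) (f x * f x).
  by [].
ring.
Qed.

End Dyadic.

(** * From increments of dyadic energies to the L2 norm *)

Section DyadicLimit.
Context (R : realType).
Local Notation S := (@unit_square R).
Local Notation sqS := (sqint (leb2 R) S).
Implicit Types (f v : mplane R -> R) (m n i j : nat) (c : R).

Lemma dyadic_energy_growth f c m k : 0 <= c ->
  (forall m, dyadic_energy m.+1 f <= dyadic_energy m f + c / 2 ^+ m) ->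
  (m <= k)%N -> dyadic_energy k f <= dyadic_energy m f + 2 * c / 2 ^+ m.
Proof.
move=> c0 hY mk; suff h n : dyadic_energy (m + n) f <= dyadic_energy m f + 2 * c / 2 ^+ m - 2 * c / 2 ^+ (m + n).
  have := h (k - m)%N; rewrite subnKC// => /le_trans; apply.
  by rewrite gerBl divr_ge0 ?mulr_ge0// ltW// pow2_gt0.
elim: n => [|n IH]; first by rewrite addn0 addrK.
rewrite addnS; apply: le_trans (hY _) _.
have -> : 2 * c / 2 ^+ (m + n).+1 = c / 2 ^+ (m + n).
  by rewrite exprS invfM mulrACA mulfV// mul1r.
move: IH; set r := c / _.
have -> : 2 * c / 2 ^+ (m + n) = 2 * r by rewrite /r mulrA.
lra.
Qed.

Lemma near_pow2_small (a e : R) : 0 < e -> \forall n \near \oo, a / 2 ^+ n < e.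
Proof.
move=> e0; have [a0|a0] := leP a 0.
  apply: nearW => n; apply: le_lt_trans e0.
  by rewrite mulr_le0_ge0// invr_ge0 ltW// pow2_gt0.
near=> n; rewrite ltr_pdivrMr ?pow2_gt0//.
have : a < n.+1%:R * e by near: n; exact: near_natmul_gt.
move=> /lt_le_trans; apply; rewrite mulrC ler_pM2l// -natrX ler_nat.
exact: ltn_expl.
Unshelve. all: by end_near.
Qed.

Lemma dyadic_itv_small n i t s : t \in dyadic_itv R n i -> s \in dyadic_itv R n i -> `|t - s| < 1 / 2 ^+ n.
Proof.
rewrite !in_dyadic_itv => /andP[h1 h2] /andP[h3 h4].
rewrite ltr_pdivlMr ?pow2_gt0// -[X in _ * X]gtr0_norm ?pow2_gt0// -normrM mulrBl ltr_norml.
move: h1 h2 h3 h4; rewrite -addn1 natrD => h1 h2 h3 h4.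
by apply/andP; split; lra.
Qed.

(** The indicator of an open box is the pointwise limit of the sums of the indicators of the dyadic
    cells contained in it: around a point of the box, the cell fits inside once 2^-n is below the
    distances to the four sides. *)
Lemma ae0_of_dyadic f : sqS f ->
  (forall m i j, (i < 2 ^ m)%N -> (j < 2 ^ m)%N -> sq_int m i j f = 0) ->
  ae_eq (leb2 R) S (EFin \o f) (cst 0%E).
Proof.
move=> sf f0; have mS := @unit_square_measurable R; have fi := sqint_integrable1 sf.
apply: ae0_of_boxes => // a b c d.
set box := `]a, b[%classic `*` `]c, d[%classic.
pose B n i j : R := (`[< [set` dyadic_itv R n i] `*` [set` dyadic_itv R n j] `<=` box >])%:R.
pose chi n x := \sum_(i < 2 ^ n) \sum_(j < 2 ^ n) B n i j * square_ind n i j x.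
have mchi n : measurable_fun S (chi n).
  apply: measurable_funTS; apply: measurable_sum => i; apply: measurable_sum => j.
  by apply: measurable_funM => //; exact: measurable_square_ind.
have chiE n x : S x -> exists i j, [/\ (i < 2 ^ n)%N, (j < 2 ^ n)%N,
    x.1 \in dyadic_itv R n i, x.2 \in dyadic_itv R n j & chi n x = B n i j].
  move=> [/= + +]; rewrite !in_itv/= => /(dyadic_ind_ex n)[i im xi] /(dyadic_ind_ex n)[j jm xj].
  exists i, j; split => //; rewrite /chi.
  have ind1 k t : t \in dyadic_itv R n k -> forall l, dyadic_ind n l t = (l == k)%:R.
    move=> tk l; have := dyadic_ind_disjoint n l k t; have [->|_] := eqVneq l k.
      by rewrite /dyadic_ind tk.
    by rewrite [in X in X * _]/dyadic_ind [X in _ * X]/dyadic_ind tk mulr1 mul0r.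
  rewrite (bigD1 (Ordinal im))//= [X in _ + X]big1 ?addr0; last first.
    move=> k; rewrite -val_eqE/= => /negbTE ne; rewrite big1// => l _.
    by rewrite /square_ind (ind1 _ _ xi) ne mul0r mulr0.
  rewrite (bigD1 (Ordinal jm))//= [X in _ + X]big1 ?addr0; last first.
    move=> l; rewrite -val_eqE/= => /negbTE ne.
    by rewrite /square_ind (ind1 _ _ xj) ne !mulr0.
  by rewrite /square_ind (ind1 _ _ xi) (ind1 _ _ xj) !eqxx !mulr1.
have chiB n x : S x -> `|chi n x| <= 1.
  by move=> /(chiE n)[i [j [_ _ _ _ ->]]]; rewrite /B; case: asboolP; rewrite ?normr1 ?normr0.
have chic x : S x -> chi n x @[n --> \oo] --> (\1_box x : R).
  move=> Sx; have [bx|nbx] := pselect (box x); last first.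
    rewrite indicE memNset// (_ : (fun n => _) = fun=> 0); first exact: cvg_cst.
    apply/funext => n; have [i [j [_ _ xi xj ->]]] := chiE n x Sx.
    by rewrite /B; case: asboolP => // h; exfalso; apply: nbx; apply: h; split.
  rewrite indicE mem_set//; apply: cvg_near_cst.
  case: bx => /=; rewrite !in_itv/= => /andP[ax xb] /andP[cx xd].
  have e1 : 0 < x.1 - a by rewrite subr_gt0.
  have e2 : 0 < b - x.1 by rewrite subr_gt0.
  have e3 : 0 < x.2 - c by rewrite subr_gt0.
  have e4 : 0 < d - x.2 by rewrite subr_gt0.
  near=> n; have [i [j [_ _ xi xj ->]]] := chiE n x Sx.
  have s1 : 1 / 2 ^+ n < x.1 - a by near: n; exact: near_pow2_small.
  have s2 : 1 / 2 ^+ n < b - x.1 by near: n; exact: near_pow2_small.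
  have s3 : 1 / 2 ^+ n < x.2 - c by near: n; exact: near_pow2_small.
  have s4 : 1 / 2 ^+ n < d - x.2 by near: n; exact: near_pow2_small.
  rewrite /B asboolT// => y [/= yi yj].
  have := dyadic_itv_small xi yi; have := dyadic_itv_small xj yj.
  rewrite !ltr_norml => /andP[k1 k2] /andP[k3 k4].
  move: s1 s2 s3 s4 k1 k2 k3 k4; set r := 1 / _ => *.
  by split; rewrite /= in_itv/=; apply/andP; split; lra.
have [ib cb] := cvg_integral_bounded_mul mS fi mchi chiB chic.
rewrite integral_mkcondr; transitivity (\int[leb2 R]_(x in S) (f x * \1_box x)%:E)%E.
  apply: eq_integral => x _; rewrite patchE indicE.
  by case: ifP => _; rewrite ?mulr1 ?mulr0.
have -> : (\int[leb2 R]_(x in S) (f x * \1_box x)%:E = (\int[leb2 R]_(x in S) (f x * \1_box x))%:E)%E.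
  by rewrite /Rintegral fineK//; exact: (integrable_fin_num mS ib).
rewrite -(cvg_lim _ cb)//; rewrite (_ : (fun n => _) = fun=> 0) ?lim_cst//.
apply/funext => n.
have iq k l : (leb2 R).-integrable S (EFin \o (fun x => f x * square_ind n k l x)).
  by apply: sqintM => //; exact: sqint_square_ind.
transitivity (\int[leb2 R]_(x in S) (\sum_(i < 2 ^ n) \sum_(j < 2 ^ n)
    B n i j * (f x * square_ind n i j x))).
  apply: eq_Rintegral => x _; rewrite mulr_sumr; apply: eq_bigr => i _.
  by rewrite mulr_sumr; apply: eq_bigr => j _; ring.
rewrite Rintegral_sum//; last first.
  by move=> i; apply: integrableR_sum => // j; exact: integrableRZ.
rewrite big1// => i _; rewrite Rintegral_sum//; last by move=> j; exact: integrableRZ.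
rewrite big1// => j _; rewrite RintegralZl//.
by have := f0 n i j (ltn_ord i) (ltn_ord j); rewrite /sq_int => ->; rewrite mulr0.
Unshelve. all: by end_near.
Qed.

(** The growth hypothesis makes the projections Cauchy, with a limit [v]. Convergence keeps dyadic
    integrals, so [f - v] has only zero ones and vanishes almost everywhere. Hence the energies tend
    to the squared norm of [f], and the geometric bound passes to the limit. *)
Lemma energy_limit f c m : 0 <= c -> sqS f ->
  (forall m, dyadic_energy m.+1 f <= dyadic_energy m f + c / 2 ^+ m) ->
  \int[leb2 R]_(x in S) f x ^+ 2 <= dyadic_energy m f + 2 * c / 2 ^+ m.
Proof.
move=> c0 sf hY; have mS := @unit_square_measurable R.
have sE n := sqint_dyadic_mean n f.
have cauchy e : 0 < e -> exists N, forall p q, (N <= p)%N -> (N <= q)%N ->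
    \int[leb2 R]_(x in S) (dyadic_mean p f x - dyadic_mean q f x) ^+ 2 <= e.
  move=> e0; have [N _ HN] := near_pow2_small (2 * c) e0.
  have H p q : (N <= p)%N -> (p <= q)%N ->
      \int[leb2 R]_(x in S) (dyadic_mean p f x - dyadic_mean q f x) ^+ 2 <= e.
    move=> Np pq; rewrite dyadic_mean_dist// lerBlDl.
    apply: le_trans (dyadic_energy_growth c0 hY pq) _; rewrite lerD2l.
    exact/ltW/HN.
  exists N => p q Np Nq; have [pq|/ltnW qp] := leqP p q; first exact: H.
  by under eq_Rintegral do rewrite -sqrrN opprB; exact: H.
have [v sv Ev] := riesz_fischer mS sE cauchy.
have sq_v k i j : (i < 2 ^ k)%N -> (j < 2 ^ k)%N -> sq_int k i j v = sq_int k i j f.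
  move=> ik jk; have := cvg_sqint mS sE sv (@sqint_square_ind R k i j) Ev.
  rewrite -/(sq_int k i j v) => /cvg_lim <-//.
  apply: lim_near_cst => //; exists k => // n /= kn.
  by rewrite -(sq_int_dyadic_mean kn ik jk sf).
have sfv := sqintB mS sf sv.
have ifv : ae_eq (leb2 R) S (EFin \o (fun x => f x - v x)) (cst 0%E).
  apply: ae0_of_dyadic => // k i j ik jk.
  rewrite /sq_int; under eq_Rintegral do rewrite mulrBl.
  rewrite RintegralB//; try by apply: sqintM => //; exact: sqint_square_ind.
  by rewrite -!/(sq_int _ _ _ _) sq_v// subrr.
have dist n : \int[leb2 R]_(x in S) (dyadic_mean n f x - v x) ^+ 2 =
    \int[leb2 R]_(x in S) f x ^+ 2 - dyadic_energy n f.
  rewrite -dyadic_mean_dist_self//; congr fine; apply: ae_eq_integral => //.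
  - by apply/measurable_EFinP; apply: measurable_funX; case: (sqintB mS (sE n) sv).
  - by apply/measurable_EFinP; apply: measurable_funX; case: (sqintB mS (sE n) sf).
  - case: ifv => N [mN N0 hN]; exists N; split => // x /= nx; apply: hN => /= h; apply: nx => Sx.
    have [/eqP] := h Sx; rewrite subr_eq0 => /eqP e; by rewrite e.
rewrite -lerBlDl; apply/ler_addgt0Pr => e e0.
move/cvgrPdist_le : Ev => /(_ e e0)[N _ HN].
have := HN (maxn m N) (leq_maxr _ _); rewrite /= sub0r normrN dist => h.
have {h} := le_trans (ler_norm _) h.
have := dyadic_energy_growth c0 hY (leq_maxl m N); lra.
Qed.

(** For the four subcells of a cell, 4 sum p^2 - (sum p)^2 is the sum of the six squared
    differences. The two diagonal ones are bounded by twice the squares of adjacent ones; the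
    difference p10 - p11 is then used most, 1 + 2 + 2 = 5 times. The factor 10 adds both directions,
    and 4^m / 8^m = 2^-m. *)
Lemma energy_step f c m : sqS f ->
  \sum_(i < 2 ^ m) \sum_(j < 2 ^ m.+1)
    (sq_int m.+1 (i * 2) j f - sq_int m.+1 (i * 2).+1 j f) ^+ 2 <= c / 8 ^+ m ->
  \sum_(i < 2 ^ m.+1) \sum_(j < 2 ^ m)
    (sq_int m.+1 i (j * 2) f - sq_int m.+1 i (j * 2).+1 f) ^+ 2 <= c / 8 ^+ m ->
  dyadic_energy m.+1 f <= dyadic_energy m f + 10 * c / 2 ^+ m.
Proof.
move=> sf h1 h2.
have p4 : 0 < (4 : R) ^+ m by rewrite exprn_gt0.
have -> : 10 * c / 2 ^+ m = 4 ^+ m * (5 * (c / 8 ^+ m) + 5 * (c / 8 ^+ m)).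
  have -> : (8 : R) ^+ m = 4 ^+ m * 2 ^+ m by rewrite -exprMn; congr (_ ^+ m); ring.
  by field; rewrite !expf_neq0.
rewrite /dyadic_energy exprSr -mulrA -mulrDr ler_pM2l//.
apply: (@le_trans _ _ (\sum_(i < 2 ^ m) \sum_(j < 2 ^ m) sq_int m i j f ^+ 2 +
  (5 * \sum_(i < 2 ^ m) \sum_(j < 2 ^ m.+1)
    (sq_int m.+1 (i * 2) j f - sq_int m.+1 (i * 2).+1 j f) ^+ 2 +
   5 * \sum_(i < 2 ^ m.+1) \sum_(j < 2 ^ m)
    (sq_int m.+1 i (j * 2) f - sq_int m.+1 i (j * 2).+1 f) ^+ 2))); last first.
  by rewrite lerD2l lerD// ler_pM2l.
rewrite expnSr.
rewrite (sum_even_odd (2 ^ m) (fun i => \sum_(j < 2 ^ m * 2) sq_int m.+1 i j f ^+ 2)).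
rewrite (sum_even_odd (2 ^ m) (fun i => \sum_(j < 2 ^ m)
  (sq_int m.+1 i (j * 2) f - sq_int m.+1 i (j * 2).+1 f) ^+ 2)).
rewrite !mulr_sumr -!big_split/=.
apply: ler_sum => i _.
rewrite (sum_even_odd (2 ^ m) (fun j => sq_int m.+1 (i * 2) j f ^+ 2)).
rewrite (sum_even_odd (2 ^ m) (fun j => sq_int m.+1 (i * 2).+1 j f ^+ 2)).
rewrite (sum_even_odd (2 ^ m) (fun j => (sq_int m.+1 (i * 2) j f - sq_int m.+1 (i * 2).+1 j f) ^+ 2)).
rewrite -!big_split/= !mulr_sumr -!big_split/=.
apply: ler_sum => j _.
rewrite (sq_int_split m i j sf).
move: (sq_int _ (i * 2) (j * 2) f) (sq_int _ (i * 2) (j * 2).+1 f)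
  (sq_int _ (i * 2).+1 (j * 2) f) (sq_int _ (i * 2).+1 (j * 2).+1 f) => p00 p01 p10 p11.
have s1 := sqrrD_le (p00 - p10) (p10 - p11).
have s2 := sqrrD_le (p01 - p11) (p11 - p10).
have t1 := sqr_ge0 (p00 - p10); have t2 := sqr_ge0 (p01 - p11); have t3 := sqr_ge0 (p00 - p01).
have t4 := sqr_ge0 (p10 - p11).
lra.
Qed.

End DyadicLimit.

(** * Geometry of triangles and edges *)

Section Geometry.
Context (R : realType).
Implicit Types (a b c p q x y z : plane R) (O : set (plane R)) (s t r : R).

Lemma plane_eqP x y : x.1 = y.1 -> x.2 = y.2 -> x = y.
Proof. by case: x y => [x1 x2] [y1 y2] /= -> ->. Qed.

(* For an open triangle or an open segment O, [reachable O] is its closure,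
   described by segments only; vertices and end points are then recovered from the
   set O as its extreme points. *)
Definition reachable O : set (plane R) :=
  [set x | exists2 y, O y & forall s, 0 < s -> s <= 1 -> O (seg_point x y s)].

Definition extreme O x := reachable O x /\
  forall y z, reachable O y -> reachable O z ->
    x.1 + x.1 = y.1 + z.1 -> x.2 + x.2 = y.2 + z.2 -> y = x.

Definition closed_triangle a b c : set (plane R) :=
  [set x | exists s t r, [/\ 0 <= s, 0 <= t, 0 <= r, s + t + r = 1 &
     x = (s * a.1 + t * b.1 + r * c.1, s * a.2 + t * b.2 + r * c.2)]].

(** An affine function with a negative value at 0 and a positive one at 1 would vanish at -u / (v -
    u), inside the interval. This replaces limits when passing from an open triangle to its
    closure. *)
Lemma limit_ge0 (u v : R) : (forall s, 0 < s -> s <= 1 -> 0 < u + s * (v - u)) -> 0 <= u.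
Proof.
move=> h; rewrite leNgt; apply/negP => u0.
have v0 := h 1 ltr01 (lexx _).
have d0 : 0 < v - u by lra.
have h1 : 0 < - u / (v - u) by rewrite divr_gt0// oppr_gt0.
have h2 : - u / (v - u) <= 1 by rewrite ler_pdivrMr//; lra.
by have := h _ h1 h2; rewrite divfK ?gt_eqF// subrr ltxx.
Qed.

Lemma in_closed_triangle a b c x : noncollinear a b c -> closed_triangle a b c x <->
  [/\ 0 <= orient x b c / orient a b c, 0 <= orient a x c / orient a b c &
      0 <= orient a b x / orient a b c].
Proof.
move=> d0; have {}d0 : orient a b c != 0 by [].
split=> [[s [t [r [s0 t0 r0 str ->]]]]|[h1 h2 h3]].
  have -> : s = 1 - t - r by lra.
  rewrite (_ : orient (_, _) b c = (1 - t - r) * orient a b c); last by rewrite /orient/=; ring.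
  rewrite (_ : orient a (_, _) c = t * orient a b c); last by rewrite /orient/=; ring.
  rewrite (_ : orient a b (_, _) = r * orient a b c); last by rewrite /orient/=; ring.
  by rewrite !mulfK//; split => //; lra.
exists (orient x b c / orient a b c), (orient a x c / orient a b c), (orient a b x / orient a b c).
split => //; first by rewrite -!mulrDl orient_sum mulfV.
have E1 : orient x b c * a.1 + orient a x c * b.1 + orient a b x * c.1 = x.1 * orient a b c.
  by rewrite /orient; ring.
have E2 : orient x b c * a.2 + orient a x c * b.2 + orient a b x * c.2 = x.2 * orient a b c.
  by rewrite /orient; ring.
rewrite !(mulrAC _ (orient a b c)^-1) -!mulrDl E1 E2 !mulfK//.
exact: surjective_pairing.
Qed.

Lemma open_triangle_nonempty a b c : exists x, open_triangle a b c x.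
Proof.
exists (3^-1 * a.1 + 3^-1 * b.1 + 3^-1 * c.1, 3^-1 * a.2 + 3^-1 * b.2 + 3^-1 * c.2).
by exists 3^-1, 3^-1, 3^-1; split => //; lra.
Qed.

Lemma reachable_triangle a b c : noncollinear a b c ->
  reachable (open_triangle a b c) = closed_triangle a b c.
Proof.
move=> d0; have d0' : orient a b c != 0 by [].
apply/seteqP; split => [x [y Oy h]|x].
  have E s : [/\ orient (seg_point x y s) b c / orient a b c =
      orient x b c / orient a b c + s * (orient y b c / orient a b c - orient x b c / orient a b c),
      orient a (seg_point x y s) c / orient a b c =
      orient a x c / orient a b c + s * (orient a y c / orient a b c - orient a x c / orient a b c) &
      orient a b (seg_point x y s) / orient a b c =
      orient a b x / orient a b c + s * (orient a b y / orient a b c - orient a b x / orient a b c)].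
    by rewrite /seg_point /orient/=; split; field.
  apply/in_closed_triangle => //; split.
  - apply: (@limit_ge0 _ (orient y b c / orient a b c)) => s s0 s1.
    by have [<- _ _] := E s; have /(in_open_triangle _ d0)[] := h s s0 s1.
  - apply: (@limit_ge0 _ (orient a y c / orient a b c)) => s s0 s1.
    by have [_ <- _] := E s; have /(in_open_triangle _ d0)[] := h s s0 s1.
  - apply: (@limit_ge0 _ (orient a b y / orient a b c)) => s s0 s1.
    by have [_ _ <-] := E s; have /(in_open_triangle _ d0)[] := h s s0 s1.
move=> [s [t [r [s0 t0 r0 str ->]]]].
have [y [s' [t' [r' [s'0 t'0 r'0 str' _]]]]] := open_triangle_nonempty a b c.
exists (s' * a.1 + t' * b.1 + r' * c.1, s' * a.2 + t' * b.2 + r' * c.2); first by exists s', t', r'.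
move=> e e0 e1; exists (s + e * (s' - s)), (t + e * (t' - t)), (r + e * (r' - r)).
have P (w w' : R) : 0 <= w -> 0 < w' -> 0 < w + e * (w' - w).
  move=> w0 w'0; have h1 : 0 <= (1 - e) * w by apply: mulr_ge0 => //; lra.
  have h2 : 0 < e * w' by apply: mulr_gt0.
  lra.
split; try exact: P.
  have -> : s + e * (s' - s) + (t + e * (t' - t)) + (r + e * (r' - r)) =
    (1 - e) * (s + t + r) + e * (s' + t' + r') by ring.
  by rewrite str str'; ring.
by rewrite /seg_point/=; congr pair; ring.
Qed.

Lemma closed_triangle_rot a b c : closed_triangle a b c = closed_triangle b c a.
Proof.
apply/seteqP; split => x [s [t [r [s0 t0 r0 str ->]]]].
  by exists t, r, s; split => //; [lra|congr pair; ring].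
by exists r, s, t; split => //; [lra|congr pair; ring].
Qed.

Lemma open_triangle_rot a b c : open_triangle a b c = open_triangle b c a.
Proof.
apply/seteqP; split => x [s [t [r [s0 t0 r0 str ->]]]].
  by exists t, r, s; split => //; [lra|congr pair; ring].
by exists r, s, t; split => //; [lra|congr pair; ring].
Qed.

Lemma open_triangle_swap a b c : open_triangle a b c = open_triangle b a c.
Proof.
apply/seteqP; split => x [s [t [r [s0 t0 r0 str ->]]]].
  by exists t, s, r; split => //; [lra|congr pair; ring].
by exists t, s, r; split => //; [lra|congr pair; ring].
Qed.

Lemma noncollinear_rot a b c : noncollinear a b c -> noncollinear b c a.
Proof. by rewrite /noncollinear -!/(orient _ _ _) (orient_rot a). Qed.

Lemma noncollinear_swap a b c : noncollinear a b c -> noncollinear b a c.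
Proof.
rewrite /noncollinear -!/(orient _ _ _); apply: contra_neq => h.
by rewrite -[LHS]opprK -[in RHS](oppr0 R) -h /orient; congr (- _); ring.
Qed.

Lemma noncollinear_neq a b c : noncollinear a b c -> [/\ a <> b, b <> c & a <> c].
Proof.
rewrite /noncollinear => d0; split => e; move: d0; rewrite e.
- by rewrite !subrr !mul0r subrr eqxx.
- by rewrite mulrC subrr eqxx.
- by rewrite !subrr !mulr0 subrr eqxx.
Qed.

(** If [a] is the midpoint of two points, the coordinates of these along b - a and c - a add up to
    zero by linear independence; being nonnegative, they all vanish. *)
Lemma vertex_extreme a b c : noncollinear a b c -> extreme (open_triangle a b c) a.
Proof.
move=> d0; rewrite /extreme (reachable_triangle d0); split.
  by exists 1, 0, 0; split => //; [lra|rewrite !mul1r !mul0r !addr0 -surjective_pairing].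
move=> _ _ [s [t [r [s0 t0 r0 str ->]]]] [s' [t' [r' [s'0 t'0 r'0 str' ->]]]] /= e1 e2.
have d0' : orient a b c != 0 by [].
have hs : s = 1 - t - r by lra.
have hs' : s' = 1 - t' - r' by lra.
have {}e1 : (t + t') * (b.1 - a.1) + (r + r') * (c.1 - a.1) = 0.
  have -> : 0 = (s * a.1 + t * b.1 + r * c.1 + (s' * a.1 + t' * b.1 + r' * c.1)) - (a.1 + a.1) by rewrite e1 subrr.
  by rewrite hs hs'; ring.
have {}e2 : (t + t') * (b.2 - a.2) + (r + r') * (c.2 - a.2) = 0.
  have -> : 0 = (s * a.2 + t * b.2 + r * c.2 + (s' * a.2 + t' * b.2 + r' * c.2)) - (a.2 + a.2) by rewrite e2 subrr.
  by rewrite hs hs'; ring.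
have h1 : t + t' = 0.
  apply: (mulIf d0'); rewrite mul0r.
  transitivity (((t + t') * (b.1 - a.1) + (r + r') * (c.1 - a.1)) * (c.2 - a.2)
     - ((t + t') * (b.2 - a.2) + (r + r') * (c.2 - a.2)) * (c.1 - a.1)).
    by rewrite /orient; ring.
  by rewrite e1 e2 !mul0r subrr.
have h2 : r + r' = 0.
  apply: (mulIf d0'); rewrite mul0r.
  transitivity (((t + t') * (b.2 - a.2) + (r + r') * (c.2 - a.2)) * (b.1 - a.1)
     - ((t + t') * (b.1 - a.1) + (r + r') * (c.1 - a.1)) * (b.2 - a.2)).
    by rewrite /orient; ring.
  by rewrite e1 e2 !mul0r subrr.
have -> : t = 0 by lra. have -> : r = 0 by lra. have -> : s = 1 by lra.
by rewrite !mul1r !mul0r !addr0 -surjective_pairing.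
Qed.

(** If two barycentric coordinates are positive, moving the amount [d], the smaller of the two, from
    one to the other and back exhibits x as the midpoint of two other points. So only one coordinate
    is positive, and it equals 1. *)
Lemma extreme_vertex a b c x : noncollinear a b c -> extreme (open_triangle a b c) x ->
  [\/ x = a, x = b | x = c].
Proof.
move=> d0; rewrite /extreme (reachable_triangle d0) => -[[s [t [r [s0 t0 r0 str xE]]]] ext].
have [ab bc ac] := noncollinear_neq d0.
have key p q w (s1 t1 r1 : R) : closed_triangle p q w = closed_triangle a b c -> p <> q ->
    0 < s1 -> 0 < t1 -> 0 <= r1 -> s1 + t1 + r1 = 1 ->
    x = (s1 * p.1 + t1 * q.1 + r1 * w.1, s1 * p.2 + t1 * q.2 + r1 * w.2) -> False.
  move=> eqT pq s10 t10 r10 str1 xE1.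
  pose d := Num.min s1 t1; have d0' : 0 < d by rewrite lt_min s10.
  have ds : d <= s1 by rewrite ge_min lexx.
  have dt : d <= t1 by rewrite ge_min lexx orbT.
  pose y : plane R := ((s1 + d) * p.1 + (t1 - d) * q.1 + r1 * w.1, (s1 + d) * p.2 + (t1 - d) * q.2 + r1 * w.2).
  pose z : plane R := ((s1 - d) * p.1 + (t1 + d) * q.1 + r1 * w.1, (s1 - d) * p.2 + (t1 + d) * q.2 + r1 * w.2).
  have Ty : closed_triangle a b c y by rewrite -eqT; exists (s1 + d), (t1 - d), r1; split => //; lra.
  have Tz : closed_triangle a b c z by rewrite -eqT; exists (s1 - d), (t1 + d), r1; split => //; lra.
  have e1 : x.1 + x.1 = y.1 + z.1 by rewrite xE1 /y /z/=; ring.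
  have e2 : x.2 + x.2 = y.2 + z.2 by rewrite xE1 /y /z/=; ring.
  have := ext y z Ty Tz e1 e2; rewrite xE1 /y => -[e3 e4].
  by apply: pq; apply: plane_eqP; apply: (mulfI (lt0r_neq0 d0')); lra.
have T2 : closed_triangle b c a = closed_triangle a b c by rewrite (closed_triangle_rot a).
have T3 : closed_triangle c a b = closed_triangle a b c by rewrite closed_triangle_rot.
have [s_gt|s_le] := ltP 0 s; have [t_gt|t_le] := ltP 0 t; have [r_gt|r_le] := ltP 0 r.
- by exfalso; apply: (key a b c s t r).
- by exfalso; apply: (key a b c s t r).
- exfalso; apply: (key c a b r s t) => //; [exact/nesym|lra|].
  by rewrite xE; congr pair; ring.
- apply: Or31; rewrite xE.
  have -> : t = 0 by lra. have -> : r = 0 by lra. have -> : s = 1 by lra.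
  by rewrite !mul1r !mul0r !addr0 -surjective_pairing.
- exfalso; apply: (key b c a t r s) => //; [lra|].
  by rewrite xE; congr pair; ring.
- apply: Or32; rewrite xE.
  have -> : t = 1 by lra. have -> : r = 0 by lra. have -> : s = 0 by lra.
  by rewrite !mul1r !mul0r !addr0 !add0r -surjective_pairing.
- apply: Or33; rewrite xE.
  have -> : t = 0 by lra. have -> : r = 1 by lra. have -> : s = 0 by lra.
  by rewrite !mul1r !mul0r !add0r -surjective_pairing.
- by exfalso; lra.
Qed.

Lemma open_segment_rev p q : open_segment p q = open_segment q p.
Proof.
apply/seteqP; split => _ [t /= + <-]; rewrite in_itv/= => /andP[t0 t1]; exists (1 - t);
  rewrite ?seg_point_rev//= in_itv/=; apply/andP; split; lra.
Qed.

(** [is_edge] allows any representation of the set as a triangle. The vertices of every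
    representation are extreme points of the same set, so they are among a, b, c. *)
Lemma triangle_edges a b c e : noncollinear a b c -> is_edge (open_triangle a b c) e ->
  [\/ e = open_segment a b, e = open_segment b c | e = open_segment c a].
Proof.
move=> d0 [a' [b' [c' [d1 E ->]]]].
have va : extreme (open_triangle a b c) a' by rewrite E; exact: vertex_extreme.
have vb : extreme (open_triangle a b c) b'.
  by rewrite E open_triangle_rot; apply: vertex_extreme; exact: noncollinear_rot.
have [ab _ _] := noncollinear_neq d1.
case: (extreme_vertex d0 va) => ea; case: (extreme_vertex d0 vb) => eb; rewrite ea eb.
- by exfalso; apply: ab; rewrite ea eb.
- exact: Or31.
- by apply: Or33; exact: open_segment_rev.
- by apply: Or31; exact: open_segment_rev.
- by exfalso; apply: ab; rewrite ea eb.
- exact: Or32.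
- exact: Or33.
- by apply: Or32; exact: open_segment_rev.
- by exfalso; apply: ab; rewrite ea eb.
Qed.

Lemma reachable_segment p q : reachable (open_segment p q) = closed_segment p q.
Proof.
apply/seteqP; split => [x [y [t /= + yE] h]|_ [t /= + <-]].
- rewrite in_itv/= => /andP[t0 t1].
  have [s0] := h 1 ltr01 (lexx _).
  have [pq|pq] := eqVneq p q.
    move=> _ _; exists 0; first by rewrite /= in_itv/= lexx ler01.
    have S u : seg_point p q u = p.
      by rewrite -pq /seg_point !subrr !mulr0 !addr0 -surjective_pairing.
    rewrite S; have [u _] := h 2^-1 ltac:(lra) ltac:(lra).
    rewrite S -yE S /seg_point => e; apply: plane_eqP; move: (congr1 fst e) (congr1 snd e) => /=; lra.
  move=> _ _; pose N := (q.1 - p.1) ^+ 2 + (q.2 - p.2) ^+ 2.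
  have N0 : N != 0.
    apply: contra_neq pq => /eqP; rewrite paddr_eq0 ?sqr_ge0// !sqrf_eq0 !subr_eq0 => /andP[/eqP e1 /eqP e2].
    exact: plane_eqP.
  (* The coordinate along the segment by orthogonal projection: it is affine in the point and
     returns the parameter on the segment, so the bounds 0 and 1 pass to the closure through
     [limit_ge0]. *)
  pose k (z : plane R) := ((z.1 - p.1) * (q.1 - p.1) + (z.2 - p.2) * (q.2 - p.2)) / N.
  have kS u : k (seg_point p q u) = u by rewrite /k /seg_point /N/=; field.
  have kl z w u : k (seg_point z w u) = k z + u * (k w - k z) by rewrite /k /seg_point/=; field.
  have ky : k y = t by rewrite -yE kS.
  have hk s : 0 < s -> s <= 1 -> 0 < k x + s * (k y - k x) /\ k x + s * (k y - k x) < 1.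
    move=> s0' s1; have [u /= + e] := h s s0' s1; rewrite -kl -e kS in_itv/=.
    by move=> /andP.
  have k0 : 0 <= k x by apply: (@limit_ge0 _ (k y)) => s s0' s1; case: (hk s s0' s1).
  have k1 : 0 <= 1 - k x.
    apply: (@limit_ge0 _ (1 - k y)) => s s0' s1; case: (hk s s0' s1) => _; lra.
  exists (k x); first by rewrite /= in_itv/=; apply/andP; split; lra.
  have [u _ e] := h 2^-1 ltac:(lra) ltac:(lra).
  have ku : u = k x + 2^-1 * (t - k x) by rewrite -ky -kl -e kS.
  move: e; rewrite ku -yE /seg_point => e.
  by apply: plane_eqP; move: (congr1 fst e) (congr1 snd e) => /=; lra.
- rewrite in_itv/= => /andP[t0 t1]; exists (seg_point p q 2^-1).
    by exists 2^-1 => //; rewrite /= in_itv/=; apply/andP; split; lra.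
  move=> s s0 s1; exists (t + s * (2^-1 - t)).
    rewrite /= in_itv/=.
    have h1 : 0 <= (1 - s) * t by apply: mulr_ge0; lra.
    have h2 : 0 <= (1 - s) * (1 - t) by apply: mulr_ge0; lra.
    by apply/andP; split; lra.
  by rewrite /seg_point/=; congr pair; ring.
Qed.

Lemma segment_end_extreme p q : extreme (open_segment p q) p.
Proof.
rewrite /extreme reachable_segment; split.
  exists 0; first by rewrite /= in_itv/= lexx ler01.
  by rewrite /seg_point !mul0r !addr0 -surjective_pairing.
move=> _ _ [t /= + <-] [t' /= + <-]; rewrite !in_itv/= => /andP[t0 _] /andP[t'0 _] e1 e2.
have [tt0|tt0] := eqVneq (t + t') 0.
  have -> : t = 0 by lra.
  by rewrite /seg_point !mul0r !addr0 -surjective_pairing.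
have e3 : q.1 - p.1 = 0 by apply: (mulfI tt0); rewrite mulr0; move: e1; rewrite /seg_point/=; lra.
have e4 : q.2 - p.2 = 0 by apply: (mulfI tt0); rewrite mulr0; move: e2; rewrite /seg_point/=; lra.
by rewrite /seg_point e3 e4 !mulr0 !addr0 -surjective_pairing.
Qed.

Lemma extreme_segment_end p q x : extreme (open_segment p q) x -> x = p \/ x = q.
Proof.
rewrite /extreme reachable_segment => -[[t /= + xE] ext]; rewrite in_itv/= => /andP[t0 t1].
have [t_eq0|tn0] := eqVneq t 0.
  by left; rewrite -xE t_eq0 /seg_point !mul0r !addr0 -surjective_pairing.
have [t_eq1|tn1] := eqVneq t 1.
  right; rewrite -xE t_eq1 /seg_point !mul1r; apply: plane_eqP => /=; lra.
have tp : 0 < t by rewrite lt_neqAle eq_sym tn0.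
have tl : t < 1 by rewrite lt_neqAle tn1.
pose d := Num.min t (1 - t); have d0 : 0 < d by rewrite lt_min tp; lra.
have dt : d <= t by rewrite ge_min lexx.
have dt' : d <= 1 - t by rewrite ge_min lexx orbT.
have S1 : closed_segment p q (seg_point p q (t + d)).
  by exists (t + d) => //; rewrite /= in_itv/=; apply/andP; split; lra.
have S2 : closed_segment p q (seg_point p q (t - d)).
  by exists (t - d) => //; rewrite /= in_itv/=; apply/andP; split; lra.
have e1 : x.1 + x.1 = (seg_point p q (t + d)).1 + (seg_point p q (t - d)).1.
  by rewrite -xE /seg_point/=; ring.
have e2 : x.2 + x.2 = (seg_point p q (t + d)).2 + (seg_point p q (t - d)).2.
  by rewrite -xE /seg_point/=; ring.
have := ext _ _ S1 S2 e1 e2; rewrite -xE /seg_point => -[e3 e4].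
have e5 : q.1 - p.1 = 0 by apply: (mulfI (lt0r_neq0 d0)); lra.
have e6 : q.2 - p.2 = 0 by apply: (mulfI (lt0r_neq0 d0)); lra.
by left; rewrite e5 e6 !mulr0 !addr0 -surjective_pairing.
Qed.

Lemma open_segment_inj a b p q : a <> b -> open_segment a b = open_segment p q ->
  (p = a /\ q = b) \/ (p = b /\ q = a).
Proof.
move=> ab E; have ea := segment_end_extreme a b; have eb := segment_end_extreme b a.
rewrite open_segment_rev in eb; rewrite E in ea eb.
case: (extreme_segment_end ea) => ha; case: (extreme_segment_end eb) => hb.
- by exfalso; apply: ab; rewrite ha hb.
- by left.
- by right.
- by exfalso; apply: ab; rewrite ha hb.
Qed.

Lemma edge_ends_segment a b : a <> b ->
  edge_ends (open_segment a b) = (a, b) \/ edge_ends (open_segment a b) = (b, a).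
Proof.
move=> ab; rewrite /edge_ends; set P := [set ab | _].
have : P (get P) by apply: (getPex (ex_intro P (a, b) erefl)).
rewrite /P; case: (get _) => u v /= E.
by have [[e1 e2]|[e1 e2]] := open_segment_inj ab E; [left|right]; rewrite e1 e2.
Qed.

Lemma is_edge_ends tau e : is_edge tau e -> exists c,
  let p := (edge_ends e).1 in let q := (edge_ends e).2 in
  [/\ noncollinear p q c, tau = open_triangle p q c & e = open_segment p q].
Proof.
move=> [a [b [c [d0 -> ->]]]]; exists c; have [ab _ _] := noncollinear_neq d0.
have [->|->] /= := edge_ends_segment ab; split => //.
- exact: noncollinear_swap.
- exact: open_triangle_swap.
- exact: open_segment_rev.
Qed.

(** A point slightly above the midpoint of the common edge, at the small height [e] towards c, lies
    in both triangles. [A] and [B] are barycentric coordinates of c in the second triangle, and [e]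
    is small enough to keep (1 - e)/2 + e A and (1 - e)/2 + e B positive. Consequently disjoint
    elements sharing an edge lie on opposite sides of it. *)
Lemma same_side_meet p q c c' : noncollinear p q c -> noncollinear p q c' ->
  0 < orient p q c * orient p q c' ->
  exists x, open_triangle p q c x /\ open_triangle p q c' x.
Proof.
move=> d0 d1 s0; have d0' : orient p q c != 0 by []; have d1' : orient p q c' != 0 by [].
pose A := orient c q c' / orient p q c'; pose B := orient p c c' / orient p q c'.
pose e := (2 * (`|A| + `|B| + 2))^-1.
have den : 0 < 2 * (`|A| + `|B| + 2) by have := normr_ge0 A; have := normr_ge0 B; lra.
have e0 : 0 < e by rewrite invr_gt0.
have eden : e * (2 * (`|A| + `|B| + 2)) = 1 by rewrite mulVf ?gt_eqF.
have eA : 0 <= e * (`|A| + A) by apply: mulr_ge0 (ltW e0) _; have := ler_norm (- A); rewrite normrN; lra.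
have eB : 0 <= e * (`|B| + B) by apply: mulr_ge0 (ltW e0) _; have := ler_norm (- B); rewrite normrN; lra.
have eA' : 0 <= e * `|A| by apply: mulr_ge0 (ltW e0) _.
have eB' : 0 <= e * `|B| by apply: mulr_ge0 (ltW e0) _.
exists ((1 - e) / 2 * p.1 + (1 - e) / 2 * q.1 + e * c.1, (1 - e) / 2 * p.2 + (1 - e) / 2 * q.2 + e * c.2).
split; first by exists ((1 - e) / 2), ((1 - e) / 2), e; split => //; lra.
apply/in_open_triangle => //.
have -> : orient ((1 - e) / 2 * p.1 + (1 - e) / 2 * q.1 + e * c.1, (1 - e) / 2 * p.2 + (1 - e) / 2 * q.2 + e * c.2) q c' / orient p q c'
    = (1 - e) / 2 + e * A.
  rewrite /A; transitivity (((1 - e) / 2 * orient p q c' + e * orient c q c') / orient p q c').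
    by congr (_ / _); rewrite /orient/=; field.
  by rewrite mulrDl mulfK// mulrA.
have -> : orient p ((1 - e) / 2 * p.1 + (1 - e) / 2 * q.1 + e * c.1, (1 - e) / 2 * p.2 + (1 - e) / 2 * q.2 + e * c.2) c' / orient p q c'
    = (1 - e) / 2 + e * B.
  rewrite /B; transitivity (((1 - e) / 2 * orient p q c' + e * orient p c c') / orient p q c').
    by congr (_ / _); rewrite /orient/=; field.
  by rewrite mulrDl mulfK// mulrA.
have -> : orient p q ((1 - e) / 2 * p.1 + (1 - e) / 2 * q.1 + e * c.1, (1 - e) / 2 * p.2 + (1 - e) / 2 * q.2 + e * c.2) / orient p q c'
    = e * (orient p q c * orient p q c' / orient p q c' ^+ 2).
  have -> : orient p q c * orient p q c' / orient p q c' ^+ 2 = orient p q c / orient p q c'.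
    by rewrite expr2 invfM mulrA mulfK.
  rewrite mulrA; congr (_ / _).
  by rewrite /orient/=; field.
split; try lra.
by rewrite mulr_gt0// divr_gt0// lt_neqAle eq_sym sqrf_eq0 d1' sqr_ge0.
Qed.

(* [all_analysis] exports another [edist]. *)
Local Notation edist := Defs.edist.

Lemma edist_sqr x y : edist x y ^+ 2 = (x.1 - y.1) ^+ 2 + (x.2 - y.2) ^+ 2.
Proof. by rewrite /edist sqr_sqrtr// addr_ge0 ?sqr_ge0. Qed.

Lemma edist_ge0 x y : 0 <= edist x y.
Proof. exact: sqrtr_ge0. Qed.

Lemma edist_coord x y : `|x.1 - y.1| <= edist x y /\ `|x.2 - y.2| <= edist x y.
Proof.
split; rewrite -(@ler_pXn2r _ 2) ?nnegrE ?edist_ge0// edist_sqr real_normK ?num_real//.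
  by rewrite lerDl sqr_ge0.
by rewrite lerDr sqr_ge0.
Qed.

Lemma edist_gt0 x y : x <> y -> 0 < edist x y.
Proof.
move=> xy; rewrite /edist sqrtr_gt0 lt_neqAle eq_sym addr_ge0 ?sqr_ge0// andbT.
apply/negP; rewrite paddr_eq0 ?sqr_ge0// !sqrf_eq0 !subr_eq0 => /andP[/eqP e1 /eqP e2].
by apply: xy; exact: plane_eqP.
Qed.

(** The height over pq is |orient p q c| / |pq|. A disc of larger radius would contain its centre z
    and the point [w] obtained by moving z by that height along the normal; the third barycentric
    coordinates of the two differ by 1, yet both would lie in ]0, 1[. *)
Lemma disc_in_triangle p q c (z : plane R) (r : R) : noncollinear p q c -> 0 <= r ->
  [set x | edist z x < r] `<=` open_triangle p q c -> r * edist p q <= `|orient p q c|.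
Proof.
move=> d0 r0 sub; have d0' : orient p q c != 0 by [].
have [pq _ _] := noncollinear_neq d0; have L0 := edist_gt0 pq.
set L := edist p q in L0 *.
have LE : L ^+ 2 = (p.1 - q.1) ^+ 2 + (p.2 - q.2) ^+ 2 by exact: edist_sqr.
rewrite leNgt; apply/negP => h.
pose s := `|orient p q c| / L.
have s0 : 0 <= s by rewrite divr_ge0// ltW.
have sr : s < r by rewrite ltr_pdivrMr.
have zT : open_triangle p q c z.
  apply: sub; rewrite /= /edist !subrr expr0n/= addr0 sqrtr0.
  by apply: le_lt_trans sr.
pose sg := Num.sg (orient p q c).
pose w : plane R := (z.1 - sg * (s / L) * (q.2 - p.2), z.2 + sg * (s / L) * (q.1 - p.1)).
have sg2 : sg * sg = 1 by rewrite -expr2 sqr_sg d0'.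
have wT : open_triangle p q c w.
  apply: sub; rewrite /= -(@ltr_pXn2r _ 2) ?nnegrE ?edist_ge0// edist_sqr /w/=.
  have -> : (z.1 - (z.1 - sg * (s / L) * (q.2 - p.2))) ^+ 2 + (z.2 - (z.2 + sg * (s / L) * (q.1 - p.1))) ^+ 2
     = (sg * sg) * (s / L) ^+ 2 * ((p.1 - q.1) ^+ 2 + (p.2 - q.2) ^+ 2) by ring.
  by rewrite -LE sg2 mul1r -exprMn divfK ?gt_eqF// ltr_pXn2r ?nnegrE.
move/(in_open_triangle _ d0) : zT => [_ _ z3]; move/(in_open_triangle _ d0) : wT => [w1 w2 w3].
have wsum : orient w q c / orient p q c + orient p w c / orient p q c + orient p q w / orient p q c = 1.
  by rewrite -!mulrDl orient_sum mulfV.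
have : orient p q w / orient p q c = orient p q z / orient p q c + 1.
  have -> : orient p q w = orient p q z + sg * (s / L) * L ^+ 2 by rewrite LE /w /orient/=; ring.
  have e1 : s / L * L ^+ 2 = `|orient p q c| by rewrite expr2 mulrA !divfK ?gt_eqF.
  by rewrite -mulrA e1 /sg mulr_sg_norm mulrDl mulfV.
lra.
Qed.

(** The vertices are not in the open triangle, so two interior points are used whose difference is
    (p - q)/2; they are at distance at most 2 r. *)
Lemma triangle_in_disc p q c (z : plane R) (r : R) : 0 <= r ->
  open_triangle p q c `<=` [set x | edist z x <= r] -> edist p q <= 4 * r.
Proof.
move=> r0 sub.
pose x : plane R := (2 / 3 * p.1 + 6^-1 * q.1 + 6^-1 * c.1, 2 / 3 * p.2 + 6^-1 * q.2 + 6^-1 * c.2).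
pose y : plane R := (6^-1 * p.1 + 2 / 3 * q.1 + 6^-1 * c.1, 6^-1 * p.2 + 2 / 3 * q.2 + 6^-1 * c.2).
have /= hx : edist z x <= r by apply: sub; exists (2 / 3), 6^-1, 6^-1; split => //; lra.
have /= hy : edist z y <= r by apply: sub; exists 6^-1, (2 / 3), 6^-1; split => //; lra.
have {}hx : edist z x ^+ 2 <= r ^+ 2 by rewrite ler_pXn2r ?nnegrE ?edist_ge0.
have {}hy : edist z y ^+ 2 <= r ^+ 2 by rewrite ler_pXn2r ?nnegrE ?edist_ge0.
rewrite -(@ler_pXn2r _ 2) ?nnegrE ?edist_ge0 ?mulr_ge0//.
move: hx hy; rewrite !edist_sqr.
have k1 := sqrrD_le (z.1 - y.1) (x.1 - z.1); have k2 := sqrrD_le (z.2 - y.2) (x.2 - z.2).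
have -> : (p.1 - q.1) ^+ 2 + (p.2 - q.2) ^+ 2 = 4 * ((z.1 - y.1 + (x.1 - z.1)) ^+ 2 + (z.2 - y.2 + (x.2 - z.2)) ^+ 2).
  by rewrite /x /y/=; field.
move: k1 k2; move: (x) (y) => x' y' k1 k2 hx hy; lra.
Qed.

(** The form in which shape regularity is used: circumradius at least |pq| / 4 and inradius at most
    |orient p q c| / |pq|, hence a squared edge length bounded by the area. *)
Lemma shape_regular_edge p q c (K : R) : noncollinear p q c ->
  triangle_regularity (open_triangle p q c) <= K ->
  edist p q ^+ 2 <= 4 * K * `|orient p q c|.
Proof.
move=> d0; rewrite /triangle_regularity.
have [pq _ _] := noncollinear_neq d0; have L0 := edist_gt0 pq.
set A := inscribed_radius _; set B := circumscribed_radius _.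
have A_ub : A <= `|orient p q c| / edist p q.
  apply: ge_sup.
    by exists 0; split => //; exists p => x /=; rewrite ltNge edist_ge0.
  by move=> r [r0 [z hz]]; rewrite ler_pdivlMr//; exact: disc_in_triangle hz.
have A0 : 0 < A.
  have [x Tx] := open_triangle_nonempty p q c.
  have := open_triangle_open d0; rewrite openE => /(_ _ Tx) /nbhs_ballP[r /= r0 hr].
  apply: (lt_le_trans r0); apply: ub_le_sup.
    exists (`|orient p q c| / edist p q) => s [s0 [z hz]].
    by rewrite ler_pdivlMr//; exact: disc_in_triangle hz.
  split; first exact: ltW.
  exists x => y /= hy; apply: hr; have [h1 h2] := edist_coord x y.
  by split; rewrite /ball/=; apply: le_lt_trans hy.
have B_lb : edist p q / 4 <= B.
  apply: lb_le_inf.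
    pose M := `|p.1| + `|q.1| + `|c.1| + `|p.2| + `|q.2| + `|c.2|.
    have M0 : 0 <= M by rewrite !addr_ge0.
    exists (2 * M); split; first by rewrite mulr_ge0.
    exists (0, 0) => x /open_triangle_bounded[h1 h2] /=.
    rewrite -(@ler_pXn2r _ 2) ?nnegrE ?edist_ge0 ?mulr_ge0// edist_sqr/= !sub0r !sqrrN.
    have k (u : R) : `|u| <= M -> u ^+ 2 <= M ^+ 2.
      by move=> hu; rewrite -real_normK ?num_real// ler_pXn2r ?nnegrE.
    by have := k _ h1; have := k _ h2; have := sqr_ge0 M; lra.
  by move=> r [r0 [z hz]]; rewrite ler_pdivrMr// mulrC; exact: triangle_in_disc hz.
rewrite ler_pdivrMr// => BK.
have K0 : 0 <= K by rewrite -(pmulr_lge0 _ A0); apply: le_trans BK; apply: le_trans B_lb; rewrite divr_ge0// ltW.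
have := le_trans B_lb (le_trans BK (ler_wpM2l K0 A_ub)).
rewrite mulrA ler_pdivlMr// -(@ler_pM2l _ 4)//.
by rewrite (_ : 4 * (_ / 4 * _) = edist p q ^+ 2); [rewrite mulrA|field].
Qed.

End Geometry.

(** * Weak gradients and traces on one element *)

Section Elements.
Context (R : realType).
Implicit Types (f fx fy phi : plane R -> R) (u h k : mplane R -> R) (x a b c p q : plane R) (tau e : set (plane R)).

Lemma weak_gradientR tau u g phi : weak_gradient tau u g -> C1c tau phi ->
  \int[leb2 R]_(x in tau) (u x * dx phi x) = - (\int[leb2 R]_(x in tau) ((g x).1 * phi x)) /\
  \int[leb2 R]_(x in tau) (u x * dy phi x) = - (\int[leb2 R]_(x in tau) ((g x).2 * phi x)).
Proof.
move=> [_ _ H] /H[E1 E2]; rewrite /Rintegral.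
by rewrite E1 E2 !fineN.
Qed.

Lemma seg_point_notin a b c (t : R) : noncollinear a b c -> ~ open_triangle a b c (seg_point a b t).
Proof.
move=> d0 /(in_open_triangle _ d0)[_ _].
by rewrite (_ : orient a b _ = 0) ?mul0r ?ltxx// /orient /seg_point/=; ring.
Qed.

Lemma edge_integral_eq0 p q f : (forall t, t \in `]0, 1[ -> f (seg_point p q t) = 0) ->
  edge_integral p q f = 0.
Proof.
move=> h; rewrite /edge_integral /Rintegral.
under eq_integral => t /set_mem/= t01 do rewrite h//.
by rewrite integral0.
Qed.

(** Green's formula for the product of [f] and [phi]; the edge terms vanish because [phi] is
    supported in the open triangle. *)
Lemma C1_weak_gradient a b c f fx fy phi : noncollinear a b c -> has_partials f fx fy ->
  C1c (open_triangle a b c) phi ->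
  \int[leb2 R]_(x in open_triangle a b c) (f x * dx phi x) =
    - (\int[leb2 R]_(x in open_triangle a b c) (fx x * phi x)) /\
  \int[leb2 R]_(x in open_triangle a b c) (f x * dy phi x) =
    - (\int[leb2 R]_(x in open_triangle a b c) (fy x * phi x)).
Proof.
move=> d0 hf [cphi [K [_ KT K0]]]; have hphi := C1_has_partials cphi.
have mT := open_triangle_measurable d0.
have [cf cfx cfy _ _] := hf; have [cp cpx cpy _ _] := hphi.
have phi0 x : ~ open_triangle a b c x -> phi x = 0 by move=> nT; apply: K0 => /KT.
have e0 p q : (forall t : R, ~ open_triangle a b c (seg_point p q t)) ->
    edge_integral p q (fun x => f x * phi x) = 0.
  by move=> h; apply: edge_integral_eq0 => t _; rewrite phi0 ?mulr0.
have cM (g k : plane R -> R) : continuous g -> continuous k -> continuous (fun x : plane R => g x * k x : R).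
  by move=> cg ck x; apply: cvgM; [exact: cg|exact: ck].
have iM (g k : plane R -> R) : continuous g -> continuous k -> (leb2 R).-integrable (open_triangle a b c)
    (EFin \o (fun x => g x * k x)).
  by move=> cg ck; apply: triangle_integrable => //; exact: cM.
have aux (A B : R) : A + B = 0 -> B = - A by lra.
have [E1 E2] := divergence_theorem d0 (has_partialsM hf hphi).
have n1 (t : R) := @seg_point_notin a b c t d0.
have n2 (t : R) : ~ open_triangle a b c (seg_point b c t).
  by rewrite open_triangle_rot; apply: seg_point_notin; exact: noncollinear_rot.
have n3 (t : R) : ~ open_triangle a b c (seg_point c a t).
  by rewrite 2!open_triangle_rot; apply: seg_point_notin; do 2 apply: noncollinear_rot.
move: E1 E2; rewrite (e0 _ _ n1) (e0 _ _ n2) (e0 _ _ n3) !mulr0 !addr0 !mulr0 oppr0.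
rewrite !RintegralD//; try exact: iM.
by move=> h1 h2; split; [exact: aux h1|exact: aux h2].
Qed.

Lemma weak_partial_unique a b c h k : noncollinear a b c ->
  sqint (leb2 R) (open_triangle a b c) h -> sqint (leb2 R) (open_triangle a b c) k ->
  (forall phi, C1c (open_triangle a b c) phi ->
    \int[leb2 R]_(x in open_triangle a b c) (h x * phi x) =
    \int[leb2 R]_(x in open_triangle a b c) (k x * phi x)) ->
  \int[leb2 R]_(x in open_triangle a b c) (h x - k x) ^+ 2 = 0.
Proof.
move=> d0 sh sk E; have mT := open_triangle_measurable d0.
have shk := sqintB mT sh sk.
have ae0 : ae_eq (leb2 R) (open_triangle a b c) (EFin \o (fun x => h x - k x)) (cst 0%E).
  apply: fundamental_lemma => // phi cphi.
  have [[cp _ _ _ _] _] := cphi.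
  have sp : sqint (leb2 R) (open_triangle a b c) phi.
    apply: sqintP => //; first by apply: measurable_funTS; exact: continuous_plane_measurable.
    by apply: triangle_integrable => // x; apply: cvgM; exact: cp.
  under eq_Rintegral do rewrite mulrBl.
  rewrite RintegralB//; try exact: sqintM.
  by rewrite E// subrr.
rewrite /Rintegral (_ : (\int[leb2 R]_(x in _) _)%E = 0%E)//.
have [mhk _] := shk.
rewrite (ae_eq_integral (cst 0%E)) ?integral0//.
  by apply/measurable_EFinP; apply: measurable_funX.
by apply: filterS ae0 => x /= H Tx; have [->] := H Tx; rewrite expr0n.
Qed.

End Elements.

Section Traces.
Context (R : realType).
Implicit Types (phi : plane R -> R) (u h k : mplane R -> R) (x a b c p q : plane R) (tau e : set (plane R)).

Lemma cvg0_le_ereal (r : nat -> R) (h : nat -> \bar R) : (forall n, 0 <= r n) ->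
  (forall n, ((r n)%:E <= 2%:E * h n)%E) -> h n @[n --> \oo] --> 0%E -> r n @[n --> \oo] --> (0 : R).
Proof.
move=> r0 rh h0.
have c : (2%:E * h n)%E @[n --> \oo] --> 0%E by rewrite -(mule0 2%:E); apply: cvgeZl.
have : (r n)%:E @[n --> \oo] --> 0%E.
  apply: (squeeze_cvge (f := fun=> 0%E) (h := fun n => (2%:E * h n)%E)) => //; last exact: cvg_cst.
  by apply: nearW => n; rewrite lee_fin r0/=.
by move/fine_cvg.
Qed.

Lemma continuous_sqint a b c phi : noncollinear a b c -> continuous phi ->
  sqint (leb2 R) (open_triangle a b c) phi.
Proof.
move=> d0 cp; apply: sqintP.
  by apply: measurable_funTS; exact: continuous_plane_measurable.
by apply: triangle_integrable => // x; apply: cvgM; exact: cp.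
Qed.

(** [H1_sq] hides the gradient in an infimum. Here the weak gradient [g] is fixed in advance, so
    that the gradient taken from the broken norm can be the one appearing in Green's formula. *)
Definition h1_cvg tau (f : nat -> plane R -> R) u (g : plane R -> plane R) :=
  [/\ forall n, C1 (f n),
      \int[leb2 R]_(x in tau) (f n x - u x) ^+ 2 @[n --> \oo] --> (0 : R),
      \int[leb2 R]_(x in tau) (dx (f n) x - (g x).1) ^+ 2 @[n --> \oo] --> (0 : R) &
      \int[leb2 R]_(x in tau) (dy (f n) x - (g x).2) ^+ 2 @[n --> \oo] --> (0 : R)].

(** Every competitor in the infimum is a weak gradient of phi - u, hence equals grad phi - g by
    uniqueness on the triangle. Convergence of [H1_sq] to 0 thus forces L2 convergence of both
    partials to those of the given [g]. *)
Lemma gradient_L2_sq_ge a b c u g phi : noncollinear a b c ->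
  sqint (leb2 R) (open_triangle a b c) u -> weak_gradient (open_triangle a b c) u g -> C1 phi ->
  let G := gradient_L2_sq (open_triangle a b c) (fun x => phi x - u x) in
  [/\ (0 <= G)%E,
   ((\int[leb2 R]_(x in open_triangle a b c) (dx phi x - (g x).1) ^+ 2)%R%:E <= 2%:E * G)%E &
   ((\int[leb2 R]_(x in open_triangle a b c) (dy phi x - (g x).2) ^+ 2)%R%:E <= 2%:E * G)%E].
Proof.
move=> d0 su wg cphi G; have mT := open_triangle_measurable d0.
have hphi := C1_has_partials cphi; have [cp cpx cpy _ _] := hphi.
have sp := continuous_sqint d0 cp.
have [sg1 sg2 _] := wg.
have spx : sqint (leb2 R) (open_triangle a b c) (fun x => dx phi x - (g x).1).
  by apply: sqintB => //; exact: continuous_sqint.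
have spy : sqint (leb2 R) (open_triangle a b c) (fun x => dy phi x - (g x).2).
  by apply: sqintB => //; exact: continuous_sqint.
have half (r : R) (z : \bar R) : ((r / 2)%:E <= z -> r%:E <= 2%:E * z)%E.
  by move=> H; rewrite -(divfK (_ : (2 : R) != 0) r)// mulrC EFinM; apply: lee_wpmul2l.
(* Two functions with the same pairings are at L2 distance 0. The factor 2 is the price of
   concluding by (a + b)^2 <= 2 a^2 + 2 b^2 and not by almost everywhere equality. *)
have key k h : sqint (leb2 R) (open_triangle a b c) h -> sqint (leb2 R) (open_triangle a b c) k ->
    (forall psi, C1c (open_triangle a b c) psi ->
      \int[leb2 R]_(x in open_triangle a b c) (h x * psi x) =
      \int[leb2 R]_(x in open_triangle a b c) (k x * psi x)) ->
    \int[leb2 R]_(x in open_triangle a b c) (h x) ^+ 2 / 2 <= \int[leb2 R]_(x in open_triangle a b c) (k x) ^+ 2.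
  move=> sh sk E; have := le_sqint_add mT (sqintB mT sh sk) sk.
  rewrite (weak_partial_unique d0 sh sk E).
  under eq_Rintegral do rewrite subrK.
  by rewrite mulr0 add0r ler_pdivrMr// mulrC.
have test k l j psi m : sqint (leb2 R) (open_triangle a b c) psi ->
    sqint (leb2 R) (open_triangle a b c) m ->
    sqint (leb2 R) (open_triangle a b c) k -> sqint (leb2 R) (open_triangle a b c) l ->
    sqint (leb2 R) (open_triangle a b c) j ->
    \int[leb2 R]_(x in open_triangle a b c) (phi x * psi x) = - (\int[leb2 R]_(x in open_triangle a b c) (k x * m x)) ->
    \int[leb2 R]_(x in open_triangle a b c) (u x * psi x) = - (\int[leb2 R]_(x in open_triangle a b c) (l x * m x)) ->
    \int[leb2 R]_(x in open_triangle a b c) ((phi x - u x) * psi x) = - (\int[leb2 R]_(x in open_triangle a b c) (j x * m x)) ->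
    \int[leb2 R]_(x in open_triangle a b c) ((k x - l x) * m x) = \int[leb2 R]_(x in open_triangle a b c) (j x * m x).
  move=> spsi sm sk sl sj e1 e2.
  under eq_Rintegral do rewrite mulrBl.
  rewrite RintegralB//; [|exact: sqintM|exact: sqintM].
  under [in X in _ -> X]eq_Rintegral do rewrite mulrBl.
  rewrite RintegralB//; [|exact: sqintM|exact: sqintM].
  rewrite e1 e2 => e3; apply: oppr_inj; rewrite -e3; ring.
split.
- by apply: le_ereal_inf_tmp => _ [g' _ ->]; apply: integral_ge0 => x _; rewrite lee_fin addr_ge0 ?sqr_ge0.
- apply: half; apply: le_ereal_inf_tmp => _ [g' wg' ->].
  have [sg1' sg2' _] := wg'.
  have H : \int[leb2 R]_(x in open_triangle a b c) (dx phi x - (g x).1) ^+ 2 / 2 <=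
      \int[leb2 R]_(x in open_triangle a b c) ((g' x).1) ^+ 2.
    apply: key => // psi cpsi.
    have [[c1 _ _ c2 c3] _] := cpsi.
    have [e1 _] := C1_weak_gradient d0 hphi cpsi.
    have [e2 _] := weak_gradientR wg cpsi.
    have [e3 _] := weak_gradientR wg' cpsi.
    by apply: (test _ _ _ _ _ _ _ _ _ _ e1 e2 e3) => //; exact: continuous_sqint.
  apply: (le_trans (_ : _ <= (\int[leb2 R]_(x in open_triangle a b c) ((g' x).1) ^+ 2)%R%:E)%E); first by rewrite lee_fin.
  rewrite EFin_sqint//; apply: ge0_le_integral => //.
  + by move=> x _; rewrite lee_fin sqr_ge0.
  + by apply/measurable_EFinP; apply: measurable_funX; case: sg1'.
  + by apply/measurable_EFinP; apply: measurable_funD; apply: measurable_funX; [case: sg1'|case: sg2'].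
  + by move=> x _; rewrite lee_fin lerDl sqr_ge0.
- apply: half; apply: le_ereal_inf_tmp => _ [g' wg' ->].
  have [sg1' sg2' _] := wg'.
  have H : \int[leb2 R]_(x in open_triangle a b c) (dy phi x - (g x).2) ^+ 2 / 2 <=
      \int[leb2 R]_(x in open_triangle a b c) ((g' x).2) ^+ 2.
    apply: key => // psi cpsi.
    have [[c1 _ _ c2 c3] _] := cpsi.
    have [_ e1] := C1_weak_gradient d0 hphi cpsi.
    have [_ e2] := weak_gradientR wg cpsi.
    have [_ e3] := weak_gradientR wg' cpsi.
    by apply: (test _ _ _ _ _ _ _ _ _ _ e1 e2 e3) => //; exact: continuous_sqint.
  apply: (le_trans (_ : _ <= (\int[leb2 R]_(x in open_triangle a b c) ((g' x).2) ^+ 2)%R%:E)%E); first by rewrite lee_fin.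
  rewrite EFin_sqint//; apply: ge0_le_integral => //.
  + by move=> x _; rewrite lee_fin sqr_ge0.
  + by apply/measurable_EFinP; apply: measurable_funX; case: sg2'.
  + by apply/measurable_EFinP; apply: measurable_funD; apply: measurable_funX; [case: sg1'|case: sg2'].
  + by move=> x _; rewrite lee_fin lerDr sqr_ge0.
Qed.

Lemma h1_cvg_approximants a b c u g (f : nat -> plane R -> R) : noncollinear a b c ->
  sqint (leb2 R) (open_triangle a b c) u -> weak_gradient (open_triangle a b c) u g ->
  (forall n, C1 (f n)) ->
  H1_sq (open_triangle a b c) (fun x => f n x - u x) @[n --> \oo] --> 0%E ->
  h1_cvg (open_triangle a b c) f u g.
Proof.
move=> d0 su wg cf H; have mT := open_triangle_measurable d0.
have G n := gradient_L2_sq_ge d0 su wg (cf n).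
have L0 n : (0 <= L2_sq (open_triangle a b c) (fun x => (f n x - u x)%R))%E.
  by apply: integral_ge0 => x _; rewrite lee_fin sqr_ge0.
split => //; apply: (cvg0_le_ereal _ _ H) => n; try exact: Rintegral_sqr_ge0.
- have [G0 _ _] := G n.
  have sfu : sqint (leb2 R) (open_triangle a b c) (fun x => f n x - u x).
    by apply: sqintB => //; apply: continuous_sqint => //; case: (cf n).
  rewrite EFin_sqint// -[leLHS]mul1e; apply: lee_pmul => //.
    by apply: integral_ge0 => x _; rewrite lee_fin sqr_ge0.
    by rewrite lee_fin ler1n.
  by rewrite /H1_sq; apply: leeDl.
- have [G0 G1 _] := G n; apply: (le_trans G1); apply: lee_wpmul2l => //.
  by rewrite /H1_sq; apply: leeDr.
- have [G0 _ G1] := G n; apply: (le_trans G1); apply: lee_wpmul2l => //.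
  by rewrite /H1_sq; apply: leeDr.
Qed.

End Traces.

Section SquareDistance.
Context d (X : measurableType d) (R : realType).
Variables (mu : {measure set X -> \bar R}) (D : set X).
Hypothesis mD : measurable D.

Lemma sqint_dist_sym (f g : X -> R) :
  \int[mu]_(x in D) (f x - g x) ^+ 2 = \int[mu]_(x in D) (g x - f x) ^+ 2.
Proof. by under eq_Rintegral do rewrite -sqrrN opprB. Qed.

Lemma cvg_sqint_dist (F G H : nat -> X -> R) :
  (forall n, sqint mu D (F n)) -> (forall n, sqint mu D (G n)) -> (forall n, sqint mu D (H n)) ->
  \int[mu]_(x in D) (F n x - H n x) ^+ 2 @[n --> \oo] --> (0 : R) ->
  \int[mu]_(x in D) (H n x - G n x) ^+ 2 @[n --> \oo] --> (0 : R) ->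
  \int[mu]_(x in D) (F n x - G n x) ^+ 2 @[n --> \oo] --> (0 : R).
Proof.
move=> sF sG sH c1 c2.
apply: (@squeeze_cvgr _ _ _ _ (fun=> 0) (fun n => 2 * \int[mu]_(x in D) (F n x - H n x) ^+ 2
    + 2 * \int[mu]_(x in D) (H n x - G n x) ^+ 2)).
- apply: nearW => n; rewrite Rintegral_sqr_ge0/=.
  have := le_sqint_add mD (sqintB mD (sF n) (sH n)) (sqintB mD (sH n) (sG n)).
  by under eq_Rintegral do rewrite subrKA.
- exact: cvg_cst.
- rewrite -[X in _ --> X](_ : 2 * 0 + 2 * 0 = 0 :> R); last by rewrite !mulr0 addr0.
  by apply: cvgD; apply: cvgMr.
Qed.

End SquareDistance.

(** * Green's formula for H1 functions on one element *)

Section ElementIdentity.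
Context (R : realType).
Local Notation mu := (@lebesgue_measure R).
Local Notation I01 := (`]0%R, 1%R[%classic : set (measurableTypeR R)).
Implicit Types (f phi : plane R -> R) (u h k : mplane R -> R) (x a b c p q : plane R) (tau e : set (plane R)).

Lemma edge_length_gt0 tau e : is_edge tau e -> 0 < edge_length e.
Proof. by move=> /is_edge_ends[c [d0 _ _]]; apply: edist_gt0; have [] := noncollinear_neq d0. Qed.

Lemma edge_L2_sqE tau e (h : plane R -> R) : is_edge tau e -> in_edge_L2 e h ->
  sqint mu I01 (h \o edge_point e) /\
  edge_L2_sq e h = (edge_length e * \int[mu]_(t in I01) (h (edge_point e t)) ^+ 2)%R%:E.
Proof.
move=> /edge_length_gt0 L0 [mh fh].
have sh : sqint mu I01 (h \o edge_point e).
  split => //; apply: (lty_pmule L0) fh.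
  by apply: integral_ge0 => t _; rewrite lee_fin sqr_ge0.
by split => //; rewrite EFinM EFin_sqint.
Qed.

Lemma continuous_edge_sqint e phi : continuous phi -> sqint mu I01 (phi \o edge_point e).
Proof.
move=> cp; apply: sqintP; first exact: (integrable_measurable (edge_integrable _ _ cp)).
by apply: (@edge_integrable R _ _ (fun x => phi x ^+ 2)) => x; apply: cvgM; exact: cp.
Qed.

(** The trace inequality for the square of [f]. The constant may depend on the element: it only
    serves to transfer convergence from the element to its edge. *)
Lemma trace_bound tau e : is_edge tau e -> exists A, forall f, C1 f ->
  \int[mu]_(t in I01) (f (edge_point e t)) ^+ 2 <=
  A * (\int[leb2 R]_(x in tau) (f x) ^+ 2 + \int[leb2 R]_(x in tau) (dx f x) ^+ 2 +
     \int[leb2 R]_(x in tau) (dy f x) ^+ 2).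
Proof.
move=> /is_edge_ends[c [d0 -> _]]; rewrite /edge_point.
set p := (edge_ends e).1 in d0 *; set q := (edge_ends e).2 in d0 *.
have d1 : noncollinear c p q by do 2 apply: noncollinear_rot.
rewrite -open_triangle_rot.
pose M := `|c.1| + `|p.1| + `|q.1| + `|c.2| + `|p.2| + `|q.2|.
have M0 : 0 <= M by rewrite !addr_ge0.
have HM x : open_triangle c p q x -> `|x.1 - c.1| <= 2 * M /\ `|x.2 - c.2| <= 2 * M.
  move=> /open_triangle_bounded; rewrite -/M => -[h1 h2].
  have [k1 k2] : `|c.1| <= M /\ `|c.2| <= M.
    have := normr_ge0 c.1; have := normr_ge0 c.2; have := normr_ge0 p.1; have := normr_ge0 p.2.
    by have := normr_ge0 q.1; have := normr_ge0 q.2; rewrite /M; split; lra.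
  have := ler_normB x.1 c.1; have := ler_normB x.2 c.2; split; lra.
have D0 : 0 < `|orient c p q| by rewrite normr_gt0.
exists ((2 + 4 * M) / `|orient c p q|) => f cf; have hf := C1_has_partials cf.
have [cf0 cfx cfy _ _] := hf.
have mT := open_triangle_measurable d1.
have := trace_inequality d1 (has_partialsM hf hf) (fun x => _ : 0 <= f x * f x) HM.
rewrite -(_ : edge_integral p q (fun x => f x * f x) = \int[mu]_(t in I01) (f (seg_point p q t)) ^+ 2)//.
move=> /(_ (fun x => sqr_ge0 (f x))) tr.
rewrite [leRHS]mulrAC ler_pdivlMr// mulrC; apply: (le_trans tr).
have s0 := continuous_sqint d1 cf0; have s1 := continuous_sqint d1 cfx; have s2 := continuous_sqint d1 cfy.
have i0 := sqint_integrable s0; have i1 := sqint_integrable s1; have i2 := sqint_integrable s2.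
have i01 := integrableRD mT i0 i1; have i012 := integrableRD mT i01 i2.
have -> : \int[leb2 R]_(x in open_triangle c p q) f x ^+ 2 + \int[leb2 R]_(x in open_triangle c p q) dx f x ^+ 2 +
    \int[leb2 R]_(x in open_triangle c p q) dy f x ^+ 2 =
    \int[leb2 R]_(x in open_triangle c p q) (f x ^+ 2 + dx f x ^+ 2 + dy f x ^+ 2).
  by rewrite (RintegralD mT i01 i2) (RintegralD mT i0 i1).
rewrite -(RintegralZl _ mT i012).
have iM (g h : mplane R -> R) : sqint (leb2 R) (open_triangle c p q) g ->
    sqint (leb2 R) (open_triangle c p q) h -> (leb2 R).-integrable (open_triangle c p q)
      (EFin \o (fun x => `|g x * h x + h x * g x|)).
  by move=> sg sh; apply: integrableR_norm => //; apply: (integrableRD mT); exact: sqintM.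
apply: le_Rintegral => //.
- have k1 := integrableRZ mT 2 (sqintM mT s0 s0).
  have k2 := integrableRZ mT (2 * M) (integrableRD mT (iM _ _ s1 s0) (iM _ _ s2 s0)).
  have k3 := integrableRD mT k1 k2. exact: k3.
- exact: (integrableRZ mT).
- move=> x _.
  have k1 := normM_le (dx f x) (f x); have k2 := normM_le (dy f x) (f x).
  have two (z : R) : `|z + z| = 2 * `|z| by rewrite -mulr2n normrMn mulr_natl.
  rewrite [f x * dx f x]mulrC [f x * dy f x]mulrC !two -expr2.
  have l1 : M * `|dx f x * f x| <= M * ((dx f x ^+ 2 + f x ^+ 2) / 2) by apply: ler_wpM2l.
  have l2 : M * `|dy f x * f x| <= M * ((dy f x ^+ 2 + f x ^+ 2) / 2) by apply: ler_wpM2l.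
  have := sqr_ge0 (dx f x); have := sqr_ge0 (dy f x); have := mulr_ge0 M0 (sqr_ge0 (f x)).
  have := mulr_ge0 M0 (sqr_ge0 (dx f x)); have := mulr_ge0 M0 (sqr_ge0 (dy f x)).
  lra.
Qed.

(** A trace comes with its own approximating sequence, different for each edge. Two sequences with
    the same H1 limit have a difference tending to 0 in H1, hence on the edge by [trace_bound]; so
    one sequence serves all edges of the element. *)
Lemma trace_cvg tau e u g (gt : plane R -> R) (f : nat -> plane R -> R) : is_edge tau e ->
  sqint (leb2 R) tau u -> weak_gradient tau u g -> is_trace tau e u gt -> h1_cvg tau f u g ->
  sqint mu I01 (gt \o edge_point e) /\
  \int[mu]_(t in I01) (f n (edge_point e t) - gt (edge_point e t)) ^+ 2 @[n --> \oo] --> (0 : R).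
Proof.
move=> eE su wg [ggt [phi [C1phi H1phi Ephi]]] [C1f f1 f2 f3].
have [sg _] := edge_L2_sqE eE ggt; split => //.
have [A HA] := trace_bound eE.
have L0 := edge_length_gt0 eE.
have [c [d0 tauE _]] := is_edge_ends eE.
have sI psi : C1 psi -> sqint mu I01 (psi \o edge_point e).
  by move=> [cp _ _ _ _]; exact: continuous_edge_sqint.
have mT : measurable (tau : set (mplane R)) by rewrite tauE; exact: open_triangle_measurable.
have mI : measurable I01 by exact: measurable_itv.
have [phi1 phi2 phi3 phi4] : h1_cvg tau phi u g.
  by move: su wg H1phi; rewrite tauE => su wg; exact: h1_cvg_approximants.
have sT psi : continuous psi -> sqint (leb2 R) tau psi by rewrite tauE; exact: continuous_sqint.
have key (F G : nat -> plane R -> R) h : (forall n, sqint (leb2 R) tau (F n)) ->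
    (forall n, sqint (leb2 R) tau (G n)) -> sqint (leb2 R) tau h ->
    \int[leb2 R]_(x in tau) (F n x - h x) ^+ 2 @[n --> \oo] --> (0 : R) ->
    \int[leb2 R]_(x in tau) (G n x - h x) ^+ 2 @[n --> \oo] --> (0 : R) ->
    \int[leb2 R]_(x in tau) (F n x - G n x) ^+ 2 @[n --> \oo] --> (0 : R).
  move=> sF sG sh c1 c2; apply: (@cvg_sqint_dist _ _ _ (leb2 R) tau mT F G (fun=> h)) => //.
  by under eq_fun do rewrite sqint_dist_sym.
apply: (cvg_sqint_dist mI (F := fun n t => f n (edge_point e t))
  (G := fun=> gt \o edge_point e) (H := fun n t => phi n (edge_point e t))) => //.
- by move=> n; exact: sI.
- by move=> n; exact: sI.
- have w n : C1 (fun x => f n x - phi n x).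
    exact: (has_partials_C1 (has_partialsB (C1_has_partials (C1f n)) (C1_has_partials (C1phi n)))).
  have wE n : dx (fun x => f n x - phi n x) = (fun x => dx (f n) x - dx (phi n) x) /\
      dy (fun x => f n x - phi n x) = (fun x => dy (f n) x - dy (phi n) x).
    exact: (has_partialsE (has_partialsB (C1_has_partials (C1f n)) (C1_has_partials (C1phi n)))).
  apply: (@squeeze_cvgr _ _ _ _ (fun=> 0) (fun n => A * (\int[leb2 R]_(x in tau) (f n x - phi n x) ^+ 2 +
      \int[leb2 R]_(x in tau) (dx (f n) x - dx (phi n) x) ^+ 2 +
      \int[leb2 R]_(x in tau) (dy (f n) x - dy (phi n) x) ^+ 2))).
  + apply: nearW => n; rewrite Rintegral_sqr_ge0/=.
    by have := HA _ (w n); have [-> ->] := wE n.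
  + exact: cvg_cst.
  + rewrite -[X in _ --> X](_ : A * (0 + 0 + 0) = 0 :> R); last by rewrite !addr0 mulr0.
    have [gx gy _] := wg.
    have cf n := let: And5 c _ _ _ _ := C1f n in c.
    have cp n := let: And5 c _ _ _ _ := C1phi n in c.
    apply: cvgMr; apply: cvgD; first apply: cvgD.
    * exact: (key _ _ u (fun n => sT _ (cf n)) (fun n => sT _ (cp n)) su f1 phi2).
    * have cfx n := let: And5 _ _ _ c _ := C1f n in c.
      have cpx n := let: And5 _ _ _ c _ := C1phi n in c.
      exact: (key _ _ _ (fun n => sT _ (cfx n)) (fun n => sT _ (cpx n)) gx f2 phi3).
    * have cfy n := let: And5 _ _ _ _ c := C1f n in c.
      have cpy n := let: And5 _ _ _ _ c := C1phi n in c.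
      exact: (key _ _ _ (fun n => sT _ (cfy n)) (fun n => sT _ (cpy n)) gy f3 phi4).
- have En n : in_edge_L2 e (fun x => phi n x - gt x).
    have [m1 l1] : sqint mu I01 (fun t => phi n (edge_point e t) - gt (edge_point e t)).
      by apply: sqintB => //; exact: sI.
    split; first exact: m1.
    rewrite /edge_L2_sq; case: (X in (_ * X)%E) l1 => [r _| |] //.
      by rewrite -EFinM ltry.
    by move=> _; rewrite gt0_muleNy// ltNyr.
  have Ereal n : \int[mu]_(t in I01) (phi n (edge_point e t) - gt (edge_point e t)) ^+ 2 =
      (edge_length e)^-1 * fine (edge_L2_sq e (fun x => phi n x - gt x)).
    by have [_ ->] := edge_L2_sqE eE (En n); rewrite /= mulKf// gt_eqF.
  have : (edge_length e)^-1 * fine (edge_L2_sq e (fun x => phi n x - gt x)) @[n --> \oo]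
      --> (edge_length e)^-1 * 0 by apply: cvgMr; exact: (fine_cvg Ephi).
  rewrite mulr0; apply: cvg_trans; apply: near_eq_cvg.
  by apply: nearW => n; rewrite -Ereal.
Qed.

(* The sign tells on which side of e the triangle lies: times the rotated edge
   vector it is the normal of e pointing out of tau, scaled by the length of e. *)
Definition edge_sign tau e : R := Num.sg (orient (edge_ends e).1 (edge_ends e).2 (get tau)).

Definition set_edge_integral e (f : plane R -> R) : R := \int[mu]_(t in I01) f (edge_point e t).

Lemma sg_orient_mem a b c x : noncollinear a b c -> open_triangle a b c x ->
  Num.sg (orient a b x) = Num.sg (orient a b c).
Proof.
move=> d0 /(in_open_triangle _ d0)[_ _]; have d0' : orient a b c != 0 by [].
by rewrite -sgr_cp0 sgrM sgrV => /eqP/(congr1 (fun z => z * Num.sg (orient a b c)));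
  rewrite -mulrA -expr2 sqr_sg d0' mulr1 mul1r.
Qed.

(** Reversing the order chosen by [edge_ends] changes the sign of the orientation and of the edge
    vector, so their product does not depend on the choice. *)
Lemma edge_flux a b c f : noncollinear a b c -> continuous f ->
  let tau := open_triangle a b c in let e := open_segment a b in
  edge_sign tau e * ((edge_ends e).2.2 - (edge_ends e).1.2) * set_edge_integral e f =
    Num.sg (orient a b c) * (b.2 - a.2) * edge_integral a b f /\
  edge_sign tau e * ((edge_ends e).2.1 - (edge_ends e).1.1) * set_edge_integral e f =
    Num.sg (orient a b c) * (b.1 - a.1) * edge_integral a b f.
Proof.
move=> d0 cf tau e; have [ab _ _] := noncollinear_neq d0.
have gT : tau (get tau).
  by have [x Tx] := open_triangle_nonempty a b c; apply: (getPex (ex_intro _ x Tx)).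
rewrite /edge_sign /set_edge_integral /edge_point.
rewrite -/(edge_integral (edge_ends e).1 (edge_ends e).2 f).
have [->|->] /= := edge_ends_segment ab; first by rewrite (sg_orient_mem d0 gT).
have -> : orient b a (get tau) = - orient a b (get tau) by rewrite /orient; ring.
rewrite sgrN (sg_orient_mem d0 gT) (edge_integral_rev b a cf).
by split; ring.
Qed.

Definition triangle_edge_seq a b c : seq (set (plane R)) :=
  [:: open_segment a b; open_segment b c; open_segment c a].

Lemma divergence_edges a b c f fx fy : noncollinear a b c -> has_partials f fx fy ->
  let tau := open_triangle a b c in
  \int[leb2 R]_(x in tau) fx x = \sum_(e <- triangle_edge_seq a b c)
     edge_sign tau e * ((edge_ends e).2.2 - (edge_ends e).1.2) * set_edge_integral e f /\
  \int[leb2 R]_(x in tau) fy x = - (\sum_(e <- triangle_edge_seq a b c)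
     edge_sign tau e * ((edge_ends e).2.1 - (edge_ends e).1.1) * set_edge_integral e f).
Proof.
move=> d0 hf tau; have [cf _ _ _ _] := hf.
have d1 := noncollinear_rot d0; have d2 := noncollinear_rot d1.
have [-> ->] := divergence_theorem d0 hf.
rewrite /triangle_edge_seq !big_cons !big_nil.
have [-> ->] := edge_flux d0 cf.
have := edge_flux d1 cf; rewrite /= -open_triangle_rot => -[-> ->].
have := edge_flux d2 cf; rewrite /= -open_triangle_rot -open_triangle_rot => -[-> ->].
rewrite -(orient_rot b) -(orient_rot a b c) -(orient_rot c a b) -(orient_rot b c a).
by split; ring.
Qed.

(** Outward normal times length, up to the quarter turn: the increment of the second coordinate
    belongs to the x-derivative, that of the first, with a minus sign, to the y-derivative. *)
Definition edge_flux_y tau e : R := edge_sign tau e * ((edge_ends e).2.2 - (edge_ends e).1.2).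
Definition edge_flux_x tau e : R := edge_sign tau e * ((edge_ends e).2.1 - (edge_ends e).1.1).

Lemma edge_point_in tau e (t : R) : is_edge tau e -> t \in `]0, 1[ -> e (edge_point e t).
Proof.
move=> eE t01; have [c [_ _ E]] := is_edge_ends eE.
by rewrite [X in X _]E; exists t.
Qed.

Lemma set_edge_integral_eq0 tau e (f : plane R -> R) : is_edge tau e -> (forall x, e x -> f x = 0) ->
  set_edge_integral e f = 0.
Proof.
move=> eE f0; rewrite /set_edge_integral /Rintegral.
under eq_integral => t /set_mem/= t01 do rewrite (f0 _ (edge_point_in eE t01)).
by rewrite integral0.
Qed.

Lemma triangle_edge_seqP a b c e : noncollinear a b c ->
  e \in triangle_edge_seq a b c -> is_edge (open_triangle a b c) e.
Proof.
move=> d0; have d1 := noncollinear_rot d0; have d2 := noncollinear_rot d1.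
rewrite !inE => /or3P[] /eqP ->.
- by exists a, b, c.
- by exists b, c, a; split => //; exact: open_triangle_rot.
- by exists c, a, b; split => //; rewrite -open_triangle_rot.
Qed.

(** Green's formula for C1 approximants of [u] multiplied by [phi], passed to the limit. The
    approximants are borrowed from one edge that has a trace, hence the existence hypothesis; on
    edges without a known trace [phi] vanishes. *)
Lemma element_identity a b c u g phi phix phiy (tr : set (plane R) -> plane R -> R) :
  let tau := open_triangle a b c in noncollinear a b c ->
  sqint (leb2 R) tau u -> weak_gradient tau u g -> has_partials phi phix phiy ->
  (forall e, is_edge tau e -> is_trace tau e u (tr e) \/ forall x, e x -> phi x = 0) ->
  (exists2 e, is_edge tau e & is_trace tau e u (tr e)) ->
  \int[leb2 R]_(x in tau) (u x * phix x) = - (\int[leb2 R]_(x in tau) ((g x).1 * phi x)) +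
    \sum_(e <- triangle_edge_seq a b c)
      edge_flux_y tau e * set_edge_integral e (fun x => tr e x * phi x) /\
  \int[leb2 R]_(x in tau) (u x * phiy x) = - (\int[leb2 R]_(x in tau) ((g x).2 * phi x)) -
    \sum_(e <- triangle_edge_seq a b c)
      edge_flux_x tau e * set_edge_integral e (fun x => tr e x * phi x).
Proof.
move=> tau d0 su wg hphi trP [e0 e0E [_ [f [C1f H1f _]]]].
have mT : measurable (tau : set (mplane R)) := open_triangle_measurable d0.
have mI : measurable I01 by exact: measurable_itv.
have hcvg := h1_cvg_approximants d0 su wg C1f H1f.
have [_ f1 f2 f3] := hcvg.
have [cphi cphix cphiy _ _] := hphi.
have sphi := continuous_sqint d0 cphi; have sphix := continuous_sqint d0 cphix.
have sphiy := continuous_sqint d0 cphiy.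
have [sg1 sg2 _] := wg.
have hf n := C1_has_partials (C1f n).
have sf n : sqint (leb2 R) tau (f n) by apply: continuous_sqint => //; case: (hf n).
have sfx n : sqint (leb2 R) tau (dx (f n)) by apply: continuous_sqint => //; case: (hf n).
have sfy n : sqint (leb2 R) tau (dy (f n)) by apply: continuous_sqint => //; case: (hf n).
have edge_cvg e : is_edge tau e ->
    set_edge_integral e (fun x => f n x * phi x) @[n --> \oo] --> set_edge_integral e (fun x => tr e x * phi x).
  move=> eE; have [htr|phi0] := trP e eE; last first.
    rewrite (set_edge_integral_eq0 eE) => [|x /phi0 ->]; last by rewrite mulr0.
    apply: cvg_near_cst; apply: nearW => n.
    by rewrite (set_edge_integral_eq0 eE) => // x /phi0 ->; rewrite mulr0.
  have [str ctr] := trace_cvg eE su wg htr hcvg.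
  have sI psi : continuous psi -> sqint mu I01 (psi \o edge_point e) := @continuous_edge_sqint e psi.
  apply: (@cvg_sqint _ _ _ mu I01 mI (fun n => f n \o edge_point e) (tr e \o edge_point e)
    (phi \o edge_point e)) => //; last exact: sI.
  by move=> n; apply: sI; case: (hf n).
have sum_cvg (k : set (plane R) -> R) :
    \sum_(e <- triangle_edge_seq a b c) k e * set_edge_integral e (fun x => f n x * phi x)
      @[n --> \oo] --> \sum_(e <- triangle_edge_seq a b c) k e * set_edge_integral e (fun x => tr e x * phi x).
  have E e : e \in triangle_edge_seq a b c ->
      k e * set_edge_integral e (fun x => f n x * phi x) @[n --> \oo] -->
      k e * set_edge_integral e (fun x => tr e x * phi x).
    by move=> /(triangle_edge_seqP d0) eE; apply: cvgMr; exact: edge_cvg.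
  rewrite /triangle_edge_seq !big_cons !big_nil; under eq_fun do rewrite !big_cons !big_nil.
  apply: cvgD; first by apply: E; rewrite !inE eqxx.
  apply: cvgD; first by apply: E; rewrite !inE eqxx orbT.
  by apply: cvgD; [apply: E; rewrite !inE eqxx !orbT|exact: cvg_cst].
have int_cvg (F : nat -> mplane R -> R) h l : (forall n, sqint (leb2 R) tau (F n)) -> sqint (leb2 R) tau h ->
    sqint (leb2 R) tau l ->
    \int[leb2 R]_(x in tau) (F n x - h x) ^+ 2 @[n --> \oo] --> (0 : R) ->
    \int[leb2 R]_(x in tau) (F n x * phi x + f n x * l x) @[n --> \oo] -->
      \int[leb2 R]_(x in tau) (h x * phi x) + \int[leb2 R]_(x in tau) (u x * l x).
  move=> sF sh sl cF.
  have -> : (fun n => \int[leb2 R]_(x in tau) (F n x * phi x + f n x * l x)) =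
      (fun n => \int[leb2 R]_(x in tau) (F n x * phi x) + \int[leb2 R]_(x in tau) (f n x * l x)).
    by apply/funext => n; rewrite (RintegralD mT (sqintM mT (sF n) sphi) (sqintM mT (sf n) sl)).
  by apply: cvgD; [exact: (cvg_sqint mT sF sh sphi cF)|exact: (cvg_sqint mT sf su sl f1)].
have D n := divergence_edges d0 (has_partialsM (hf n) hphi).
have aux (A B S : R) : A + B = S -> B = - A + S by lra.
have U (F G : nat -> R) (y z : R) : (forall n, F n = G n) -> F n @[n --> \oo] --> y ->
    G n @[n --> \oo] --> z -> y = z.
  move=> /funext -> h1 h2; exact: (cvg_unique (@norm_hausdorff _ R) h1 h2).
split; apply: aux.
- by apply: (U _ _ _ _ _ (int_cvg _ _ _ sfx sg1 sphix f2) (sum_cvg (edge_flux_y tau))) => n; have [] := D n.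
- by apply: (U _ _ _ _ _ (int_cvg _ _ _ sfy sg2 sphiy f3) (cvgN (sum_cvg (edge_flux_x tau)))) => n; have [] := D n.
Qed.

(** The set [K] outside which [f] vanishes touches the closure of tau only inside tau. A point off
    tau therefore has a neighbourhood in which every point of tau is off [K], so the function cut to
    tau is locally either [f] or 0, and inherits its regularity. *)
Lemma glue_near tau K f x : closed K -> open tau -> K `&` closure tau `<=` tau ->
  (forall y, ~ K y -> f y = 0) ->
  (tau x /\ \forall y \near x, f y = (if `[< tau y >] then f y else 0)) \/
  (~ tau x /\ \forall y \near x, 0 = (if `[< tau y >] then f y else 0)).
Proof.
move=> cK oT KT f0; have [Tx|nTx] := pselect (tau x); [left|right]; split => //.
  have : \forall y \near x, tau y by exact: open_nbhs_nbhs.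
  by apply: filterS => y Ty; rewrite asboolT.
have : \forall y \near x, (~` (K `&` closure tau)) y.
  apply: open_nbhs_nbhs; split; last by move=> /KT.
  by apply: closed_openC; apply: closedI => //; exact: closed_closure.
apply: filterS => y H; case: asboolP => // Ty; rewrite f0// => Ky; apply: H; split => //.
exact: subset_closure.
Qed.

Lemma glue_continuous tau K f : closed K -> open tau -> K `&` closure tau `<=` tau ->
  (forall y, ~ K y -> f y = 0) -> continuous f ->
  continuous (fun y : plane R => if `[< tau y >] then f y else 0 : R).
Proof.
move=> cK oT KT f0 cf x; have [[Tx H]|[nTx H]] := glue_near x cK oT KT f0.
  rewrite /continuous_at/= asboolT//; apply: cvg_trans (cf x); exact: near_eq_cvg.
have c0 : continuous (fun _ : plane R => 0 : R) by move=> z; exact: cvg_cst.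
by rewrite /continuous_at/= asboolF//; apply: cvg_trans (c0 x); exact: near_eq_cvg.
Qed.

Lemma restrict_C1c tau K phi : compact K -> open tau -> K `&` closure tau `<=` tau ->
  (forall y, ~ K y -> phi y = 0) -> C1 phi ->
  let psi := fun y => if `[< tau y >] then phi y else 0 in
  C1c tau psi /\ forall x, tau x -> dx psi x = dx phi x /\ dy psi x = dy phi x.
Proof.
move=> cK oT KT phi0 [cphi px py cdx cdy] psi.
have clK : closed K by apply: compact_closed => //; exact: norm_hausdorff.
have D v : (forall x, derivable phi x v) ->
    (forall x, derivable psi x v) /\ forall x, 'D_v psi x = if `[< tau x >] then 'D_v phi x else 0.
  move=> pv; split => x; have [[Tx H]|[nTx H]] := glue_near x clK oT KT phi0.
  - exact: near_eq_derivable (pv x).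
  - by apply: (near_eq_derivable (f := cst 0) H); exact: derivable_cst.
  - by rewrite asboolT//; rewrite (near_eq_derive _ H).
  - by rewrite asboolF//; rewrite -(near_eq_derive (f := cst 0) _ H) derive_cst.
have D0 v x : ~ K x -> 'D_v phi x = 0.
  move=> nKx; rewrite (near_eq_derive (g := cst 0)) ?derive_cst//.
  have : \forall y \near x, (~` K) y by apply: open_nbhs_nbhs; split => //; exact: closed_openC.
  by apply: filterS => y; exact: phi0.
have [dpx Ex] := D _ px; have [dpy Ey] := D _ py.
split; last by move=> x Tx; rewrite /dx /dy Ex Ey asboolT.
have g0 := glue_continuous clK oT KT phi0 cphi.
have gx := glue_continuous clK oT KT (D0 _) cdx.
have gy := glue_continuous clK oT KT (D0 _) cdy.
have dxE : dx psi = (fun y => if `[< tau y >] then dx phi y else 0) by exact/funext.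
have dyE : dy psi = (fun y => if `[< tau y >] then dy phi y else 0) by exact/funext.
have Cpsi : C1 psi by split; [exact: g0|exact: dpx|exact: dpy|rewrite dxE; exact: gx|rewrite dyE; exact: gy].
split; first exact: Cpsi.
exists (K `&` closure tau); split; [|exact: KT|].
- apply: (subclosed_compact _ cK (@subIsetl _ K (closure tau))).
  by apply: closedI; [exact: clK|exact: closed_closure].
- move=> x nK; rewrite /psi; case: asboolP => // Tx; apply: phi0 => Kx; apply: nK; split => //.
  exact: subset_closure.
Qed.

(** Meant for elements without any interior edge: no trace, hence no sequence of approximants, is
    available there, but [phi] vanishes near the sides, so its restriction is an admissible test
    function for the weak gradient itself. *)
Lemma inner_element_identity a b c u g phi K :
  let tau := open_triangle a b c in noncollinear a b c ->
  weak_gradient tau u g -> C1 phi -> compact K -> K `&` closure tau `<=` tau ->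
  (forall y, ~ K y -> phi y = 0) ->
  \int[leb2 R]_(x in tau) (u x * dx phi x) = - (\int[leb2 R]_(x in tau) ((g x).1 * phi x)) /\
  \int[leb2 R]_(x in tau) (u x * dy phi x) = - (\int[leb2 R]_(x in tau) ((g x).2 * phi x)).
Proof.
move=> tau d0 wg cphi cK KT phi0.
have [cpsi dpsi] := restrict_C1c cK (open_triangle_open d0) KT phi0 cphi.
have [e1 e2] := weak_gradientR wg cpsi.
split; [transitivity (\int[leb2 R]_(x in tau) (u x * dx (fun y => if `[< tau y >] then phi y else 0) x))|
        transitivity (\int[leb2 R]_(x in tau) (u x * dy (fun y => if `[< tau y >] then phi y else 0) x))].
- by apply: eq_Rintegral => x /set_mem Tx; have [-> _] := dpsi x Tx.
- by rewrite e1; congr (- _); apply: eq_Rintegral => x /set_mem Tx; rewrite asboolT.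
- by apply: eq_Rintegral => x /set_mem Tx; have [_ ->] := dpsi x Tx.
- by rewrite e2; congr (- _); apply: eq_Rintegral => x /set_mem Tx; rewrite asboolT.
Qed.

End ElementIdentity.

(** * Summation over a triangulation *)

Section Subdomains.
Context d (X : measurableType d) (R : realType) (mu : {measure set X -> \bar R}).

Lemma sqint_subset (D E : set X) (f : X -> R) : measurable D -> measurable E -> E `<=` D ->
  sqint mu D f -> sqint mu E f.
Proof.
move=> mD mE ED [mf ff]; have mfE := measurable_funS mD ED mf.
split => //; apply: le_lt_trans ff; apply: ge0_subset_integral => //.
  by apply/measurable_EFinP; exact: measurable_funX.
by move=> x _; rewrite lee_fin sqr_ge0.
Qed.

Lemma Rintegral_disjoint_seq (s : seq (set X)) (D : set X) (f : X -> R) :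
  measurable D -> mu.-integrable D (EFin \o f) -> uniq s ->
  (forall E, E \in s -> measurable E /\ E `<=` D) ->
  (forall E E', E \in s -> E' \in s -> E <> E' -> E `&` E' = set0) ->
  mu (D `\` [set x | exists2 E, E \in s & E x]) = 0%E ->
  \int[mu]_(x in D) f x = \sum_(E <- s) \int[mu]_(x in E) f x.
Proof.
elim: s D => [|E s IH] D mD fi us sD sdisj null.
  rewrite big_nil /Rintegral null_set_integral//.
    by case/integrableP: fi.
  by rewrite -null; congr (mu _); apply/seteqP; split => [x Dx|x []//]; split => // -[].
have [mE ED] := sD E (mem_head _ _).
have DE : D = E `|` (D `\` E) by rewrite setDUK.
have mDE : measurable (D `\` E) by exact: measurableD.
rewrite big_cons {1}DE Rintegral_setU//; last 2 first.
- by rewrite -DE.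
- by apply/disj_setPS => x [Ex [_]].
congr (_ + _); move: us => /= /andP[Es us]; apply: IH => //.
- by apply: (integrableS mD) => //; exact: subDsetl.
- move=> E' E's; have [mE' E'D] := sD E' (mem_behead (s := E :: s) E's).
  split => // x E'x; split; first exact: E'D.
  move=> Ex; have : (E `&` E') x by [].
  rewrite sdisj ?mem_head//; first by rewrite inE E's orbT.
  by move=> EE'; move: Es; rewrite EE' E's.
- by move=> E1 E2 h1 h2; apply: sdisj; rewrite inE ?h1 ?h2 orbT.
- rewrite -null; congr (mu _); apply/seteqP; split => x [].
  + move=> [Dx nEx] nx; split => // -[E1]; rewrite inE => /orP[/eqP ->//|E1s E1x].
    by apply: nx; exists E1.
  + move=> Dx nx; split; first by split => // Ex; apply: nx; exists E => //; exact: mem_head.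
    by move=> [E1 E1s E1x]; apply: nx; exists E1 => //; rewrite inE E1s orbT.
Qed.

End Subdomains.

Section TriangleTopology.
Context (R : realType).
Implicit Types (phi : plane R -> R) (u : mplane R -> R) (x a b c p q : plane R) (tau e : set (plane R)).

Lemma closed_triangle_closed a b c : noncollinear a b c -> closed (closed_triangle a b c).
Proof.
move=> d0; have cl (y z : plane R) : closed [set x | 0 <= orient y z x / orient a b c].
  have [p [q [r E]]] := orient_affine y z.
  rewrite (_ : [set x | _] = (fun x : plane R => p / orient a b c + x.1 * (q / orient a b c) + x.2 * (r / orient a b c))
    @^-1` [set t | 0 <= t]).
    by apply: closed_comp; [move=> x _; exact: continuous_affine|exact: closed_ge].
  by apply/seteqP; split => x /=; rewrite E; congr (is_true (_ <= _)); ring.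
rewrite (_ : closed_triangle a b c = [set x | 0 <= orient b c x / orient a b c] `&`
  ([set x | 0 <= orient c a x / orient a b c] `&` [set x | 0 <= orient a b x / orient a b c])).
  by apply: closedI => //; exact: closedI.
apply/seteqP; split => x.
  move=> /(in_closed_triangle _ d0)[]; rewrite (orient_rot x b c) -(orient_rot c a x) => h1 h2 h3.
  by split => //; split.
by move=> [h1 [h2 h3]]; apply/(in_closed_triangle _ d0); rewrite (orient_rot x b c) -(orient_rot c a x).
Qed.

Lemma closure_triangle_sub a b c : noncollinear a b c ->
  closure (open_triangle a b c) `<=` closed_triangle a b c.
Proof.
move=> d0; have E : closed_triangle a b c = closure (closed_triangle a b c).
  by apply/closure_id; exact: closed_triangle_closed.
by rewrite E; apply: closure_subset => x [s [t [r [s0 t0 r0 str ->]]]]; exists s, t, r; split => //; exact: ltW.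
Qed.

Lemma closed_triangle_cases a b c x : closed_triangle a b c x ->
  [\/ open_triangle a b c x, closed_segment a b x, closed_segment b c x | closed_segment c a x].
Proof.
move=> [s [t [r [s0 t0 r0 str xE]]]].
have [r1|/eqP r1] := eqVneq r 0.
  constructor 2; exists t; first by rewrite /= in_itv/=; apply/andP; split; lra.
  have E : s = 1 - t by lra.
  by rewrite xE /seg_point r1 E; congr pair; ring.
have [s1|/eqP s1] := eqVneq s 0.
  constructor 3; exists r; first by rewrite /= in_itv/=; apply/andP; split; lra.
  have E : t = 1 - r by lra.
  by rewrite xE /seg_point s1 E; congr pair; ring.
have [t1|/eqP t1] := eqVneq t 0.
  constructor 4; exists s; first by rewrite /= in_itv/=; apply/andP; split; lra.
  have E : r = 1 - s by lra.
  by rewrite xE /seg_point t1 E; congr pair; ring.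
by constructor 1; exists s, t, r; split => //; lra.
Qed.

Lemma closed_segment_sub a b (F : set (plane R)) : closed F ->
  open_segment a b `<=` F -> closed_segment a b `<=` F.
Proof.
move=> clF sub _ [t /= t01 <-].
have cl : closed ((fun t : R => seg_point a b t) @^-1` F).
  by apply: closed_comp => // s _; exact: continuous_seg_point.
apply: contrapT => nF; have : nbhs t (~` ((fun t : R => seg_point a b t) @^-1` F)).
  by apply: open_nbhs_nbhs; split => //; exact: closed_openC.
move=> /nbhs_ballP[d /= d0 hd]; move: t01; rewrite in_itv/= => /andP[t0 t1].
pose m := Num.min d 1 / 2.
have m0 : 0 < m by rewrite divr_gt0// lt_min d0/=.
have [md m1] : m <= d / 2 /\ m <= 1 / 2 by rewrite !ler_pM2r ?invr_gt0//; split; rewrite ge_min lexx ?orbT.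
pose s := t + m * (1 / 2 - t).
have mt := mulr_ge0 (ltW m0) t0; have mt1 : m * t <= m by rewrite -[leRHS]mulr1 ler_pM2l.
have m1t : 0 <= (1 - m) * t by apply: mulr_ge0 => //; lra.
have m1t' : (1 - m) * t <= (1 - m) by rewrite -[leRHS]mulr1; apply: ler_wpM2l => //; lra.
have s01 : s \in `]0, 1[ by rewrite in_itv/= /s; apply/andP; split; lra.
apply: (hd s); last by apply: sub; exists s.
by rewrite /ball/= /s ltr_norml; apply/andP; split; lra.
Qed.

Lemma closed_segment_null a b : a <> b -> measurable (closed_segment a b : set (mplane R)) ->
  leb2 R (closed_segment a b) = 0%E.
Proof.
move=> ab mS.
pose L : set (mplane R) := [set x | (b.2 - a.2) * a.1 * - 1 + (b.1 - a.1) * a.2 + x.1 * (b.2 - a.2) + x.2 * - (b.1 - a.1) = 0].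
have L0 : leb2 R L = 0%E.
  apply: negligible_line; rewrite oppr_eq0 !subr_eq0; apply: contraT; rewrite negb_or !negbK => /andP[/eqP h1 /eqP h2].
  by exfalso; apply: ab; exact: plane_eqP.
apply/eqP; rewrite eq_le measure_ge0 andbT -L0; apply: le_measure; rewrite ?inE//.
  rewrite (_ : L = (fun x : mplane R => ((b.2 - a.2) * a.1 * - 1 + (b.1 - a.1) * a.2) + x.1 * (b.2 - a.2) + x.2 * - (b.1 - a.1)) @^-1` [set 0]) ; last by [].
  by rewrite -[X in measurable X]setTI; apply: measurable_affine2 => //.
by move=> _ [t _ <-]; rewrite /L /seg_point/=; ring.
Qed.

Lemma closed_segment_measurable a b : measurable (closed_segment a b : set (mplane R)).
Proof.
apply: closed_plane_measurable; apply: compact_closed; first exact: norm_hausdorff.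
have := @segment_compact R 0 1; move=> /(continuous_compact (f := seg_point a b)); apply.
by apply: continuous_subspaceT => t; exact: continuous_seg_point.
Qed.

Lemma interior_edges_finite (Omega : set (plane R)) T : is_triangulation Omega T ->
  finite_set (interior_edges Omega T).
Proof.
move=> [fT triT _ _ _].
apply: (sub_finite_set (B := \bigcup_(tau in T) [set e | is_edge tau e])).
  by move=> e [[tau Ttau eE] _]; exists tau.
apply: bigcup_finite => // tau /triT[[a [b [c [d0 ->]]]] _].
apply: (sub_finite_set (B := [set` triangle_edge_seq a b c])); last exact: finite_seq.
by move=> e /(triangle_edges d0)[->|->|->]; rewrite /= !inE eqxx ?orbT.
Qed.

(** The closure of an element exceeds it by points of its three sides, which are null, and finitely
    many closures cover Omega. *)
Lemma triangulation_null (Omega : set (plane R)) T : open Omega -> is_triangulation Omega T ->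
  leb2 R (Omega `\` element_union T) = 0%E.
Proof.
move=> oO [fT triT _ clO _].
have mO := open_plane_measurable oO.
have mU : measurable (element_union T : set (mplane R)).
  apply: open_plane_measurable; apply: bigcup_open => tau /triT[[a [b [c [d0 ->]]]] _].
  exact: open_triangle_open.
have [s Ts] := (finite_seqP T).1 fT.
have N0 tau : T tau -> exists M : set (mplane R), [/\ measurable M, leb2 R M = 0%E & closure tau `\` tau `<=` M].
  move=> /triT[[a [b [c [d0 ->]]]] _].
  have [ab bc ac] := noncollinear_neq d0.
  have nz p q : p <> q -> (leb2 R).-negligible (closed_segment p q).
    move=> pq; exists (closed_segment p q); split => //; first exact: closed_segment_measurable.
    by apply: closed_segment_null => //; exact: closed_segment_measurable.
  have : (leb2 R).-negligible (closed_segment a b `|` (closed_segment b c `|` closed_segment c a)).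
    by apply: negligibleU; [exact: nz|apply: negligibleU; apply: nz => // /esym].
  move=> [M [mM M0 subM]]; exists M; split => // x [clx nx]; apply: subM.
  have := closure_triangle_sub d0 clx.
  by move=> /closed_triangle_cases[//|h|h|h]; [left|right; left|right; right].
have : (leb2 R).-negligible (Omega `\` element_union T).
  have : forall tau, tau \in s -> (leb2 R).-negligible (closure tau `\` tau).
    move=> tau ts; have [|M [mM M0 sub]] := N0 tau; first by rewrite Ts.
    by exists M.
  move=> H; have : exists M : set (mplane R), [/\ measurable M, leb2 R M = 0%E &
      forall tau, tau \in s -> closure tau `\` tau `<=` M].
    elim: (s) H => [|tau r IH] H; first by exists set0; split.
    have [M [mM M0 subM]] : exists M : set (mplane R), [/\ measurable M, leb2 R M = 0%E &
      forall tau, tau \in r -> closure tau `\` tau `<=` M].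
      by apply: IH => tau' h; apply: H; rewrite inE h orbT.
    have [M' [mM' M0' subM']] := H tau (mem_head _ _).
    exists (M' `|` M); split; first exact: measurableU.
      by rewrite measureU0.
    move=> tau'; rewrite inE => /orP[/eqP ->|h]; first by apply: subset_trans subM' _; exact: subsetUl.
    by apply: subset_trans (subM _ h) _; exact: subsetUr.
  move=> [M [mM M0 subM]]; exists M; split => // x [Ox nx].
  have : closure Omega x by exact: subset_closure.
  rewrite clO => -[tau Ttau cltau]; apply: (subM tau); first by move: Ttau; rewrite Ts.
  by split => // taux; apply: nx; exists tau.
by move/(measure_negligible (measurableD mO mU)).
Qed.

Lemma derive_off_support K phi v x : closed K -> (forall y, ~ K y -> phi y = 0) -> ~ K x ->
  'D_v phi x = 0.
Proof.
move=> clK phi0 nKx; rewrite (near_eq_derive (g := cst 0)) ?derive_cst//.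
have : \forall y \near x, (~` K) y by apply: open_nbhs_nbhs; split => //; exact: closed_openC.
by apply: filterS => y; exact: phi0.
Qed.

(** A test function of tau is one of U, and both integrals only see its support, off which the
    derivatives vanish as well. *)
Lemma weak_gradient_subset (U : set (plane R)) tau u g : measurable (U : set (mplane R)) -> measurable (tau : set (mplane R)) ->
  tau `<=` U -> weak_gradient U u g -> weak_gradient tau u g.
Proof.
move=> mU mtau sub [s1 s2 H]; split.
- exact: (sqint_subset mU mtau sub s1).
- exact: (sqint_subset mU mtau sub s2).
move=> phi [cphi [K [cK KU phi0]]].
have clK : closed K by apply: compact_closed => //; exact: norm_hausdorff.
have E (F : mplane R -> R) : (forall x, ~ K x -> F x = 0) ->
    (\int[leb2 R]_(x in U) (F x)%:E = \int[leb2 R]_(x in tau) (F x)%:E)%E.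
  move=> F0; rewrite integral_mkcond [RHS]integral_mkcond; apply: eq_integral => x _.
  rewrite !patchE; case: ifPn => [xU|xU]; case: ifPn => [xt|xt] //.
    by rewrite F0// => /KU xt'; move: xt; rewrite mem_set.
  by exfalso; move/negP: xU; apply; apply: mem_set; apply: sub; exact: set_mem.
have [|e1 e2] := H phi; first by split => //; exists K; split => // x /KU /sub.
rewrite -!E ?e1 ?e2//; move=> x nK; rewrite ?(phi0 x nK) ?mulr0//.
  by rewrite /dy (derive_off_support _ clK phi0 nK) mulr0.
by rewrite /dx (derive_off_support _ clK phi0 nK) mulr0.
Qed.

End TriangleTopology.

(** * Broken gradient and edge traces extracted from the norm *)

Section MeshData.
Context (R : realType).
Local Notation mu := (@lebesgue_measure R).
Local Notation I01 := (`]0%R, 1%R[%classic : set (measurableTypeR R)).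
Implicit Types (u : mplane R -> R) (tau e Omega : set (plane R)) (T : set (set (plane R))).

Lemma sqrte_le (X : \bar R) (C : R) : (0 <= X)%E -> (sqrte X <= C%:E)%E -> (X <= (C ^+ 2)%:E)%E.
Proof.
case: X => [r| |] //=; rewrite !lee_fin => r0 rC.
by rewrite -(sqr_sqrtr r0) ler_sqr ?nnegrE ?sqrtr_ge0//; apply: le_trans rC; exact: sqrtr_ge0.
Qed.

Lemma edge_L2_sq_ge0 tau e (h : plane R -> R) : is_edge tau e -> (0 <= edge_L2_sq e h)%E.
Proof.
move=> /edge_length_gt0 L0; apply: mule_ge0; first by rewrite lee_fin ltW.
by apply: integral_ge0 => t _; rewrite lee_fin sqr_ge0.
Qed.

Lemma sqint_in_edge_L2 e (h : plane R -> R) : sqint mu I01 (h \o edge_point e) -> in_edge_L2 e h.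
Proof.
move=> sh; split; first by case: sh.
have mI : measurable I01 by exact: measurable_itv.
by rewrite /edge_L2_sq -[X in (_ * X)%E](EFin_sqint mI sh) -EFinM; exact: ltry.
Qed.

Definition jump_data T u (sE : seq (set (plane R))) (t1 t2 : set (plane R) -> set (plane R))
    (g1 g2 : set (plane R) -> plane R -> R) :=
  forall e, e \in sE -> [/\ [/\ T (t1 e), T (t2 e) & t1 e <> t2 e],
    is_edge (t1 e) e, is_edge (t2 e) e, is_trace (t1 e) e u (g1 e) & is_trace (t2 e) e u (g2 e)].

(** The norm is built from infima. Its finiteness provides competitors, and near-minimisers are
    chosen with slack 1 for the gradient and total slack at most 1 for the jumps, whence
    [C ^+ 2 + 1]. The weight 1/|e| cancels the length in [edge_L2_sq], leaving integrals over the
    parameter. *)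
Lemma mesh_data Omega T u (C : R) : open Omega -> is_triangulation Omega T -> in_H1h Omega T u ->
  (H1h_norm Omega T u <= C%:E)%E ->
  exists g sE t1 t2 g1 g2,
  [/\ \int[leb2 R]_(x in Omega) u x ^+ 2 <= C ^+ 2 + 1,
      weak_gradient (element_union T) u g /\
      \int[leb2 R]_(x in element_union T) (g x).1 ^+ 2 <= C ^+ 2 + 1 /\
      \int[leb2 R]_(x in element_union T) (g x).2 ^+ 2 <= C ^+ 2 + 1,
      uniq sE /\ interior_edges Omega T = [set` sE],
      jump_data T u sE t1 t2 g1 g2 &
      \sum_(e <- sE) \int[mu]_(t in I01) (g1 e (edge_point e t) - g2 e (edge_point e t)) ^+ 2 <= C ^+ 2 + 1].
Proof.
move=> oO triT [sOu Hu] HC; have mO := open_plane_measurable oO.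
have [s Es] := (finite_seqP _).1 (interior_edges_finite triT).
pose sE := undup s.
have usE : uniq sE by exact: undup_uniq.
have EsE : interior_edges Omega T = [set` sE].
  by rewrite Es; apply/seteqP; split => x /=; rewrite mem_undup.
have eE e : e \in sE -> exists2 tau, T tau & is_edge tau e.
  move=> h; have : interior_edges Omega T e by rewrite EsE.
  by move=> [].
have L0 e : e \in sE -> 0 < edge_length e by move=> /eE[tau _]; exact: edge_length_gt0.
have J0 e : e \in sE -> (0 <= jump_L2_sq T e u)%E.
  move=> he; apply: le_ereal_inf_tmp => _ [t1 [t2 [g1 [g2 [_ h _ _ ->]]]]].
  exact: edge_L2_sq_ge0 h.
pose F e := (((edge_length e)^-1)%:E * jump_L2_sq T e u)%E.
have F0 e : e \in sE -> (0 <= F e)%E.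
  by move=> he; apply: mule_ge0; [rewrite lee_fin invr_ge0 ltW// L0|exact: J0].
have sumE : (\sum_(e \in interior_edges Omega T) F e = \sum_(e <- sE) F e)%E.
  by rewrite EsE -fsbig_seq.
have sF0 : (0 <= \sum_(e <- sE) F e)%E.
  by rewrite big_seq; apply: sume_ge0.
have A0 : (0 <= L2_sq Omega u)%E by apply: integral_ge0 => x _; rewrite lee_fin sqr_ge0.
have B0 : (0 <= gradient_L2_sq (element_union T) u)%E.
  by apply: le_ereal_inf_tmp => _ [g _ ->]; apply: integral_ge0 => x _; rewrite lee_fin addr_ge0 ?sqr_ge0.
have : (L2_sq Omega u + gradient_L2_sq (element_union T) u + \sum_(e <- sE) F e <= (C ^+ 2)%:E)%E.
  apply: sqrte_le; first by apply: adde_ge0 => //; exact: adde_ge0.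
  by rewrite -sumE.
move=> tot.
have A1 : (L2_sq Omega u <= (C ^+ 2)%:E)%E.
  by apply: le_trans tot; rewrite -addeA leeDl//; exact: adde_ge0.
have B1 : (gradient_L2_sq (element_union T) u <= (C ^+ 2)%:E)%E.
  by apply: le_trans tot; rewrite addeAC leeDr//; exact: adde_ge0.
have F1 : (\sum_(e <- sE) F e <= (C ^+ 2)%:E)%E.
  by apply: le_trans tot; rewrite leeDr//; exact: adde_ge0.
have Bfin : gradient_L2_sq (element_union T) u \is a fin_num.
  by rewrite ge0_fin_numE//; apply: le_lt_trans B1 _; rewrite ltry.
have Ffin e : e \in sE -> F e \is a fin_num.
  move=> he; rewrite ge0_fin_numE ?F0//; apply: (@le_lt_trans _ _ (\sum_(e <- sE) F e)%E).
    rewrite (bigD1_seq e)//= leeDl// big_seq_cond; apply: sume_ge0 => e' /andP[h _]; exact: F0.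
  by apply: le_lt_trans F1 _; rewrite ltry.
have [z [g wg ->] gz] := lb_ereal_inf_adherent ltr01 Bfin.
have N0 : (0 : R) < (size sE).+1%:R by rewrite ltr0n.
have key e : exists d : set (plane R) * set (plane R) * (plane R -> R) * (plane R -> R), e \in sE ->
    [/\ [/\ T d.1.1.1, T d.1.1.2 & d.1.1.1 <> d.1.1.2],
    is_edge d.1.1.1 e, is_edge d.1.1.2 e, is_trace d.1.1.1 e u d.1.2 /\ is_trace d.1.1.2 e u d.2 &
     \int[mu]_(t in I01) (d.1.2 (edge_point e t) - d.2 (edge_point e t)) ^+ 2 <= fine (F e) + (size sE).+1%:R^-1].
  have [he|he] := boolP (e \in sE); last by exists (set0, set0, cst 0, cst 0).
  have l0 := L0 e he.
  have Jfin : jump_L2_sq T e u \is a fin_num.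
    rewrite ge0_fin_numE ?J0//; apply: (@lty_pmule R (edge_length e)^-1); rewrite ?invr_gt0 ?J0//.
    by rewrite -ge0_fin_numE ?F0// Ffin.
  (* After division by the edge length this is 1/(N+1) for each of the N interior edges, less than 1
     in all. *)
  have d0 : 0 < edge_length e / (size sE).+1%:R by rewrite divr_gt0.
  have [_ [t1 [t2 [g1 [g2 [h1 h2 h3 [h4 h5] ->]]]]] hz] := lb_ereal_inf_adherent d0 Jfin.
  exists (t1, t2, g1, g2) => _; split => //=.
  have [[e1 _] [e2 _]] := (h4, h5).
  have [s1 _] := edge_L2_sqE h2 e1; have [s2 _] := edge_L2_sqE h2 e2.
  have mI : measurable I01 by exact: measurable_itv.
  have [_ E12] := edge_L2_sqE h2 (@sqint_in_edge_L2 e (fun x => g1 x - g2 x) (sqintB mI s1 s2)).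
  move: hz; rewrite -/(jump_L2_sq T e u) E12 /F -(fineK Jfin) -EFinD -EFinM lte_fin /= => hz.
  rewrite -(ler_pM2l l0) mulrDr mulrA mulfV ?gt_eqF// mul1r; exact: ltW.
have [D HD] := choice key.
exists g, sE, (fun e => (D e).1.1.1), (fun e => (D e).1.1.2), (fun e => (D e).1.2), (fun e => (D e).2).
have [sg1 sg2 _] := wg.
have gz' : (\int[leb2 R]_(x in element_union T) ((g x).1 ^+ 2 + (g x).2 ^+ 2)%:E <= (C ^+ 2 + 1)%:E)%E.
  apply: ltW; apply: (lt_le_trans gz); rewrite EFinD; exact: leeD2r.
have mU : measurable (element_union T : set (mplane R)).
  apply: open_plane_measurable; apply: bigcup_open => tau; case: triT => _ triT' _ _ _.
  by move=> /triT'[[a [b [c [d0 ->]]]] _]; exact: open_triangle_open.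
split => //.
- rewrite -lee_fin EFin_sqint//; apply: (le_trans A1); rewrite lee_fin; lra.
- split => //; split; rewrite -lee_fin EFin_sqint//; apply: le_trans gz'; apply: ge0_le_integral => //.
  + by move=> x _; rewrite lee_fin sqr_ge0.
  + by apply/measurable_EFinP; apply: measurable_funX; case: sg1.
  + by apply/measurable_EFinP; apply: measurable_funD; apply: measurable_funX; [case: sg1|case: sg2].
  + by move=> x _; rewrite lee_fin lerDl sqr_ge0.
  + by move=> x _; rewrite lee_fin sqr_ge0.
  + by apply/measurable_EFinP; apply: measurable_funX; case: sg2.
  + by apply/measurable_EFinP; apply: measurable_funD; apply: measurable_funX; [case: sg1|case: sg2].
  + by move=> x _; rewrite lee_fin lerDr sqr_ge0.
- by move=> e he; have [h1 h2 h3 [h4 h5] _] := HD e he.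
- apply: (@le_trans _ _ (\sum_(e <- sE) (fine (F e) + (size sE).+1%:R^-1))).
    by rewrite big_seq [leRHS]big_seq; apply: ler_sum => e he; have [] := HD e he.
  rewrite big_split/=; apply: lerD.
    rewrite -lee_fin -sumEFin big_seq; under eq_bigr do rewrite fineK ?Ffin//.
    by rewrite -big_seq.
  rewrite big_const_seq count_predT iter_addr_0 -[leLHS]mulr_natl ler_pdivrMr// mul1r ler_nat; exact: leqnSn.
Qed.

End MeshData.

Section MeshSums.
Context (R : realType).
Implicit Types (u : mplane R -> R) (a b c p q : plane R) (tau e Omega : set (plane R)) (T : set (set (plane R))).

Lemma triangle_edge_seq_uniq a b c : noncollinear a b c -> uniq (triangle_edge_seq a b c).
Proof.
move=> d0; have [ab bc ac] := noncollinear_neq d0.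
rewrite /= !inE negb_or andbT; apply/andP; split; [apply/andP; split|]; apply/eqP => E.
- by have [[e1 _]|[_ e1]] := open_segment_inj ab E; [apply: ab|apply: ac].
- by have [[e1 _]|[e1 _]] := open_segment_inj ab E; [apply: ac|apply: bc].
- by have [[e1 _]|[_ e1]] := open_segment_inj bc E; [apply: bc|apply: ab].
Qed.

Lemma sum_triangle_edges a b c (sE : seq (set (plane R))) (F : set (plane R) -> R) :
  noncollinear a b c -> uniq sE ->
  (forall e, is_edge (open_triangle a b c) e -> e \notin sE -> F e = 0) ->
  \sum_(e <- triangle_edge_seq a b c) F e = \sum_(e <- sE | `[< is_edge (open_triangle a b c) e >]) F e.
Proof.
move=> d0 us F0.
have E := triangle_edge_seqP d0.
transitivity (\sum_(e <- triangle_edge_seq a b c | e \in sE) F e).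
  rewrite [RHS]big_mkcond big_seq [RHS]big_seq; apply: eq_bigr => e he.
  by case: ifPn => // nh; apply: F0 => //; exact: E.
rewrite -big_filter -[RHS]big_filter; apply: perm_big; apply: uniq_perm.
- by apply: filter_uniq; exact: triangle_edge_seq_uniq.
- exact: filter_uniq.
move=> e; rewrite !mem_filter andbC; case: (e \in sE); rewrite ?andbF// !andbT.
apply/idP/asboolP; first exact: E.
by move=> /(triangle_edges d0)[->|->|->]; rewrite !inE eqxx ?orbT.
Qed.

Lemma edge_signE tau e c : noncollinear (edge_ends e).1 (edge_ends e).2 c ->
  tau = open_triangle (edge_ends e).1 (edge_ends e).2 c ->
  edge_sign tau e = Num.sg (orient (edge_ends e).1 (edge_ends e).2 c).
Proof.
move=> d0 E; rewrite /edge_sign; apply: (sg_orient_mem d0); rewrite -E.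
have [x Tx] := open_triangle_nonempty (edge_ends e).1 (edge_ends e).2 c.
by apply: (getPex (ex_intro _ x _)); rewrite E.
Qed.

(** Distinct elements are disjoint, so by [same_side_meet] the orientations of their third vertices
    with respect to the common edge have opposite signs. *)
Lemma edge_signN Omega T tau tau' e : is_triangulation Omega T -> T tau -> T tau' -> tau <> tau' ->
  is_edge tau e -> is_edge tau' e -> edge_sign tau' e = - edge_sign tau e /\ edge_sign tau e != 0.
Proof.
move=> [_ _ disj _ _] Tt Tt' tt' /is_edge_ends[c [d0 E _]] /is_edge_ends[c' [d0' E' _]].
rewrite (edge_signE d0 E) (edge_signE d0' E').
have n0 : orient (edge_ends e).1 (edge_ends e).2 c != 0 := d0.
have n0' : orient (edge_ends e).1 (edge_ends e).2 c' != 0 := d0'.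
have [s0|s0] := ltP 0 (orient (edge_ends e).1 (edge_ends e).2 c * orient (edge_ends e).1 (edge_ends e).2 c').
  have [x [x1 x2]] := same_side_meet d0 d0' s0.
  have : (tau `&` tau') x by rewrite E E'.
  by rewrite disj.
rewrite sgr_eq0; split => //.
move: n0 n0' s0; move: (orient _ _ c) (orient _ _ c') => y z y0 z0 yz.
have [yp|yn] := ltP 0 y.
  have zn : z < 0 by rewrite lt_neqAle z0 -(pmulr_rle0 _ yp).
  by rewrite (gtr0_sg yp) (ltr0_sg zn).
have {}yn : y < 0 by rewrite lt_neqAle y0.
have zp : 0 < z by rewrite lt_neqAle eq_sym z0 -(nmulr_rle0 _ yn).
by rewrite (gtr0_sg zp) (ltr0_sg yn) opprK.
Qed.

(** A third element would have a sign opposite to those of t1 and of t2, which are opposite to each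
    other and nonzero. *)
Lemma edge_two_elements Omega T tau t1 t2 e : is_triangulation Omega T -> T tau -> T t1 -> T t2 ->
  t1 <> t2 -> is_edge tau e -> is_edge t1 e -> is_edge t2 e -> tau = t1 \/ tau = t2.
Proof.
move=> triT Tt T1 T2 t12 eE e1 e2.
have [->|/eqP n1] := eqVneq tau t1; first by left.
have [->|/eqP n2] := eqVneq tau t2; first by right.
have [h1 h1'] := edge_signN triT Tt T1 n1 eE e1.
have [h2 _] := edge_signN triT Tt T2 n2 eE e2.
have [h3 h3'] := edge_signN triT T1 T2 t12 e1 e2.
by exfalso; move: h3' h3; rewrite h2 h1 opprK oppr_eq0 => /negP h /eqP; rewrite -subr_eq0 -opprD oppr_eq0 -mulr2n mulrn_eq0/=.
Qed.

Lemma sum_two_elements Omega T (sT : seq (set (plane R))) t1 t2 e (F : set (plane R) -> R) :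
  is_triangulation Omega T -> uniq sT -> T = [set` sT] -> T t1 -> T t2 -> t1 <> t2 ->
  is_edge t1 e -> is_edge t2 e ->
  \sum_(tau <- sT | `[< is_edge tau e >]) F tau = F t1 + F t2.
Proof.
move=> triT us ET T1 T2 t12 e1 e2.
have -> : F t1 + F t2 = \sum_(tau <- [:: t1; t2]) F tau by rewrite !big_cons big_nil addr0.
rewrite -big_filter; apply: perm_big; apply: uniq_perm.
- exact: filter_uniq.
- by rewrite /= !inE andbT; apply/eqP.
move=> tau; rewrite mem_filter !inE; apply/andP/orP.
  move=> [/asboolP eE ts]; have Tt : T tau by rewrite ET.
  by have [->|->] := edge_two_elements triT Tt T1 T2 t12 eE e1 e2; [left|right].
move=> [] /eqP ->; split; try exact/asboolP.
  by move: T1; rewrite ET.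
by move: T2; rewrite ET.
Qed.

Lemma continuous_bounded_sqint Omega (B : R) (f : plane R -> R) : measurable (Omega : set (mplane R)) ->
  (forall x, Omega x -> `|x.1| <= B /\ `|x.2| <= B) -> continuous f -> sqint (leb2 R) Omega f.
Proof.
move=> mO OB cf; apply: sqintP.
  by apply: measurable_funTS; exact: continuous_plane_measurable.
by apply: (continuous_integrable mO OB) => x; apply: cvgM; exact: cf.
Qed.

(** A vertex is not in the open triangle, so the bound passes to it through [limit_ge0], which asks
    for a strictly positive affine function; the slack 1 provides it. *)
Lemma vertex_bounded a b c (B : R) : (forall x, open_triangle a b c x -> `|x.1| <= B /\ `|x.2| <= B) ->
  `|a.1| <= B + 1 /\ `|a.2| <= B + 1.
Proof.
move=> H.
have key (k : plane R -> R) : (forall s, k (seg_point a (3^-1 * a.1 + 3^-1 * b.1 + 3^-1 * c.1,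
    3^-1 * a.2 + 3^-1 * b.2 + 3^-1 * c.2) s) = k a + s * (k (3^-1 * a.1 + 3^-1 * b.1 + 3^-1 * c.1,
    3^-1 * a.2 + 3^-1 * b.2 + 3^-1 * c.2) - k a)) ->
    (forall x, open_triangle a b c x -> 0 < k x) -> 0 <= k a.
  move=> kE kT; apply: (limit_ge0 (v := k (3^-1 * a.1 + 3^-1 * b.1 + 3^-1 * c.1,
    3^-1 * a.2 + 3^-1 * b.2 + 3^-1 * c.2))) => s s0 s1.
  rewrite -kE; apply: kT; exists (1 - s + s / 3), (s / 3), (s / 3); split; [lra|lra|lra|lra|].
  by rewrite /seg_point/=; congr pair; field.
have k1 := key (fun x => B + 1 - x.1); have k2 := key (fun x => B + 1 + x.1).
have k3 := key (fun x => B + 1 - x.2); have k4 := key (fun x => B + 1 + x.2).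
have := k1 _ _; have := k2 _ _; have := k3 _ _; have := k4 _ _ => /= h4 h3 h2 h1.
rewrite !ler_norml; split; apply/andP; split.
- rewrite -subr_ge0 opprK addrC; apply: h2 => [s|x /H[]]; [ring|rewrite ler_norml => /andP[]; lra].
- rewrite -subr_ge0; apply: h1 => [s|x /H[]]; [ring|rewrite ler_norml => /andP[]; lra].
- rewrite -subr_ge0 opprK addrC; apply: h4 => [s|x /H[_]]; [ring|rewrite ler_norml => /andP[]; lra].
- rewrite -subr_ge0; apply: h3 => [s|x /H[_]]; [ring|rewrite ler_norml => /andP[]; lra].
Qed.

End MeshSums.

(** * The weak derivative estimate, summed over the mesh *)

Section DerivativeBound.
Context (R : realType).
Local Notation mu := (@lebesgue_measure R).
Local Notation I01 := (`]0%R, 1%R[%classic : set (measurableTypeR R)).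
Implicit Types (a b c p q : plane R) (tau e : set (plane R)).
Variables (Omega : set (plane R)) (T : set (set (plane R))) (u : mplane R -> R) (B C K : R).
Hypotheses (oO : open Omega) (OB : forall x, Omega x -> `|x.1| <= B /\ `|x.2| <= B).
Hypotheses (triT : is_triangulation Omega T) (regT : forall tau, T tau -> triangle_regularity tau <= K).
Hypotheses (Hu : in_H1h Omega T u) (HC : (H1h_norm Omega T u <= C%:E)%E) (K0 : 0 <= K).

Let mO : measurable (Omega : set (mplane R)). Proof. exact: open_plane_measurable. Qed.

Let elemP tau : T tau -> exists a b c, noncollinear a b c /\ tau = open_triangle a b c.
Proof. by move: triT => [_ h _ _ _] /h[[a [b [c H]]] _]; exists a, b, c. Qed.

Let melem tau : T tau -> measurable (tau : set (mplane R)).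
Proof. by move=> /elemP[a [b [c [d0 ->]]]]; exact: open_triangle_measurable. Qed.

Let elem_sub tau : T tau -> tau `<=` Omega.
Proof. by move: triT => [_ h _ _ _] /h[]. Qed.

Let mU : measurable (element_union T : set (mplane R)).
Proof.
apply: open_plane_measurable; apply: bigcup_open => tau /elemP[a [b [c [d0 ->]]]].
exact: open_triangle_open.
Qed.

Let US : element_union T `<=` Omega.
Proof. by move=> x [tau /elem_sub sub]; exact: sub. Qed.

Let int_split (sT : seq (set (plane R))) (f : mplane R -> R) : uniq sT -> T = [set` sT] ->
  (leb2 R).-integrable Omega (EFin \o f) ->
  \int[leb2 R]_(x in Omega) f x = \sum_(tau <- sT) \int[leb2 R]_(x in tau) f x.
Proof.
move=> us ET fi; apply: Rintegral_disjoint_seq => //.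
- by move=> E Es; have TE : T E by [rewrite ET]; split; [exact: melem|exact: elem_sub].
- move=> E E' Es Es'; have TE : T E by [rewrite ET]; have TE' : T E' by [rewrite ET].
  by case: triT => _ _ h _ _; exact: h.
- rewrite -(triangulation_null oO triT); congr (leb2 R (_ `\` _)).
  by apply/seteqP; split => x; [move=> [E Es Ex]; exists E; rewrite ?ET|move=> [E TE Ex]; exists E => //; move: TE; rewrite ET].
Qed.

Let int_splitU (sT : seq (set (plane R))) (f : mplane R -> R) : uniq sT -> T = [set` sT] ->
  (leb2 R).-integrable (element_union T) (EFin \o f) ->
  \int[leb2 R]_(x in element_union T) f x = \sum_(tau <- sT) \int[leb2 R]_(x in tau) f x.
Proof.
move=> us ET fi; apply: Rintegral_disjoint_seq => //.
- move=> E Es; have TE : T E by [rewrite ET]; split; first exact: melem.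
  by move=> x Ex; exists E.
- move=> E E' Es Es'; have TE : T E by [rewrite ET]; have TE' : T E' by [rewrite ET].
  by case: triT => _ _ h _ _; exact: h.
- rewrite (_ : _ `\` _ = set0) ?measure0//; apply/seteqP; split => // x [[E TE Ex]]; apply.
  by exists E => //; move: TE; rewrite ET.
Qed.

(** Shape regularity gives |e|^2 <= 4 K |orient|, and |orient| times the edge mean is what the trace
    inequality bounds. Each element is charged by at most three edges: 12 = 4 * 3. The length 2 B +
    1 bounds |x - c| coordinatewise, with B for x and B + 1 for the vertex, and stands in for any
    mesh size. *)
Lemma sum_edges_trace (sE : seq (set (plane R))) (t1 : set (plane R) -> set (plane R))
    (eta etax etay : plane R -> R) : uniq sE ->
  (forall e, e \in sE -> T (t1 e) /\ is_edge (t1 e) e) ->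
  has_partials eta etax etay -> (forall x, 0 <= eta x) ->
  \sum_(e <- sE) edge_length e ^+ 2 * \int[mu]_(t in I01) eta (edge_point e t) <=
  12 * K * \int[leb2 R]_(x in Omega) (2 * eta x + (2 * B + 1) * (`|etax x| + `|etay x|)).
Proof.
move=> us t1P heta eta0; set H := 2 * B + 1.
have [ceta cetax cetay _ _] := heta.
pose G x := 2 * eta x + H * (`|etax x| + `|etay x|).
have cG : continuous G.
  move=> x; apply: cvgD; first by apply: cvgMr; exact: ceta.
  by apply: cvgMr; apply: cvgD; apply: cvg_norm; [exact: cetax|exact: cetay].
have iG : (leb2 R).-integrable Omega (EFin \o G) := continuous_integrable mO OB cG.
have key e : e \in sE -> edge_length e ^+ 2 * \int[mu]_(t in I01) eta (edge_point e t) <=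
    4 * K * \int[leb2 R]_(x in t1 e) G x.
  move=> he; have [T1 e1] := t1P e he; have [c [d0 E _]] := is_edge_ends e1.
  have d1 : noncollinear c (edge_ends e).1 (edge_ends e).2 by do 2 apply: noncollinear_rot.
  have E' : t1 e = open_triangle c (edge_ends e).1 (edge_ends e).2 by rewrite E open_triangle_rot open_triangle_rot.
  have reg : triangle_regularity (open_triangle (edge_ends e).1 (edge_ends e).2 c) <= K by rewrite -E; exact: regT.
  have := shape_regular_edge d0 reg; rewrite -/(edge_length e) => L2.
  have bd x : open_triangle c (edge_ends e).1 (edge_ends e).2 x -> `|x.1| <= B /\ `|x.2| <= B.
    by rewrite -E' => /(elem_sub T1)/OB.
  have [c1 c2] := vertex_bounded bd.
  have trB x : open_triangle c (edge_ends e).1 (edge_ends e).2 x -> `|x.1 - c.1| <= H /\ `|x.2 - c.2| <= H.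
    move=> /bd[x1 x2]; have := ler_normB x.1 c.1; have := ler_normB x.2 c.2.
    by rewrite /H; split; lra.
  have := trace_inequality d1 heta eta0 trB; rewrite -E' (orient_rot c) /edge_integral => tr.
  have I0 : 0 <= \int[mu]_(t in I01) eta (edge_point e t).
    by apply: Rintegral_ge0 => t _; exact: eta0.
  apply: (le_trans (ler_wpM2r I0 L2)); rewrite -[leLHS]mulrA; apply: ler_wpM2l; first by rewrite mulr_ge0.
  exact: tr.
apply: (@le_trans _ _ (\sum_(e <- sE) 4 * K * \int[leb2 R]_(x in t1 e) G x)).
  by rewrite [leLHS]big_seq [leRHS]big_seq; apply: ler_sum => e; exact: key.
have [s0 Es0] := (finite_seqP _).1 (let: And5 h _ _ _ _ := triT in h).
have usT := undup_uniq s0.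
have ET : T = [set` undup s0] by rewrite Es0; apply/seteqP; split => x /=; rewrite mem_undup.
have intG tau : T tau -> 0 <= \int[leb2 R]_(x in tau) G x.
  move=> Tt; apply: Rintegral_ge0 => x tx.
  have [h1 h2] := OB (elem_sub Tt tx).
  by rewrite /G /H addr_ge0 ?mulr_ge0 ?addr_ge0// mulr_ge0//; apply: le_trans h1.
rewrite -mulr_sumr (_ : 12 * K = 4 * K * 3); last by ring.
rewrite -[leRHS]mulrA; apply: ler_wpM2l; first by rewrite mulr_ge0.
apply: (@le_trans _ _ (\sum_(e <- sE) \sum_(tau <- undup s0 | `[< is_edge tau e >]) \int[leb2 R]_(x in tau) G x)).
  rewrite [leLHS]big_seq [leRHS]big_seq; apply: ler_sum => e he; have [T1 e1] := t1P e he.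
  rewrite big_mkcond/= (bigD1_seq (t1 e))//=; last first.
    by move: T1; rewrite ET.
  rewrite asboolT// lerDl big_seq_cond; apply: sumr_ge0 => tau /andP[ts _].
  by case: ifP => // _; apply: intG; rewrite ET.
under eq_bigr do rewrite big_mkcond/=.
rewrite exchange_big/= (int_split usT ET iG) mulr_sumr [leLHS]big_seq [leRHS]big_seq.
apply: ler_sum => tau ts; have Tt : T tau by rewrite ET.
have [a [b [c [d0 E]]]] := elemP Tt.
rewrite -big_mkcond/= {1}E.
have G0 := intG _ Tt.
apply: (@le_trans _ _ (\sum_(e <- triangle_edge_seq a b c) if e \in sE then \int[leb2 R]_(x in tau) G x else 0)).
  rewrite (sum_triangle_edges (sE := sE) d0 us) => [|e _ /negPf ->]//.
  rewrite [leLHS]big_seq_cond [leRHS]big_seq_cond; apply: ler_sum => e /andP[-> _].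
  exact: lexx.
have h e : (if e \in sE then \int[leb2 R]_(x in tau) G x else 0) <= \int[leb2 R]_(x in tau) G x.
  by case: ifP.
rewrite !big_cons big_nil addr0.
have := h (open_segment a b); have := h (open_segment b c); have := h (open_segment c a); lra.
Qed.

Lemma edge_flux_le tau tau' e : is_edge tau e ->
  `|edge_flux_y tau' e| <= edge_length e /\ `|edge_flux_x tau' e| <= edge_length e.
Proof.
move=> eE; have [h1 h2] := edist_coord (edge_ends e).1 (edge_ends e).2.
have sg : `|edge_sign tau' e| <= 1.
  by rewrite /edge_sign normr_sg; case: (_ != 0); rewrite ?ler01 ?lexx.
rewrite /edge_flux_y /edge_flux_x !normrM; split.
  by rewrite -[leRHS]mul1r; apply: ler_pM => //; rewrite distrC.
by rewrite -[leRHS]mul1r; apply: ler_pM => //; rewrite distrC.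
Qed.

Let le_sum3 (i1 i2 k x y z : R) :
  i1 <= k + x -> i2 <= k + y -> y <= z -> i1 + i2 <= (k + k) + (x + z).
Proof. lra. Qed.

(** The part common to both coordinate directions: [D] is the derivative of [phi] in the direction,
    [g] the component of the broken gradient, [flux] the normal component. Volume and edge terms
    each get half of the weight [s] in Young's inequality. *)
Let derivative_bound (g : plane R -> R) sE t1 t2 g1 g2 (phi eta etax etay D : plane R -> R)
    (flux : set (plane R) -> set (plane R) -> R) (s : R) :
  sqint (leb2 R) (element_union T) g ->
  \int[leb2 R]_(x in element_union T) g x ^+ 2 <= C ^+ 2 + 1 ->
  uniq sE -> interior_edges Omega T = [set` sE] -> jump_data T u sE t1 t2 g1 g2 ->
  \sum_(e <- sE) \int[mu]_(t in I01) (g1 e (edge_point e t) - g2 e (edge_point e t)) ^+ 2 <= C ^+ 2 + 1 ->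
  continuous phi -> continuous D ->
  (forall e tau, e \in sE -> `|flux tau e| <= edge_length e) ->
  (forall e, e \in sE -> flux (t2 e) e = - flux (t1 e) e) ->
  (forall a b c, let tau := open_triangle a b c in noncollinear a b c -> T tau ->
    \int[leb2 R]_(x in tau) (u x * D x) = - (\int[leb2 R]_(x in tau) (g x * phi x)) +
    \sum_(e <- sE | `[< is_edge tau e >])
      flux tau e * set_edge_integral e (fun x => (if `[< tau = t1 e >] then g1 e else g2 e) x * phi x)) ->
  has_partials eta etax etay -> (forall x, phi x ^+ 2 <= eta x) -> 0 < s ->
  `|\int[leb2 R]_(x in Omega) (u x * D x)| <= s * (C ^+ 2 + 1) + (2 * s)^-1 *
    (\int[leb2 R]_(x in Omega) eta x +
     12 * K * \int[leb2 R]_(x in Omega) (2 * eta x + (2 * B + 1) * (`|etax x| + `|etay x|))).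
Proof.
move=> sg gM us EsE jd jM cphi cD fluxL fluxN ident heta phieta s0.
have [ceta _ _ _ _] := heta.
have eta0 x : 0 <= eta x by apply: le_trans (phieta x); exact: sqr_ge0.
have su : sqint (leb2 R) Omega u by case: Hu.
have sD := continuous_bounded_sqint mO OB cD.
have sphi := continuous_bounded_sqint mO OB cphi.
have ieta : (leb2 R).-integrable Omega (EFin \o eta) := continuous_integrable mO OB ceta.
have sphiU := sqint_subset mO mU US sphi.
have mI : measurable I01 by exact: measurable_itv.
have [s0' Es0] := (finite_seqP _).1 (let: And5 h _ _ _ _ := triT in h).
have usT := undup_uniq s0'.
have ET : T = [set` undup s0'] by rewrite Es0; apply/seteqP; split => x /=; rewrite mem_undup.
set sT := undup s0' in usT ET.
have sphiI e : sqint mu I01 (phi \o edge_point e) := @continuous_edge_sqint R e phi cphi.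
have sgI e : e \in sE -> sqint mu I01 (g1 e \o edge_point e) /\ sqint mu I01 (g2 e \o edge_point e).
  move=> he; have [_ e1 e2 [h1 _] [h2 _]] := jd e he.
  by have [? _] := edge_L2_sqE e1 h1; have [? _] := edge_L2_sqE e2 h2.
(* After exchanging the sums over elements and edges, each interior edge is met by exactly two
   elements, with opposite fluxes, so the two traces combine into the jump. *)
have E0 : \int[leb2 R]_(x in Omega) (u x * D x) = - (\int[leb2 R]_(x in element_union T) (g x * phi x)) +
    \sum_(e <- sE) \int[mu]_(t in I01) ((g1 e (edge_point e t) - g2 e (edge_point e t)) * (flux (t1 e) e * phi (edge_point e t))).
  rewrite (int_split usT ET (sqintM mO su sD)) (int_splitU usT ET (sqintM mU sg sphiU)).
  transitivity (\sum_(tau <- sT) (- (\int[leb2 R]_(x in tau) (g x * phi x)) +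
    \sum_(e <- sE) if `[< is_edge tau e >] then
      flux tau e * set_edge_integral e (fun x => (if `[< tau = t1 e >] then g1 e else g2 e) x * phi x) else 0)).
    rewrite big_seq [RHS]big_seq; apply: eq_bigr => tau ts; have Tt : T tau by rewrite ET.
    have [a [b [c [d0 E]]]] := elemP Tt.
    by rewrite -big_mkcond/=; move: Tt; rewrite E => Tt; exact: ident.
  rewrite big_split/= sumrN exchange_big/=; congr (_ + _).
  rewrite big_seq [RHS]big_seq; apply: eq_bigr => e he.
  have [[T1 T2 t12] e1 e2 _ _] := jd e he.
  rewrite -big_mkcond/= (sum_two_elements _ triT usT ET T1 T2 t12 e1 e2).
  rewrite asboolT// asboolF; last by move/esym.
  have [sg1 sg2] := sgI e he.
  rewrite (fluxN e he) mulNr -mulrBr /set_edge_integral.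
  rewrite -(RintegralB mI (sqintM mI sg1 (sphiI e)) (sqintM mI sg2 (sphiI e))).
  rewrite -(RintegralZl _ mI (integrableRB mI (sqintM mI sg1 (sphiI e)) (sqintM mI sg2 (sphiI e)))).
  by apply: eq_Rintegral => t _ /=; ring.
have b1 : `|\int[leb2 R]_(x in element_union T) (g x * phi x)| <=
    s / 2 * (C ^+ 2 + 1) + (2 * s)^-1 * \int[leb2 R]_(x in Omega) eta x.
  apply: (le_trans (young_sqint mU s0 sg sphiU)); apply: lerD.
    by apply: ler_wpM2l => //; rewrite divr_ge0 ?ltW.
  apply: ler_wpM2l; first by rewrite invr_ge0 mulr_ge0 ?ltW.
  apply: (@le_trans _ _ (\int[leb2 R]_(x in Omega) phi x ^+ 2)).
    rewrite -lee_fin !EFin_sqint//; apply: ge0_subset_integral => //.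
      by apply/measurable_EFinP; apply: measurable_funX; case: sphi.
    by move=> x _; rewrite lee_fin sqr_ge0.
  by apply: le_Rintegral => //; exact: (sqint_integrable sphi).
have b2 : `|\sum_(e <- sE) \int[mu]_(t in I01) ((g1 e (edge_point e t) - g2 e (edge_point e t)) * (flux (t1 e) e * phi (edge_point e t)))|
    <= s / 2 * (C ^+ 2 + 1) + (2 * s)^-1 * \sum_(e <- sE) edge_length e ^+ 2 * \int[mu]_(t in I01) eta (edge_point e t).
  apply: (@le_trans _ _ (\sum_(e <- sE) (s / 2 * \int[mu]_(t in I01) (g1 e (edge_point e t) - g2 e (edge_point e t)) ^+ 2 +
    (2 * s)^-1 * (edge_length e ^+ 2 * \int[mu]_(t in I01) eta (edge_point e t))))); last first.
    rewrite big_split/= -!mulr_sumr lerD2r; apply: ler_wpM2l => //.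
    by rewrite divr_ge0 ?ltW.
  apply: (le_trans (ler_norm_sum _ _ _)); rewrite [leLHS]big_seq [leRHS]big_seq.
  apply: ler_sum => e he; have [sg1 sg2] := sgI e he.
  have := young_sqint mI s0 (sqintB mI sg1 sg2) (sqintZ mI (flux (t1 e) e) (sphiI e)) => /= yb.
  apply: (le_trans yb); rewrite lerD2l; apply: ler_wpM2l; first by rewrite invr_ge0 mulr_ge0 ?ltW.
  have ie : mu.-integrable I01 (EFin \o (eta \o edge_point e)) := edge_integrable _ _ ceta.
  rewrite -(RintegralZl _ mI ie).
  apply: le_Rintegral => //.
  - exact: (sqint_integrable (sqintZ mI _ (sphiI e))).
  - exact: (integrableRZ mI _ ie).
  - move=> t _ /=; rewrite exprMn; apply: ler_pM; rewrite ?sqr_ge0//.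
    rewrite -[leLHS]real_normK ?num_real// ler_sqr ?nnegrE//; first exact: fluxL.
    exact: edist_ge0.
have b3 : \sum_(e <- sE) edge_length e ^+ 2 * \int[mu]_(t in I01) eta (edge_point e t) <=
    12 * K * \int[leb2 R]_(x in Omega) (2 * eta x + (2 * B + 1) * (`|etax x| + `|etay x|)).
  apply: (sum_edges_trace us (t1 := t1)) => // e he.
  by have [[T1 _ _] e1 _ _ _] := jd e he.
rewrite E0; apply: (le_trans (ler_normD _ _)); rewrite normrN.
have s2 : 0 <= (2 * s)^-1 by rewrite invr_ge0 mulr_ge0 ?ltW.
have -> : s * (C ^+ 2 + 1) = s / 2 * (C ^+ 2 + 1) + s / 2 * (C ^+ 2 + 1) by field.
by rewrite [X in _ <= _ + X]mulrDr; exact: le_sum3 b1 b2 (ler_wpM2l s2 b3).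
Qed.

(* Young's inequality with parameter s on the Green formula summed over the
   elements; [eta] dominates [phi ^+ 2], so that no bound on the gradient of [phi]
   is needed. *)
Lemma weak_derivative_bound (phi eta etax etay : plane R -> R) (s : R) :
  C1c Omega phi -> has_partials eta etax etay -> (forall x, phi x ^+ 2 <= eta x) -> 0 < s ->
  let S := s * (C ^+ 2 + 1) + (2 * s)^-1 * (\int[leb2 R]_(x in Omega) eta x +
     12 * K * \int[leb2 R]_(x in Omega) (2 * eta x + (2 * B + 1) * (`|etax x| + `|etay x|))) in
  `|\int[leb2 R]_(x in Omega) (u x * dx phi x)| <= S /\
  `|\int[leb2 R]_(x in Omega) (u x * dy phi x)| <= S.
Proof.
move=> [cphi [Ks [cK KO phi0]]] heta phieta s0 S.
have hphi := C1_has_partials cphi; have [cp cpx cpy _ _] := hphi.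
have [g [sE [t1 [t2 [g1 [g2 [_ [wg [M1 M2]] [us EsE] jd jM]]]]]]] := mesh_data oO triT Hu HC.
have [sg1 sg2 _] := wg.
have su : sqint (leb2 R) Omega u by case: Hu.
pose tr tau e := if `[< tau = t1 e >] then g1 e else g2 e.
have eE e : e \in sE -> is_edge (t1 e) e by move=> /jd[].
(* An element edge that is not interior lies in the boundary of Omega, slits included; [phi]
   vanishes there because its support is a subset of the open set Omega. *)
have bdy0 tau e : T tau -> is_edge tau e -> e \notin sE -> e `<=` boundary Omega.
  move=> Tt eE' nE; apply: contrapT => nb; move/negP: nE; apply.
  have : interior_edges Omega T e by split => //; exists tau.
  by rewrite EsE.
have bO x : boundary Omega x -> ~ Omega x by move=> [_]; rewrite (interior_id _).1.
have phib x : boundary Omega x -> phi x = 0 by move=> /bO nO; apply: phi0 => /KO.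
have ident a b c : let tau := open_triangle a b c in noncollinear a b c -> T tau ->
    \int[leb2 R]_(x in tau) (u x * dx phi x) = - (\int[leb2 R]_(x in tau) ((g x).1 * phi x)) +
    \sum_(e <- sE | `[< is_edge tau e >]) edge_flux_y tau e * set_edge_integral e (fun x => tr tau e x * phi x) /\
    \int[leb2 R]_(x in tau) (u x * dy phi x) = - (\int[leb2 R]_(x in tau) ((g x).2 * phi x)) +
    \sum_(e <- sE | `[< is_edge tau e >]) (- edge_flux_x tau e) * set_edge_integral e (fun x => tr tau e x * phi x).
  move=> tau d0 Tt.
  have sut : sqint (leb2 R) tau u := sqint_subset mO (melem Tt) (elem_sub Tt) su.
  have wgt : weak_gradient tau u g.
    by apply: (weak_gradient_subset mU (melem Tt) _ wg) => x tx; exists tau.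
  (* One interior edge suffices to supply C1 approximants of [u] on the element; an element without
     any needs the other argument. *)
  have [[e0 he0 e0E]|nE] := pselect (exists2 e, e \in sE & is_edge tau e).
    have trP e : e \in sE -> is_edge tau e -> is_trace tau e u (tr tau e).
      move=> he eE'; have [[T1 T2 t12] e1 e2 h1 h2] := jd e he; rewrite /tr.
      case: asboolP => [->//|n1].
      have [/n1 []|E] := edge_two_elements triT Tt T1 T2 t12 eE' e1 e2.
      by rewrite E; exact: h2.
    have trP' e : is_edge tau e -> is_trace tau e u (tr tau e) \/ forall x, e x -> phi x = 0.
      move=> eE'; have [he|he] := boolP (e \in sE); [left; exact: trP|right => x ex].
      by apply: phib; exact: (bdy0 tau e Tt eE' he).
    have exE : exists2 e, is_edge tau e & is_trace tau e u (tr tau e) by exists e0 => //; exact: trP.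
    have [i1 i2] := element_identity d0 sut wgt hphi trP' exE.
    have F0 (f : set (plane R) -> R) e : is_edge tau e -> e \notin sE ->
        f e * set_edge_integral e (fun x => tr tau e x * phi x) = 0.
      move=> eE' he; rewrite (set_edge_integral_eq0 eE') ?mulr0// => x ex.
      by rewrite phib ?mulr0//; exact: (bdy0 tau e Tt eE' he).
    rewrite (sum_triangle_edges d0 us (F0 (edge_flux_y tau))) in i1.
    rewrite (sum_triangle_edges d0 us (F0 (edge_flux_x tau))) -sumrN in i2.
    split; first exact: i1.
    by under eq_bigr do rewrite mulNr; exact: i2.
  (* All three sides now lie on the boundary of Omega, so the support of [phi] avoids them and meets
     the closure of tau only inside tau. *)
  have nE' e : is_edge tau e -> e `<=` boundary Omega.
    by move=> eE'; apply: (bdy0 tau) => //; apply/negP => he; apply: nE; exists e.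
  have clb : closed (boundary Omega).
    rewrite /boundary (interior_id _).1// setDE; apply: closedI; first exact: closed_closure.
    exact: open_closedC.
  have eS := triangle_edge_seqP d0.
  have KT : Ks `&` closure tau `<=` tau.
    move=> x [Kx /(closure_triangle_sub d0)/closed_triangle_cases[//|h|h|h]]; exfalso;
      apply: (bO x) (KO _ Kx); apply: (closed_segment_sub clb _ h); apply: nE'; apply: eS.
    + by rewrite !inE eqxx.
    + by rewrite !inE eqxx orbT.
    + by rewrite !inE eqxx !orbT.
  have S0 (f : set (plane R) -> R) : \sum_(e <- sE | `[< is_edge tau e >]) f e = 0.
    rewrite big_seq_cond big_pred0// => e; apply/negP => /andP[he /asboolP eE'].
    by apply: nE; exists e.
  have [i1 i2] := inner_element_identity d0 wgt cphi cK KT phi0.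
  by rewrite !S0 !addr0; split; [exact: i1|exact: i2].
have fl e tau : e \in sE -> `|edge_flux_y tau e| <= edge_length e /\ `|edge_flux_x tau e| <= edge_length e.
  by move=> /eE eE'; exact: edge_flux_le eE'.
have sN e : e \in sE -> edge_sign (t2 e) e = - edge_sign (t1 e) e.
  move=> he; have [[T1 T2 t12] e1 e2 h1 h2] := jd e he.
  by have [] := edge_signN triT T1 T2 t12 e1 e2.
split.
- have f1 e tau : e \in sE -> `|edge_flux_y tau e| <= edge_length e by move=> he; have [] := fl e tau he.
  have n1 e : e \in sE -> edge_flux_y (t2 e) e = - edge_flux_y (t1 e) e.
    by move=> /sN E; rewrite /edge_flux_y E mulNr.
  exact: (derivative_bound sg1 M1 us EsE jd jM cp cpx f1 n1 (fun a b c d0 Tt => (ident a b c d0 Tt).1) heta phieta s0).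
- have f2 e tau : e \in sE -> `|- edge_flux_x tau e| <= edge_length e.
    by move=> he; have [_] := fl e tau he; rewrite normrN.
  have n2 e : e \in sE -> - edge_flux_x (t2 e) e = - - edge_flux_x (t1 e) e.
    by move=> /sN E; rewrite /edge_flux_x E mulNr.
  exact: (derivative_bound (flux := fun tau e => - edge_flux_x tau e) sg2 M2 us EsE jd jM cp cpy f2 n2
    (fun a b c d0 Tt => (ident a b c d0 Tt).2) heta phieta s0).
Qed.

End DerivativeBound.

(** * Haar coefficients on a parallelogram *)

Section DominoFunctions.
Context (R : realType).
Implicit Types (m n i j N : nat) (t : R).

(** Disjointness makes the sum equal to its own square, hence 0 or 1. *)
Lemma sum_dyadic_ind_le1 m t : \sum_(i < 2 ^ m) dyadic_ind m i t <= 1.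
Proof.
set X := \sum_(i < _) _.
have X0 : 0 <= X by apply: sumr_ge0 => i _; exact: ler0n.
have E : X * X = X.
  rewrite /X mulr_suml; apply: eq_bigr => i _; rewrite mulr_sumr (bigD1 i)//=.
  rewrite dyadic_ind_disjoint eqxx mul1r big1 ?addr0// => k ki.
  by rewrite dyadic_ind_disjoint (inj_eq val_inj) eq_sym (negPf ki) mul0r.
have [->//|X1] := eqVneq X 0.
by have -> : X = 1 by apply: (mulfI X1); rewrite E mulr1.
Qed.

(** The tent has base [0, 2]; at scale 2^-(m+1) it spans two consecutive cells, which form one cell
    of level m. *)
Lemma tent_le_dyadic N m i t : 0 <= tent N (t * 2 ^+ m.+1 - (i * 2)%:R) <= dyadic_ind m i t.
Proof.
rewrite tent_ge0/= /dyadic_ind in_dyadic_itv; set z := t * _ - _.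
have E : z = 2 * (t * 2 ^+ m - i%:R) by rewrite /z natrM exprS; ring.
have [z0|z0] := leP z 0; first by rewrite tent_eq0 ?ler0n//; left; apply: le_trans z0 _.
have [z2|z2] := leP 2 z.
  by rewrite tent_eq0 ?ler0n//; right; apply: le_trans z2; rewrite gerBl.
rewrite (_ : (i%:R <= t * 2 ^+ m < i.+1%:R) = true) ?tent_le1//.
by rewrite -[i.+1]addn1 natrD; apply/andP; split; lra.
Qed.

Lemma bump_le_dyadic N m j t : 0 <= bump N (t * 2 ^+ m - j%:R) <= dyadic_ind m j t.
Proof.
rewrite bump_ge0/= /dyadic_ind in_dyadic_itv.
have [z0|z0] := boolP (t * 2 ^+ m - j%:R \in `]0, 1[); last by rewrite bump_outside// ler0n.
move: z0; rewrite in_itv/= => /andP[z0 z1].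
rewrite (_ : (j%:R <= t * 2 ^+ m < j.+1%:R) = true) ?bump_le1//.
by rewrite -[j.+1]addn1 natrD; apply/andP; split; lra.
Qed.

Lemma dyadic_le_hat m i t :
  dyadic_ind m i t <= hat (t * 2 ^+ m - i%:R) /\
  dyadic_ind m i t <= hat (t * 2 ^+ m.+1 - (i * 2)%:R).
Proof.
rewrite /dyadic_ind in_dyadic_itv; case: andP => [[h1 h2]|_]; last by rewrite !hat_ge0.
move: h2; rewrite -[i.+1]addn1 natrD => h2; split; apply: hat_ge1; first by apply/andP; split; lra.
by rewrite natrM exprS; apply/andP; split; lra.
Qed.

(** Jensen's inequality, from nonnegativity of the sum of (c_k - X)^2 w_k with X the weighted sum;
    weights of total mass below 1 go in the right direction. *)
Lemma weighted_sqr_le (I : finType) (c w : I -> R) : (forall k, 0 <= w k) -> \sum_k w k <= 1 ->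
  (\sum_k c k * w k) ^+ 2 <= \sum_k c k ^+ 2 * w k.
Proof.
move=> w0 w1.
have E (X : R) : \sum_k (c k - X) ^+ 2 * w k =
    \sum_k c k ^+ 2 * w k - 2 * X * (\sum_k c k * w k) + X ^+ 2 * \sum_k w k.
  by rewrite !mulr_sumr -sumrB -big_split/=; apply: eq_bigr => k _; ring.
set X := \sum_k c k * w k.
have : 0 <= \sum_k (c k - X) ^+ 2 * w k by apply: sumr_ge0 => k _; rewrite mulr_ge0 ?sqr_ge0.
rewrite E -/X; have := ler_wpM2l (sqr_ge0 X) w1; rewrite mulr1.
have e : 2 * X * X = X ^+ 2 + X ^+ 2 by ring.
rewrite e; move: (X ^+ 2) (\sum_k _ * _) (_ * \sum_k w k) => x y z; lra.
Qed.

End DominoFunctions.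

(** * Test functions attached to dominoes of two dyadic cells *)

Section Domino.
Context (R : realType).
Variables (k1 l1 m1 k2 l2 m2 : R) (v : plane R) (m : nat).
Let n := m.+1.
Let D : R := 2 ^+ n.
Local Notation I := ('I_(2 ^ m) * 'I_(2 ^ n))%type.
Variable c : I -> R.
Let c1 (x : plane R) := k1 + x.1 * l1 + x.2 * m1.
Let c2 (x : plane R) := k2 + x.1 * l2 + x.2 * m2.
Hypotheses (e1 : v.1 * l1 + v.2 * m1 = 1) (e2 : v.1 * l2 + v.2 * m2 = 0).

Let D0 : 0 < D. Proof. exact: exprn_gt0. Qed.

(** A domino is two cells long in the coordinate c1 and one cell wide in c2, hence the index doubled
    here and not in [strip2]. The argument is expanded into an affine form of x to match
    [has_partials_affine]. *)
Definition strip1 (F : R -> R) (k : I) (x : plane R) : R :=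
  F ((k1 * D - (k.1 * 2)%:R) + x.1 * (l1 * D) + x.2 * (m1 * D)).
Definition strip2 (F : R -> R) (k : I) (x : plane R) : R :=
  F ((k2 * D - k.2%:R) + x.1 * (l2 * D) + x.2 * (m2 * D)).

Lemma strip1E F k x : strip1 F k x = F (c1 x * D - (k.1 * 2)%:R).
Proof. by rewrite /strip1 /c1; congr F; ring. Qed.

Lemma strip2E F k x : strip2 F k x = F (c2 x * D - k.2%:R).
Proof. by rewrite /strip2 /c2; congr F; ring. Qed.

Lemma has_partials_strips (F dF G dG : R -> R) (a : I -> R) :
  continuous dF -> continuous dG -> (forall t : R, is_derive t (1 : R) F (dF t)) ->
  (forall t : R, is_derive t (1 : R) G (dG t)) ->
  has_partials (fun x => \sum_k a k * (strip1 F k x * strip2 G k x))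
    (fun x => \sum_k a k * (strip1 dF k x * (l1 * D) * strip2 G k x + strip1 F k x * (strip2 dG k x * (l2 * D))))
    (fun x => \sum_k a k * (strip1 dF k x * (m1 * D) * strip2 G k x + strip1 F k x * (strip2 dG k x * (m2 * D)))).
Proof.
move=> cF cG dF' dG'; apply: has_partials_sum => k; apply: has_partialsZ.
exact: (has_partialsM (has_partials_affine _ _ _ cF dF') (has_partials_affine _ _ _ cG dG')).
Qed.

(** The factor 1/D compensates the chain rule, so that the derivative along [v] tends to the
    combination of Haar functions with coefficients exactly [c]. *)
Definition domino_test N (x : plane R) : R :=
  \sum_k c k * D^-1 * (strip1 (tent N) k x * strip2 (bump N) k x).

(* The gradient of [domino_test N] blows up with N, that of its majorant does
   not: only the majorant enters the trace inequality. *)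
Definition domino_majorant (x : plane R) : R :=
  \sum_k (c k * D^-1) ^+ 2 * (strip1 (@hat R) k x * strip2 (@hat R) k x).

(** Along [v] the form c1 has slope 1 and c2 slope 0: the derivative falls on the tent only, and the
    unbounded derivative of the bump never appears. *)
Lemma domino_test_partials N : exists phix phiy, has_partials (domino_test N) phix phiy /\
  forall x, v.1 * phix x + v.2 * phiy x = \sum_k c k * (strip1 (dtent N) k x * strip2 (bump N) k x).
Proof.
have H := has_partials_strips (fun k => c k * D^-1) (@continuous_dtent R N) (@continuous_dbump R N)
  (@is_derive_tent R N) (@is_derive_bump R N).
do 2 eexists; split; first exact: H.
move=> x; rewrite !mulr_sumr -big_split/=; apply: eq_bigr => k _.
transitivity (c k * (D^-1 * D) * (strip1 (dtent N) k x * strip2 (bump N) k x * (v.1 * l1 + v.2 * m1) +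
   strip1 (tent N) k x * strip2 (dbump N) k x * (v.1 * l2 + v.2 * m2))); first by ring.
by rewrite e1 e2 mulVf ?gt_eqF// !mulr1 mulr0 addr0.
Qed.

(** Tents and bumps lie below the indicators of disjoint dyadic cells, so the sum is at most a
    product of two sums bounded by 1. This feeds [weighted_sqr_le]. *)
Lemma strips_weights N x : (forall k, 0 <= strip1 (tent N) k x * strip2 (bump N) k x <=
    strip1 (@hat R) k x * strip2 (@hat R) k x) /\
  \sum_k strip1 (tent N) k x * strip2 (bump N) k x <= 1.
Proof.
split=> [k|].
  rewrite !strip1E !strip2E.
  have /andP[h1 h2] := tent_le_dyadic N m k.1 (c1 x); have /andP[h3 h4] := bump_le_dyadic N n k.2 (c2 x).
  have [_ h5] := dyadic_le_hat m k.1 (c1 x); have [h6 _] := dyadic_le_hat n k.2 (c2 x).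
  by rewrite mulr_ge0//=; apply: ler_pM => //; [exact: le_trans h5|exact: le_trans h6].
apply: (@le_trans _ _ ((\sum_(i < 2 ^ m) dyadic_ind m i (c1 x)) * (\sum_(j < 2 ^ n) dyadic_ind n j (c2 x)))).
  rewrite big_distrlr/= pair_big/=; apply: ler_sum => k _; rewrite strip1E strip2E.
  have /andP[h1 h2] := tent_le_dyadic N m k.1 (c1 x); have /andP[h3 h4] := bump_le_dyadic N n k.2 (c2 x).
  exact: ler_pM.
apply: mulr_ile1; rewrite ?sum_dyadic_ind_le1//; apply: sumr_ge0 => i _; exact: ler0n.
Qed.

Lemma domino_test_sqr_le N x : domino_test N x ^+ 2 <= domino_majorant x.
Proof.
have [h1 h2] := strips_weights N x.
apply: (le_trans (weighted_sqr_le (fun k => c k * D^-1) _ h2)); first by move=> k; case/andP: (h1 k).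
by apply: ler_sum => k _; apply: ler_wpM2l; [exact: sqr_ge0|case/andP: (h1 k)].
Qed.

Let P : set (plane R) := [set x | [/\ 0 < c1 x, c1 x < 1, 0 < c2 x & c2 x < 1]].

(** Profiles vanish within d = 1/(N+1) of their ends. In the coordinates c1 and c2 this leaves a
    margin d / D on every side of the parallelogram, because the last domino ends at 1. *)
Lemma domino_test_support N (B : R) : (forall x, P x -> `|x.1| <= B /\ `|x.2| <= B) ->
  exists K, [/\ compact K, K `<=` P & forall x, ~ K x -> domino_test N x = 0].
Proof.
move=> PB; pose d : R := N.+1%:R^-1; have d0 : 0 < d by rewrite invr_gt0 ltr0n.
pose K (a b : R) (f : plane R -> R) : set (plane R) := [set x | a <= f x] `&` [set x | f x <= b].
have clK a b p q r : closed (K a b (fun x => p + x.1 * q + x.2 * r)).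
  apply: closedI.
    rewrite (_ : [set x | _] = (fun x : plane R => p + x.1 * q + x.2 * r) @^-1` [set t | a <= t])//.
    by apply: closed_comp; [move=> x _; exact: continuous_affine|exact: closed_ge].
  rewrite (_ : [set x | _] = (fun x : plane R => p + x.1 * q + x.2 * r) @^-1` [set t | t <= b])//.
  by apply: closed_comp; [move=> x _; exact: continuous_affine|exact: closed_le].
pose KK := K (d / D) (1 - d / D) c1 `&` K (d / D) (1 - d / D) c2.
have dD : 0 < d / D by rewrite divr_gt0.
have KP : KK `<=` P by move=> x [[/= h1 h2] [/= h3 h4]]; split; lra.
exists KK; split => //.
  apply: (bounded_closed_compact_plane (M := B)); last by move=> x /KP/PB.
  by apply: closedI; exact: clK.
move=> x nK; rewrite /domino_test big1// => k _; rewrite strip1E strip2E.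
have dDD : d / D * D = d by rewrite divfK ?gt_eqF.
have i2 : (k.1 * 2)%:R + 2 <= D.
  have H (i : nat) : (i < 2 ^ m)%N -> (i * 2 + 2 <= 2 ^ n)%N.
    by rewrite /n expnS; move: (2 ^ m)%N => q; lia.
  by rewrite -natrD /D -natrX ler_nat; exact: H.
have j1 : k.2%:R + 1 <= D by rewrite natr1 /D -natrX ler_nat ltn_ord.
have i0 : 0 <= (k.1 * 2)%:R :> R by exact: ler0n.
have j0 : 0 <= k.2%:R :> R by exact: ler0n.
have [h1|h1] := ltP (c1 x * D) d.
  by rewrite tent_eq0 ?mul0r ?mulr0//; left; rewrite -/d; lra.
have [h2|h2] := ltP (D - d) (c1 x * D).
  by rewrite tent_eq0 ?mul0r ?mulr0//; right; rewrite -/d; lra.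
have [h3|h3] := ltP (c2 x * D) d.
  by rewrite bump_eq0 ?mulr0//; left; rewrite -/d; lra.
have [h4|h4] := ltP (D - d) (c2 x * D).
  by rewrite bump_eq0 ?mulr0//; right; rewrite -/d; lra.
exfalso; apply: nK; split; split => /=; rewrite -(ler_pM2r D0) ?mulrBl ?dDD ?mul1r//.
Qed.

End Domino.

Lemma cvg_sum_seq (R : realType) (I : Type) (s : seq I) (F : nat -> I -> R) (l : I -> R) :
  (forall i, F n i @[n --> \oo] --> l i) ->
  \sum_(i <- s) F n i @[n --> \oo] --> \sum_(i <- s) l i.
Proof.
move=> H; elim: s => [|i s IH].
  by rewrite big_nil; under eq_fun do rewrite big_nil; exact: cvg_cst.
by rewrite big_cons; under eq_fun do rewrite big_cons; apply: cvgD.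
Qed.

(** * Decay of the Haar coefficients in one direction *)

Section DominoBound.
Context (R : realType).
Local Notation mu2 := (leb2 R).
Variables (k1 l1 m1 k2 l2 m2 : R) (v : plane R).
Let c1 (x : plane R) := k1 + x.1 * l1 + x.2 * m1.
Let c2 (x : plane R) := k2 + x.1 * l2 + x.2 * m2.
Hypotheses (e1 : v.1 * l1 + v.2 * m1 = 1) (e2 : v.1 * l2 + v.2 * m2 = 0).
Variables (Omega : set (plane R)) (B J : R).
Hypotheses (oO : open Omega) (OB : forall x, Omega x -> `|x.1| <= B /\ `|x.2| <= B).
Hypothesis PO : [set x | [/\ 0 < c1 x, c1 x < 1, 0 < c2 x & c2 x < 1]] `<=` Omega.
Hypothesis area : forall p q h : R, 0 <= h ->
  (mu2 [set x | (p <= c1 x <= p + h)%R /\ (q <= c2 x <= q + h)%R] <= (J * h ^+ 2)%:E)%E.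

Let mO : measurable (Omega : set (mplane R)). Proof. exact: open_plane_measurable. Qed.

Section Level.
Variable m : nat.
Let D : R := 2 ^+ m.+1.
Local Notation I := ('I_(2 ^ m) * 'I_(2 ^ m.+1))%type.
Implicit Types (k : I).
Let D0 : 0 < D. Proof. exact: exprn_gt0. Qed.
Let D1 : 1 <= D. Proof. by rewrite exprn_ege1// ler1n. Qed.

(** The domino widened to the support [-1, 3] of [hat] in both coordinates: sides 4 / D, area at
    most 16 J / D^2. *)
Let box k : set (mplane R) :=
  [set x | ((k.1 * 2)%:R - 1) / D <= c1 x <= ((k.1 * 2)%:R - 1) / D + 4 / D /\
           (k.2%:R - 1) / D <= c2 x <= (k.2%:R - 1) / D + 4 / D].

Let box_measurable k : measurable (box k).
Proof.
have H (a b p q r : R) : measurable ([set x | a <= p + x.1 * q + x.2 * r <= b] : set (mplane R)).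
  rewrite (_ : [set x | _] = [set x | (p + x.1 * q + x.2 * r) \in `[a, b]]); last first.
    by apply/seteqP; split => x; rewrite /= in_itv.
  by apply: (preimage_itv_measurable (h := fun x : mplane R => p + x.1 * q + x.2 * r)); exact: measurable_affine2.
have -> : box k = [set x | ((k.1 * 2)%:R - 1) / D <= c1 x <= ((k.1 * 2)%:R - 1) / D + 4 / D] `&`
   [set x | (k.2%:R - 1) / D <= c2 x <= (k.2%:R - 1) / D + 4 / D] by [].
by apply: measurableI; exact: H.
Qed.

Let in_box k x : (c1 x * D - (k.1 * 2)%:R \in `[-1, 3]) && (c2 x * D - k.2%:R \in `[-1, 3]) = (x \in box k).
Proof.
have H (a y : R) : (a - 1) / D <= y <= (a - 1) / D + 4 / D = (y * D - a \in `[-1, 3]).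
  rewrite in_itv/= -mulrDl ler_pdivrMr// ler_pdivlMr//.
  by apply/andP/andP => -[g1 g2]; split; lra.
apply/idP/idP => [/andP[h1 h2]|/set_mem[h1 h2]].
  by apply/mem_set; split; rewrite H.
by rewrite -!H h1 h2.
Qed.

Let J0 : 0 <= J.
Proof.
have := area 0 0 (ler01 : 0 <= 1 :> R); rewrite expr1n mulr1 => h.
by rewrite -lee_fin; apply: le_trans h; exact: measure_ge0.
Qed.

Let box_integral k : mu2.-integrable Omega (EFin \o \1_(box k)) /\
  \int[mu2]_(x in Omega) \1_(box k) x <= 16 * J / D ^+ 2.
Proof.
have d0 : 0 <= 4 / D by rewrite divr_ge0 ?ltW.
have bd : (mu2 (box k `&` Omega) <= (16 * J / D ^+ 2)%:E)%E.
  apply: (@le_trans _ _ (mu2 (box k))).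
    apply: le_measure; [rewrite inE; exact: measurableI|rewrite inE; exact: box_measurable|].
    exact: subIsetl.
  apply: (le_trans (area _ _ d0)); rewrite lee_fin (_ : J * _ = 16 * J / D ^+ 2)//.
  by field; rewrite gt_eqF.
split.
  apply/integrableP; split; first by apply/measurable_EFinP; exact: measurable_indic.
  under eq_integral do rewrite /= ger0_norm//.
  by rewrite integral_indic//; apply: (le_lt_trans bd); exact: ltry.
rewrite -lee_fin /Rintegral integral_indic// fineK//.
by rewrite ge0_fin_numE//; apply: (le_lt_trans bd); exact: ltry.
Qed.

Variable c : I -> R.
Let Q := \sum_k c k ^+ 2.
Let eta := domino_majorant k1 l1 m1 k2 l2 m2 c.
Let L := `|l1| + `|m1| + `|l2| + `|m2|.

Let box_ind k x : \1_(box k) x =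
  (c1 x * D - (k.1 * 2)%:R \in `[-1, 3])%:R * (c2 x * D - k.2%:R \in `[-1, 3])%:R :> R.
Proof. by rewrite indicE -in_box -mulnb [LHS]natrM. Qed.

Let hat_box k x : strip1 k1 l1 m1 (@hat R) k x * strip2 k2 l2 m2 (@hat R) k x <= 16 * \1_(box k) x.
Proof.
rewrite strip1E strip2E box_ind.
have -> : 16 * ((c1 x * D - (k.1 * 2)%:R \in `[-1, 3])%:R * (c2 x * D - k.2%:R \in `[-1, 3])%:R) =
  4 * (c1 x * D - (k.1 * 2)%:R \in `[-1, 3])%:R * (4 * (c2 x * D - k.2%:R \in `[-1, 3])%:R) :> R by ring.
by apply: ler_pM; rewrite ?hat_ge0 ?hat_le.
Qed.

Let dhat_box k x : `|strip1 k1 l1 m1 (@dhat R) k x * strip2 k2 l2 m2 (@hat R) k x| <= 16 * \1_(box k) x /\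
  `|strip1 k1 l1 m1 (@hat R) k x * strip2 k2 l2 m2 (@dhat R) k x| <= 16 * \1_(box k) x.
Proof.
rewrite !strip1E !strip2E box_ind.
have -> : 16 * ((c1 x * D - (k.1 * 2)%:R \in `[-1, 3])%:R * (c2 x * D - k.2%:R \in `[-1, 3])%:R) =
  4 * (c1 x * D - (k.1 * 2)%:R \in `[-1, 3])%:R * (4 * (c2 x * D - k.2%:R \in `[-1, 3])%:R) :> R by ring.
have hn z : `|hat z| <= 4 * (z \in `[-1, 3])%:R :> R by rewrite ger0_norm ?hat_ge0 ?hat_le.
by split; rewrite normrM; apply: ler_pM; rewrite ?normr_ge0 ?hn ?dhat_le.
Qed.

(** Each differentiation costs one factor D; [L] collects the coefficients of the two affine forms,
    and 16 = 4 * 4 bounds the product of two profiles. *)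
Let majorant_partials : exists etax etay, has_partials eta etax etay /\
  forall x, `|etax x| + `|etay x| <= \sum_k (c k * D^-1) ^+ 2 * (16 * D * L * \1_(box k) x).
Proof.
have H := has_partials_strips (m := m) k1 l1 m1 k2 l2 m2 (fun k => (c k * D^-1) ^+ 2) (@continuous_dhat R) (@continuous_dhat R)
  (@is_derive_hat R) (@is_derive_hat R).
do 2 eexists; split; first exact: H.
move=> x.
have key (a b : R) : `|\sum_k (c k * D^-1) ^+ 2 *
   (strip1 k1 l1 m1 (@dhat R) k x * (a * D) * strip2 k2 l2 m2 (@hat R) k x +
    strip1 k1 l1 m1 (@hat R) k x * (strip2 k2 l2 m2 (@dhat R) k x * (b * D)))| <=
    \sum_k (c k * D^-1) ^+ 2 * (16 * D * (`|a| + `|b|) * \1_(box k) x).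
  apply: (le_trans (ler_norm_sum _ _ _)); apply: ler_sum => k _.
  rewrite normrM ger0_norm ?sqr_ge0//; apply: ler_wpM2l; first exact: sqr_ge0.
  have [h1 h2] := dhat_box k x.
  set A := strip1 _ _ _ _ _ _ * strip2 _ _ _ _ _ _ in h1; set A' := strip1 _ _ _ _ _ _ * strip2 _ _ _ _ _ _ in h2.
  rewrite (_ : _ + _ = a * D * A + b * D * A'); last by rewrite /A /A'; ring.
  move: A A' h1 h2 => A A' h1 h2.
  apply: (le_trans (ler_normD _ _)); rewrite !normrM (gtr0_norm D0).
  rewrite (_ : 16 * D * _ * _ = `|a| * D * (16 * \1_(box k) x) + `|b| * D * (16 * \1_(box k) x)); last by ring.
  have aD (z : R) : 0 <= `|z| * D by apply: mulr_ge0 => //; exact: ltW.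
  exact: (lerD (ler_wpM2l (aD a) h1) (ler_wpM2l (aD b) h2)).
apply: (le_trans (lerD (key l1 l2) (key m1 m2))).
rewrite -big_split/=; apply: ler_sum => k _; rewrite -mulrDr le_eqVlt; apply/orP; left; apply/eqP.
by congr (_ * _); rewrite /L; ring.
Qed.

(** Two powers of 1/D come from the squared coefficients c_k / D and two from the area of the
    boxes. *)
Let integral_boxes (f : plane R -> R) (Z : R) : 0 <= Z -> continuous f ->
  (forall x, f x <= \sum_k (c k * D^-1) ^+ 2 * (Z * \1_(box k) x)) ->
  \int[mu2]_(x in Omega) f x <= Z * (16 * J) / D ^+ 4 * Q.
Proof.
move=> Z0 cf H.
have i1 k : mu2.-integrable Omega (EFin \o (fun x => (c k * D^-1) ^+ 2 * (Z * \1_(box k) x))).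
  by have [ib _] := box_integral k; apply: (integrableRZ mO); apply: (integrableRZ mO).
apply: (@le_trans _ _ (\int[mu2]_(x in Omega) \sum_k (c k * D^-1) ^+ 2 * (Z * \1_(box k) x))).
  apply: le_Rintegral => //; [exact: (continuous_integrable mO OB cf)|exact: integrableR_sum].
rewrite (Rintegral_sum mO _ i1) /Q mulr_sumr; apply: ler_sum => k _.
have [ib le] := box_integral k.
rewrite (RintegralZl _ mO (integrableRZ mO Z ib)) (RintegralZl _ mO ib).
rewrite (_ : Z * (16 * J) / D ^+ 4 * c k ^+ 2 = (c k * D^-1) ^+ 2 * (Z * (16 * J / D ^+ 2))); last first.
  by field; rewrite gt_eqF.
by apply: ler_wpM2l; [exact: sqr_ge0|apply: ler_wpM2l].
Qed.

Let majorant_le x : eta x <= \sum_k (c k * D^-1) ^+ 2 * (16 * \1_(box k) x).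
Proof. by apply: ler_sum => k _; apply: ler_wpM2l; [exact: sqr_ge0|exact: hat_box]. Qed.

(** The values of eta contribute at order D^-4, its gradient at order D^-3; as D >= 1 everything is
    stated at the latter order. The constant 256 is 16 for the profiles times 16 for the boxes. *)
Lemma majorant_integrals (A H : R) : 0 <= A -> 0 <= H ->
  exists etax etay, has_partials eta etax etay /\
  \int[mu2]_(x in Omega) eta x + A * \int[mu2]_(x in Omega) (2 * eta x + H * (`|etax x| + `|etay x|)) <=
  256 * J * (1 + 2 * A + A * H * L) / D ^+ 3 * Q.
Proof.
move=> A0 H0; have [etax [etay [heta bd]]] := majorant_partials.
exists etax, etay; split => //.
have [ceta cx cy _ _] := heta.
have L0 : 0 <= L by rewrite !addr_ge0.
have Q0 : 0 <= Q by apply: sumr_ge0 => k _; exact: sqr_ge0.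
have z16 : 0 <= 16 :> R by [].
have b1 := integral_boxes z16 ceta majorant_le.
have cG : continuous (fun x => 2 * eta x + H * (`|etax x| + `|etay x|)).
  move=> x; apply: cvgD; first by apply: cvgMr; exact: ceta.
  by apply: cvgMr; apply: cvgD; apply: cvg_norm; [exact: cx|exact: cy].
have ZZ0 : 0 <= 32 + H * (16 * D * L).
  by rewrite addr_ge0// mulr_ge0// mulr_ge0// mulr_ge0// ltW.
have b2 : \int[mu2]_(x in Omega) (2 * eta x + H * (`|etax x| + `|etay x|)) <=
    (32 + H * (16 * D * L)) * (16 * J) / D ^+ 4 * Q.
  apply: integral_boxes => // x.
  apply: (@le_trans _ _ (2 * \sum_k (c k * D^-1) ^+ 2 * (16 * \1_(box k) x) +
     H * \sum_k (c k * D^-1) ^+ 2 * (16 * D * L * \1_(box k) x))).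
    by apply: lerD; apply: ler_wpM2l => //; exact: majorant_le.
  rewrite !mulr_sumr -big_split/=; apply: ler_sum => k _; rewrite le_eqVlt; apply/orP; left; apply/eqP; ring.
have JQ : 0 <= J * Q / D ^+ 4 by rewrite divr_ge0 ?mulr_ge0// exprn_ge0 ?ltW.
apply: (le_trans (lerD b1 (ler_wpM2l A0 b2))).
have -> : 256 * J * (1 + 2 * A + A * H * L) / D ^+ 3 * Q =
   J * Q / D ^+ 4 * (256 * D * (1 + 2 * A + A * H * L)) by field; rewrite gt_eqF.
have -> : 16 * (16 * J) / D ^+ 4 * Q + A * ((32 + H * (16 * D * L)) * (16 * J) / D ^+ 4 * Q) =
   J * Q / D ^+ 4 * (256 * (1 + 2 * A) + 256 * D * (A * H * L)) by field; rewrite gt_eqF.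
apply: ler_wpM2l => //.
have : 0 <= (D - 1) * (1 + 2 * A) by apply: mulr_ge0; rewrite ?subr_ge0// addr_ge0// mulr_ge0.
by move: (A * H * L) => z; nra.
Qed.

Definition domino k (x : plane R) : R :=
  haar (c1 x * D - (k.1 * 2)%:R) * (c2 x * D - k.2%:R \in `]0, 1[)%:R.

(** Bounded convergence: the products of [dtent] and [bump] are at most 4 in absolute value,
    uniformly in N. *)
Lemma domino_cvg (u : mplane R -> R) : sqint mu2 Omega u ->
  (forall k, mu2.-integrable Omega (EFin \o (fun x => u x * domino k x))) /\
  \int[mu2]_(x in Omega) (u x * \sum_k c k * (strip1 k1 l1 m1 (dtent N) k x * strip2 k2 l2 m2 (bump N) k x)) @[N --> \oo]
   --> \sum_k c k * \int[mu2]_(x in Omega) (u x * domino k x).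
Proof.
move=> su.
have c01 : continuous (fun _ : plane R => 1 : R) by move=> z; exact: cvg_cst.
have s1 : sqint mu2 Omega (fun=> 1) := continuous_bounded_sqint mO OB c01.
have iu : mu2.-integrable Omega (EFin \o u).
  by apply: (eq_integrableR mO _ (sqintM mO su s1)) => x _; rewrite mulr1.
pose F N k (x : plane R) := strip1 k1 l1 m1 (dtent N) k x * strip2 k2 l2 m2 (bump N) k x.
have cF N k : continuous (F N k).
  move=> x; apply: cvgM.
    apply: (continuous_comp (g := dtent N) (f := fun x : plane R => _ + x.1 * _ + x.2 * _)).
      exact: continuous_affine.
    exact: continuous_dtent.
  apply: (continuous_comp (g := bump N) (f := fun x : plane R => _ + x.1 * _ + x.2 * _)).
    exact: continuous_affine.
  exact: (continuous_of_derive (@is_derive_bump R N)).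
have mF N k : measurable_fun (Omega : set (mplane R)) (F N k).
  by apply: measurable_funTS; exact: continuous_plane_measurable.
have bF N k x : `|F N k x| <= 4.
  rewrite /F normrM -[leRHS]mulr1; apply: ler_pM => //; first exact: dtent_le.
  by rewrite ger0_norm ?bump_ge0 ?bump_le1.
have lF k x : F N k x @[N --> \oo] --> domino k x.
  rewrite /F; under eq_fun do rewrite strip1E strip2E.
  by apply: cvgM; [exact: dtent_cvg|exact: bump_cvg].
have key k := cvg_integral_bounded_mul mO iu (fun N => mF N k) (fun N x _ => bF N k x) (fun x _ => lF k x).
split => [k|]; first by have [] := key k.
have -> : (fun N => \int[mu2]_(x in Omega) (u x * \sum_k c k * F N k x)) =
    (fun N => \sum_k c k * \int[mu2]_(x in Omega) (u x * F N k x)).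
  apply/funext => N.
  have iF k : mu2.-integrable Omega (EFin \o (fun x => u x * F N k x)).
    apply: (sqintM mO su); exact: (continuous_bounded_sqint mO OB).
  transitivity (\int[mu2]_(x in Omega) \sum_k c k * (u x * F N k x)).
    by apply: eq_Rintegral => x _; rewrite mulr_sumr; apply: eq_bigr => k _; ring.
  rewrite (Rintegral_sum mO _ (fun k => integrableRZ mO (c k) (iF k))); apply: eq_bigr => k _.
  by rewrite (RintegralZl _ mO (iF k)).
by apply: cvg_sum_seq => k; apply: cvgMr; have [] := key k.
Qed.

End Level.

(** Duality with the Haar coefficients of [u] as coefficients of the test function: the pairing
    tends to their sum of squares [Q], while the hypothesis bounds it by W (s M + (2 s)^-1 Z Q /
    D^3). *)
Lemma domino_bound (u : mplane R -> R) (M A H : R) : sqint mu2 Omega u -> 0 <= M -> 0 <= A -> 0 <= H ->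
  (forall phi eta etax etay s, C1c Omega phi -> has_partials eta etax etay ->
    (forall x, phi x ^+ 2 <= eta x) -> 0 < s ->
    let S := s * M + (2 * s)^-1 * (\int[mu2]_(x in Omega) eta x +
      A * \int[mu2]_(x in Omega) (2 * eta x + H * (`|etax x| + `|etay x|))) in
    `|\int[mu2]_(x in Omega) (u x * dx phi x)| <= S /\ `|\int[mu2]_(x in Omega) (u x * dy phi x)| <= S) ->
  forall m, \sum_k (\int[mu2]_(x in Omega) (u x * @domino m k x)) ^+ 2 <=
    2 * (`|v.1| + `|v.2| + 1) ^+ 2 * (256 * J * (1 + 2 * A + A * H * (`|l1| + `|m1| + `|l2| + `|m2|)) + 1) * M / 8 ^+ m.
Proof.
move=> su M0 A0 H0 wdb m.
(* Coefficients of [u] itself, so that the limit of the pairings is the sum of their squares. *)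
pose c k := \int[mu2]_(x in Omega) (u x * @domino m k x).
have [etax [etay [heta bd]]] := majorant_integrals c A0 H0.
set L := _ + _ + _ + `|m2| in bd *; set W := _ + _ + 1.
have W1 : 1 <= W by rewrite /W lerDr addr_ge0.
set Z := _ + 1; set D : R := 2 ^+ m.+1 in bd; set Q := \sum_k _ in bd.
rewrite -[leLHS]/Q.
have D0 : 0 < D by exact: exprn_gt0.
have Q0 : 0 <= Q by apply: sumr_ge0 => k _; exact: sqr_ge0.
have L0 : 0 <= L by rewrite !addr_ge0.
have J0 : 0 <= J.
  have := area 0 0 (ler01 : 0 <= 1 :> R); rewrite expr1n mulr1 => h.
  by rewrite -lee_fin; apply: le_trans h; exact: measure_ge0.
have Z0 : 0 < Z.
  have h : 0 <= 256 * J * (1 + 2 * A + A * H * L).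
    apply: mulr_ge0; first exact: mulr_ge0.
    by apply: addr_ge0; [apply: addr_ge0 => //; exact: mulr_ge0|apply: mulr_ge0 => //; exact: mulr_ge0].
  by rewrite /Z; lra.
have bdZ : \int[mu2]_(x in Omega) domino_majorant k1 l1 m1 k2 l2 m2 c x +
    A * \int[mu2]_(x in Omega) (2 * domino_majorant k1 l1 m1 k2 l2 m2 c x + H * (`|etax x| + `|etay x|)) <= Z / D ^+ 3 * Q.
  apply: (le_trans bd); apply: ler_wpM2r => //; apply: ler_wpM2r; first by rewrite invr_ge0 exprn_ge0 ?ltW.
  by rewrite /Z lerDl.
(* This [s] makes the second term exactly Q / 2, which moves to the left-hand side. The 1 added to
   the constant in [Z] keeps [s] positive even if J = 0. *)
pose s := W * Z / D ^+ 3.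
have s0 : 0 < s by rewrite divr_gt0 ?exprn_gt0// mulr_gt0//; exact: lt_le_trans W1.
have PB x : [/\ 0 < c1 x, c1 x < 1, 0 < c2 x & c2 x < 1] -> `|x.1| <= B /\ `|x.2| <= B by move/PO/OB.
have bound N : `|\int[mu2]_(x in Omega) (u x * \sum_k c k * (strip1 k1 l1 m1 (dtent N) k x * strip2 k2 l2 m2 (bump N) k x))|
    <= W * (s * M + (2 * s)^-1 * (Z / D ^+ 3 * Q)).
  have [phix [phiy [hphi dphi]]] := domino_test_partials k1 k2 c e1 e2 N.
  have [Ex Ey] := has_partialsE hphi.
  have [cphi cpx cpy _ _] := hphi.
  have Cphi : C1c Omega (domino_test k1 l1 m1 k2 l2 m2 c N).
    split; first exact: has_partials_C1 hphi.
    have [K [cK KP K0]] := domino_test_support (m := m) c N PB.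
    by exists K; split => //; apply: subset_trans KP PO.
  have [b1 b2] := wdb _ _ _ _ s Cphi heta (domino_test_sqr_le k1 l1 m1 k2 l2 m2 c N) s0.
  have s2 : 0 <= (2 * s)^-1 by rewrite invr_ge0 mulr_ge0 ?ltW.
  have T0 := ler_wpM2l s2 bdZ.
  set S := s * M + _ * _ in b1 b2.
  have SS : S <= s * M + (2 * s)^-1 * (Z / D ^+ 3 * Q) by rewrite /S lerD2l.
  have sx := continuous_bounded_sqint mO OB cpx; have sy := continuous_bounded_sqint mO OB cpy.
  have ix := sqintM mO su sx; have iy := sqintM mO su sy.
  have -> : \int[mu2]_(x in Omega) (u x * \sum_k c k * (strip1 k1 l1 m1 (dtent N) k x * strip2 k2 l2 m2 (bump N) k x)) =
      v.1 * \int[mu2]_(x in Omega) (u x * phix x) + v.2 * \int[mu2]_(x in Omega) (u x * phiy x).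
    rewrite -(RintegralZl _ mO ix) -(RintegralZl _ mO iy).
    rewrite -(RintegralD mO (integrableRZ mO _ ix) (integrableRZ mO _ iy)).
    by apply: eq_Rintegral => x _; rewrite -dphi; ring.
  rewrite Ex in b1; rewrite Ey in b2.
  move: b1 b2; set i1 := \int[mu2]_(x in Omega) (u x * phix x); set i2 := \int[mu2]_(x in Omega) (u x * phiy x).
  move: i1 i2 => i1 i2 b1 b2.
  apply: (le_trans (ler_normD _ _)); rewrite !normrM.
  apply: (le_trans _ (ler_wpM2l (le_trans ler01 W1) SS)).
  have S0 : 0 <= S by apply: le_trans b1.
  rewrite /W !mulrDl mul1r; apply: ler_wpDr => //.
  by apply: lerD; apply: ler_wpM2l.
have [iD cv] := domino_cvg c su.
have QE : \sum_k c k * \int[mu2]_(x in Omega) (u x * @domino m k x) = Q.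
  by apply: eq_bigr => k _; rewrite -expr2.
rewrite QE in cv.
(* The bound does not depend on N, because only the majorant entered it, and so survives the
   limit. *)
have lim : Q <= W * (s * M + (2 * s)^-1 * (Z / D ^+ 3 * Q)).
  rewrite -[leLHS](cvg_lim _ cv)//; apply: limr_le; first exact: cvgP cv.
  by apply: nearW => N; apply: le_trans (bound N); exact: ler_norm.
have W0 : 0 < W by apply: lt_le_trans W1.
have E : W * (s * M + (2 * s)^-1 * (Z / D ^+ 3 * Q)) = W ^+ 2 * Z * M / D ^+ 3 + Q / 2.
  by rewrite /s; field; rewrite !gt_eqF.
rewrite E in lim.
have D3 : D ^+ 3 = 8 * 8 ^+ m.
  by rewrite -exprS /D -exprM mulnC exprM; congr (_ ^+ _); ring.
have e8 : 0 < (8 : R) ^+ m by rewrite exprn_gt0.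
have h : 0 <= W ^+ 2 * Z * M by rewrite mulr_ge0// mulr_ge0 ?sqr_ge0// ltW.
have E2 : W ^+ 2 * Z * M / D ^+ 3 = W ^+ 2 * Z * M / 8 ^+ m / 8.
  by rewrite D3; field; rewrite gt_eqF.
have -> : 2 * W ^+ 2 * Z * M / 8 ^+ m = 2 * (W ^+ 2 * Z * M / 8 ^+ m) by ring.
have : 0 <= W ^+ 2 * Z * M / 8 ^+ m by rewrite divr_ge0// ltW.
by move: lim; rewrite E2; move: (_ / 8 ^+ m) => z; lra.
Qed.

End DominoBound.

Section DyadicDominoes.
Context (R : realType).
Implicit Types (m i j : nat) (t : R) (f : mplane R -> R).
Local Notation mu2 := (leb2 R).
Local Notation S := (@unit_square R).

(** The three excluded values are the break points, where half-open cells and the open intervals of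
    [haar] may disagree. *)
Lemma dyadic_haar m i t : t * 2 ^+ m.+1 - (i * 2)%:R != 0 -> t * 2 ^+ m.+1 - (i * 2)%:R != 1 ->
  t * 2 ^+ m.+1 - (i * 2)%:R != 2 ->
  dyadic_ind m.+1 (i * 2) t - dyadic_ind m.+1 (i * 2).+1 t = haar (t * 2 ^+ m.+1 - (i * 2)%:R).
Proof.
rewrite /dyadic_ind !in_dyadic_itv /haar !in_itv/= -[(i * 2).+2%:R]natr1 -[(i * 2).+1%:R]natr1.
set z := t * _; set a := (i * 2)%:R => z0 z1 z2.
have E1 : (a <= z < a + 1) = (0 < z - a < 1).
  by apply/andP/andP => -[h1 h2]; split; try lra; rewrite lt_neqAle eq_sym z0; lra.
have E2 : (a + 1 <= z < a + 1 + 1) = (1 < z - a < 2).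
  by apply/andP/andP => -[h1 h2]; split; try lra; rewrite lt_neqAle eq_sym z1; lra.
by rewrite E1 E2.
Qed.

Lemma dyadic_open m j t : t * 2 ^+ m - j%:R != 0 ->
  dyadic_ind m j t = (t * 2 ^+ m - j%:R \in `]0, 1[)%:R.
Proof.
rewrite /dyadic_ind in_dyadic_itv in_itv/= -natr1 => z0; congr (nat_of_bool _)%:R.
by apply/andP/andP => -[h1 h2]; split; try lra; rewrite lt_neqAle eq_sym z0; lra.
Qed.

Lemma measurable_plane_ind (h : mplane R -> R) (i : interval R) : measurable_fun setT h ->
  measurable_fun (setT : set (mplane R)) (fun x => (h x \in i)%:R : R).
Proof.
move=> mh; have -> : (fun x => (h x \in i)%:R : R) = \1_([set x | h x \in i]).
  by apply/funext => x; rewrite indicE; congr (nat_of_bool _)%:R; apply/idP/idP => [/mem_set|/set_mem].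
by apply: measurable_indic; exact: preimage_itv_measurable.
Qed.

(** Breaking points of Haar functions form finitely many lines, each listed by its coefficients;
    these are null by [negligible_line]. *)
Lemma ae_eq_off_lines (F G : mplane R -> R) (l : seq (R * R * R)) :
  (forall q, q \in l -> (q.1.2 != 0) || (q.2 != 0)) ->
  (forall x, S x -> (forall q, q \in l -> q.1.1 + x.1 * q.1.2 + x.2 * q.2 != 0) -> F x = G x) ->
  measurable_fun S F -> measurable_fun S G ->
  \int[mu2]_(x in S) F x = \int[mu2]_(x in S) G x.
Proof.
move=> lP FG mF mG; rewrite /Rintegral; congr fine.
apply: ae_eq_integral; [exact: unit_square_measurable|exact/measurable_EFinP|exact/measurable_EFinP|].
pose line (q : R * R * R) : set (mplane R) := [set x | q.1.1 + x.1 * q.1.2 + x.2 * q.2 = 0].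
have nl : mu2.-negligible (\big[setU/set0]_(q <- l) line q).
  elim: l lP {FG} => [|q l IH] lP; first by rewrite big_nil; exact: negligible_set0.
  rewrite big_cons; apply: negligibleU; last by apply: IH => q' h; apply: lP; rewrite inE h orbT.
  exists (line q); split => //; last by apply: negligible_line; apply: lP; exact: mem_head.
  rewrite -[X in measurable X]setTI.
  rewrite (_ : line q = (fun x : mplane R => q.1.1 + x.1 * q.1.2 + x.2 * q.2) @^-1` [set 0])//.
  exact: (measurable_affine2 _ _ _).
apply: negligibleS nl => x /= H; apply: contrapT => nx; apply: H => Sx; congr (_%:E).
apply: FG => // q ql; apply/eqP => e0; apply: nx; rewrite -bigcup_seq; exists q => //.
Qed.

Lemma sq_int_haar1 m i j f : sqint mu2 S f ->
  sq_int m.+1 (i * 2) j f - sq_int m.+1 (i * 2).+1 j f =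
  \int[mu2]_(x in S) (f x * (haar (x.1 * 2 ^+ m.+1 - (i * 2)%:R) * (x.2 * 2 ^+ m.+1 - j%:R \in `]0, 1[)%:R)).
Proof.
move=> sf; have mS := @unit_square_measurable R.
have i1 := sqintM mS sf (@sqint_square_ind R m.+1 (i * 2) j).
have i2 := sqintM mS sf (@sqint_square_ind R m.+1 (i * 2).+1 j).
rewrite /sq_int -RintegralB//.
have D0 : (2 : R) ^+ m.+1 != 0 by rewrite expf_neq0.
have maff (k a b : R) : measurable_fun (setT : set (mplane R)) (fun x : mplane R => k + x.1 * a + x.2 * b).
  exact: measurable_affine2.
apply: (@ae_eq_off_lines _ _ [:: (- (i * 2)%:R, 2 ^+ m.+1, 0); (- (i * 2)%:R - 1, 2 ^+ m.+1, 0);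
   (- (i * 2)%:R - 2, 2 ^+ m.+1, 0); (- j%:R, 0, 2 ^+ m.+1)]).
- by move=> q; rewrite !inE => /or4P[] /eqP -> /=; rewrite D0 ?orbT.
- move=> x _ H.
  have n0 : x.1 * 2 ^+ m.+1 - (i * 2)%:R != 0.
    by have := H (- (i * 2)%:R, 2 ^+ m.+1, 0); rewrite !inE eqxx /= => /(_ isT); rewrite mulr0 addr0 addrC.
  have n1 : x.1 * 2 ^+ m.+1 - (i * 2)%:R != 1.
    have := H (- (i * 2)%:R - 1, 2 ^+ m.+1, 0); rewrite !inE eqxx !orbT /= => /(_ isT).
    by apply: contra_neq => e; transitivity (x.1 * 2 ^+ m.+1 - (i * 2)%:R - 1); [ring|rewrite e subrr].
  have n2 : x.1 * 2 ^+ m.+1 - (i * 2)%:R != 2.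
    have := H (- (i * 2)%:R - 2, 2 ^+ m.+1, 0); rewrite !inE eqxx !orbT /= => /(_ isT).
    by apply: contra_neq => e; transitivity (x.1 * 2 ^+ m.+1 - (i * 2)%:R - 2); [ring|rewrite e subrr].
  have n3 : x.2 * 2 ^+ m.+1 - j%:R != 0.
    by have := H (- j%:R, 0, 2 ^+ m.+1); rewrite !inE eqxx !orbT /= => /(_ isT); rewrite mulr0 addr0 addrC.
  by rewrite /square_ind -(dyadic_haar n0 n1 n2) -(dyadic_open n3); ring.
- by apply: measurable_funB; apply: (integrable_measurable (mu := mu2)).
- have [mf _] := sf; apply: measurable_funM => //; apply: measurable_funTS.
  have mz : measurable_fun (setT : set (mplane R)) (fun x : mplane R => x.1 * 2 ^+ m.+1 - (i * 2)%:R).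
    by apply: eq_measurable_fun (maff (- (i * 2)%:R) (2 ^+ m.+1) 0) => x _; ring.
  have mz2 : measurable_fun (setT : set (mplane R)) (fun x : mplane R => x.2 * 2 ^+ m.+1 - j%:R).
    by apply: eq_measurable_fun (maff (- j%:R) 0 (2 ^+ m.+1)) => x _; ring.
  by apply: measurable_funM; [apply: measurable_funB|]; exact: measurable_plane_ind.
Qed.

Lemma sq_int_haar2 m i j f : sqint mu2 S f ->
  sq_int m.+1 i (j * 2) f - sq_int m.+1 i (j * 2).+1 f =
  \int[mu2]_(x in S) (f x * (haar (x.2 * 2 ^+ m.+1 - (j * 2)%:R) * (x.1 * 2 ^+ m.+1 - i%:R \in `]0, 1[)%:R)).
Proof.
move=> sf; have mS := @unit_square_measurable R.
have i1 := sqintM mS sf (@sqint_square_ind R m.+1 i (j * 2)).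
have i2 := sqintM mS sf (@sqint_square_ind R m.+1 i (j * 2).+1).
rewrite /sq_int -RintegralB//.
have D0 : (2 : R) ^+ m.+1 != 0 by rewrite expf_neq0.
have maff (k a b : R) : measurable_fun (setT : set (mplane R)) (fun x : mplane R => k + x.1 * a + x.2 * b).
  exact: measurable_affine2.
apply: (@ae_eq_off_lines _ _ [:: (- (j * 2)%:R, 0, 2 ^+ m.+1); (- (j * 2)%:R - 1, 0, 2 ^+ m.+1);
   (- (j * 2)%:R - 2, 0, 2 ^+ m.+1); (- i%:R, 2 ^+ m.+1, 0)]).
- by move=> q; rewrite !inE => /or4P[] /eqP -> /=; rewrite D0 ?orbT.
- move=> x _ H.
  have n0 : x.2 * 2 ^+ m.+1 - (j * 2)%:R != 0.
    by have := H (- (j * 2)%:R, 0, 2 ^+ m.+1); rewrite !inE eqxx /= => /(_ isT); rewrite mulr0 addr0 addrC.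
  have n1 : x.2 * 2 ^+ m.+1 - (j * 2)%:R != 1.
    have := H (- (j * 2)%:R - 1, 0, 2 ^+ m.+1); rewrite !inE eqxx !orbT /= => /(_ isT).
    by apply: contra_neq => e; transitivity (x.2 * 2 ^+ m.+1 - (j * 2)%:R - 1); [ring|rewrite e subrr].
  have n2 : x.2 * 2 ^+ m.+1 - (j * 2)%:R != 2.
    have := H (- (j * 2)%:R - 2, 0, 2 ^+ m.+1); rewrite !inE eqxx !orbT /= => /(_ isT).
    by apply: contra_neq => e; transitivity (x.2 * 2 ^+ m.+1 - (j * 2)%:R - 2); [ring|rewrite e subrr].
  have n3 : x.1 * 2 ^+ m.+1 - i%:R != 0.
    by have := H (- i%:R, 2 ^+ m.+1, 0); rewrite !inE eqxx !orbT /= => /(_ isT); rewrite mulr0 addr0 addrC.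
  by rewrite /square_ind -(dyadic_haar n0 n1 n2) -(dyadic_open n3); ring.
- by apply: measurable_funB; apply: (integrable_measurable (mu := mu2)).
- have [mf _] := sf; apply: measurable_funM => //; apply: measurable_funTS.
  have mz : measurable_fun (setT : set (mplane R)) (fun x : mplane R => x.2 * 2 ^+ m.+1 - (j * 2)%:R).
    by apply: eq_measurable_fun (maff (- (j * 2)%:R) 0 (2 ^+ m.+1)) => x _; ring.
  have mz2 : measurable_fun (setT : set (mplane R)) (fun x : mplane R => x.1 * 2 ^+ m.+1 - i%:R).
    by apply: eq_measurable_fun (maff (- i%:R) (2 ^+ m.+1) 0) => x _; ring.
  by apply: measurable_funM; [apply: measurable_funB|]; exact: measurable_plane_ind.
Qed.

End DyadicDominoes.

(** What remains of the broken norm once the mesh is forgotten. Unlike the norm it applies to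
    differences of functions living on different triangulations. *)
Definition derivative_bounded (R : realType) (Omega : set (plane R)) (M A H : R) (u : mplane R -> R) :=
  forall phi eta etax etay s, C1c Omega phi -> has_partials eta etax etay ->
    (forall x, phi x ^+ 2 <= eta x) -> 0 < s ->
    let S := s * M + (2 * s)^-1 * (\int[leb2 R]_(x in Omega) eta x +
      A * \int[leb2 R]_(x in Omega) (2 * eta x + H * (`|etax x| + `|etay x|))) in
    `|\int[leb2 R]_(x in Omega) (u x * dx phi x)| <= S /\
    `|\int[leb2 R]_(x in Omega) (u x * dy phi x)| <= S.

(** * Energy estimate on one parallelogram inside Omega *)

Section Parallelogram.
Context (R : realType).
Implicit Types (m i j : nat) (t : R) (f : mplane R -> R).
Local Notation mu2 := (leb2 R).
Local Notation S := (@unit_square R).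
Variables (a v w : plane R) (Omega : set (plane R)) (B : R).
Hypotheses (d0 : det2 v w != 0) (oO : open Omega).
Hypothesis OB : forall x, Omega x -> `|x.1| <= B /\ `|x.2| <= B.

Let mO : measurable (Omega : set (mplane R)). Proof. exact: open_plane_measurable. Qed.

Definition open_square : set (mplane R) := [set y | (y.1 \in `]0, 1[) /\ (y.2 \in `]0, 1[)].

Hypothesis PO : forall y, open_square y -> Omega (para a v w y).

(** Set to zero off the open square: the dyadic theory lives on the half-open [unit_square], whose
    remaining sides may be mapped outside Omega. *)
Definition pullback (u : mplane R -> R) : mplane R -> R := (fun y => u (para a v w y)) \_ open_square.

Lemma open_square_measurable : measurable open_square.
Proof.
rewrite (_ : open_square = `]0, 1[%classic `*` `]0, 1[%classic)//.
by apply: measurableX; exact: measurable_itv.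
Qed.

Lemma open_square_sub : open_square `<=` S.
Proof.
move=> y [+ +]; rewrite !in_itv/= => /andP[h1 h2] /andP[h3 h4].
by split; rewrite /= in_itv/= ltW.
Qed.

Lemma pullback_sqint u : sqint mu2 Omega u -> sqint mu2 S (pullback u).
Proof.
move=> su; have [mu1 fu] := su.
have mO' := preimage_para_measurable a v w mO.
have s1 : sqint mu2 ([set y | Omega (para a v w y)] : set (mplane R)) (fun y => u (para a v w y)).
  split; first exact: measurable_fun_para.
  have := fu; rewrite (ge0_integral_para_in a d0 mO).
  - apply: lty_pmule; first by rewrite normr_gt0.
    by apply: integral_ge0 => x _; rewrite lee_fin sqr_ge0.
  - by apply/measurable_EFinP; exact: measurable_funX.
  - by move=> x _; rewrite lee_fin sqr_ge0.
have [m2 f2] := sqint_subset mO' open_square_measurable PO s1.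
split.
  apply/(measurable_restrict _ open_square_measurable (@unit_square_measurable R)).
  by apply: measurable_funS m2; [exact: open_square_measurable|exact: subIsetr].
apply: le_lt_trans f2; rewrite le_eqVlt; apply/orP; left; apply/eqP.
rewrite integral_mkcond [RHS]integral_mkcond; apply: eq_integral => y _; rewrite /pullback !patchE.
have [yO|yO] := pselect (open_square y); last by rewrite (memNset yO) expr0n; case: ifP.
by rewrite !mem_set//; exact: open_square_sub.
Qed.

(** Cramer's rule: the affine coordinates inverse to [para a v w], in which the parallelogram
    becomes the unit square. *)
Let l1 := w.2 / det2 v w. Let m1 := - w.1 / det2 v w.
Let k1 := - (a.1 * w.2 - a.2 * w.1) / det2 v w.
Let l2 := - v.2 / det2 v w. Let m2 := v.1 / det2 v w.
Let k2 := - (v.1 * a.2 - v.2 * a.1) / det2 v w.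

Let d0' : v.1 * w.2 - v.2 * w.1 != 0. Proof. exact: d0. Qed.

Let coord1 y : k1 + (para a v w y).1 * l1 + (para a v w y).2 * m1 = y.1.
Proof. by rewrite /k1 /l1 /m1 /para /det2/=; field; exact: d0'. Qed.

Let coord2 y : k2 + (para a v w y).1 * l2 + (para a v w y).2 * m2 = y.2.
Proof. by rewrite /k2 /l2 /m2 /para /det2/=; field; exact: d0'. Qed.

Let para_coord (x : plane R) : para a v w (k1 + x.1 * l1 + x.2 * m1, k2 + x.1 * l2 + x.2 * m2) = x.
Proof.
by apply: plane_eqP; rewrite /k1 /l1 /m1 /k2 /l2 /m2 /para /det2/=; field; exact: d0'.
Qed.

Definition parallelogram : set (plane R) := [set para a v w y | y in open_square].

Lemma parallelogram_measurable : measurable (parallelogram : set (mplane R)).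
Proof.
rewrite (_ : parallelogram = [set x | open_square (k1 + x.1 * l1 + x.2 * m1, k2 + x.1 * l2 + x.2 * m2)]).
  rewrite -[X in measurable X]setTI; apply: measurable_fun_pair => //; last exact: open_square_measurable.
    exact: measurable_affine2.
  exact: measurable_affine2.
apply/seteqP; split => [_ [y yO <-]|x xO]; first by rewrite /= coord1 coord2 -surjective_pairing.
by eexists; [exact: xO|exact: para_coord].
Qed.

Lemma parallelogram_sub : parallelogram `<=` Omega.
Proof. by move=> _ [y /PO yO <-]. Qed.

Lemma integral_pullback_sqr u : sqint mu2 Omega u ->
  \int[mu2]_(x in parallelogram) u x ^+ 2 = `|det2 v w| * \int[mu2]_(y in S) pullback u y ^+ 2.
Proof.
move=> su.
have E : [set y | parallelogram (para a v w y)] = open_square.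
  apply/seteqP; split => [y [y' y'O e]|y yO]; last by exists y.
  suff -> : y = y' by [].
  by apply: plane_eqP; rewrite -?(coord1 y) -?(coord1 y') -?(coord2 y) -?(coord2 y') e.
have mP := parallelogram_measurable; have PsO := parallelogram_sub.
have sP := sqint_subset mO mP PsO su.
rewrite (Rintegral_para a d0 mP (sqint_integrable sP)) E; congr (_ * _).
rewrite /Rintegral; congr fine; rewrite integral_mkcond [RHS]integral_mkcond.
apply: eq_integral => y _; rewrite /pullback !patchE.
have [yO|yO] := pselect (open_square y); last by rewrite (memNset yO) expr0n; case: ifP.
by rewrite !mem_set//; exact: open_square_sub.
Qed.

Let cell_area (p q h : R) : 0 <= h ->
  (mu2 [set x | (p <= k1 + x.1 * l1 + x.2 * m1 <= p + h)%R /\ (q <= k2 + x.1 * l2 + x.2 * m2 <= q + h)%R] <=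
   (`|det2 v w| * h ^+ 2)%:E)%E.
Proof.
move=> h0.
have mC : measurable ([set x | (p <= k1 + x.1 * l1 + x.2 * m1 <= p + h)%R /\ (q <= k2 + x.1 * l2 + x.2 * m2 <= q + h)%R] : set (mplane R)).
  have H (b c s t r : R) : measurable ([set x | b <= s + x.1 * t + x.2 * r <= c] : set (mplane R)).
    rewrite (_ : [set x | _] = [set x | (s + x.1 * t + x.2 * r) \in `[b, c]]); last first.
      by apply/seteqP; split => x; rewrite /= in_itv.
    by apply: (preimage_itv_measurable (h := fun x : mplane R => s + x.1 * t + x.2 * r)); exact: measurable_affine2.
  exact: (measurableI _ _ (H _ _ _ _ _) (H _ _ _ _ _)).
rewrite (leb2_para a d0 mC).
rewrite (_ : [set y | _] = `[p, p + h]%classic `*` `[q, q + h]%classic); last first.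
  by apply/seteqP; split => y; rewrite /= coord1 coord2 !in_itv.
rewrite product_measure1E; try exact: measurable_itv.
rewrite /= !lebesgue_measure_itv/= !lte_fin !ltrDl.
case: ifPn => [h1|_]; last by rewrite mule0 mule0 lee_fin mulr_ge0 ?sqr_ge0.
by rewrite -!EFinB -!EFinM lee_fin !(addrC _ h) !addrK -expr2.
Qed.

Let integral_domino u (h : mplane R -> R) (g : plane R -> R) : sqint mu2 Omega u ->
  mu2.-integrable Omega (EFin \o (fun x => u x * g x)) ->
  (forall y, g (para a v w y) = h y) -> (forall y, ~ open_square y -> h y = 0) ->
  \int[mu2]_(x in Omega) (u x * g x) = `|det2 v w| * \int[mu2]_(y in S) (pullback u y * h y).
Proof.
move=> su ig gh h0; rewrite (Rintegral_para a d0 mO ig); congr (_ * _).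
rewrite /Rintegral; congr fine; rewrite integral_mkcond [RHS]integral_mkcond.
apply: eq_integral => y _; rewrite /pullback !patchE gh.
have [yO|yO] := pselect (open_square y); last first.
  by rewrite (h0 _ yO) !mulr0; case: ifP => _; case: ifP.
by rewrite !mem_set//; [exact: open_square_sub|exact: PO].
Qed.

Let haar_support m (i : nat) t : (i < 2 ^ m)%N -> haar (t * 2 ^+ m.+1 - (i * 2)%:R) != 0 -> t \in `]0, 1[.
Proof.
move=> im h; set z := t * _ - _ in h.
have [z0|z0] := leP z 0; first by rewrite haar_outside ?eqxx// in h; constructor 1.
have [z2|z2] := leP 2 z; first by rewrite haar_outside ?eqxx// in h; constructor 3.
have D0 : 0 < (2 : R) ^+ m.+1 by rewrite exprn_gt0.
have i2 : (i * 2)%:R + 2 <= 2 ^+ m.+1 :> R.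
  by rewrite -natrD -natrX ler_nat expnS; move: im; move: (2 ^ m)%N => q; lia.
have i0 : 0 <= (i * 2)%:R :> R by exact: ler0n.
have [h1 h2] : 0 < t * 2 ^+ m.+1 /\ t * 2 ^+ m.+1 < 2 ^+ m.+1 by rewrite /z in z0 z2; split; lra.
by rewrite in_itv/=; apply/andP; split; [rewrite -(pmulr_lgt0 _ D0)|rewrite -(ltr_pM2r D0) mul1r].
Qed.

Let ind_support m (j : nat) t : (j < 2 ^ m)%N -> (t * 2 ^+ m - j%:R \in `]0, 1[)%:R != 0 :> R -> t \in `]0, 1[.
Proof.
move=> jm; have [|_] := boolP (t * 2 ^+ m - j%:R \in `]0, 1[); last by rewrite eqxx.
rewrite in_itv/= => /andP[z0 z1] _.
have D0 : 0 < (2 : R) ^+ m by rewrite exprn_gt0.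
have j1 : j%:R + 1 <= 2 ^+ m :> R by rewrite natr1 -natrX ler_nat.
have j0 : 0 <= j%:R :> R by exact: ler0n.
have [h1 h2] : 0 < t * 2 ^+ m /\ t * 2 ^+ m < 2 ^+ m by split; lra.
by rewrite in_itv/=; apply/andP; split; [rewrite -(pmulr_lgt0 _ D0)|rewrite -(ltr_pM2r D0) mul1r].
Qed.

(** [domino_bound] is applied along [v] and, with the coordinates exchanged, along [w]; together
    they give the 8^-m decay that [energy_step] asks for. The factor 20 is 10 from that step times 2
    from the geometric series. [K1] is chosen before [u] and M. *)
Lemma parallelogram_energy (A H : R) : 0 <= A -> 0 <= H ->
  exists2 K1, 0 <= K1 & forall M u m, 0 <= M -> sqint mu2 Omega u -> derivative_bounded Omega M A H u ->
  \int[mu2]_(y in S) pullback u y ^+ 2 <= dyadic_energy m (pullback u) + K1 * M / 2 ^+ m.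
Proof.
move=> A0 H0.
have e11 : v.1 * l1 + v.2 * m1 = 1 by rewrite /l1 /m1 /det2; field; exact: d0'.
have e12 : v.1 * l2 + v.2 * m2 = 0 by rewrite /l2 /m2 /det2; field; exact: d0'.
have e21 : w.1 * l2 + w.2 * m2 = 1 by rewrite /l2 /m2 /det2; field; exact: d0'.
have e22 : w.1 * l1 + w.2 * m1 = 0 by rewrite /l1 /m1 /det2; field; exact: d0'.
have PO1 : [set x : plane R | [/\ 0 < k1 + x.1 * l1 + x.2 * m1, k1 + x.1 * l1 + x.2 * m1 < 1,
    0 < k2 + x.1 * l2 + x.2 * m2 & k2 + x.1 * l2 + x.2 * m2 < 1]] `<=` Omega.
  by move=> x [h1 h2 h3 h4]; rewrite -(para_coord x); apply: PO; rewrite /open_square/= !in_itv/= h1 h2 h3 h4.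
have PO2 : [set x : plane R | [/\ 0 < k2 + x.1 * l2 + x.2 * m2, k2 + x.1 * l2 + x.2 * m2 < 1,
    0 < k1 + x.1 * l1 + x.2 * m1 & k1 + x.1 * l1 + x.2 * m1 < 1]] `<=` Omega.
  by move=> x [h1 h2 h3 h4]; apply: PO1.
have area2 (p q h : R) : 0 <= h ->
  (mu2 [set x | (p <= k2 + x.1 * l2 + x.2 * m2 <= p + h)%R /\ (q <= k1 + x.1 * l1 + x.2 * m1 <= q + h)%R] <=
   (`|det2 v w| * h ^+ 2)%:E)%E.
  move=> h0; apply: le_trans (cell_area q p h0); rewrite le_eqVlt; apply/orP; left; apply/eqP.
  by congr (mu2 _); apply/seteqP; split => x [].
have bd1 := domino_bound e11 e12 oO OB PO1 cell_area.
have bd2 := domino_bound e21 e22 oO OB PO2 area2.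
set C1 := 2 * (`|v.1| + `|v.2| + 1) ^+ 2 *
  (256 * `|det2 v w| * (1 + 2 * A + A * H * (`|l1| + `|m1| + `|l2| + `|m2|)) + 1).
set C2 := 2 * (`|w.1| + `|w.2| + 1) ^+ 2 *
  (256 * `|det2 v w| * (1 + 2 * A + A * H * (`|l2| + `|m2| + `|l1| + `|m1|)) + 1).
have Cpos (x y z : R) : 0 <= z -> 0 <= 2 * x ^+ 2 * (256 * `|y| * (1 + 2 * A + A * H * z) + 1).
  move=> z0; apply: mulr_ge0; first by rewrite mulr_ge0 ?sqr_ge0.
  apply: addr_ge0; last exact: ler01.
  apply: mulr_ge0; first exact: mulr_ge0.
  by have := mulr_ge0 (mulr_ge0 A0 H0) z0; lra.
have C10 : 0 <= C1 by apply: Cpos; rewrite !addr_ge0.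
have C20 : 0 <= C2 by apply: Cpos; rewrite !addr_ge0.
have dd : 0 < `|det2 v w| ^+ 2 by rewrite exprn_gt0// normr_gt0.
exists (20 * ((C1 + C2) / `|det2 v w| ^+ 2)).
  by rewrite mulr_ge0// divr_ge0 ?addr_ge0// ltW.
move=> M u m M0 su wdb.
have sf := pullback_sqint su.
have {}bd1 := bd1 _ _ _ _ su M0 A0 H0 wdb.
have {}bd2 := bd2 _ _ _ _ su M0 A0 H0 wdb.
pose c := (C1 + C2) / `|det2 v w| ^+ 2 * M.
have c0 : 0 <= c by rewrite mulr_ge0// divr_ge0 ?addr_ge0// ltW.
have step n : dyadic_energy n.+1 (pullback u) <= dyadic_energy n (pullback u) + 10 * c / 2 ^+ n.
  have pn : 0 < (8 : R) ^+ n by rewrite exprn_gt0.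
  (* Passing from the square to Omega multiplies each coefficient by |det2 v w|, hence the squares
     by its square. *)
  have scale (X Y : R) : `|det2 v w| ^+ 2 * X <= Y * M / 8 ^+ n -> Y <= C1 + C2 -> X <= c / 8 ^+ n.
    move=> h hY; rewrite -(ler_pM2l dd); apply: (le_trans h).
    have -> : `|det2 v w| ^+ 2 * (c / 8 ^+ n) = (C1 + C2) * M / 8 ^+ n.
      by rewrite /c; field; rewrite !gt_eqF//= normr_gt0.
    by apply: ler_wpM2r; [rewrite invr_ge0 ltW|apply: ler_wpM2r].
  apply: energy_step => //.
  - apply: (scale _ C1); last by rewrite lerDl.
    apply: le_trans (bd1 n); rewrite pair_big/= mulr_sumr; apply: ler_sum => k _.
    rewrite -exprMn (sq_int_haar1 _ _ _ sf).
    rewrite -(integral_domino (g := domino k1 l1 m1 k2 l2 m2 k) su)//.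
    + exact: (domino_cvg k1 l1 m1 k2 l2 m2 oO OB (fun=> 0) su).1.
    + by move=> y; rewrite /domino coord1 coord2.
    + move=> y nO; apply/eqP; apply: contraT => h; exfalso; apply: nO.
      by move: h; rewrite mulf_eq0 negb_or => /andP[h1 h2]; split; [exact: haar_support h1|exact: ind_support h2].
  - apply: (scale _ C2); last by rewrite lerDr.
    rewrite exchange_big/=; apply: le_trans (bd2 n); rewrite pair_big/= mulr_sumr; apply: ler_sum => k _.
    rewrite -exprMn (sq_int_haar2 _ _ _ sf).
    rewrite -(integral_domino (g := domino k2 l2 m2 k1 l1 m1 k) su)//.
    + exact: (domino_cvg k2 l2 m2 k1 l1 m1 oO OB (fun=> 0) su).1.
    + by move=> y; rewrite /domino coord1 coord2.
    + move=> y nO; apply/eqP; apply: contraT => h; exfalso; apply: nO.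
      by move: h; rewrite mulf_eq0 negb_or => /andP[h1 h2]; split; [exact: ind_support h2|exact: haar_support h1].
have := energy_limit m (_ : 0 <= 10 * c) sf step.
by rewrite mulr_ge0// => /(_ isT); rewrite (_ : 2 * (10 * c) = 20 * ((C1 + C2) / `|det2 v w| ^+ 2) * M)// /c; ring.
Qed.

End Parallelogram.

(** * Compactness *)

(** The sets may overlap, so only an inequality holds: the part covered by the first set is removed
    and the rest handled by induction. *)
Lemma le_integral_cover (R : realType) d (X : measurableType d) (mu : {measure set X -> \bar R}) (I : eqType) (l : seq I)
    (P : I -> set X) (D : set X) (F : X -> \bar R) : measurable D ->
  (forall i, i \in l -> measurable (P i) /\ P i `<=` D) ->
  measurable_fun D F -> (forall x, D x -> (0 <= F x)%E) ->
  forall E, measurable E -> E `<=` D -> (forall x, E x -> exists2 i, i \in l & P i x) ->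
  (\int[mu]_(x in E) F x <= \sum_(i <- l) \int[mu]_(x in P i) F x)%E.
Proof.
move=> mD; elim: l => [|i l IH] lP mF F0 E mE ED cov.
  rewrite big_nil (_ : E = set0) ?integral_set0//.
  by apply/seteqP; split => // x /cov[].
have [mP PD] := lP i (mem_head _ _).
have EE : E = (E `&` P i) `|` (E `\` P i) by rewrite setUIDK.
have m1 : measurable (E `&` P i) by exact: measurableI.
have m2 : measurable (E `\` P i) by exact: measurableD.
rewrite big_cons {1}EE ge0_integral_setU//; last 3 first.
- by rewrite -EE; exact: measurable_funS mF.
- by move=> x; rewrite -EE => /ED/F0.
- by apply/disj_setPS => x [[_ h] [_]].
apply: leeD.
  apply: ge0_subset_integral => //.
  - exact: measurable_funS mF.
  - by move=> x /PD/F0.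
apply: IH => //.
- by move=> j jl; apply: lP; rewrite inE jl orbT.
- by move=> x [/ED].
- move=> x [Ex nPx]; have [j] := cov x Ex; rewrite inE => /orP[/eqP ->//|jl Pj].
  by exists j.
Qed.

Section Covering.
Context (R : realType).
Implicit Types (a b c x y : plane R) (Omega tau : set (plane R)) (T : set (set (plane R))).
Local Notation frame := (plane R * plane R * plane R)%type.

Definition half_side a b : plane R := (2^-1 * (b.1 - a.1), 2^-1 * (b.2 - a.2)).

(** The parallelogram at a vertex spanned by half the adjacent sides: it stays in the triangle and
    consists of the points whose coordinates at the two other vertices lie in ]0, 1/2[. *)
Definition corner a b c : frame := (a, half_side a b, half_side a c).

Definition frame_set (p : frame) : set (plane R) := parallelogram p.1.1 p.1.2 p.2.

Definition frame_in Omega (p : frame) : Prop :=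
  det2 p.1.2 p.2 != 0 /\ forall y, open_square y -> Omega (para p.1.1 p.1.2 p.2 y).

Lemma corner_in a b c : noncollinear a b c -> frame_in (open_triangle a b c) (corner a b c).
Proof.
move=> d0; split.
  have -> : det2 (corner a b c).1.2 (corner a b c).2 = 4^-1 * orient a b c.
    by rewrite /corner /det2 /half_side /orient/=; field.
  by rewrite mulf_neq0.
move=> y [+ +]; rewrite !in_itv/= => /andP[h1 h2] /andP[h3 h4].
exists (1 - y.1 / 2 - y.2 / 2), (y.1 / 2), (y.2 / 2); split; [lra|lra|lra|ring|].
by rewrite /para /corner /half_side/=; congr pair; field.
Qed.

(** The three positive barycentric coordinates sum to 1, so at most one reaches 1/2; the corner at
    that vertex contains the point, and if none does the corner at [a] will do. *)
Lemma corner_cover a b c : open_triangle a b c `<=`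
  frame_set (corner a b c) `|` (frame_set (corner b c a) `|` frame_set (corner c a b)).
Proof.
move=> _ [s [t [r [s0 t0 r0 str ->]]]].
have E : s = 1 - t - r by lra.
have in_sq (p q : R) : 0 < p -> p < 1 / 2 -> 0 < q -> q < 1 / 2 -> open_square (2 * p, 2 * q).
  by move=> p0 p1 q0 q1; split; rewrite /= in_itv/=; apply/andP; split; lra.
have [t2|t2] := ltP t (1 / 2); [have [r2|r2] := ltP r (1 / 2)|].
- left; exists (2 * t, 2 * r); first exact: in_sq.
  by rewrite /para /corner /half_side/= E; congr pair; field.
- right; right; exists (2 * s, 2 * t); first by apply: in_sq => //; lra.
  by rewrite /para /corner /half_side/= E; congr pair; field.
- right; left; exists (2 * r, 2 * s); first by apply: in_sq => //; lra.
  by rewrite /para /corner /half_side/= E; congr pair; field.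
Qed.

Lemma triangulation_frames Omega T : is_triangulation Omega T ->
  exists l : seq frame, (forall p, p \in l -> frame_in Omega p) /\
    forall x, element_union T x -> exists2 p, p \in l & frame_set p x.
Proof.
move=> [/finite_seqP[s ->] triT _ _ _].
have {}triT tau : tau \in s -> is_triangle tau /\ tau `<=` Omega by exact: triT.
elim: s triT => [|tau s IH] triT; first by exists [::]; split => // x [].
have [|l [lin lcov]] := IH; first by move=> tau' h; apply: triT; rewrite inE h orbT.
have [[a [b [c [d0 E]]]] sub] := triT tau (mem_head _ _).
have sub' p : frame_in (open_triangle a b c) p -> frame_in Omega p.
  by move=> [h1 h2]; split => // y /h2; rewrite -E => /sub.
exists (corner a b c :: corner b c a :: corner c a b :: l); split.
  have d1 := noncollinear_rot d0; have d2 := noncollinear_rot d1.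
  move=> p; rewrite !inE => /or4P[/eqP ->|/eqP ->|/eqP ->|/lin//]; apply: sub'.
  - exact: corner_in.
  - by rewrite open_triangle_rot; exact: corner_in.
  - by rewrite 2!open_triangle_rot; exact: corner_in.
move=> x [tau']; rewrite /= inE => /orP[/eqP ->|h tx].
  rewrite E => /corner_cover[h|[h|h]]; [exists (corner a b c)|exists (corner b c a)|exists (corner c a b)] => //;
    by rewrite !inE eqxx ?orbT.
have [p pl px] := lcov x (ex_intro2 _ _ tau' h tx).
by exists p => //; rewrite !inE pl !orbT.
Qed.

End Covering.

Section Differences.
Context (R : realType).
Local Notation mu2 := (leb2 R).
Implicit Types (u : mplane R -> R) (Omega : set (plane R)).

(** Both hypotheses are used with parameter 2 s and added: the weights 1/(4 s) restore 1/(2 s), and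
    2 s M twice becomes s (4 M). *)
Lemma derivative_boundedB Omega B M A H u1 u2 : open Omega ->
  (forall x, Omega x -> `|x.1| <= B /\ `|x.2| <= B) ->
  sqint mu2 Omega u1 -> sqint mu2 Omega u2 ->
  derivative_bounded Omega M A H u1 -> derivative_bounded Omega M A H u2 ->
  derivative_bounded Omega (4 * M) A H (fun x => u1 x - u2 x).
Proof.
move=> oO OB s1 s2 b1 b2 phi eta etax etay s cphi heta phieta s0 S.
have mO := open_plane_measurable oO.
have ss : 0 < 2 * s by rewrite mulr_gt0.
have [x1 y1] := b1 phi eta etax etay (2 * s) cphi heta phieta ss.
have [x2 y2] := b2 phi eta etax etay (2 * s) cphi heta phieta ss.
have [_ cx cy _ _] := C1_has_partials (let: conj h _ := cphi in h).
have sx := continuous_bounded_sqint mO OB cx; have sy := continuous_bounded_sqint mO OB cy.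
have E (g : mplane R -> R) : sqint mu2 Omega g ->
    \int[mu2]_(x in Omega) ((u1 x - u2 x) * g x) =
    \int[mu2]_(x in Omega) (u1 x * g x) - \int[mu2]_(x in Omega) (u2 x * g x).
  move=> sg; rewrite -(RintegralB mO (sqintM mO s1 sg) (sqintM mO s2 sg)).
  by apply: eq_Rintegral => x _; rewrite mulrBl.
have SE (z : R) : 2 * s * M + (2 * (2 * s))^-1 * z + (2 * s * M + (2 * (2 * s))^-1 * z) =
    s * (4 * M) + (2 * s)^-1 * z by field; rewrite gt_eqF.
rewrite /S -SE; split; [rewrite (E _ sx)|rewrite (E _ sy)]; apply: (le_trans (ler_normB _ _)).
- exact: lerD x1 x2.
- exact: lerD y1 y2.
Qed.

Lemma sq_intB m i j (f g : mplane R -> R) : sqint mu2 (@unit_square R) f -> sqint mu2 (@unit_square R) g ->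
  sq_int m i j (fun x => f x - g x) = sq_int m i j f - sq_int m i j g.
Proof.
move=> sf sg; have mS := @unit_square_measurable R; have si := @sqint_square_ind R m i j.
rewrite /sq_int -(RintegralB mS (sqintM mS sf si) (sqintM mS sg si)).
by apply: eq_Rintegral => x _; rewrite mulrBl.
Qed.

Lemma sq_int_le m i j (f : mplane R -> R) : sqint mu2 (@unit_square R) f ->
  `|sq_int m i j f| <= \int[mu2]_(x in @unit_square R) f x ^+ 2 + 1.
Proof.
move=> sf; have mS := @unit_square_measurable R; have si := @sqint_square_ind R m i j.
have h : 0 < 2 :> R by [].
have := young_sqint mS h sf si; rewrite -/(sq_int m i j f) => /le_trans; apply.
rewrite divff// mul1r lerD2l.
have s1 : sqint mu2 (@unit_square R) (fun=> 1).
  by apply: (bounded_sqint (B := 1)) => // x _; rewrite normr1.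
have : \int[mu2]_(x in @unit_square R) square_ind m i j x ^+ 2 <= \int[mu2]_(x in @unit_square R) 1 ^+ 2.
  apply: le_Rintegral => //; [exact: sqint_integrable si|exact: sqint_integrable s1|].
  move=> x _; have /andP[h0 h1] := square_ind01 m i j x.
  by rewrite ler_sqr ?nnegrE.
have -> : \int[mu2]_(x in @unit_square R) 1 ^+ 2 = 1 :> R.
  by rewrite expr1n /Rintegral integral_cst// mul1e [X in fine X]leb2_unit_square.
have := Rintegral_sqr_ge0 mu2 (@unit_square R) (square_ind m i j).
by move: (\int[mu2]_(x in _) _) => z h1 h2; lra.
Qed.

Lemma pullbackB (a v w : plane R) u1 u2 :
  pullback a v w (fun x => u1 x - u2 x) = (fun y => pullback a v w u1 y - pullback a v w u2 y).
Proof. by apply/funext => y; rewrite /pullback !patchE; case: ifP; rewrite ?subr0. Qed.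

Lemma diagonal_subsequence_countable (I : countType) (x : I -> nat -> R) (b : I -> R) :
  (forall i n, `|x i n| <= b i) ->
  exists2 k : nat -> nat, {homo k : m n / (m < n)%N} & forall i, cvgn (fun n => x i (k n)).
Proof.
move=> xb.
pose y (m : nat) n := if unpickle m is Some i then x i n else 0.
pose c (m : nat) := if @unpickle I m is Some i then b i else 0.
have [|k kinc kc] := @diagonal_subsequence R y c.
  by move=> m n; rewrite /y /c; case: (unpickle m) => [i|]; [exact: xb|rewrite normr0].
exists k; first exact: kinc.
by move=> i; have := kc (pickle i); rewrite /y pickleK.
Qed.

End Differences.

(** * Extraction of the subsequence *)

Section Compactness.
Context (R : realType).
Local Notation mu2 := (leb2 R).
Local Notation S := (@unit_square R).
Local Notation frame := (plane R * plane R * plane R)%type.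

Lemma Rintegral_sqr_subset d (X : measurableType d) (mu : {measure set X -> \bar R}) (D E : set X) (f : X -> R) :
  measurable D -> measurable E -> E `<=` D -> sqint mu D f ->
  \int[mu]_(x in E) f x ^+ 2 <= \int[mu]_(x in D) f x ^+ 2.
Proof.
move=> mD mE ED sf; have sE := sqint_subset mD mE ED sf.
rewrite -lee_fin !EFin_sqint//; apply: ge0_subset_integral => //.
  by apply/measurable_EFinP; apply: measurable_funX; case: sf.
by move=> x _; rewrite lee_fin sqr_ge0.
Qed.

(** The diagonal subsequence makes all dyadic integrals of all pullbacks converge. For a difference
    of two terms the energy at a fixed level m is then small, and the part above level m is at most
    a constant times 2^-m, the same for all pairs. *)
Lemma compactness (Omega : set (plane R)) (B M A H : R) (l : seq frame) (u : nat -> mplane R -> R) :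
  open Omega -> (forall x, Omega x -> `|x.1| <= B /\ `|x.2| <= B) -> 0 <= A -> 0 <= H ->
  (forall p, p \in l -> frame_in Omega p) ->
  (forall h, sqint mu2 Omega h ->
    \int[mu2]_(x in Omega) h x ^+ 2 <= \sum_(p <- l) \int[mu2]_(x in frame_set p) h x ^+ 2) ->
  (forall i, sqint mu2 Omega (u i)) -> (forall i, derivative_bounded Omega M A H (u i)) ->
  (forall i, \int[mu2]_(x in Omega) u i x ^+ 2 <= M) ->
  exists2 k : nat -> nat, {homo k : m n / (m < n)%N} &
    exists2 v, sqint mu2 Omega v &
      \int[mu2]_(x in Omega) (u (k n) x - v x) ^+ 2 @[n --> \oo] --> (0 : R).
Proof.
move=> oO OB A0 H0 lin lcov su du Mu.
have mO := open_plane_measurable oO.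
have M0 : 0 <= M by apply: le_trans (Mu 0%N); exact: Rintegral_sqr_ge0.
pose p (i : 'I_(size l)) : frame := tnth (in_tuple l) i.
have pl i : frame_in Omega (p i) by apply: lin; exact: mem_tnth.
pose D i := `|det2 (p i).1.2 (p i).2|.
have D0 i : 0 < D i by have [h _] := pl i; rewrite normr_gt0.
pose pull i h := pullback (p i).1.1 (p i).1.2 (p i).2 h.
have pullE i h : sqint mu2 Omega h ->
    \int[mu2]_(x in frame_set (p i)) h x ^+ 2 = D i * \int[mu2]_(y in S) pull i h y ^+ 2.
  by move=> sh; have [h1 h2] := pl i; exact: (integral_pullback_sqr h1 oO h2 sh).
have pullS i h : sqint mu2 Omega h -> sqint mu2 S (pull i h).
  by move=> sh; have [h1 h2] := pl i; exact: (pullback_sqint h1 oO h2 sh).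
have exK i : exists K1, 0 <= K1 /\ forall M u m, 0 <= M -> sqint mu2 Omega u -> derivative_bounded Omega M A H u ->
    \int[mu2]_(y in S) pull i u y ^+ 2 <= dyadic_energy m (pull i u) + K1 * M / 2 ^+ m.
  have [h1 h2] := pl i; have [K1 K10 HK] := parallelogram_energy h1 oO OB h2 A0 H0.
  by exists K1.
have [K HK] := choice exK.
pose x (q : 'I_(size l) * (nat * nat * nat)) n := sq_int q.2.1.1 q.2.1.2 q.2.2 (pull q.1 (u n)).
have xb q n : `|x q n| <= M / D q.1 + 1.
  apply: (le_trans (sq_int_le _ _ _ (pullS _ _ (su n)))); rewrite lerD2r ler_pdivlMr// mulrC -pullE//.
  apply: le_trans (Mu n); have [h1 h2] := pl q.1.
  by apply: Rintegral_sqr_subset => //; [exact: parallelogram_measurable h1|exact: parallelogram_sub h2].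
have [k kinc kcvg] := diagonal_subsequence_countable xb.
exists k => //.
pose L q := lim (x q (k n) @[n --> \oo]).
have cL q : x q (k n) @[n --> \oo] --> L q by exact: kcvg.
(* Weighted sum over frames and level m cells of the squared deviations of the coefficients from
   their limits. The factor 2 lets each of the two terms of a difference have its own copy. *)
pose G m n := \sum_(i < size l) D i * (4 ^+ m * \sum_(a < 2 ^ m) \sum_(b < 2 ^ m)
   2 * (x (i, (m, nat_of_ord a, nat_of_ord b)) (k n) - L (i, (m, nat_of_ord a, nat_of_ord b))) ^+ 2).
have cG m : G m n @[n --> \oo] --> (0 : R).
  rewrite (_ : 0 = \sum_(i < size l) D i * (4 ^+ m * \sum_(a < 2 ^ m) \sum_(b < 2 ^ m) 2 * (0 : R) ^+ 2)); last first.
    rewrite big1// => i _; rewrite big1 ?mulr0// => a _; rewrite big1// => b _.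
    by rewrite expr0n/= mulr0.
  apply: cvg_sum_seq => i; apply: cvgMr; apply: cvgMr; apply: cvg_sum_seq => a; apply: cvg_sum_seq => b.
  apply: cvgMr; set q := (i, _).
  have cd : x q (k n) - L q @[n --> \oo] --> (0 : R) by rewrite -(subrr (L q)); apply: cvgB; [exact: cL|exact: cvg_cst].
  by apply: cvgM; exact: cd.
have energy m i n n' : dyadic_energy m (pull i (fun x => u (k n) x - u (k n') x)) <=
    4 ^+ m * (\sum_(a < 2 ^ m) \sum_(b < 2 ^ m)
       2 * (x (i, (m, nat_of_ord a, nat_of_ord b)) (k n) - L (i, (m, nat_of_ord a, nat_of_ord b))) ^+ 2) +
    4 ^+ m * (\sum_(a < 2 ^ m) \sum_(b < 2 ^ m)
       2 * (x (i, (m, nat_of_ord a, nat_of_ord b)) (k n') - L (i, (m, nat_of_ord a, nat_of_ord b))) ^+ 2).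
  rewrite /dyadic_energy /pull pullbackB -mulrDr; apply: ler_wpM2l; first by rewrite exprn_ge0.
  rewrite -big_split/=; apply: ler_sum => a _; rewrite -big_split/=; apply: ler_sum => b _.
  rewrite sq_intB; [|exact: pullS|exact: pullS].
  set q := (i, _); rewrite -/(x q (k n)) -/(x q (k n')).
  have := sqrrD_le (x q (k n) - L q) (L q - x q (k n')).
  by rewrite subrKA -[in X in _ <= _ + X -> _]sqrrN opprB.
(* 4 M is the constant that [derivative_boundedB] gives for differences. *)
pose KK := \sum_(i < size l) D i * (K i * (4 * M)).
have dist m n n' : \int[mu2]_(x in Omega) (u (k n) x - u (k n') x) ^+ 2 <= G m n + G m n' + KK / 2 ^+ m.
  have sd := sqintB mO (su (k n)) (su (k n')).
  apply: (le_trans (lcov _ sd)); rewrite big_tnth /G /KK -big_split/= mulr_suml -big_split/=.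
  apply: ler_sum => i _; rewrite -/(p i) pullE// -mulrDr -mulrA -mulrDr; apply: ler_wpM2l; first exact: ltW.
  have [_ HKi] := HK i.
  have M40 : 0 <= 4 * M by rewrite mulr_ge0.
  apply: (le_trans (HKi _ _ m M40 sd (derivative_boundedB oO OB (su (k n)) (su (k n')) (du (k n)) (du (k n'))))).
  by rewrite lerD2r; exact: energy.
have [|v sv cv] := riesz_fischer mO (fun n => su (k n)); last by exists v.
move=> e e0.
have e2 : 0 < e / 2 by rewrite divr_gt0.
have e4 : 0 < e / 4 by rewrite divr_gt0.
(* The level is fixed before the index: KK / 2^m below e/2 first, then each of the two [G m] terms
   below e/4. *)
have [m hm] := filter_ex (near_pow2_small KK e2).
have [N _ HN] := cvgr_lt _ (cG m) _ e4.
exists N => n n' Nn Nn'; apply: (le_trans (dist m n n')).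
have := HN n Nn; have := HN n' Nn' => /= h1 h2; lra.
Qed.

Lemma sqrte_L2_cvg (Omega : set (plane R)) (w : nat -> mplane R -> R) : measurable (Omega : set (mplane R)) ->
  (forall n, sqint mu2 Omega (w n)) ->
  \int[mu2]_(x in Omega) w n x ^+ 2 @[n --> \oo] --> (0 : R) ->
  sqrte (L2_sq Omega (w n)) @[n --> \oo] --> 0%E.
Proof.
move=> mO sw c0.
have -> : (fun n => sqrte (L2_sq Omega (w n))) = (fun n => (Num.sqrt (\int[mu2]_(x in Omega) w n x ^+ 2))%:E).
  by apply/funext => n; rewrite /L2_sq -(EFin_sqint mO (sw n)).
apply: cvg_EFin; first exact: nearW.
rewrite -[X in _ --> X](@sqrtr0 R); apply: (cvg_comp _ _ c0); exact: sqrt_continuous.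
Qed.

Lemma regularity_bound (T : nat -> set (set (plane R))) : (family_regularity T < +oo)%E ->
  exists2 K, 0 <= K & forall i tau, T i tau -> triangle_regularity tau <= K.
Proof.
move=> fin.
have le i tau : T i tau -> ((triangle_regularity tau)%:E <= family_regularity T)%E.
  move=> Ti; apply: (@le_trans _ _ (triangulation_regularity (T i))).
    by apply: ereal_sup_ubound; exists tau.
  by apply: ereal_sup_ubound; exists i.
(* A real supremum is replaced by its absolute value to obtain a nonnegative constant; the value -oo
   would mean that no triangle occurs at all. *)
move: fin le; case: (family_regularity T) => [r _ le| |_ le]//.
  by exists `|r| => // i tau Ti; have := le i tau Ti; rewrite lee_fin => /le_trans; apply; exact: ler_norm.
by exists 0 => // i tau Ti; have := le i tau Ti.
Qed.

Lemma bounded_set_coord (Omega : set (plane R)) : bounded_set Omega ->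
  exists2 B, 0 <= B & forall x, Omega x -> `|x.1| <= B /\ `|x.2| <= B.
Proof.
move=> /pinfty_ex_gt0[B B0 HB]; exists B; first exact: ltW.
move=> x Ox; have := HB x Ox; rewrite /= /Num.norm/= => h.
by split; apply: le_trans h; rewrite le_max lexx ?orbT.
Qed.

End Compactness.

Theorem theorem3p3 (R : realType) (Omega : set (plane R))
    (T : nat -> set (set (plane R))) (u : nat -> plane R -> R) (C : R)
    (Omega_polygonal : polygonal_domain Omega)
    (Omega_bounded : bounded_set Omega)
    (T_triangulation : forall i, is_triangulation Omega (T i))
    (T_shape_regular : (family_regularity T < +oo)%E)
    (u_H1h : forall i, in_H1h Omega (T i) (u i))
    (u_bounded : forall i, (H1h_norm Omega (T i) (u i) <= C%:E)%E) :
  exists2 k : nat -> nat, {homo k : m n / (m < n)%N} &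
    exists v : plane R -> R, cvg_L2 Omega (fun n => u (k n)) v.
Proof.
have [_ oO _ _] := Omega_polygonal.
have mO := open_plane_measurable oO.
have [B B0 OB] := bounded_set_coord Omega_bounded.
have [K K0 HK] := regularity_bound T_shape_regular.
have su i : sqint (leb2 R) Omega (u i) by case: (u_H1h i).
have du i : derivative_bounded Omega (C ^+ 2 + 1) (12 * K) (2 * B + 1) (u i).
  move=> phi eta etax etay s cphi heta phieta s0.
  exact: (weak_derivative_bound oO OB (T_triangulation i) (HK i) (u_H1h i) (u_bounded i) K0 cphi heta phieta s0).
have Mu i : \int[leb2 R]_(x in Omega) u i x ^+ 2 <= C ^+ 2 + 1.
  by have [g [sE [t1 [t2 [g1 [g2 [h _ _ _ _]]]]]]] := mesh_data oO (T_triangulation i) (u_H1h i) (u_bounded i).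
have A0 : 0 <= 12 * K by rewrite mulr_ge0.
have H0 : 0 <= 2 * B + 1 by rewrite addr_ge0 ?mulr_ge0.
(* The first triangulation alone supplies the frames: they cover Omega up to a null set and are kept
   for all functions, whatever their own meshes. *)
have [l [lin lcov]] := triangulation_frames (T_triangulation 0%N).
have cov h : sqint (leb2 R) Omega h ->
    \int[leb2 R]_(x in Omega) h x ^+ 2 <= \sum_(p <- l) \int[leb2 R]_(x in frame_set p) h x ^+ 2.
  move=> sh.
  have mU : measurable (element_union (T 0%N) : set (mplane R)).
    apply: open_plane_measurable; apply: bigcup_open => tau; case: (T_triangulation 0%N) => _ triT _ _ _.
    by move=> /triT[[a [b [c [d0 ->]]]] _]; exact: open_triangle_open.
  have US : element_union (T 0%N) `<=` Omega.
    by move=> x [tau Tt]; case: (T_triangulation 0%N) => _ triT _ _ _; have [_] := triT tau Tt; apply.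
  have lP p : p \in l -> measurable (frame_set p : set (mplane R)) /\ frame_set p `<=` Omega.
    by move=> /lin[h1 h2]; split; [exact: parallelogram_measurable h1|exact: parallelogram_sub h2].
  have mh : measurable_fun (Omega : set (mplane R)) (fun x => (h x ^+ 2)%:E).
    by apply/measurable_EFinP; apply: measurable_funX; case: sh.
  have h0 x : Omega x -> (0 <= (h x ^+ 2)%:E)%E by move=> _; rewrite lee_fin sqr_ge0.
  have E : (\sum_(p <- l) \int[leb2 R]_(x in frame_set p) (h x ^+ 2)%:E =
      (\sum_(p <- l) \int[leb2 R]_(x in frame_set p) h x ^+ 2)%R%:E)%E.
    rewrite -sumEFin big_seq [RHS]big_seq; apply: eq_bigr => p pl; have [mp pO] := lP p pl.
    by rewrite (EFin_sqint mp (sqint_subset mO mp pO sh)).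
  rewrite -lee_fin -E (EFin_sqint mO sh).
  rewrite (ge0_negligible_integral (measurableD mO mU) mO mh h0 (triangulation_null oO (T_triangulation 0%N))).
  rewrite setDD (setIidr US).
  exact: (le_integral_cover (leb2 R) mO lP mh h0 mU US lcov).
have [k kinc [v sv cv]] := compactness oO OB A0 H0 lin cov su du Mu.
exists k => //; exists v; split; first exact: sv.
by apply: (sqrte_L2_cvg mO _ cv) => n; exact: (sqintB mO (su (k n)) sv).
Qed.
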